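(* Consider a family in prenormal form $(x^2-\epsilon)y'=B(\epsilon,x)y$, with $r$ and then $\rho$ sufficiently small, $\hat\epsilon\in S$, and let $\mathcal H^j_q$ ($q\neq j$) be the first integrals of the $j$-th Riccati system, with $\mathcal H_j^j=1$. The monodromy of a first integral $\mathcal H^j_q$ around $x=\hat x_l$ may be written as the composition of a wild part (i.e. multiplication by a factor of the form $e^{2\pi i/\alpha}$ with $\alpha\in\mathbb{C}$, $\alpha\to0$) depending on the formal invariants, and of a map depending on the entries of the inverse of the unfolded Stokes matrices and having a limit for $\epsilon=0$. More precisely, $$M_{\hat x_R}(\mathcal H^j_q)=\hat\Delta_{jq,R}\,\frac{\mathcal H^j_q+\sum_{p=q+1}^n(\hat C_R^{-1})_{qp}\mathcal H^j_p}{1+\sum_{p=j+1}^n(\hat C_R^{-1})_{jp}\mathcal H^j_p},\qquad M_{\hat x_L}(\mathcal H^j_q)=\hat\Delta_{jq,L}\,\frac{\mathcal H^j_q+\sum_{p=1}^{q-1}(\hat C_L^{-1})_{qp}\mathcal H^j_p}{1+\sum_{p=1}^{j-1}(\hat C_L^{-1})_{jp}\mathcal H^j_p}.$$ Denoting $\mathcal H^j=(\mathcal H^j_1,\dots,\mathcal H^j_n)^T$, this is equivalent to $$M_{\hat x_l}(\mathcal H^j)=\mathrm{diag}\{\hat\Delta_{j1,l},\dots,\hat\Delta_{jn,l}\}\,\frac{\hat C_l^{-1}\mathcal H^j}{[(\hat C_l^{-1})_{j1},\dots,(\hat C_l^{-1})_{jn}]\,\mathcal H^j},\qquad l=L,R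.$$
   Context: Systems. A family in prenormal form is a family $(x^2-\epsilon)y'=B(\epsilon,x)y$, $y\in\mathbb{C}^n$, $n\ge2$, $'=d/dx$, with $B=\Lambda(\epsilon,x)+(x^2-\epsilon)R(\epsilon,x)$, $\Lambda(\epsilon,x)=\mathrm{diag}\{\lambda_1(\epsilon,x),\dots,\lambda_n(\epsilon,x)\}=\Lambda_0(\epsilon)+\Lambda_1(\epsilon)x$, $\Lambda_0,\Lambda_1$ diagonal and analytic in $\epsilon$ near $0$, $R$ a matrix of germs of analytic functions of $(\epsilon,x)$ at the origin, and $\Re(\lambda_q(0,0)-\lambda_j(0,0))>0$ for $q<j$. Model system: $(x^2-\epsilon)z'=\Lambda(\epsilon,x)z$. Parameter sector. Let $\theta_0$ be the largest angle (supremum) in $(0,\frac\pi2)$ with $\Re(e^{\pm i\theta_0}(\lambda_q(0,0)-\lambda_j(0,0)))\ge0$ for $q<j$. Fix $\gamma>0$ with $\gamma(1+\frac{2\gamma}{\pi})<\theta_0$ and let $S=\{\hat\epsilon:0<|\hat\epsilon|<\rho,\ \arg\hat\epsilon\in(\pi-2\gamma,3\pi+2\gamma)\}$ (on the universal covering of $\mathbb{C}^*$; $\epsilon$ is the projection of $\hat\epsilon$). Put $\arg\sqrt{\hat\epsilon}=\frac12\arg\hat\epsilon$, $\hat x_L=\sqrt{\hat\epsilon}$, $\hat x_R=-\sqrt{\hat\epsilon}$. The radius $\rho>0$ is small, in particular so that for some $C>0$, $\Re(e^{\pm i\gamma(1+2\gamma/\pi)}(\lambda_q(\epsilon,\hat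 x_l)-\lambda_j(\epsilon,\hat x_l)))>C$ for $q<j$, $l=L,R$, $\hat\epsilon\in S$. $S_\cap$ is the auto-intersection of $S$: it consists of the pairs $\bar\epsilon$, $\tilde\epsilon=\bar\epsilon e^{2\pi i}$ both in $S$. Sectorial domains. Fix $r>0$ small, $\mathbb{D}_r=\{|x|<r\}$, $\delta>0$ small, $\Omega_D=\{|x|<r,\,-(\pi+\delta)<\arg x<\delta\}$, $\Omega_U=\{|x|<r,\,-\delta<\arg x<\pi+\delta\}$, such that the closure of $\Omega_D$ (resp. $\Omega_U$) contains no ray $\Re((\lambda_q(0,0)-\lambda_j(0,0))/x)=0$, $q\ne j$, of the upper (resp. lower) half-plane. Use the time $t$ of $\dot x=x^2-\epsilon$: $x(t)=-\sqrt{\hat\epsilon}\coth(\sqrt{\hat\epsilon}\,t)$ if $\epsilon\neq0$ (period $\pi i/\sqrt{\hat\epsilon}$), $x(t)=-1/t$ if $\epsilon=0$. Fix small constants $c_0>0$, $h\in(0,1/r)$, $\kappa\in(0,\frac12)$ independent of $\hat\epsilon$. Let $N_{\hat\epsilon}$ be the connected component containing $t=0$ of $\{t:|x(t)|\ge r\}$, $P=-\pi i/\sqrt{\hat\epsilon}$, $\hat\theta=\frac{2\gamma}{\pi}(\pi-\arg\sqrt{\hat\epsilon})$, and $\sigma(u)=0$ if $|u|\le c_0/\sqrt{|\epsilon|}$, $\sigma(u)=(u-\mathrm{sgn}(u)c_0/\sqrt{|\epsilon|})\tan\hat\theta$ otherwise. $\Gamma_D^{\hat\epsilon}$ is the set of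 $t\notin N_{\hat\epsilon}$ with $\Im t<h+\sigma(\Re t)$ lying above the line $-(\frac12+\kappa)P+\mathbb{R}e^{i\hat\theta}$; $\Gamma_U^{\hat\epsilon}$ is the set of $t\notin N_{\hat\epsilon}$ with $\Im t>-h+\sigma(\Re t)$ lying below the line $(\frac12+\kappa)P+\mathbb{R}e^{i\hat\theta}$. $\Omega_s^{\hat\epsilon}=x(\Gamma_s^{\hat\epsilon})$, $s=D,U$. $\Omega_D^{\hat\epsilon}\cap\Omega_U^{\hat\epsilon}$ has three connected components $\Omega_L^{\hat\epsilon},\Omega_R^{\hat\epsilon},\Omega_C^{\hat\epsilon}$, images of the right and left components of $\Gamma_D^{\hat\epsilon}\cap\Gamma_U^{\hat\epsilon}$ and of $\Gamma_D^{\hat\epsilon}\cap(\Gamma_U^{\hat\epsilon}-P)$; their closures contain respectively $\hat x_L$, $\hat x_R$, and both; $0\in\Omega_C^{\hat\epsilon}$. Model solutions. For $l=L,R$, $\mathcal U_l=\frac1{2\hat x_l}\Lambda(\epsilon,\hat x_l)=\mathrm{diag}\{\hat\mu_{1,l},\dots,\hat\mu_{n,l}\}$, $\hat D_R=e^{-2\pi i\,\mathcal U_R}$, $\hat D_L=e^{2\pi i\,\mathcal U_L}$, $\hat\Delta_{sj,l}=(\hat D_l)_{ss}(\hat D_l^{-1})_{jj}$. $F(\epsilon,x)=(x-\hat x_R)^{\mathcal U_R}(x-\hat x_L)^{\mathcal U_L}$ is a fundamental matrix of the model. $F_D(\hat\epsilon,\cdot)$ is its branch on $\Omega_D^{\hat\epsilon}$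 (namely $e^{t\Lambda_0}(x^2-\epsilon)^{\Lambda_1/2}$ with $x=x(t)$, $t\in\Gamma_D^{\hat\epsilon}$, converging as $\hat\epsilon\to0$ to $x^{\Lambda_1(0)}e^{-\Lambda_0(0)/x}$ with $-(\pi+\delta)<\arg x<\delta$), and $F_U(\hat\epsilon,\cdot)$ is the analytic continuation of $F_D$ to $\Omega_U^{\hat\epsilon}$ through $\Omega_R^{\hat\epsilon}$. Normalizing and unfolded Stokes matrices. $H_s(\hat\epsilon,x)$, $s=D,U$, are the matrices, analytic for $\hat\epsilon\in S$, $x\in\Omega_s^{\hat\epsilon}$, such that $W_s=H_sF_s$ is a fundamental matrix of solutions of the family on $\Omega_s^{\hat\epsilon}$; $\lim_{x\to\hat x_l,x\in\Omega_s^{\hat\epsilon}}H_s(\hat\epsilon,x)$ ($l=L,R$) is an invertible diagonal matrix independent of $s$, analytic in $\hat\epsilon\in S$ with nonsingular limit at $\epsilon=0$; $|H_s(\bar\epsilon,0)-H_s(\tilde\epsilon,0)|\le c|\bar\epsilon|$ on $S_\cap$ for some $c\ge0$; $|H_s(\hat\epsilon,0)|$, $|H_s(\hat\epsilon,0)^{-1}|$ are bounded on $S_\cap$; and normalized by $(H_s(\hat\epsilon,0))_{jj}=1$ for all $j$. The unfolded Stokes matrices $\hat C_R$ (upper triangular unipotent) and $\hat C_L$ (lower triangular unipotent) are defined by $H_D^{-1}H_U=F_D\hat C_RF_D^{-1}$ on $\Omega_R^{\hat\epsilon}$, $H_D^{-1}H_U=F_D\hat C_LF_D^{-1}$ on $\Omega_L^{\hat\epsilon}$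 (and $H_D^{-1}H_U=I$ on $\Omega_C^{\hat\epsilon}$). Monodromy. $V^{\hat\epsilon}$ is the ramified domain obtained from $\Omega_D^{\hat\epsilon}$ and $\Omega_U^{\hat\epsilon}$ by gluing along $\Omega_C^{\hat\epsilon}$ only; $W_V(\hat\epsilon,x)=[w_1(\hat\epsilon,x)\ \cdots\ w_n(\hat\epsilon,x)]$ is the analytic continuation of $W_D(\hat\epsilon,x)$ from $\Omega_D^{\hat\epsilon}$ to $V^{\hat\epsilon}$ through $\Omega_C^{\hat\epsilon}$. The monodromy operator $M_{\hat x_R}$ (resp. $M_{\hat x_L}$) is analytic continuation of solutions along a loop based at a point of $\Omega_R^{\hat\epsilon}$ (resp. $\Omega_L^{\hat\epsilon}$), regarded as lying on $\Omega_D^{\hat\epsilon}$, making one turn around $\hat x_R$ in the negative (resp. around $\hat x_L$ in the positive) direction and surrounding no other singular point; it is extended to functions of the solutions (here, to functions of $(x,[y]_j)$ built from the $w_i$, with $[y]_j$ as an independent variable). Riccati systems and first integrals. For an $n$-vector $v$ with $j$-th component $(v)_j$, $[v]_j\in\mathbb{C}^{n-1}$ is the column vector with entries $-(v)_i/(v)_j$, $i\neq j$. The $j$-th Riccati system is the system satisfied by $(x,[y]_j)$ with time $t$, $\frac{dx}{dt}=x^2-\epsilon$, when $y$ solves the linear system. Put $b_i^j(\hat\epsilon,x,[y]_j)=(w_i(\hat\epsilon,x))_j([y]_j-[w_i]_j)$ (a column vector of size $n-1$). The first integrals $\mathcal H^j_q$, $q\ne j$, with values in $\mathbb{CP}^1$,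 are $$\mathcal H^j_q=(-1)^{q-j}\,\frac{\det[b_1^j\ \cdots\ \widehat{b_q^j}\ \cdots\ b_n^j]}{\det[b_1^j\ \cdots\ \widehat{b_j^j}\ \cdots\ b_n^j]},$$ the hat on a column denoting omission; equivalently $\sum_{q=1}^n\mathcal H^j_q\,b^j_q=0$ with $\mathcal H^j_j=1$. *)

(* Defs.v *)
From HB Require Import structures.
From mathcomp Require Import all_boot all_order all_algebra.
From mathcomp Require Import complex.
From mathcomp Require Import all_classical all_reals all_analysis.

Set Implicit Arguments.
Unset Strict Implicit.
Unset Printing Implicit Defensive.

Import Order.TTheory GRing.Theory Num.Theory.
Import numFieldNormedType.Exports.

Local Open Scope classical_set_scope.
Local Open Scope ring_scope.

(* R[i] packaged as a numClosedFieldType, so that it carries the topology and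
   the normed-module structure that MathComp-Analysis gives to numeric fields. *)
Definition CC (R : realType) : numClosedFieldType := complex R.

Section ComplexAnalysis.
Variable R : realType.
Local Notation C := (CC R).

Definition reC (z : C) : R := complex.Re z.
Definition imC (z : C) : R := complex.Im z.
Definition absC (z : C) : R := ComplexField.Normc.normc z.
Definition ofR (x : R) : C := Complex x 0.
Definition iC : C := Complex 0 1.

Definition cexp (z : C) : C :=
  Complex (expR (reC z) * cos (imC z)) (expR (reC z) * sin (imC z)).
Definition ccosh (z : C) : C := (cexp z + cexp (- z)) / 2.
Definition csinh (z : C) : C := (cexp z - cexp (- z)) / 2.

Definition analytic_at (f : C -> C) (a : C) : Prop :=
  exists (c : nat -> C) (d : R), 0 < d /\
    forall x, absC (x - a) < d ->
      series (fun k => c k * (x - a) ^+ k) @ \oo --> f x.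

(* The bound on the coefficients makes the double series absolutely convergent
   on the polydisc, so that summing over squares is harmless. *)
Definition analytic2_at (f : C -> C -> C) (a b : C) : Prop :=
  exists (c : nat -> nat -> C) (d M : R), [/\ 0 < d,
    forall k l, absC (c k l) * d ^+ (k + l) <= M &
    forall x y, absC (x - a) < d -> absC (y - b) < d ->
      (fun N : nat => \sum_(k < N) \sum_(l < N)
          c k l * (x - a) ^+ k * (y - b) ^+ l) @ \oo --> f x y].

(* gm winds k times (counterclockwise) around a: L is a continuous branch of
   log (gm - a) along the closed path gm : [0, 1] -> C. *)
Definition winding (gm : R -> C) (a : C) (k : int) : Prop :=
  exists L : R -> C, [/\ {within `[0, 1]%classic, continuous L},
    forall u : R, 0 <= u <= 1 -> cexp (L u) = gm u - a &
    L 1 - L 0 = 2 * ofR pi * iC * k%:~R].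

(* The germ of g at gm 1 is the analytic continuation along gm of the germ
   of f at gm 0. *)
Definition continuation (n : nat) (gm : R -> C) (f g : C -> 'M[C]_n) : Prop :=
  exists phi : R -> C -> 'M[C]_n, [/\
    \forall x \near gm 0, phi 0 x = f x,
    \forall x \near gm 1, phi 1 x = g x,
    forall (u : R) i k, 0 <= u <= 1 -> analytic_at (fun x => phi u x i k) (gm u) &
    forall u : R, 0 <= u <= 1 ->
      \forall v \near within `[0, 1]%classic (nbhs u),
        \forall x \near gm v, phi v x = phi u x].

End ComplexAnalysis.

Section Systems.
Variable R : realType.
Local Notation C := (CC R).

(* (x^2 - eps) y' = B(eps, x) y, B = Lambda0 + Lambda1 x + (x^2 - eps) Rem, where
   Lambda0, Lambda1 are given by the rows of their diagonal entries. *)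
Record linear_family (n : nat) := LinearFamily {
  Lam0 : C -> 'rV[C]_n;
  Lam1 : C -> 'rV[C]_n;
  Rem : C -> C -> 'M[C]_n }.

Variable n : nat.
Variable sys : linear_family n.

Definition lam (eps x : C) (i : 'I_n) : C :=
  Lam0 sys eps 0 i + Lam1 sys eps 0 i * x.
Definition Lam (eps x : C) : 'M[C]_n := diag_mx (\row_i lam eps x i).
Definition Bmx (eps x : C) : 'M[C]_n :=
  Lam eps x + (x ^+ 2 - eps) *: Rem sys eps x.

Definition prenormal : Prop := [/\
  forall i, analytic_at (fun eps => Lam0 sys eps 0 i) 0,
  forall i, analytic_at (fun eps => Lam1 sys eps 0 i) 0,
  forall i k, analytic2_at (fun eps x => Rem sys eps x i k) 0 0 &
  forall q j : 'I_n, (q < j)%N -> 0 < reC (lam 0 0 q - lam 0 0 j)].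

Definition fundamental (eps : C) (Om : set C) (W : C -> 'M[C]_n) : Prop :=
  forall x, Om x -> [/\ W x \in unitmx,
    forall i k, derivable (fun y : C => W y i k : C) x 1 &
    (x ^+ 2 - eps) *: (\matrix_(i, k) 'D_1 (fun y : C => W y i k : C) x)
      = Bmx eps x *m W x].

Definition theta0 : R := sup [set th : R | 0 < th < pi / 2 /\
  forall q j : 'I_n, (q < j)%N ->
    0 <= reC (cexp (iC R * ofR th) * (lam 0 0 q - lam 0 0 j)) /\
    0 <= reC (cexp (- (iC R * ofR th)) * (lam 0 0 q - lam 0 0 j))].

End Systems.

(* D, U: the two sheets Omega_D, Omega_U. L, R: the two singular points. *)
Inductive sheet := ShD | ShU.
Inductive side := SdL | SdR.

Definition opposite (l : side) : side :=
  match l with SdL => SdR | SdR => SdL end.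

Section Domains.
Variable R : realType.
Local Notation C := (CC R).

Record geometry := Geometry {
  gamma : R; rad : R; delta : R; kappa : R; c0 : R; hgt : R; rho : R }.

(* The universal covering of C^* is C with projection cexp: the point zeta
   stands for the hat-epsilon of modulus expR (reC zeta), argument imC zeta. *)
Definition eps (z : C) : C := cexp z.
Definition sqrt_eps (z : C) : C := cexp (z / 2).
Definition turn (z : C) : C := z + 2 * ofR pi * iC R.

Definition xhat (l : side) (z : C) : C :=
  match l with SdL => sqrt_eps z | SdR => - sqrt_eps z end.

(* The Fatou time; the value at the poles of the flow is irrelevant. *)
Definition xt (z t : C) : C :=
  - (sqrt_eps z) * ccosh (sqrt_eps z * t) / csinh (sqrt_eps z * t).

Definition period (z : C) : C := - (ofR pi * iC R) / sqrt_eps z.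

(* The limiting sectors Omega_D, Omega_U at eps = 0. *)
Definition sector0 (r d : R) (s : sheet) : set C :=
  [set x : C | exists m th : R, [/\ 0 < m < r,
    match s with
    | ShD => - (pi + d) < th < d
    | ShU => - d < th < pi + d
    end & x = ofR m * cexp (iC R * ofR th)]].

Definition admissible_delta (n : nat) (sys : linear_family R n) (r d : R) : Prop :=
  forall (q j : 'I_n) (x : C), q != j ->
    reC ((lam sys 0 0 q - lam sys 0 0 j) / x) = 0 ->
    (0 < imC x -> ~ closure (sector0 r d ShD) x) /\
    (imC x < 0 -> ~ closure (sector0 r d ShU) x).

Variable g : geometry.

Definition sectorS : set C :=
  [set z : C | expR (reC z) < rho g /\
     pi - 2 * gamma g < imC z < 3 * pi + 2 * gamma g].

(* hat-epsilon -> 0 inside S *)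
Definition hat0 : set_system C :=
  filter_from [set d : R | 0 < d]
    (fun d => [set z : C | sectorS z /\ absC (eps z) < d]).

Definition theta_hat (z : C) : R :=
  2 * gamma g / pi * (pi - imC z / 2).

Definition sigma (z : C) (u : R) : R :=
  let a := c0 g / Num.sqrt (absC (eps z)) in
  if `|u| <= a then 0 else (u - Num.sg u * a) * tan (theta_hat z).

(* |x(t)| >= r, cleared of denominators: the poles of x(t) belong to the set. *)
Definition Nset (z : C) : set C :=
  connected_component
    [set t : C | rad g * absC (csinh (sqrt_eps z * t))
                 <= absC (sqrt_eps z * ccosh (sqrt_eps z * t))] 0.

Definition halfP (z : C) : C := ofR (1 / 2 + kappa g) * period z.

Definition Gam (s : sheet) (z : C) : set C :=
  match s with
  | ShD => [set t : C | [/\ ~ Nset z t,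
      imC t < hgt g + sigma z (reC t) &
      0 < imC ((t + halfP z) * cexp (- (iC R * ofR (theta_hat z))))]]
  | ShU => [set t : C | [/\ ~ Nset z t,
      - hgt g + sigma z (reC t) < imC t &
      imC ((t - halfP z) * cexp (- (iC R * ofR (theta_hat z)))) < 0]]
  end.

Definition Omega (s : sheet) (z : C) : set C := xt z @` Gam s z.

(* Gam D `&` Gam U is a strip around the graph of sigma cut by Nset, which
   contains the segment of the imaginary axis |Im t| < hgt: its two components
   are told apart by the sign of Re t. *)
Definition Omega_side (l : side) (z : C) : set C :=
  xt z @` [set t : C | [/\ Gam ShD z t, Gam ShU z t &
    match l with SdL => 0 < reC t | SdR => reC t < 0 end]].

Definition Omega_C (z : C) : set C :=
  xt z @` [set t : C | Gam ShD z t /\ Gam ShU z (t + period z)].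

(* The ramified domain V is Omega_D and Omega_U glued along Omega_C only: the
   last condition is the continuity of u |-> (sh u, gm u) in this quotient. *)
Definition path_in_V (z : C) (gm : R -> C) (sh : R -> sheet) : Prop := [/\
  {within `[0, 1]%classic, continuous gm},
  forall u : R, 0 <= u <= 1 -> Omega (sh u) z (gm u) &
  forall u : R, 0 <= u <= 1 -> \forall v \near within `[0, 1]%classic (nbhs u),
    sh v = sh u \/ Omega_C z (gm v)].

(* A loop based at p, from p regarded as lying on Omega_D to p regarded as lying
   on Omega_U, turning once around xhat l (negatively for R, positively for L)
   and not around the other singular point. *)
Definition monodromy_loop (l : side) (z p : C) (gm : R -> C) : Prop := [/\
  Omega_side l z p, gm 0 = p, gm 1 = p,
  exists sh : R -> sheet, [/\ path_in_V z gm sh, sh 0 = ShD & sh 1 = ShU] &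
  winding gm (xhat l z) (match l with SdL => 1 | SdR => - 1 end) /\
  winding gm (xhat (opposite l) z) 0].

End Domains.

Section Solutions.
Variable R : realType.
Local Notation C := (CC R).
Variable n : nat.
Variable sys : linear_family R n.
Variable g : geometry R.

Definition spectral_gap : Prop := exists c : R, 0 < c /\
  forall (z : C) (l : side) (q j : 'I_n), sectorS g z -> (q < j)%N ->
    let d := lam sys (eps z) (xhat l z) q - lam sys (eps z) (xhat l z) j in
    let a := gamma g * (1 + 2 * gamma g / pi) in
    c < reC (cexp (iC R * ofR a) * d) /\ c < reC (cexp (- (iC R * ofR a)) * d).

Definition Umx (l : side) (z : C) : 'M[C]_n :=
  (2 * xhat l z)^-1 *: Lam sys (eps z) (xhat l z).
Definition mu (l : side) (z : C) (i : 'I_n) : C := Umx l z i i.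

Definition Dhat (l : side) (z : C) : 'M[C]_n :=
  let e : C := match l with SdL => 1 | SdR => - 1 end in
  diag_mx (\row_i cexp (e * 2 * ofR pi * iC R * mu l z i)).
Definition Delta (l : side) (z : C) (s j : 'I_n) : C :=
  Dhat l z s s * invmx (Dhat l z) j j.

(* F_D = e^{t Lambda0} (x^2 - eps)^{Lambda1 / 2} with x = x(t), where Lg is the
   branch of log (x^2 - eps) tending, when eps -> 0, to 2 log x with
   -(pi + delta) < arg x < delta; w stands for log x and - e^{-w} = - 1 / x for
   the limiting time. *)
Definition is_FD (FD : C -> C -> 'M[C]_n) : Prop :=
  exists Lg : C -> C -> C, [/\
    {within [set p : C * C | sectorS g p.1 /\ Gam g ShD p.1 p.2],
       continuous (fun p : C * C => Lg p.1 p.2)},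
    forall z t, sectorS g z -> Gam g ShD z t ->
      cexp (Lg z t) = xt z t ^+ 2 - eps z,
    forall w : C, absC (cexp w) < rad g ->
      - (pi + delta g) < imC w < delta g -> imC (- cexp (- w)) < hgt g ->
      (fun z => Lg z (- cexp (- w))) @ hat0 g --> 2 * w &
    forall z t, sectorS g z -> Gam g ShD z t ->
      FD z (xt z t) = diag_mx (\row_i
        cexp (t * Lam0 sys (eps z) 0 i + Lam1 sys (eps z) 0 i / 2 * Lg z t))].

Definition is_FU (FD FU : C -> C -> 'M[C]_n) : Prop :=
  forall z, sectorS g z ->
    (forall x i k, Omega g ShU z x -> analytic_at (fun y => FU z y i k) x) /\
    (forall x, Omega_side g SdR z x -> FU z x = FD z x).

Definition Fsheet (FD FU : C -> C -> 'M[C]_n) (s : sheet) :=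
  match s with ShD => FD | ShU => FU end.

Record normalizing (FD FU : C -> C -> 'M[C]_n)
    (H : sheet -> C -> C -> 'M[C]_n) : Prop := Normalizing {
  H_analytic : forall s z x i k, sectorS g z -> Omega g s z x ->
    analytic2_at (fun z' x' => H s z' x' i k) z x;
  H_fundamental : forall s z, sectorS g z ->
    fundamental sys (eps z) (Omega g s z)
      (fun x => H s z x *m Fsheet FD FU s z x);
  H_ends : exists d : side -> C -> 'rV[C]_n, [/\
    forall l s z i k, sectorS g z ->
      H s z x i k @[x --> within (Omega g s z) (nbhs (xhat l z))]
        --> (diag_mx (d l z) i k : C),
    forall l z i, sectorS g z -> d l z 0 i != 0,
    forall l z i, sectorS g z -> analytic_at (fun z' => d l z' 0 i) z &
    forall l i, exists2 d0 : C, d0 != 0 & (fun z => d l z 0 i) @ hat0 g --> d0];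
  H_jump : forall s, exists2 c : R, 0 <= c &
    forall z i k, sectorS g z -> sectorS g (turn z) ->
      absC (H s z 0 i k - H s (turn z) 0 i k) <= c * absC (eps z);
  H_bounded : forall s, exists M : R,
    forall z z' i k, sectorS g z -> sectorS g (turn z) ->
      z' = z \/ z' = turn z ->
      absC (H s z' 0 i k) <= M /\ absC (invmx (H s z' 0) i k) <= M;
  H_diag1 : forall s z j, sectorS g z -> H s z 0 j j = 1 }.

Record unfolded_stokes (FD : C -> C -> 'M[C]_n)
    (H : sheet -> C -> C -> 'M[C]_n) (St : side -> C -> 'M[C]_n) : Prop :=
  UnfoldedStokes {
  St_unipotent : forall l z i, sectorS g z -> St l z i i = 1;
  St_upper : forall z (i k : 'I_n),
    sectorS g z -> (k < i)%N -> St SdR z i k = 0;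
  St_lower : forall z (i k : 'I_n),
    sectorS g z -> (i < k)%N -> St SdL z i k = 0;
  St_side : forall l z x, sectorS g z -> Omega_side g l z x ->
    invmx (H ShD z x) *m H ShU z x = FD z x *m St l z *m invmx (FD z x);
  St_center : forall z x, sectorS g z -> Omega_C g z x ->
    invmx (H ShD z x) *m H ShU z x = 1%:M }.

(* W_V on the two sheets of V; the solution w_i is the i-th column. *)
Definition is_WV (WD : C -> C -> 'M[C]_n) (WV : sheet -> C -> C -> 'M[C]_n) :
    Prop :=
  forall z, sectorS g z -> [/\
    forall x, Omega g ShD z x -> WV ShD z x = WD z x,
    forall x i k, Omega g ShU z x -> analytic_at (fun y => WV ShU z y i k) x &
    forall x, Omega_C g z x -> WV ShU z x = WV ShD z x].

End Solutions.

Section FirstIntegrals.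
Variable R : realType.
Local Notation C := (CC R).
Variable n : nat.

Definition bracket (j : 'I_n) (v : 'cV[C]_n) : 'cV[C]_(n.-1) :=
  \col_k (- v (lift j k) 0 / v j 0).

(* (w_i)_j (Y - [w_i]_j), expanded so that it makes sense when (w_i)_j = 0. *)
Definition bvec (W : 'M[C]_n) (j i : 'I_n) (Y : 'cV[C]_(n.-1)) :
    'cV[C]_(n.-1) :=
  \col_k (W j i * Y k 0 + W (lift j k) i).

Lemma bvecE (W : 'M[C]_n) (j i : 'I_n) (Y : 'cV[C]_(n.-1)) :
  W j i != 0 -> bvec W j i Y = W j i *: (Y - bracket j (col i W)).
Proof.
move=> Wji0; apply/colP => k; rewrite !mxE mulNr opprK mulrDr.
by rewrite [W j i * (_ / _)]mulrC divfK.
Qed.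

(* The point (a : b) of the projective line, None being infinity; the
   indeterminate (0 : 0) is also sent to None. *)
Definition quotP1 (a b : C) : option C :=
  if b == 0 then None else Some (a / b).

Definition omit (W : 'M[C]_n) (j : 'I_n) (Y : 'cV[C]_(n.-1)) (q : 'I_n) : C :=
  \det (\matrix_(k < n.-1, m < n.-1) bvec W j (lift q m) Y k 0).

(* The first integral H^j_q at (x, Y), as a function of W = [w_1 ... w_n](x);
   (-1)^(q + j) = (-1)^(q - j). *)
Definition first_integral (W : 'M[C]_n) (j : 'I_n) (Y : 'cV[C]_(n.-1))
    (q : 'I_n) : option C :=
  quotP1 ((-1) ^+ (q + j) * omit W j Y q) (omit W j Y j).

(* Delta_jq (h_q + sum_p K_qp h_p) / (1 + sum_p K_jp h_p), the sums being over
   p > q, p > j for R and over p < q, p < j for L. *)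
Definition monodromy_entry (l : side) (D : 'I_n -> C) (K : 'M[C]_n)
    (h : 'cV[C]_n) (j q : 'I_n) : option C :=
  match l with
  | SdR => quotP1 (D q * (h q 0 + \sum_(p < n | (q < p)%N) K q p * h p 0))
                  (1 + \sum_(p < n | (j < p)%N) K j p * h p 0)
  | SdL => quotP1 (D q * (h q 0 + \sum_(p < n | (p < q)%N) K q p * h p 0))
                  (1 + \sum_(p < n | (p < j)%N) K j p * h p 0)
  end.

(* diag (D) K h / (row_j K) h *)
Definition monodromy_vector (D : 'I_n -> C) (K : 'M[C]_n) (h : 'cV[C]_n)
    (j q : 'I_n) : option C :=
  quotP1 ((diag_mx (\row_k D k) *m (K *m h)) q 0) ((row j K *m h) 0 0).

End FirstIntegrals.

Section Conclusions.
Variable R : realType.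
Local Notation C := (CC R).
Variable n : nat.
Variable sys : linear_family R n.
Variable g : geometry R.

(* The number alpha depends on the formal invariants mu only. *)
Definition wild_multiplier : Prop :=
  exists wild : side -> C -> C -> C,
    forall (l : side) (j q : 'I_n), q != j ->
      let alpha z := wild l (mu sys l z j) (mu sys l z q) in
      (forall z, sectorS g z -> alpha z != 0 /\
         Delta sys l z j q = cexp (2 * ofR pi * iC R / alpha z)) /\
      alpha @ hat0 g --> (0 : C).

(* The projective transformations of matrix (hat C_l)^-1 have a limit. *)
Definition stokes_limit (St : side -> C -> 'M[C]_n) : Prop :=
  forall l : side, exists2 K : 'M[C]_n, K \in unitmx &
    forall i k, (fun z => invmx (St l z) i k : C) @ hat0 g --> (K i k : C).

(* MW is the monodromy of W = W_V. The formulas are asserted where the first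
   integrals H^j_q (x, Y) are all finite, i.e. as identities between
   meromorphic functions of (x, Y). *)
Definition monodromy_formulas (l : side) (z : C) (K : 'M[C]_n)
    (W MW : 'M[C]_n) : Prop :=
  forall (j : 'I_n) (Y : 'cV[C]_(n.-1)) (h : 'cV[C]_n),
    (forall q, first_integral W j Y q = Some (h q 0)) ->
    (forall q, q != j -> first_integral MW j Y q =
       monodromy_entry l (Delta sys l z j) K h j q) /\
    (forall q, first_integral MW j Y q =
       monodromy_vector (Delta sys l z j) K h j q).

End Conclusions.

(* Main.v *)
(* Monodromy formulas.  On a loop around xhat_l the solutions H_s F_s continue as
   H_s times the explicit branch of the model solution obtained by following
   log (x - xhat_L) and log (x - xhat_R); the two matrices H_s agree on Omega_C,
   which is the only place where the loop changes sheets.  Back at the base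
   point, W_V has become H_U F_D Dhat_l = W_V C_l Dhat_l.  The first integrals
   are the quotients of the signed maximal minors of a matrix of size
   (n - 1) x n whose columns are the b_i, and right multiplication by G acts on
   the vector of these minors as (det G) G^-1.

   Limit of the Stokes matrices.  In the time t the k-th column of H_s satisfies
   a system which is diagonal up to a perturbation O(x^2 - eps).  Along a line
   Im t = const, tilted for large |t| as the sheets are, the spectral gap gives
   the i-th diagonal coefficient a definite sign for i > k and the opposite one
   for i < k, and the perturbation is O(1 / (T + |t|)^2).  Hence the column is
   determined by its limits at both ends, it is close to the limit of H_s at
   xhat_R when T is large, and two values of hat-epsilon near 0 give columns
   that are close on every bounded part of the path.  So H_s converges at the
   points t = +T and t = -T, which lie on both sheets, to invertible matrices;
   there C_l is expressed by H_D, H_U and F_D, all of which converge. *)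

Require Import Defs.
From HB Require Import structures.
From mathcomp Require Import all_boot all_order all_algebra.
From mathcomp Require Import complex.
From mathcomp Require Import all_classical all_reals all_analysis.
From mathcomp Require Import ring lra.

Set Implicit Arguments.
Unset Strict Implicit.
Unset Printing Implicit Defensive.

Import Order.TTheory GRing.Theory Num.Theory.
Import numFieldNormedType.Exports.

Local Open Scope classical_set_scope.
Local Open Scope ring_scope.

(** * Complex calculus *)

(** Convergence of the whole matrix [H] at a fixed time is not among the hypotheses and has to be
    proved. What makes the estimates uniform is the order of the choices. The angle [gamma] fixes
    [beta_of gamma], the slowest rate at which the real part of [sqrt_eps z * t] runs to infinity on
    the tilted ends of a sheet, and this rate bounds [c0]. The size [T] of the excursion around the
    excluded set depends only on the family, on [gamma] and on [r]. Hat-epsilon is made small last,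
    so that [|u| <= T] falls into the flat part of [sigma]. Every slope of the path is at most the
    tangent of [gamma * (1 + 2 * gamma / pi)], and since this angle is smaller than [theta0], the
    spectral gap is strict for all these slopes. A second obstacle is that [FU] is only known to be
    analytic and to agree with [FD] on Omega_R: its differential equation has to be carried along
    the path by isolated zeros, and so does the uniqueness of continuations along a loop. All of
    this rests on power series with coefficients at most [M * Q ^+ k] and a geometric remainder. *)

Section ComplexBasics.
Variable R : realType.
Local Notation C := (CC R).
Implicit Types (x y z w : C) (a b : R).

Lemma ceqP x y : reC x = reC y -> imC x = imC y -> x = y.
Proof. by case: x y => [a b] [c d] /= -> ->. Qed.

Lemma reCD x y : reC (x + y) = reC x + reC y.
Proof. by case: x y => [? ?] [? ?]. Qed.
Lemma imCD x y : imC (x + y) = imC x + imC y.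
Proof. by case: x y => [? ?] [? ?]. Qed.
Lemma reCN x : reC (- x) = - reC x. Proof. by case: x. Qed.
Lemma imCN x : imC (- x) = - imC x. Proof. by case: x. Qed.
Lemma reCB x y : reC (x - y) = reC x - reC y.
Proof. by rewrite reCD reCN. Qed.
Lemma imCB x y : imC (x - y) = imC x - imC y.
Proof. by rewrite imCD imCN. Qed.
Lemma reCM x y : reC (x * y) = reC x * reC y - imC x * imC y.
Proof. by case: x y => [? ?] [? ?]. Qed.
Lemma imCM x y : imC (x * y) = reC x * imC y + imC x * reC y.
Proof. by case: x y => [? ?] [? ?] /=; rewrite addrC [X in X + _]mulrC addrC [X in _ + X]mulrC. Qed.
Lemma reC_ofR a : reC (ofR a) = a. Proof. by []. Qed.
Lemma imC_ofR a : imC (ofR a) = 0. Proof. by []. Qed.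
Lemma reC_i : reC (iC R) = 0. Proof. by []. Qed.
Lemma imC_i : imC (iC R) = 1. Proof. by []. Qed.
Lemma reC0 : reC (0 : C) = 0. Proof. by []. Qed.
Lemma reC1 : reC (1 : C) = 1. Proof. by []. Qed.
Lemma imC1 : imC (1 : C) = 0. Proof. by []. Qed.
Lemma ofRD a b : ofR (a + b) = ofR a + ofR b.
Proof. by apply: ceqP; rewrite ?reCD ?imCD !(reC_ofR, imC_ofR) ?addr0. Qed.
Lemma ofRN a : ofR (- a) = - ofR a.
Proof. by apply: ceqP; rewrite ?reCN ?imCN !(reC_ofR, imC_ofR) ?oppr0. Qed.
Lemma ofRB a b : ofR (a - b) = ofR a - ofR b.
Proof. by rewrite ofRD ofRN. Qed.
Lemma ofRM a b : ofR (a * b) = ofR a * ofR b.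
Proof.
by apply: ceqP; rewrite ?reCM ?imCM !(reC_ofR, imC_ofR) ?mulr0 ?mul0r ?subr0 ?addr0.
Qed.
Lemma ofR0 : ofR (0 : R) = 0. Proof. by []. Qed.
Lemma ofR1 : ofR (1 : R) = 1. Proof. by []. Qed.
Lemma ofR_nat n : ofR (n%:R : R) = n%:R.
Proof. by elim: n => // n IH; rewrite -!natr1 ofRD IH. Qed.
Lemma ofRV a : ofR a^-1 = (ofR a)^-1.
Proof.
have [->|a0] := eqVneq a 0; first by rewrite ofR0 !invr0.
have ha : ofR a != 0 by apply: contra a0 => /eqP /(congr1 (@reC R)) /= ->.
by apply: (mulfI ha); rewrite -ofRM !mulfV.
Qed.
Lemma ofR_int (k : int) : ofR (k%:~R : R) = k%:~R.
Proof.
case: k => k; first by rewrite -!pmulrn ofR_nat.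
by rewrite NegzE !mulrNz ofRN -!pmulrn ofR_nat.
Qed.
Lemma complexE2 x : x = ofR (reC x) + iC R * ofR (imC x).
Proof.
by apply: ceqP; rewrite ?(reCD, imCD, reCM, imCM, reC_ofR, imC_ofR, reC_i, imC_i); lra.
Qed.
Lemma reC_ofRM a x : reC (ofR a * x) = a * reC x.
Proof. by rewrite reCM imC_ofR mul0r subr0. Qed.
Lemma imC_ofRM a x : imC (ofR a * x) = a * imC x.
Proof. by rewrite imCM imC_ofR mul0r addr0. Qed.
Lemma reC_iM x : reC (iC R * x) = - imC x.
Proof. by rewrite reCM reC_i imC_i mul0r mul1r sub0r. Qed.
Lemma imC_iM x : imC (iC R * x) = reC x.
Proof. by rewrite imCM reC_i imC_i mul0r mul1r add0r. Qed.

Lemma normr_absC x : `|x| = ofR (absC x).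
Proof. by case: x. Qed.
Lemma absCE x : absC x = Num.sqrt (reC x ^+ 2 + imC x ^+ 2).
Proof. by case: x. Qed.
Lemma absC_sqr x : absC x ^+ 2 = reC x ^+ 2 + imC x ^+ 2.
Proof. by rewrite absCE sqr_sqrtr // addr_ge0 // sqr_ge0. Qed.
Lemma absC_ge0 x : 0 <= absC x. Proof. by rewrite absCE sqrtr_ge0. Qed.
Lemma absC0 : absC (0 : C) = 0.
Proof. exact: ComplexField.Normc.normc0. Qed.
Lemma absC1 : absC (1 : C) = 1.
Proof. exact: ComplexField.Normc.normc1. Qed.
Lemma absC0_eq0 x : absC x = 0 -> x = 0.
Proof. exact: ComplexField.Normc.eq0_normc. Qed.
Lemma absC_eq0 x : (absC x == 0) = (x == 0).
Proof. by apply/eqP/eqP => [/absC0_eq0|->] //; exact: absC0. Qed.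
Lemma absC_gt0 x : (0 < absC x) = (x != 0).
Proof. by rewrite lt0r absC_eq0 absC_ge0 andbT. Qed.
Lemma absCM x y : absC (x * y) = absC x * absC y.
Proof. exact: ComplexField.Normc.normcM. Qed.
Lemma absCV x : absC x^-1 = (absC x)^-1.
Proof. exact: ComplexField.Normc.normcV. Qed.
Lemma absCf x y : absC (x / y) = absC x / absC y.
Proof. by rewrite absCM absCV. Qed.
Lemma absCX x n : absC (x ^+ n) = absC x ^+ n.
Proof. by elim: n => [|n IH]; rewrite ?expr0 ?absC1 // !exprS absCM IH. Qed.
Lemma absCN x : absC (- x) = absC x.
Proof. by rewrite !absCE reCN imCN !sqrrN. Qed.
Lemma absCB x y : absC (x - y) = absC (y - x).
Proof. by rewrite -opprB absCN. Qed.
Lemma absCD x y : absC (x + y) <= absC x + absC y.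
Proof.
have := ler_normD x y; rewrite !normr_absC -ofRD.
by rewrite lecE /= => /andP[].
Qed.
Lemma absCD_le x y a b : absC x <= a -> absC y <= b -> absC (x + y) <= a + b.
Proof. by move=> h1 h2; apply: (le_trans (absCD _ _)); rewrite lerD. Qed.
Lemma absCBD x y : absC (x - y) <= absC x + absC y.
Proof. by rewrite (le_trans (absCD _ _)) // absCN. Qed.
Lemma absC_tri x y z : absC (x - z) <= absC (x - y) + absC (y - z).
Proof. by rewrite (le_trans _ (absCD _ _)) // addrA subrK. Qed.
Lemma absC_subD x y : absC x - absC y <= absC (x - y).
Proof. by rewrite lerBlDr (le_trans _ (absCD _ _)) // subrK. Qed.
Lemma absC_ofR a : absC (ofR a) = `|a|.
Proof. by rewrite absCE /= expr0n addr0 sqrtr_sqr. Qed.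
Lemma absC_i : absC (iC R) = 1.
Proof. by rewrite absCE /= expr0n expr1n add0r sqrtr1. Qed.
Lemma absC_nat n : absC (n%:R : C) = n%:R.
Proof. by rewrite -ofR_nat absC_ofR normr_nat. Qed.
Lemma abs_reC x : `|reC x| <= absC x.
Proof. by rewrite absCE -sqrtr_sqr ler_wsqrtr // lerDl sqr_ge0. Qed.
Lemma abs_imC x : `|imC x| <= absC x.
Proof. by rewrite absCE -sqrtr_sqr ler_wsqrtr // lerDr sqr_ge0. Qed.
Lemma reC_le x : reC x <= absC x.
Proof. exact: le_trans (ler_norm _) (abs_reC x). Qed.
Lemma absC_le_reim x : absC x <= `|reC x| + `|imC x|.
Proof.
rewrite -[leRHS]ger0_norm ?addr_ge0 // -sqrtr_sqr absCE ler_wsqrtr //.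
by rewrite sqrrD !real_normK ?num_real // lerD2r lerDl mulrn_wge0 // mulr_ge0.
Qed.
Lemma absC_sum (I : Type) (r : seq I) (P : pred I) (f : I -> C) :
  absC (\sum_(i <- r | P i) f i) <= \sum_(i <- r | P i) absC (f i).
Proof.
elim/big_rec2: _ => [|i a b _ h]; first by rewrite absC0.
by apply: absCD_le.
Qed.
Lemma absC_le0_eq x : (forall e : R, 0 < e -> absC x <= e) -> x = 0.
Proof.
move=> h; apply: absC0_eq0; apply/eqP; rewrite eq_le absC_ge0 andbT.
by apply/ler_addgt0Pr => e e0; rewrite add0r h.
Qed.

Lemma nbhs_absC x (A : set C) :
  nbhs x A <-> exists2 d : R, 0 < d & forall y, absC (y - x) < d -> A y.
Proof.
split.
  move/nbhs_ballP => [e /= e0 he].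
  have er : e = ofR (reC e).
    by apply: ceqP => //; move: e0; rewrite ltcE => /andP[/eqP h _]; rewrite imC_ofR; exact: h.
  exists (reC e); first by move: e0; rewrite ltcE => /andP[].
  move=> y hy; apply: he; rewrite -ball_normE /= normr_absC er ltcE /= eqxx /=.
  by rewrite -[X in absC X]opprB absCN.
move=> [d d0 h]; apply/nbhs_ballP; exists (ofR d); first by rewrite /= ltcE /= eqxx.
move=> y; rewrite -ball_normE /= normr_absC ltcE /= eqxx /= => hy.
by apply: h; rewrite -[X in absC X]opprB absCN.
Qed.

Lemma cvg_absC (T : Type) (F : set_system T) (f : T -> C) (l : C) : Filter F ->
  (f @ F --> l) <-> forall e : R, 0 < e -> F [set t | absC (f t - l) < e].
Proof.
move=> FF; split=> [h e e0|h A].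
  by apply: (h [set y | absC (y - l) < e]); apply/nbhs_absC; exists e.
move/nbhs_absC => [d d0 hd]; apply: (@filterS _ _ _ [set t | absC (f t - l) < d]).
  by move=> t; apply: hd.
exact: h.
Qed.

End ComplexBasics.

(** * Continuity and differentiability by increments *)

Section Derivatives.
Variable R : realType.
Local Notation C := (CC R).

(* Continuity and derivatives at a point along a map [io : T -> C]: complex
   ones for [io = id], those of curves of a real variable for [io = @ofR R]. *)
Section Along.
Variables (T : Type) (io : T -> C).

Definition gcont (f : T -> C) (x : T) : Prop := forall e : R, 0 < e ->
  exists2 d : R, 0 < d & forall y, absC (io y - io x) < d -> absC (f y - f x) < e.

(** The increment form with a non-strict bound contains no quotient and is true at [y = x], so the
    rules for products and compositions are estimates without exceptional points. *)
Definition gderiv (f : T -> C) (x : T) (v : C) : Prop := forall e : R, 0 < e ->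
  exists2 d : R, 0 < d & forall y, absC (io y - io x) < d ->
    absC (f y - f x - v * (io y - io x)) <= e * absC (io y - io x).

Definition gnear (x : T) (P : T -> Prop) : Prop :=
  exists2 d : R, 0 < d & forall y, absC (io y - io x) < d -> P y.

Lemma gnear_and x P Q : gnear x P -> gnear x Q -> gnear x (fun y => P y /\ Q y).
Proof.
move=> [d d0 h] [d' d'0 h']; exists (Num.min d d'); first by rewrite lt_min d0.
by move=> y; rewrite lt_min => /andP[h1 h2]; split; [apply: h|apply: h'].
Qed.

Lemma gnear_imp x (P Q : T -> Prop) : (forall y, P y -> Q y) -> gnear x P -> gnear x Q.
Proof. by move=> PQ [d d0 h]; exists d => // y /h /PQ. Qed.

Lemma gnear_at x (P : T -> Prop) : gnear x P -> P x.
Proof. by move=> [d d0]; apply; rewrite subrr absC0. Qed.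

Lemma gnear_near x (P : T -> Prop) : gnear x P -> gnear x (fun y => gnear y P).
Proof.
move=> [d d0 h]; exists d => // y hy.
exists (d - absC (io y - io x)); first by rewrite subr_gt0.
move=> w hw; apply: h; rewrite (le_lt_trans (absC_tri _ (io y) _)) //.
by rewrite -ltrBrDr.
Qed.

Lemma gderiv_ext f g x v : gnear x (fun y => f y = g y) ->
  gderiv f x v -> gderiv g x v.
Proof.
move=> fg hf e e0; have fgx := gnear_at fg.
have [d d0 h] := gnear_and fg (hf e e0).
by exists d => // y /h [<- +]; rewrite -fgx.
Qed.

Lemma gcont_ext f g x : gnear x (fun y => f y = g y) -> gcont f x -> gcont g x.
Proof.
move=> fg hf e e0; have fgx := gnear_at fg.
have [d d0 h] := gnear_and fg (hf e e0).
by exists d => // y /h [<- +]; rewrite -fgx.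
Qed.

Lemma gderiv_lip f x v : gderiv f x v ->
  gnear x (fun y => absC (f y - f x) <= (absC v + 1) * absC (io y - io x)).
Proof.
move=> /(_ 1 ltr01) [d d0 h]; exists d => // y /h hy.
rewrite -[f y - f x](subrK (v * (io y - io x))) mulrDl mul1r addrC.
by apply: absCD_le; [rewrite absCM|rewrite mul1r in hy].
Qed.

Lemma gderiv_cont f x v : gderiv f x v -> gcont f x.
Proof.
move=> /gderiv_lip [d d0 h] e e0.
have k0 : 0 < absC v + 1 by rewrite ltr_wpDl ?absC_ge0.
exists (Num.min d (e / (absC v + 1))); first by rewrite lt_min d0 divr_gt0.
move=> y; rewrite lt_min => /andP[/h hy]; rewrite ltr_pdivlMr // mulrC.
exact: le_lt_trans.
Qed.

Lemma gcont_cst c x : gcont (fun _ => c) x.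
Proof. by move=> e e0; exists 1 => // y _; rewrite subrr absC0. Qed.

Lemma gcont_near_neq0 f x : gcont f x -> f x != 0 -> gnear x (fun y => f y != 0).
Proof.
move=> hf fx0; have [d d0 h] := hf (absC (f x)) (eqbRL (absC_gt0 _) fx0).
exists d => // y /h; apply: contraTneq => ->.
by rewrite sub0r absCN ltxx.
Qed.

Lemma gcontD f g x : gcont f x -> gcont g x -> gcont (fun y => f y + g y) x.
Proof.
move=> hf hg e e0; have e2 : 0 < e / 2 by rewrite divr_gt0.
have [d d0 h] := gnear_and (hf _ e2) (hg _ e2).
exists d => // y /h [h1 h2]; rewrite opprD addrACA (splitr e).
by rewrite (le_lt_trans (absCD _ _)) // ltrD.
Qed.

Lemma gcontM f g x : gcont f x -> gcont g x -> gcont (fun y => f y * g y) x.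
Proof.
move=> hf hg e e0; set K := absC (f x) + absC (g x) + 1.
have K0 : 0 < K by rewrite ltr_wpDl // addr_ge0 ?absC_ge0.
(* The cap 1 lets the product of the two increments be absorbed by the summand 1 of [K]. *)
pose e' := Num.min 1 (e / K); have e'0 : 0 < e' by rewrite lt_min ltr01 divr_gt0.
have [d d0 h] := gnear_and (hf _ e'0) (hg _ e'0).
exists d => // y /h [h1 h2].
have -> : f y * g y - f x * g x = (f y - f x) * (g y - g x)
    + (f x * (g y - g x) + (f y - f x) * g x) by ring.
have e'1 : e' <= 1 by rewrite ge_min lexx.
have e'K : e' * K <= e by rewrite -ler_pdivlMr // ge_min lexx orbT.
apply: (lt_le_trans _ e'K).
apply: (le_lt_trans (absCD_le (lexx _) (absCD _ _))); rewrite !absCM /K.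
have := absC_ge0 (f x); have := absC_ge0 (g x).
have := absC_ge0 (f y - f x); have := absC_ge0 (g y - g x).
nra.
Qed.

Lemma gcontN f x : gcont f x -> gcont (fun y => - f y) x.
Proof. by move=> hf e /hf [d d0 h]; exists d => // y /h; rewrite -opprD absCN. Qed.

Lemma gcontB f g x : gcont f x -> gcont g x -> gcont (fun y => f y - g y) x.
Proof. by move=> hf hg; apply: gcontD => //; apply: gcontN. Qed.

Lemma gderiv_cst c x : gderiv (fun _ => c) x 0.
Proof. by move=> e e0; exists 1 => // y _; rewrite subrr mul0r subrr absC0 mulr_ge0 ?absC_ge0 ?ltW. Qed.

Lemma gderiv_io x : gderiv io x 1.
Proof. by move=> e e0; exists 1 => // y _; rewrite mul1r subrr absC0 mulr_ge0 ?absC_ge0 ?ltW. Qed.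

Lemma gderivD f g x v w : gderiv f x v -> gderiv g x w ->
  gderiv (fun y => f y + g y) x (v + w).
Proof.
move=> hf hg e e0; have e2 : 0 < e / 2 by rewrite divr_gt0.
have [d d0 h] := gnear_and (hf _ e2) (hg _ e2).
exists d => // y /h [h1 h2].
have -> : f y + g y - (f x + g x) - (v + w) * (io y - io x) =
  (f y - f x - v * (io y - io x)) + (g y - g x - w * (io y - io x)) by ring.
rewrite (_ : e * _ = e / 2 * absC (io y - io x) + e / 2 * absC (io y - io x)); last by field.
exact: absCD_le.
Qed.

Lemma gderiv_sum n (f : 'I_n -> T -> C) (v : 'I_n -> C) x :
  (forall i, gderiv (f i) x (v i)) ->
  gderiv (fun y => \sum_(i < n) f i y) x (\sum_(i < n) v i).
Proof.
move=> h; elim: n f v h => [|n IH] f v h.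
  rewrite big_ord0.
  by apply: (@gderiv_ext (fun=> 0)); [exists 1 => // y _; rewrite big_ord0|exact: gderiv_cst].
rewrite big_ord_recr /=.
apply: (@gderiv_ext (fun y => \sum_(i < n) f (widen_ord (leqnSn n) i) y + f ord_max y)).
  by exists 1 => // y _; rewrite big_ord_recr.
by apply: gderivD => //; apply: IH.
Qed.

Lemma gderivM f g x v w : gderiv f x v -> gderiv g x w ->
  gderiv (fun y => f y * g y) x (v * g x + f x * w).
Proof.
move=> hf hg e e0.
have [d1 d10 lf] := gderiv_lip hf; have cg := gderiv_cont hg.
set K := absC (f x) + absC (g x) + (absC v + 1).
have K0 : 0 < K by rewrite ltr_wpDl ?addr_ge0 ?absC_ge0 // ltr_wpDl ?absC_ge0.
have e'0 : 0 < e / K by rewrite divr_gt0.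
have [d d0 h] := gnear_and (gnear_and (hf _ e'0) (hg _ e'0)) (gnear_and (cg _ e'0) (gderiv_lip hf)).
exists d => // y /h [[h1 h2] [h3 h4]].
have -> : f y * g y - f x * g x - (v * g x + f x * w) * (io y - io x) =
  (f y - f x - v * (io y - io x)) * g x + f x * (g y - g x - w * (io y - io x))
  + (f y - f x) * (g y - g x) by ring.
have -> : e = e / K * K by rewrite divfK // gt_eqF.
set e' := e / K in h1 h2 h3 e'0 *; set t := absC (io y - io x) in h1 h2 h4 *.
have t0 : 0 <= t := absC_ge0 _.
have -> : e' * K * t = (e' * t) * absC (g x) + absC (f x) * (e' * t)
   + ((absC v + 1) * t) * e' by rewrite /K; ring.
apply: absCD_le; first (apply: absCD_le; rewrite absCM).
- by rewrite ler_wpM2r ?absC_ge0.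
- by rewrite ler_wpM2l ?absC_ge0.
- by rewrite absCM ler_pM ?absC_ge0 // ltW.
Qed.

Lemma gderivZ c f x v : gderiv f x v -> gderiv (fun y => c * f y) x (c * v).
Proof. by move=> h; have := gderivM (gderiv_cst c x) h; rewrite mul0r add0r. Qed.

Lemma gderivN f x v : gderiv f x v -> gderiv (fun y => - f y) x (- v).
Proof.
move=> /(gderivZ (-1)); rewrite mulN1r; apply: gderiv_ext.
by exists 1 => // y _; rewrite mulN1r.
Qed.

Lemma gderivB f g x v w : gderiv f x v -> gderiv g x w ->
  gderiv (fun y => f y - g y) x (v - w).
Proof. by move=> hf hg; apply: gderivD => //; apply: gderivN. Qed.

Lemma gderiv_eq f x v w : v = w -> gderiv f x v -> gderiv f x w.
Proof. by move=> ->. Qed.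

End Along.

Section Composition.
Variables (T : Type) (io : T -> C).

Lemma gcont_comp (f : C -> C) (g : T -> C) x :
  gcont id f (g x) -> gcont io g x -> gcont io (fun y => f (g y)) x.
Proof. by move=> hf hg e /hf [d /hg [d' d'0 h'] h]; exists d' => // y /h' /h. Qed.

Lemma gderiv_comp (f : C -> C) (g : T -> C) x v w :
  gderiv id f (g x) v -> gderiv io g x w -> gderiv io (fun y => f (g y)) x (v * w).
Proof.
move=> hf hg e e0.
set K := absC v + (absC w + 1).
have w1 : 0 < absC w + 1 by rewrite ltr_wpDl ?absC_ge0.
have K0 : 0 < K by rewrite ltr_wpDl ?absC_ge0.
have e'0 : 0 < e / K by rewrite divr_gt0.
have [d d0 h] := hf _ e'0.
have cg := gderiv_cont hg.
have [d' d'0 h'] := gnear_and (cg _ d0) (gnear_and (hg _ e'0) (gderiv_lip hg)).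
exists d' => // y /h' [/h h1 [h2 h3]].
have -> : f (g y) - f (g x) - v * w * (io y - io x) =
  (f (g y) - f (g x) - v * (g y - g x)) + v * (g y - g x - w * (io y - io x)) by ring.
have -> : e = e / K * K by rewrite divfK // gt_eqF.
set e' := e / K in h1 h2 e'0 *; set t := absC (io y - io x) in h2 h3 *.
have -> : e' * K * t = e' * ((absC w + 1) * t) + absC v * (e' * t) by rewrite /K; ring.
apply: absCD_le; last by rewrite absCM ler_wpM2l ?absC_ge0.
by apply: (le_trans h1); rewrite ler_wpM2l // ltW.
Qed.

End Composition.

Lemma gderiv_inv (x : C) : x != 0 -> gderiv id (fun y : C => y^-1) x (- (x * x)^-1).
Proof.
move=> x0 e e0; have a0 : 0 < absC x by rewrite absC_gt0.
exists (Num.min (absC x / 2) (e * absC x ^+ 3 / 2)).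
  by rewrite lt_min !divr_gt0 // mulr_gt0 // exprn_gt0.
move=> y; rewrite lt_min => /andP[h1 h2].
have hy : absC x / 2 <= absC y.
  have := absC_subD x (x - y); rewrite (absCB x y) /= subKr.
  by move=> h; rewrite (le_trans _ h) //; lra.
have y0 : y != 0 by rewrite -absC_gt0 (lt_le_trans _ hy) // divr_gt0.
have -> : y^-1 - x^-1 - - (x * x)^-1 * (y - x) = (y - x) ^+ 2 / (x ^+ 2 * y).
  by field; rewrite x0 y0.
rewrite absCf absCM !absCX expr2 -mulrA mulrC ler_wpM2r ?absC_ge0 //.
rewrite ler_pdivrMr; last by rewrite mulr_gt0 ?exprn_gt0 // absC_gt0.
apply: (le_trans (ltW h2)).
rewrite (_ : e * absC x ^+ 3 / 2 = e * (absC x ^+ 2 * (absC x / 2))); last by field.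
by rewrite ler_pM2l // ler_pM2l ?exprn_gt0.
Qed.

Lemma gcont_inv (x : C) : x != 0 -> gcont id (fun y : C => y^-1) x.
Proof. by move=> h; exact: gderiv_cont (gderiv_inv h). Qed.

End Derivatives.

(** * Passage to the library derivatives; monotonicity on a segment *)

Section Bridges.
Variable R : realType.
Local Notation C := (CC R).

Lemma ofR_dist (u v : R) : absC (ofR u - ofR v) = `|u - v|.
Proof. by rewrite -ofRB absC_ofR. Qed.

Lemma gderiv_derive (f : C -> C) (x : C) :
  derivable f x 1 -> gderiv id f x ('D_1 f x).
Proof.
move=> /cvg_absC H e e0; have := H _ e0.
rewrite /dnbhs /within /= => /nbhs_absC [d d0 h].
exists d => // y hy; have [->|xy] := eqVneq y x.
  by rewrite !subrr mulr0 subrr absC0 mulr0.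
have yx0 : y - x != 0 by rewrite subr_eq0.
have := h (y - x); rewrite subr0 => /(_ hy yx0) /= hh.
have -> : f y - f x - 'D_1 f x * (y - x)
   = ((y - x)^-1 * (f y - f x) - 'D_1 f x) * (y - x) by field.
rewrite absCM ler_wpM2r ?absC_ge0 //; apply: ltW.
by move: hh; rewrite /= /GRing.scale /= mulr1 subrK.
Qed.

Lemma is_derive_reC (f : R -> C) (u : R) (v : C) :
  gderiv (@ofR R) f u v -> is_derive u 1 (@reC R \o f : R -> R) (reC v).
Proof.
move=> h; have H : (fun h : R => h^-1 *: (((@reC R \o f : R -> R) \o shift u) (h *: 1) - (@reC R \o f) u))
    @ 0^' --> reC v.
  apply/cvgrPdist_le => e e0; have [d d0 hd] := h _ e0.
  rewrite /dnbhs /within; apply/nbhs_ballP; exists d => // y /=.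
  rewrite /ball /= sub0r normrN => hy y0.
  have := hd (y + u); rewrite ofR_dist addrK => /(_ hy).
  rewrite -[ofR (y + u) - _]ofRB addrK => hh.
  rewrite /GRing.scale /= mulr1.
  have -> : reC v - y^-1 * (reC (f (y + u)) - reC (f u))
    = - (y^-1 * reC (f (y + u) - f u - v * ofR y)).
    by rewrite !reCB reCM reC_ofR imC_ofR; field.
  rewrite normrN normrM normfV ler_pdivrMl ?normr_gt0 // [leRHS]mulrC.
  exact: le_trans (abs_reC _) hh.
by split; [apply/cvg_ex; exists (reC v)|apply: cvg_lim].
Qed.

Lemma gcont_reC (f : R -> C) (u : R) :
  gcont (@ofR R) f u -> {for u, continuous (@reC R \o f : R -> R)}.
Proof.
move=> h; apply/cvgrPdist_lt => e e0; have [d d0 hd] := h _ e0.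
apply/nbhs_ballP; exists d => //= y; rewrite /ball /= => hy.
have := hd y; rewrite ofR_dist distrC => /(_ hy); apply: le_lt_trans.
by rewrite -reCB (le_trans (abs_reC _)) // absCB.
Qed.

(** The mean value theorem on each piece between the exceptional points of [s], where continuity is
    enough. The list is there because the path followed later is only piecewise affine; induction on
    [s] cuts the segment at one point at a time. *)
Lemma reC_nonincr (s : seq R) (f : R -> C) (a b : R) : a <= b ->
  (forall u, a <= u <= b -> gcont (@ofR R) f u) ->
  (forall u, a < u < b -> u \notin s ->
     exists2 v, gderiv (@ofR R) f u v & reC v <= 0) ->
  reC (f b) <= reC (f a).
Proof.
elim: s a b => [|k s IH] a b ab hc hd.
  rewrite le_eqVlt in ab; case/predU1P: ab => [->//|ab].
  have cf : {within `[a, b], continuous (@reC R \o f : R -> R)}.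
    apply: continuous_in_subspaceT => u; rewrite inE /= in_itv /= => hu.
    by apply: gcont_reC; apply: hc.
  have dv u : exists v : R, (u \in `]a, b[%R -> is_derive u 1 (@reC R \o f : R -> R) v) /\ v <= 0.
    have [hu|hu] := boolP (a < u < b); last first.
      by exists 0; rewrite in_itv /= (negbTE hu).
    have [v h1 h2] := hd u hu isT.
    by exists (reC v); split => // _; apply: is_derive_reC.
  have [df hdf] := choice dv.
  have [c _ hcab] := MVT ab (fun u h => (hdf u).1 h) cf.
  rewrite -subr_le0; move: hcab => /= ->.
  by rewrite mulr_le0_ge0 ?subr_ge0 ?(ltW ab) // (hdf c).2.
have [/andP[ak kb]|hk] := boolP (a < k < b).
  apply: (@le_trans _ _ (reC (f k))).
    apply: IH => [|u /andP[h1 h2]|u /andP[h1 h2] us]; first exact: ltW.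
      by apply: hc; rewrite h2 (le_trans _ h1) // ltW.
    apply: hd; rewrite ?h2 ?(lt_trans ak) //.
    by rewrite inE negb_or us andbT gt_eqF.
  apply: IH => [|u /andP[h1 h2]|u /andP[h1 h2] us]; first exact: ltW.
    by apply: hc; rewrite h1 (le_trans h2) // ltW.
  apply: hd; rewrite ?h1 ?(lt_trans h2) //.
  by rewrite inE negb_or us andbT lt_eqF.
apply: IH => // u hu us; apply: hd => //.
by rewrite inE negb_or us andbT; apply: contra hk => /eqP <-.
Qed.

End Bridges.

(** * Quadratic estimates for the complex exponential *)

Section Exponential.
Variable R : realType.
Local Notation C := (CC R).
Implicit Types (x y z w : C).

Lemma reC_cexp x : reC (cexp x) = expR (reC x) * cos (imC x).
Proof. by []. Qed.
Lemma imC_cexp x : imC (cexp x) = expR (reC x) * sin (imC x).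
Proof. by []. Qed.
Lemma cexp0 : cexp (0 : C) = 1.
Proof. by apply: ceqP; rewrite ?reC_cexp ?imC_cexp /= expR0 ?cos0 ?sin0 ?mulr1 ?mulr0. Qed.
Lemma cexpD x y : cexp (x + y) = cexp x * cexp y.
Proof.
apply: ceqP; rewrite ?reCM ?imCM !reC_cexp !imC_cexp reCD imCD expRD ?cosD ?sinD.
  ring.
ring.
Qed.
Lemma cexpN_mul x : cexp (- x) * cexp x = 1.
Proof. by rewrite -cexpD addNr cexp0. Qed.
Lemma cexp_neq0 x : cexp x != 0.
Proof. by apply/eqP => h; have := cexpN_mul x; rewrite h mulr0 => /esym /eqP; rewrite oner_eq0. Qed.
Lemma cexpN x : cexp (- x) = (cexp x)^-1.
Proof. by apply: (mulIf (cexp_neq0 x)); rewrite cexpN_mul mulVf ?cexp_neq0. Qed.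
Lemma cexpB x y : cexp (x - y) = cexp x / cexp y.
Proof. by rewrite cexpD cexpN. Qed.
Lemma absC_cexp x : absC (cexp x) = expR (reC x).
Proof.
rewrite absCE reC_cexp imC_cexp !exprMn -mulrDr cos2Dsin2 mulr1 sqrtr_sqr.
by rewrite ger0_norm // expR_ge0.
Qed.

Lemma abs_sin_le (y : R) : `|sin y| <= `|y|.
Proof.
wlog y0 : y / 0 <= y.
  move=> h; have [/h //|/ltW y0] := leP 0 y.
  by rewrite -(normrN y) -(normrN (sin y)) -sinN; apply: h; rewrite oppr_ge0.
have [c _] := MVT_segment y0 (fun u _ => is_derive_sin u)
  (continuous_subspaceT (@continuous_sin R)).
rewrite sin0 !subr0 => ->; rewrite normrM -[leRHS]mul1r ler_wpM2r //.
exact: cos_max.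
Qed.

Lemma one_sub_cos (y : R) : 0 <= 1 - cos y <= y ^+ 2.
Proof.
have := cos_le1 y; rewrite -subr_ge0 => -> /=.
have -> : cos y = cos ((y / 2) *+ 2) by rewrite -mulr_natr divfK.
rewrite cos_mulr2n cos2sin2.
have := abs_sin_le (y / 2); rewrite -[leLHS]normr_id -ler_sqr ?nnegrE //.
rewrite normr_id !real_normK ?num_real // exprMn => h.
rewrite -mulr_natr; nra.
Qed.

Lemma abs_sin_sub (y : R) : `|y| <= 1 -> `|sin y - y| <= y ^+ 2.
Proof.
wlog y0 : y / 0 <= y.
  move=> h; have [/h //|/ltW y0] := leP 0 y.
  have := h (- y); rewrite oppr_ge0 normrN sinN sqrrN -opprD normrN; exact.
rewrite ger0_norm // => y1.
have [c /andP[c0 cy]] := MVT_segment y0 (fun u _ => is_derive_sin u)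
  (continuous_subspaceT (@continuous_sin R)).
rewrite sin0 !subr0 => ->; rewrite /= !bnd_simp in c0 cy.
have -> : cos c * y - y = - ((1 - cos c) * y) by ring.
have /andP[h1 h2] := one_sub_cos c.
rewrite normrN ger0_norm ?mulr_ge0 // expr2 ler_wpM2r // (le_trans h2) //.
nra.
Qed.

(** Only [1 + u <= expR u] is used: at [a] for the lower bound, and at [- a], in the form
    [expR a * (1 - a) <= 1], for the upper one. *)
Lemma abs_expR_sub (a : R) : `|a| <= 1 / 2 -> `|expR a - 1 - a| <= 2 * a ^+ 2.
Proof.
move=> ha; have h1 := expR_ge1Dx a; have h2 := expR_ge1Dx (- a).
have := expR_gt0 a; have := expRN a => hN e0.
have : expR a * expR (- a) = 1 by rewrite hN mulfV // gt_eqF.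
move: ha; rewrite ler_norml => /andP[h3 h4] he.
rewrite ger0_norm; last by lra.
have : expR a * (1 - a) <= expR a * expR (- a) by rewrite ler_pM2l.
rewrite he.
nra.
Qed.

(** The one estimate behind the derivative of [cexp], its local injectivity, the branches of the
    logarithm and the behaviour of [csinh] and [ccosh] near 0. The constant 10 is generous. *)
Lemma cexp_quad (x : C) : absC x <= 1 / 2 -> absC (cexp x - 1 - x) <= 10 * absC x ^+ 2.
Proof.
move=> hx; set a := reC x; set b := imC x; set t := absC x.
have ta : `|a| <= t := abs_reC x; have tb : `|b| <= t := abs_imC x.
have ta2 : `|a| <= 1 / 2 := le_trans ta hx.
have tb1 : `|b| <= 1 by rewrite (le_trans tb) // (le_trans hx) //; lra.
have h1 := abs_expR_sub ta2; have h2 := abs_sin_sub tb1.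
have /andP[h3 h4] := one_sub_cos b; have h5 := abs_sin_le b.
have a2 : a ^+ 2 <= t ^+ 2 by rewrite -real_normK ?num_real // lerXn2r ?nnegrE ?absC_ge0.
have b2 : b ^+ 2 <= t ^+ 2 by rewrite -real_normK ?num_real // lerXn2r ?nnegrE ?absC_ge0.
have ab : `|a| * `|b| <= t ^+ 2 by rewrite expr2 ler_pM.
have e1 : `|expR a - 1| <= 2 * `|a|.
  have -> : expR a - 1 = (expR a - 1 - a) + a by ring.
  rewrite (le_trans (ler_normD _ _)) // mulr2n mulrDl mul1r lerD2r (le_trans h1) //.
  by rewrite -real_normK ?num_real // expr2 mulrA ler_piMl //; lra.
rewrite (le_trans (absC_le_reim _)) //.
rewrite !reCB !imCB reC_cexp imC_cexp reC1 imC1 -/a -/b subr0.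
have i1 : `|expR a * cos b - 1 - a| <= 4 * t ^+ 2.
  have -> : expR a * cos b - 1 - a = (expR a - 1 - a) - expR a * (1 - cos b) by ring.
  rewrite (le_trans (ler_normB _ _)) // (_ : 4 * _ = 2 * t ^+ 2 + 2 * t ^+ 2); last by ring.
  apply: lerD; first by apply: (le_trans h1); lra.
  rewrite normrM (ger0_norm h3) ger0_norm ?expR_ge0 // ler_pM ?expR_ge0 //.
    have := ler_norm (expR a - 1); lra.
  exact: le_trans h4 b2.
have i2 : `|expR a * sin b - b| <= 3 * t ^+ 2.
  have -> : expR a * sin b - b = (expR a - 1) * sin b + (sin b - b) by ring.
  rewrite (le_trans (ler_normD _ _)) // (_ : 3 * _ = 2 * t ^+ 2 + t ^+ 2); last by ring.
  apply: lerD; last exact: le_trans h2 b2.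
  rewrite normrM; apply: (le_trans (ler_pM _ _ e1 h5)) => //; lra.
have : 0 <= t ^+ 2 by rewrite sqr_ge0.
lra.
Qed.

Lemma gderiv_cexp (x : C) : gderiv id (@cexp R) x (cexp x).
Proof.
move=> e e0; have K0 : 0 < 10 * expR (reC x) by rewrite mulr_gt0 ?expR_gt0.
exists (Num.min (1 / 2) (e / (10 * expR (reC x)))); first by rewrite lt_min !divr_gt0.
move=> y; rewrite lt_min => /andP[h1 h2].
have -> : cexp y - cexp x - cexp x * (y - x) = cexp x * (cexp (y - x) - 1 - (y - x)).
  by rewrite cexpB; field; exact: cexp_neq0.
rewrite absCM absC_cexp.
apply: (le_trans (ler_wpM2l (expR_ge0 _) (cexp_quad (ltW h1)))).
move: h2; rewrite ltr_pdivlMr // => /ltW h2.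
have := ler_wpM2l (absC_ge0 (y - x)) h2; lra.
Qed.

(** The floor of [b / (2 * pi)] reduces to [[0, 2 * pi[]; there [cos] is injective on the first
    half, and the second half is reflected onto it. *)
Lemma cos_eq1 (b : R) : cos b = 1 -> exists k : int, b = 2 * pi * k%:~R.
Proof.
have p0 : 0 < 2 * pi :> R by rewrite mulr_gt0 // pi_gt0.
have cosk (k : int) (a : R) : cos (a + 2 * pi * k%:~R) = cos a.
  have hn (n : nat) (c : R) : cos (c + 2 * pi * n%:R) = cos c.
    by rewrite mulr_natr mulr_natl (periodicn (@cosD2pi R)).
  case: k => n; first exact: hn.
  by rewrite NegzE mulrNz mulrN -[LHS](hn n.+1) subrK.
move=> hb; pose k := Num.floor (b / (2 * pi)).
exists k; set b' := b - 2 * pi * k%:~R.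
have cb : cos b' = 1 by rewrite -(cosk k) /b' subrK.
have b0 : 0 <= b'.
  by rewrite subr_ge0 mulrC -ler_pdivlMr // floor_le.
have b2 : b' < 2 * pi.
  have := floorD1_gt (b / (2 * pi)); rewrite ltr_pdivrMr // intrD -/k /b'.
  by set K := k%:~R; rewrite (_ : 1%:~R = 1) // => h; lra.
suff : b' = 0 by move/eqP; rewrite subr_eq0 => /eqP.
have [bp|pb] := leP b' pi.
  by apply: cos_inj; rewrite ?cos0 // in_itv /= ?lexx ?pi_ge0 ?b0.
have : 2 * pi - b' = 0.
  apply: cos_inj; rewrite ?in_itv /= ?lexx ?pi_ge0 //; first by apply/andP; split; lra.
  by rewrite cos0 mulr_natl cosB cos2pi sin2pi mul0r addr0 mul1r.
by move/eqP; rewrite subr_eq0 => /eqP h; move: b2; rewrite -h ltxx.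
Qed.

Lemma cexp_eq1 x : cexp x = 1 -> exists k : int, x = 2 * ofR pi * iC R * k%:~R.
Proof.
move=> h; have r0 : reC x = 0.
  by apply: expR_inj; rewrite expR0 -absC_cexp h absC1.
have := congr1 (@reC R) h; rewrite reC_cexp r0 expR0 mul1r => /cos_eq1 [k hk].
exists k; rewrite -ofR_int [x]complexE2 r0 ofR0 add0r hk !ofRM ofR_nat; ring.
Qed.

(** If [cexp x = 1], the quadratic remainder reads [|x| <= 10 * |x|^2]. This identifies two nearby
    logarithms of the same number without counting multiples of [2 * pi]. *)
Lemma cexp_small_eq1 x : cexp x = 1 -> absC x < 1 / 10 -> x = 0.
Proof.
move=> h hx; apply: absC0_eq0; have := absC_ge0 x.
have : absC x <= 1 / 2 by lra.
move/cexp_quad; rewrite h subrr sub0r absCN; nra.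
Qed.

End Exponential.

(** * Branches of the logarithm *)

Section Logarithm.
Variable R : realType.
Local Notation C := (CC R).

Lemma lipschitz_log (x : C) : absC x <= 1 / 20 -> absC x <= 2 * absC (cexp x - 1).
Proof.
move=> h; have : absC x <= 1 / 2 by lra.
move/cexp_quad => h1; have := absC_subD x (x - (cexp x - 1)); rewrite subKr.
rewrite (absCB x) [cexp x - 1 - x]lock -lock in h1 *.
have := absC_ge0 x; nra.
Qed.

Section Along.
Variables (T : Type) (io : T -> C).

(** Continuity makes the increment of [L] small, so [lipschitz_log] bounds it linearly in the
    increment of the variable; then the quadratic remainder of [cexp] is of second order. *)
Lemma gderiv_log (L f : T -> C) x v : gcont io L x ->
  gnear io x (fun y => cexp (L y) = f y) -> gderiv io f x v ->
  gderiv io L x (v / f x).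
Proof.
move=> hL hE hf.
have fx0 : f x != 0 by rewrite -(gnear_at hE) cexp_neq0.
have [d1 d10 lf] := gderiv_lip hf.
(* [K] is the resulting local Lipschitz constant of [L]; 20 in the radii below is twice the 10 of
   [cexp_quad], for one half of [e]. *)
set K := 2 * ((absC v + 1) / absC (f x)).
have K0 : 0 < K by rewrite mulr_gt0 // divr_gt0 ?absC_gt0 // ltr_wpDl ?absC_ge0.
move=> e e0.
have e20 : 0 < 1 / 20 :> R by rewrite divr_gt0.
have e1 : 0 < e / 2 * absC (f x) by rewrite mulr_gt0 ?absC_gt0 ?divr_gt0.
have e2 : 0 < e / (20 * K ^+ 2) by rewrite divr_gt0 // mulr_gt0 // exprn_gt0.
have [d d0 h] := gnear_and (gnear_and hE (hL _ e20)) (gnear_and (hf _ e1) (gderiv_lip hf)).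
exists (Num.min d (e / (20 * K ^+ 2))); first by rewrite lt_min d0.
move=> y; rewrite lt_min => /andP[/h [[h1 h2] [h3 h4]] h5].
set t := absC (io y - io x) in h3 h4 h5 *; have t0 : 0 <= t := absC_ge0 _.
set u := L y - L x in h2 *.
have Eu : cexp u - 1 = (f y - f x) / f x.
  by rewrite /u cexpB h1 (gnear_at hE) mulrBl divff.
have uK : absC u <= K * t.
  rewrite (le_trans (lipschitz_log (ltW h2))) // /K -mulrA ler_pM2l // Eu absCf.
  by rewrite mulrAC ler_wpM2r // invr_ge0 absC_ge0.
have -> : u - v / f x * (io y - io x) =
   - (cexp u - 1 - u) + (f y - f x - v * (io y - io x)) / f x.
  by rewrite Eu; field.
have -> : e * t = e / 2 * t + e / 2 * t by field.
apply: absCD_le; last first.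
  by rewrite absCf ler_pdivrMr ?absC_gt0 // mulrAC.
rewrite absCN; apply: (le_trans (cexp_quad _)); first by rewrite ltW // (lt_trans h2) //; lra.
have : absC u ^+ 2 <= (K * t) ^+ 2 by rewrite lerXn2r ?nnegrE ?absC_ge0 // mulr_ge0 // ltW.
move: h5; rewrite ltr_pdivlMr; last by rewrite mulr_gt0 // exprn_gt0.
have aux (U k ee : R) : U <= (k * t) ^+ 2 -> t * (20 * k ^+ 2) < ee -> 10 * U <= ee / 2 * t.
  by move=> hU /ltW /(ler_wpM2l t0); rewrite exprMn in hU; lra.
by move=> h6 h7; exact: aux h7 h6.
Qed.

End Along.

(* The principal logarithm on the half-plane [0 < reC w]; junk elsewhere. *)
Definition cLog (w : C) : C := ofR (ln (absC w)) + iC R * ofR (asin (imC w / absC w)).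

Lemma cLog1 : cLog 1 = 0.
Proof.
rewrite /cLog absC1 ln1 imC1 mul0r.
have -> : asin (0 : R) = 0.
  by rewrite -{1}sin0 sinK // in_itv /=; have := pi_gt0 R => p0; apply/andP; split; lra.
by rewrite ofR0 mulr0 addr0.
Qed.

Lemma imC_ratio (w : C) : 0 < reC w -> -1 < imC w / absC w < 1.
Proof.
move=> h; have a0 : 0 < absC w := lt_le_trans h (reC_le w).
rewrite -ltr_norml normrM normfV (ger0_norm (ltW a0)) ltr_pdivrMr // mul1r.
rewrite -(ltr_pXn2r (n := 2)) ?nnegrE ?absC_ge0 // real_normK ?num_real //.
by rewrite absC_sqr ltrDr exprn_gt0.
Qed.

Lemma cexp_cLog (w : C) : 0 < reC w -> cexp (cLog w) = w.
Proof.
move=> h; have a0 : 0 < absC w := lt_le_trans h (reC_le w).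
have /andP[/ltW r1 /ltW r2] := imC_ratio h.
have rr : -1 <= imC w / absC w <= 1 by rewrite r1.
have rE : reC (cLog w) = ln (absC w) by rewrite reCD reC_ofR reC_iM imC_ofR oppr0 addr0.
have iE : imC (cLog w) = asin (imC w / absC w) by rewrite imCD imC_ofR imC_iM add0r.
apply: ceqP; rewrite ?reC_cexp ?imC_cexp rE iE lnK ?posrE //.
  rewrite cos_asin //.
  have -> : 1 - (imC w / absC w) ^+ 2 = (reC w / absC w) ^+ 2.
    by rewrite !expr_div_n absC_sqr; field; rewrite -absC_sqr expf_neq0 // gt_eqF.
  rewrite sqrtr_sqr ger0_norm ?divr_ge0 ?ltW //.
  by rewrite mulrC divfK // gt_eqF.
by rewrite asinK // mulrC divfK // gt_eqF.
Qed.

Lemma gcont_ofR (f : C -> R) (x : C) : {for x, continuous f} -> gcont id (fun y => ofR (f y)) x.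
Proof.
move=> h e e0.
have /nbhs_absC [d d0 hd] : nbhs x [set y | `|f y - f x| < e].
  by have /cvgrPdist_lt /(_ e e0) := h; apply: filterS => y; rewrite /= distrC.
by exists d => // y /hd; rewrite ofR_dist.
Qed.

Lemma continuous_reim (x : C) :
  [/\ {for x, continuous (@reC R)}, {for x, continuous (@imC R)} & {for x, continuous (@absC R)}].
Proof.
split=> A /nbhs_ballP [e /= e0 he]; apply/nbhs_absC; exists e => // y hy; apply: he; rewrite /ball /= distrC.
- by rewrite -reCB (le_lt_trans (abs_reC _)).
- by rewrite -imCB (le_lt_trans (abs_imC _)).
- rewrite ltr_norml; apply/andP; split.
    by rewrite ltrNl opprB (le_lt_trans (absC_subD _ _)) // absCB.
  by rewrite (le_lt_trans (absC_subD _ _)).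
Qed.

Lemma gcont_cLog (w : C) : 0 < reC w -> gcont id cLog w.
Proof.
move=> h; have a0 : 0 < absC w := lt_le_trans h (reC_le w).
have [_ ci ca] := continuous_reim w.
apply: gcontD.
  apply: (@gcont_ofR (@ln R \o @absC R)).
  by apply: continuous_comp => //; exact: continuous_ln.
apply: gcontM; first exact: gcont_cst.
apply: (@gcont_ofR (@asin R \o (fun z : C => imC z / absC z))).
apply: continuous_comp; last exact: continuous_asin (imC_ratio h).
have cr : (fun z : C => imC z / absC z) @ w --> imC w / absC w.
  apply: (@cvgM _ _ (nbhs w)); first exact: ci.
  by apply: cvgV; [rewrite gt_eqF|exact: ca].
exact: cr.
Qed.

Lemma reC_pos_near1 (w : C) : absC (w - 1) < 1 -> 0 < reC w.
Proof.
move=> h; have := abs_reC (w - 1); rewrite reCB reC1 => h1.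
by have := le_lt_trans h1 h; rewrite ltr_norml => /andP[]; lra.
Qed.

(** The ratio lies in the open unit disc about 1, hence in the half-plane where [cLog] is a
    logarithm. *)
Lemma reC_pos_ratio (x x0 a : C) : x0 != a -> absC (x - x0) < absC (x0 - a) ->
  0 < reC ((x - a) / (x0 - a)).
Proof.
move=> xa h; have xa0 : x0 - a != 0 by rewrite subr_eq0.
apply: reC_pos_near1.
have -> : (x - a) / (x0 - a) - 1 = (x - x0) / (x0 - a) by field.
by rewrite absCf ltr_pdivrMr ?absC_gt0 // mul1r.
Qed.

Lemma gderiv_cLog_ratio (x x0 a : C) : x0 != a -> absC (x - x0) < absC (x0 - a) ->
  gderiv id (fun y => cLog ((y - a) / (x0 - a))) x (x - a)^-1.
Proof.
move=> xa h; have xa0 : x0 - a != 0 by rewrite subr_eq0.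
have r0 := reC_pos_ratio xa h.
have hd (z : C) : gderiv id (fun y => (y - a) / (x0 - a)) z (x0 - a)^-1.
  apply: (gderiv_eq (v := (x0 - a)^-1 * (1 - 0))); first by rewrite subr0 mulr1.
  apply: (gderiv_ext (f := fun y => (x0 - a)^-1 * (y - a))).
    by exists 1 => // y _; rewrite mulrC.
  by apply: gderivZ; apply: gderivB; [exact: gderiv_io|exact: gderiv_cst].
have x1 : x - a != 0.
  by apply: contraTneq r0 => ->; rewrite mul0r reC0 ltxx.
apply: (gderiv_eq (v := (x0 - a)^-1 / ((x - a) / (x0 - a)))).
  by field; rewrite xa0 x1.
apply: (gderiv_log (f := fun y => (y - a) / (x0 - a))) => //.
  apply: (gcont_comp (f := cLog)); last exact: gderiv_cont (hd x).
  exact: gcont_cLog.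
have d0 : 0 < absC (x0 - a) - absC (x - x0) by rewrite subr_gt0.
exists (absC (x0 - a) - absC (x - x0)) => // y hy.
apply: cexp_cLog; apply: reC_pos_ratio => //.
by rewrite (le_lt_trans (absC_tri _ x _)) // -ltrBrDr.
Qed.

End Logarithm.

(** * Differential inequalities along curves *)

Section Curves.
Variable R : realType.
Local Notation C := (CC R).

(** Induction along a segment for a property that is open and closed, by the supremum of the [t]
    such that [P] holds on [[a, t]]. It serves for equations and identities propagated by analytic
    continuation. *)
Lemma itv_connected (a b : R) (P : R -> Prop) : a <= b -> P a ->
  (forall u, a <= u <= b -> P u -> exists2 d : R, 0 < d &
     forall v, a <= v <= b -> `|v - u| < d -> P v) ->
  (forall u, a <= u <= b -> (forall d : R, 0 < d -> exists v,
     [/\ a <= v <= b, `|v - u| < d & P v]) -> P u) ->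
  forall u, a <= u <= b -> P u.
Proof.
move=> ab Pa hopen hclosed.
pose E := [set t | a <= t <= b /\ forall v, a <= v <= t -> P v].
have Ea : E a.
  split; first by rewrite lexx ab.
  by move=> v; rewrite -eq_le => /eqP <-.
have Eb : ubound E b by move=> t [/andP[]].
have hE : has_sup E by split; [exists a|exists b].
set s := sup E.
have as_ : a <= s by apply: (ub_le_sup hE.2).
have sb : s <= b by apply: (ge_sup hE.1).
have below v : a <= v < s -> P v.
  move=> /andP[av vs]; have [t [_ ht] vt] := sup_gt hE.1 vs.
  by apply: ht; rewrite av ltW.
have Ps : P s.
  move: as_; rewrite le_eqVlt => /predU1P[<-//|as_].
  apply: hclosed; first by rewrite sb ltW.
  move=> d d0; exists (Num.max a (s - d / 2)); rewrite le_max lexx /=; split.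
  - by rewrite ge_max ab (le_trans _ sb) // lerBlDr lerDl divr_ge0 // ltW.
  - rewrite distrC ger0_norm ?subr_ge0 ?ge_max ?(ltW as_) ?lerBlDr ?lerDl ?divr_ge0 ?ltW //.
    by rewrite ltrBlDr -ltrBlDl lt_max; apply/orP; right; rewrite ltrD2l ltrN2; lra.
  - by apply: below; rewrite le_max lexx /= gt_max as_ ltrBlDr ltrDl divr_gt0.
have sE : s = b.
  apply/eqP; rewrite eq_le sb /= leNgt; apply/negP => sltb.
  have [|d d0 hd] := hopen s _ Ps; first by rewrite as_ sb.
  pose t := Num.min b (s + d / 2).
  have st : s < t by rewrite lt_min sltb ltrDl divr_gt0.
  have Et : E t.
    split; first by rewrite (le_trans as_ (ltW st)) ge_min lexx.
    move=> v /andP[av vt]; have [vs|sv] := ltP v s; first by apply: below; rewrite av.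
    apply: hd; first by rewrite av (le_trans vt) // ge_min lexx.
    rewrite ger0_norm ?subr_ge0 // ltrBlDl (le_lt_trans vt) // gt_min ltrD2l.
    by apply/orP; right; lra.
  by have := ub_le_sup hE.2 Et; rewrite leNgt st.
move=> u /andP[au ub]; move: ub; rewrite le_eqVlt => /predU1P[->|ub].
  by rewrite -sE.
by apply: below; rewrite au sE.
Qed.

Local Notation rder := (gderiv (@ofR R)).
Local Notation rcont := (gcont (@ofR R)).

Definition cconj (z : C) : C := Complex (reC z) (- imC z).

Lemma cconjM_abs z : z * cconj z = ofR (absC z ^+ 2).
Proof.
apply: ceqP; rewrite ?reCM ?imCM ?reC_ofR ?imC_ofR ?absC_sqr /=; ring.
Qed.
Lemma cconjB x y : cconj (x - y) = cconj x - cconj y.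
Proof. by apply: ceqP; rewrite ?reCB ?imCB /= ?reCB ?imCB //; ring. Qed.
Lemma cconjM x y : cconj (x * y) = cconj x * cconj y.
Proof. by apply: ceqP; rewrite ?reCM ?imCM /= ?reCM ?imCM //; ring. Qed.
Lemma cconj_ofR a : cconj (ofR a) = ofR a.
Proof. by apply: ceqP; rewrite //= oppr0. Qed.
Lemma absC_conj z : absC (cconj z) = absC z.
Proof. by rewrite !absCE /= sqrrN. Qed.

Lemma rcont_conj f u : rcont f u -> rcont (fun v => cconj (f v)) u.
Proof.
by move=> h e /h [d d0 hd]; exists d => // y /hd; rewrite -cconjB absC_conj.
Qed.

Lemma rder_conj f u v : rder f u v -> rder (fun w => cconj (f w)) u (cconj v).
Proof.
move=> h e /h [d d0 hd]; exists d => // y /hd.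
by rewrite -[X in X <= _]absC_conj !cconjB cconjM cconjB !cconj_ofR.
Qed.

(** The mean value inequality with a variable majorant: multiplying [y] by the unit number [c] that
    makes [D] real and nonnegative reduces it to the monotonicity of a real part. For [D = 0] the
    convention on inverses gives [c = 0], which is harmless. *)
Lemma curve_bound (s : seq R) (y : R -> C) (phi : R -> R) (a b : R) : a <= b ->
  (forall u, a <= u <= b -> rcont y u) ->
  (forall u, a <= u <= b -> rcont (fun v => ofR (phi v)) u) ->
  (forall u, a < u < b -> u \notin s -> exists v p,
     [/\ rder y u v, rder (fun v => ofR (phi v)) u (ofR p) & absC v <= p]) ->
  absC (y b - y a) <= phi b - phi a.
Proof.
move=> ab hy hp hd; set D := y b - y a.
pose c := cconj D / ofR (absC D).
have c1 : absC c <= 1.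
  rewrite /c absCf absC_conj absC_ofR ger0_norm ?absC_ge0 //.
  by have [->|h] := eqVneq (absC D) 0; [rewrite invr0 mulr0|rewrite divff].
have cD : reC (c * y b) - reC (c * y a) = absC D.
  rewrite -reCB -mulrBr -/D /c mulrAC [cconj D * D]mulrC cconjM_abs -ofRV -ofRM reC_ofR.
  by have [->|h] := eqVneq (absC D) 0; rewrite ?expr0n ?mul0r // expr2 mulfK.
have := @reC_nonincr _ s (fun u => c * y u - ofR (phi u)) a b ab.
rewrite !reCB !reC_ofR => H; rewrite -cD.
suff : reC (c * y b) - phi b <= reC (c * y a) - phi a by lra.
apply: H => [u hu|u hu us].
  by apply: gcontB; [apply: gcontM; [exact: gcont_cst|exact: hy]|exact: hp].
have [v [p [h1 h2 h3]]] := hd u hu us.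
exists (c * v - ofR p); first by apply: gderivB => //; apply: gderivZ.
rewrite reCB reC_ofR subr_le0 (le_trans (reC_le _)) // absCM.
rewrite (le_trans _ h3) // ler_piMl ?absC_ge0 //.
Qed.

(* |y|^2 decreases wherever |y| exceeds M. *)
Lemma stable_bound (s : seq R) (y : R -> C) (a b c M : R) : 0 < c ->
  (forall u, a <= u <= b -> rcont y u) ->
  (forall u, a < u < b -> u \notin s -> exists al be : C,
     [/\ rder y u (al * y u + be), reC al <= - c & absC be <= c * M]) ->
  absC (y a) <= M -> forall u, a <= u <= b -> absC (y u) <= M.
Proof.
move=> c0 hy hd ya u /andP[au ub]; rewrite leNgt; apply/negP => Mu.
have M0 : 0 <= M := le_trans (absC_ge0 _) ya.
pose E := [set t | a <= t <= u /\ absC (y t) <= M].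
have Ea : E a by split => //; rewrite lexx au.
have Eu : ubound E u by move=> t [/andP[]].
have hE : has_sup E by split; [exists a|exists u].
(* [t0] is the last time before [u] with [|y| <= M]; it is attained by continuity, and [|y|] exceeds
   [M] on all of []t0, u]]. *)
set t0 := sup E.
have at0 : a <= t0 by apply: (ub_le_sup hE.2).
have t0u : t0 <= u by apply: (ge_sup hE.1).
have yt0 : absC (y t0) <= M.
  rewrite leNgt; apply/negP => Mt; rewrite -subr_gt0 in Mt.
  have [|d d0 hdd] := hy t0 _ _ Mt; first by rewrite at0 (le_trans t0u).
  have [t Et tt] := sup_gt hE.1 (eqbRL (ltrBlDr t0 d t0) (eqbRL (ltrDl _ _) d0)).
  have tt0 := ub_le_sup hE.2 Et.
  have := hdd t; rewrite ofR_dist distrC ger0_norm ?subr_ge0 //.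
  rewrite ltrBlDr -ltrBlDl => /(_ tt); have := absC_subD (y t0) (y t); rewrite (absCB (y t0)).
  by have := Et.2; lra.
have above t : t0 < t <= u -> M < absC (y t).
  move=> /andP[h1 h2]; rewrite ltNge; apply/negP => h3.
  have Et : E t by split => //; rewrite h2 (le_trans at0) // ltW.
  by have := ub_le_sup hE.2 Et; rewrite leNgt h1.
have := @reC_nonincr _ s (fun t => y t * cconj (y t)) t0 u t0u.
rewrite !cconjM_abs !reC_ofR => H.
have : absC (y u) ^+ 2 <= absC (y t0) ^+ 2.
  apply: H => [t /andP[h1 h2]|t /andP[h1 h2] ts].
    have ht : rcont y t by apply: hy; rewrite (le_trans at0) // (le_trans h2).
    by apply: gcontM => //; apply: rcont_conj.
  have [|al [be [h3 h4 h5]]] := hd t _ ts.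
    by rewrite (le_lt_trans at0) // (lt_le_trans h2).
  have yM : M < absC (y t) by apply: above; rewrite h1 ltW.
  exists ((al * y t + be) * cconj (y t) + y t * cconj (al * y t + be)).
    by apply: gderivM => //; apply: rder_conj.
  rewrite reCD [y t * _]mulrC.
  have -> : reC (cconj (al * y t + be) * y t) = reC ((al * y t + be) * cconj (y t)).
    by rewrite !reCM /=; ring.
  rewrite mulrDl -mulrA cconjM_abs reCD.
  have -> : reC (al * ofR (absC (y t) ^+ 2)) = reC al * absC (y t) ^+ 2.
    by rewrite mulrC reC_ofRM mulrC.
  have : reC (be * cconj (y t)) <= c * M * absC (y t).
    by rewrite (le_trans (reC_le _)) // absCM absC_conj ler_wpM2r // absC_ge0.
  set r := absC (y t) in yM *; set B := reC (be * _) => hB.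
  have : reC al * r ^+ 2 <= - c * r ^+ 2 by rewrite ler_wpM2r // sqr_ge0.
  have : c * M * r <= c * r ^+ 2.
    by rewrite -mulrA ler_pM2l // expr2 ler_wpM2r // ?ltW // (le_lt_trans M0).
  lra.
have := absC_ge0 (y t0); have := absC_ge0 (y u); nra.
Qed.

Lemma rder_rev (f : R -> C) u v : rder f (- u) v -> rder (fun w => f (- w)) u (- v).
Proof.
move=> h e /h [d d0 hd]; exists d => // y hy.
have E : ofR (- y) - ofR (- u) = - (ofR y - ofR u) by rewrite !ofRN; ring.
by have := hd (- y); rewrite E absCN mulrN mulNr => /(_ hy).
Qed.

Lemma rcont_rev (f : R -> C) u : rcont f (- u) -> rcont (fun w => f (- w)) u.
Proof.
move=> h e /h [d d0 hd]; exists d => // y hy.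
have E : ofR (- y) - ofR (- u) = - (ofR y - ofR u) by rewrite !ofRN; ring.
by have := hd (- y); rewrite E absCN => /(_ hy).
Qed.

(** The stable case under reversal of time, which is why the bound is asked at the right end. *)
Lemma unstable_bound (s : seq R) (y : R -> C) (a b c M : R) : 0 < c ->
  (forall u, a <= u <= b -> rcont y u) ->
  (forall u, a < u < b -> u \notin s -> exists al be : C,
     [/\ rder y u (al * y u + be), c <= reC al & absC be <= c * M]) ->
  absC (y b) <= M -> forall u, a <= u <= b -> absC (y u) <= M.
Proof.
move=> c0 hy hd yb u /andP[au ub].
rewrite -[u]opprK.
apply: (@stable_bound [seq - t | t <- s] (fun w => y (- w)) (- b) (- a) c M) => //.
- by move=> w /andP[h1 h2]; apply: rcont_rev; apply: hy; rewrite lerNr h2 lerNl h1.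
- move=> w /andP[h1 h2] ws; have [||al [be [h3 h4 h5]]] := hd (- w).
  + by rewrite ltrNr h2 ltrNl h1.
  + by apply: contra ws => h; apply/mapP; exists (- w) => //; rewrite opprK.
  exists (- al), (- be); split; rewrite ?reCN ?lerN2 ?absCN //.
  apply: gderiv_eq (rder_rev h3); ring.
- by rewrite opprK.
- by rewrite !lerN2 ub.
Qed.

Local Notation cder := (gderiv (@id C)).
Local Notation cnear := (gnear (@id C)).

Lemma rder_segment (x y : C) (u : R) : rder (fun v => x + ofR v * (y - x)) u (y - x).
Proof.
apply: (gderiv_eq (v := 0 + (1 * (y - x) + ofR u * 0))); first by ring.
by apply: gderivD; [exact: gderiv_cst|apply: gderivM; [exact: gderiv_io|exact: gderiv_cst]].
Qed.

Lemma cder0_const (f : C -> C) (x : C) :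
  cnear x (fun y => cder f y 0) -> cnear x (fun y => f y = f x).
Proof.
move=> [d d0 h]; exists d => // y hy; apply/eqP; rewrite -subr_eq0; apply/eqP/absC0_eq0.
have hu (u : R) : 0 <= u <= 1 -> rder (fun v => f (x + ofR v * (y - x))) u 0.
  move=> /andP[u0 u1]; apply: (gderiv_eq (v := 0 * (y - x))); first by rewrite mul0r.
  apply: (gderiv_comp (f := f)); last exact: rder_segment.
  apply: h => /=; rewrite addrC addKr absCM absC_ofR ger0_norm //.
  by rewrite (le_lt_trans _ hy) // ler_piMl // absC_ge0.
have := @curve_bound [::] (fun v => f (x + ofR v * (y - x))) (fun=> 0) 0 1 ler01.
have -> : x + ofR 1 * (y - x) = y by rewrite ofR1; ring.
have -> : x + ofR 0 * (y - x) = x by rewrite ofR0; ring.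
rewrite subrr => H.
apply/eqP; rewrite eq_le absC_ge0 andbT; apply: H => [u /hu|u _|u /andP[u0 u1] _].
- exact: gderiv_cont.
- exact: gcont_cst.
- exists 0, 0; rewrite absC0 lexx ofR0; split => //; last exact: gderiv_cst.
  by apply: hu; rewrite !ltW.
Qed.

(** The quotient [f / g] has derivative zero near [x]. *)
Lemma ode_unique (a f g : C -> C) (x : C) :
  cnear x (fun y => cder f y (a y * f y)) -> cnear x (fun y => cder g y (a y * g y)) ->
  g x != 0 -> cnear x (fun y => f y = f x / g x * g y).
Proof.
move=> hf hg gx0.
have gn0 := gcont_near_neq0 (gderiv_cont (gnear_at hg)) gx0.
have H : cnear x (fun y => cder (fun w => f w * (g w)^-1) y 0).
  apply: gnear_imp (gnear_and (gnear_and hf hg) gn0) => y [[h1 h2] h3].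
  apply: (gderiv_eq (v := a y * f y * (g y)^-1 + f y * (- (g y * g y)^-1 * (a y * g y)))).
    by field.
  apply: gderivM => //; apply: (gderiv_comp (f := fun w : C => w^-1)) => //.
  exact: gderiv_inv.
apply: gnear_imp (gnear_and (cder0_const H) gn0) => y [h1 h2].
by rewrite -h1 divfK.
Qed.

End Curves.

(** * Power series *)

Section PowerSeries.
Variable R : realType.
Local Notation C := (CC R).
Local Notation cder := (gderiv (@id C)).
Local Notation cnear := (gnear (@id C)).
Implicit Types (f g : C -> C) (a b x y : C) (c d : nat -> C).

Lemma pow_small (e K : R) : 0 < e -> 0 <= K ->
  exists N0, forall N, (N0 <= N)%N -> K * (1 / 2) ^+ N < e.
Proof.
move=> e0 K0; have [N0 hN0] := ubnP (Num.truncn (K / e)).+1.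
exists N0 => N hN.
have h1 : K / e < N%:R.
  rewrite (lt_le_trans (truncnS_gt _)) // ler_nat (leq_trans _ hN) // ltnW //.
have h2 : N%:R <= (2 : R) ^+ N by rewrite -natrX ler_nat ltnW // ltn_expl.
rewrite expr_div_n expr1n mul1r ltr_pdivrMr ?exprn_gt0 //.
by rewrite -ltr_pdivrMl // mulrC (lt_le_trans h1).
Qed.

Lemma pow_le0 (x K : R) : 0 <= K -> (forall N, x <= K * (1 / 2) ^+ N) -> x <= 0.
Proof.
move=> K0 h; apply/ler_addgt0Pr => e e0; rewrite add0r.
have [N hN] := pow_small e0 K0.
by rewrite (le_trans (h N)) // ltW // hN.
Qed.

(** Completeness of the real line applied to real and imaginary parts. A general proper filter is
    allowed because the limits needed are along sequences of partial sums and along [hat0]. *)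
Lemma C_cauchy (T : Type) (F : set_system T) (f : T -> C) : ProperFilter F ->
  (forall e : R, 0 < e -> exists2 A, F A & forall s t, A s -> A t -> absC (f s - f t) <= e) ->
  exists l : C, f @ F --> l.
Proof.
move=> FF h.
have H (p : C -> R) : (forall x y, `|p x - p y| <= absC (x - y)) ->
    exists l : R, (p \o f) @ F --> l.
  move=> hp; apply/cvg_ex; apply: cauchy_cvg; apply: cauchy_exP => e e0.
  have [A FA hA] := h (e / 2) (divr_gt0 e0 (ltr0n R 2)).
  have [s As] := filter_ex FA.
  exists (p (f s)); suff : F [set t | `|p (f s) - p (f t)| < e] by [].
  apply: filterS FA => t At /=.
  by rewrite (le_lt_trans (hp _ _)) // (le_lt_trans (hA _ _ As At)) //; lra.
have [l1 h1] : exists l : R, (@reC R \o f) @ F --> l.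
  by apply: H => x y; rewrite -reCB abs_reC.
have [l2 h2] : exists l : R, (@imC R \o f) @ F --> l.
  by apply: H => x y; rewrite -imCB abs_imC.
exists (Complex l1 l2); apply/cvg_absC => e e0.
have e2 : 0 < e / 2 by rewrite divr_gt0.
move/cvgrPdist_lt : h1 => /(_ _ e2) h1; move/cvgrPdist_lt : h2 => /(_ _ e2) h2.
apply: filterS2 h1 h2 => t /= h1 h2; rewrite (le_lt_trans (absC_le_reim _)) //.
by rewrite reCB imCB /= (splitr e) ltrD // distrC.
Qed.

Definition psum c (N : nat) (y : C) : C := \sum_(k < N) c k * y ^+ k.

Lemma psumS c N y : psum c N.+1 y = psum c N y + c N * y ^+ N.
Proof. by rewrite /psum big_ord_recr. Qed.

Lemma psum_dist c (M Q : R) y : 0 <= M -> 0 <= Q ->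
  (forall k, absC (c k) <= M * Q ^+ k) -> Q * absC y <= 1 / 2 ->
  forall N n, absC (psum c (N + n) y - psum c N y) <= 2 * M * (Q * absC y) ^+ N.
Proof.
move=> M0 Q0 hc hy N n; set q := Q * absC y in hy *.
have q0 : 0 <= q by rewrite mulr_ge0 ?absC_ge0.
have term k : absC (c k * y ^+ k) <= M * q ^+ k.
  by rewrite absCM absCX /q exprMn mulrA ler_wpM2r // exprn_ge0 // absC_ge0.
(* Subtracting the remaining geometric tail makes the bound inductive in [n]. *)
suff : absC (psum c (N + n) y - psum c N y) <= 2 * M * q ^+ N - 2 * M * q ^+ (N + n).
  by have := mulr_ge0 M0 (exprn_ge0 (N + n) q0); lra.
elim: n => [|n IH].
  by rewrite addn0 !subrr absC0.
rewrite addnS psumS addrAC; apply: (le_trans (absCD_le IH (term _))).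
rewrite exprS; have : 0 <= M * q ^+ (N + n) by rewrite mulr_ge0 // exprn_ge0.
by set w := q ^+ (N + n) => w0; nra.
Qed.

(* [f] is near [a] the sum of the power series with coefficients [c]; the
   geometric remainder makes all operations on series finite computations. *)
Definition taylor f a c : Prop := exists M Q : R, [/\ 0 < M, 1 <= Q,
  forall k, absC (c k) <= M * Q ^+ k &
  forall y, Q * absC y <= 1 / 2 -> forall N,
    absC (f (a + y) - psum c N y) <= 2 * M * (Q * absC y) ^+ N].

Lemma taylor_weaken f a c (M Q M' Q' : R) : 0 < M -> 1 <= Q -> M <= M' -> Q <= Q' ->
  (forall k, absC (c k) <= M * Q ^+ k) ->
  (forall y, Q * absC y <= 1 / 2 -> forall N,
    absC (f (a + y) - psum c N y) <= 2 * M * (Q * absC y) ^+ N) ->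
  (forall k, absC (c k) <= M' * Q' ^+ k) /\
  (forall y, Q' * absC y <= 1 / 2 -> forall N,
    absC (f (a + y) - psum c N y) <= 2 * M' * (Q' * absC y) ^+ N).
Proof.
move=> M0 Q1 MM QQ h1 h2; have Q0 : 0 <= Q by lra.
have Q0' : 0 <= Q' by lra.
split=> [k|y hy N].
  by rewrite (le_trans (h1 k)) // ler_pM ?exprn_ge0 ?(ltW M0) // lerXn2r.
have hq : Q * absC y <= Q' * absC y by rewrite ler_wpM2r // absC_ge0.
rewrite (le_trans (h2 y _ N)) ?(le_trans hq) //.
rewrite ler_pM ?exprn_ge0 ?mulr_ge0 ?absC_ge0 ?(ltW M0) //; first by lra.
by rewrite lerXn2r ?nnegrE ?mulr_ge0 ?absC_ge0.
Qed.

Lemma taylor_common f a c g b d : taylor f a c -> taylor g b d ->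
  exists M Q : R, [/\ 0 < M, 1 <= Q,
    (forall k, absC (c k) <= M * Q ^+ k) /\
    (forall y, Q * absC y <= 1 / 2 -> forall N,
      absC (f (a + y) - psum c N y) <= 2 * M * (Q * absC y) ^+ N) &
    (forall k, absC (d k) <= M * Q ^+ k) /\
    (forall y, Q * absC y <= 1 / 2 -> forall N,
      absC (g (b + y) - psum d N y) <= 2 * M * (Q * absC y) ^+ N)].
Proof.
move=> [M1 [Q1 [h1 h2 h3 h4]]] [M2 [Q2 [k1 k2 k3 k4]]].
exists (Num.max M1 M2), (Num.max Q1 Q2).
rewrite !lt_max !le_max h1 h2; split => //.
  by apply: taylor_weaken h1 h2 _ _ h3 h4; rewrite le_max lexx.
by apply: taylor_weaken k1 k2 _ _ k3 k4; rewrite le_max lexx orbT.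
Qed.

Lemma taylor_ext f g a c : cnear a (fun x => f x = g x) -> taylor f a c -> taylor g a c.
Proof.
move=> [d d0 hd] [M [Q [h1 h2 h3 h4]]].
(* With [Q] at least [d^-1], the condition [Q * |y| <= 1 / 2] keeps [a + y] inside the disc where
   [f] and [g] agree. *)
exists M, (Num.max Q d^-1); rewrite le_max h2; split => //.
  by apply: (taylor_weaken h1 h2 (lexx _) _ h3 h4).1; rewrite le_max lexx.
move=> y hy N; rewrite -hd.
  by apply: (taylor_weaken h1 h2 (lexx _) _ h3 h4).2 => //; rewrite le_max lexx.
rewrite /= addrC addKr.
have : d^-1 * absC y <= 1 / 2.
  by rewrite (le_trans _ hy) // ler_wpM2r ?absC_ge0 // le_max lexx orbT.
by rewrite ler_pdivrMl // => h; rewrite (le_lt_trans h) //; lra.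
Qed.

Lemma taylor_pow (M q : R) N : 0 <= q <= 1 / 2 -> 0 < M -> 2 * M * q ^+ N <= 2 * M * (1 / 2) ^+ N.
Proof.
move=> /andP[q0 q1] M0; rewrite ler_pM2l; last by lra.
by rewrite lerXn2r ?nnegrE //; lra.
Qed.

Lemma taylor_cvg f a c : taylor f a c -> exists2 r : R, 0 < r & forall y, absC y < r ->
  forall e : R, 0 < e -> exists N0, forall N, (N0 <= N)%N -> absC (f (a + y) - psum c N y) < e.
Proof.
move=> [M [Q [h1 h2 h3 h4]]]; exists ((2 * Q)^-1); first by rewrite invr_gt0; lra.
move=> y hy e e0.
have hq : Q * absC y <= 1 / 2.
  have Q20 : 0 < 2 * Q by lra.
  by move: hy; rewrite -div1r ltr_pdivlMr // => ?; lra.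
have [||N0 hN] := @pow_small e (2 * M) => //; first by lra.
exists N0 => N /hN; apply: le_lt_trans; rewrite (le_trans (h4 y hq N)) //.
by apply: taylor_pow => //; rewrite hq mulr_ge0 ?absC_ge0 //; lra.
Qed.

Lemma taylor_analytic f a c : taylor f a c -> analytic_at f a.
Proof.
move=> /taylor_cvg [r r0 h]; exists c, r; split => // x hx.
apply/cvg_absC => e e0; have [N0 hN] := h _ hx e e0.
exists N0 => // N /hN; rewrite [a + _]addrC subrK absCB.
by rewrite /series /= /psum big_mkord.
Qed.

(** Beyond some rank each term is the difference of two partial sums within distance 1 of the limit;
    the finitely many earlier terms are summed into the bound. *)
Lemma coef_bound c (r : R) : 0 < r -> (exists l : C, series (fun k => c k * ofR r ^+ k) @ \oo --> l) ->
  exists2 M : R, 0 < M & forall k, absC (c k) * r ^+ k <= M.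
Proof.
move=> r0 [l hl]; have [N0 _ hN] := (cvg_absC _ _ _).1 hl 1 ltr01.
exists (\sum_(k < N0) absC (c k) * r ^+ k + 2).
  rewrite ltr_wpDl // sumr_ge0 // => k _.
  by rewrite mulr_ge0 ?absC_ge0 // exprn_ge0 // ltW.
have tk k : absC (c k) * r ^+ k = absC (c k * ofR r ^+ k).
  by rewrite absCM absCX absC_ofR ger0_norm // ltW.
move=> k; have [kN|Nk] := ltnP k N0.
  rewrite (bigD1 (Ordinal kN)) //= -addrA lerDl addr_ge0 // sumr_ge0 // => i _.
  by rewrite tk absC_ge0.
rewrite -[leLHS]add0r lerD //.
  by rewrite sumr_ge0 // => i _; rewrite tk absC_ge0.
have h1 := hN _ (leqW Nk); have h2 := hN _ Nk.
rewrite tk; have -> : c k * ofR r ^+ k = series (fun k => c k * ofR r ^+ k) k.+1 - l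
     - (series (fun k => c k * ofR r ^+ k) k - l).
  by rewrite /series /= big_nat_recr //=; ring.
by rewrite (le_trans (absCBD _ _)) //; move: h1 h2 => /=; lra.
Qed.

Lemma analytic_taylor f a : analytic_at f a -> exists c, taylor f a c.
Proof.
move=> [c [d [d0 hf]]]; exists c.
have r0 : 0 < d / 2 by rewrite divr_gt0.
have [|M M0 hM] := @coef_bound c _ r0.
  exists (f (a + ofR (d / 2))); have := hf (a + ofR (d / 2)).
  by rewrite addrC addKr absC_ofR ger0_norm ?ltW //; apply; lra.
(* Convergence at distance [d / 2] gives coefficients of order [(2 / d) ^+ k]. *)
pose Q := Num.max 1 (2 / d); exists M, Q.
have Q1 : 1 <= Q by rewrite le_max lexx.
have Qd : 2 / d <= Q by rewrite le_max lexx orbT.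
have hc k : absC (c k) <= M * Q ^+ k.
  have : absC (c k) <= M * (2 / d) ^+ k.
    rewrite -ler_pdivrMr ?exprn_gt0 ?divr_gt0 // -exprVn.
    by rewrite (_ : (2 / d)^-1 = d / 2) //; field; rewrite gt_eqF.
  move/le_trans; apply; rewrite ler_pM2l // lerXn2r ?nnegrE //; last by lra.
  by rewrite divr_ge0 // ltW.
split => // y hy N.
have yd : absC y < d.
  have : 2 / d * absC y <= 1 / 2 by rewrite (le_trans _ hy) // ler_wpM2r ?absC_ge0.
  by rewrite mulrAC ler_pdivrMr // => ?; lra.
apply/ler_addgt0Pr => e e0.
have E : a + y - a = y by ring.
have := hf (a + y); rewrite E => /(_ yd) /cvg_absC /(_ e e0) [N0 _ hN].
have := hN (N + N0)%N (leq_addl _ _); rewrite /= /series /= big_mkord -/(psum c _ y) => h1.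
have -> : f (a + y) - psum c N y = (psum c (N + N0) y - psum c N y) + - (psum c (N + N0) y - f (a + y)) by ring.
apply: absCD_le; last by rewrite absCN ltW.
by apply: psum_dist => //; lra.
Qed.

Lemma taylor_exists a c (M Q : R) : 0 < M -> 1 <= Q ->
  (forall k, absC (c k) <= M * Q ^+ k) -> exists f, taylor f a c.
Proof.
move=> M0 Q1 hc; have Q0 : 0 <= Q by lra.
have H x : exists l : C, Q * absC (x - a) <= 1 / 2 -> psum c ^~ (x - a) @ \oo --> l.
  have [hx|hx] := leP (Q * absC (x - a)) (1 / 2); last by exists 0.
  suff [l hl] : exists l : C, psum c ^~ (x - a) @ \oo --> l by exists l.
  apply: C_cauchy => e e0; have [||N0 hN] := @pow_small (e / 2) (2 * M); rewrite ?divr_gt0 //; first by lra.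
  exists [set n | (N0 <= n)%N]; first by exists N0.
  have D n : (N0 <= n)%N -> absC (psum c n (x - a) - psum c N0 (x - a)) <= e / 2.
    move=> hn; rewrite -(subnKC hn); apply: (le_trans (psum_dist (ltW M0) Q0 hc hx _ _)).
    apply: ltW; apply: le_lt_trans (hN _ (leqnn _)); apply: taylor_pow => //.
    by rewrite hx mulr_ge0 ?absC_ge0.
  move=> s t /D hs /D ht; rewrite [leRHS]splitr (le_trans (absC_tri _ (psum c N0 (x - a)) _)) //.
  by rewrite lerD // absCB.
have [f hf] := choice H.
exists f, M, Q; split => // y hy N.
apply/ler_addgt0Pr => e e0.
have E : a + y - a = y by ring.
have := hf (a + y); rewrite E => /(_ hy) /cvg_absC /(_ e e0) [N0 _ hN].
have h1 := hN (N + N0)%N (leq_addl _ _).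
have -> : f (a + y) - psum c N y = (psum c (N + N0) y - psum c N y) + - (psum c (N + N0) y - f (a + y)) by ring.
apply: absCD_le; last by rewrite absCN ltW.
exact: (psum_dist (ltW M0) Q0 hc hy).
Qed.

Lemma taylor_zero f a : taylor f a (fun=> 0) -> cnear a (fun x => f x = 0).
Proof.
move=> /taylor_cvg [r r0 h]; exists r => // x /= hx.
apply: absC_le0_eq => e e0; have [N0 /(_ N0 (leqnn _))] := h _ hx e e0.
by rewrite [a + _]addrC subrK /psum big1 ?subr0 => [/ltW //|k _]; rewrite mul0r.
Qed.

(** If all coefficients before [m] vanish, the remainder of order [m.+1] at a zero [y] bounds
    [|c m|] by a constant times [|y|], and [y] can be taken arbitrarily small. *)
Lemma taylor_zeros f a c : taylor f a c ->
  (forall d : R, 0 < d -> exists y, [/\ y != 0, absC y < d & f (a + y) = 0]) ->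
  forall k, c k = 0.
Proof.
move=> [M [Q [M0 Q1 hc hf]]] hz k; elim/ltn_ind: k => m IH.
apply: absC_le0_eq => e e0.
have K0 : 0 < 2 * M * Q ^+ m.+1 by rewrite mulr_gt0 ?exprn_gt0 //; lra.
have Q20 : 0 < 2 * Q by lra.
have [|y [y0 yd fy]] := hz (Num.min (2 * Q)^-1 (e / (2 * M * Q ^+ m.+1))).
  by rewrite lt_min invr_gt0 Q20 divr_gt0.
move: yd; rewrite lt_min => /andP[h1 h2].
have hq : Q * absC y <= 1 / 2.
  by move: h1; rewrite -div1r ltr_pdivlMr // => ?; lra.
have := hf y hq m.+1; rewrite fy sub0r absCN psumS.
have -> : psum c m y = 0 by apply: big1 => k _; rewrite IH ?mul0r.
have ym : 0 < absC y ^+ m by rewrite exprn_gt0 ?absC_gt0.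
rewrite add0r absCM absCX => h.
have : absC (c m) <= 2 * M * Q ^+ m.+1 * absC y.
  rewrite -(ler_pM2r ym) (le_trans h) // exprMn (exprSr (absC y)); lra.
move/le_trans; apply; apply: ltW; move: h2; rewrite ltr_pdivlMr // mulrC.
by [].
Qed.

Lemma taylor_isolated f a c : taylor f a c ->
  (forall d : R, 0 < d -> exists x, [/\ x != a, absC (x - a) < d & f x = 0]) ->
  cnear a (fun x => f x = 0).
Proof.
move=> hf hz; apply: taylor_zero.
have -> : (fun=> 0) = c; last exact: hf.
apply/funext => k; apply/esym; apply: (taylor_zeros hf) => d /hz [x [h1 h2 h3]].
by exists (x - a); rewrite subr_eq0 [a + _]addrC subrK.
Qed.

Lemma analytic_isolated f a : analytic_at f a ->
  (forall d : R, 0 < d -> exists x, [/\ x != a, absC (x - a) < d & f x = 0]) ->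
  cnear a (fun x => f x = 0).
Proof. by move=> /analytic_taylor [c hc]; exact: taylor_isolated hc. Qed.

Lemma psum_shift c N y :
  psum (fun k => if k is k'.+1 then c k' else 0) N.+1 y = y * psum c N y.
Proof.
rewrite /psum big_ord_recl /= mul0r add0r mulr_sumr; apply: eq_bigr => i _.
by rewrite /bump /= add1n exprS; ring.
Qed.

Lemma taylor_shift f a c : taylor f a c ->
  taylor (fun x => (x - a) * f x) a (fun k => if k is k'.+1 then c k' else 0).
Proof.
move=> [M [Q [M0 Q1 hc hf]]]; exists M, Q; split => //.
  case=> [|k]; first by rewrite absC0 expr0 mulr1 ltW.
  rewrite (le_trans (hc k)) // ler_pM2l // exprS ler_peMl // exprn_ge0 //; lra.
have Q0 : 0 < Q by lra.
move=> y hy [|N].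
  have := hf y hy 0%N; rewrite /psum !big_ord0 !subr0 expr0 !mulr1 addrC addrK addrC => h.
  rewrite absCM (le_trans (ler_wpM2l (absC_ge0 _) h)) // ler_piMl //; first by lra.
  have := absC_ge0 y; nra.
rewrite psum_shift [a + y]addrC addrK -mulrBr absCM addrC.
apply: (le_trans (ler_wpM2l (absC_ge0 _) (hf y hy N))).
rewrite exprS; have q0 : 0 <= (Q * absC y) ^+ N by rewrite exprn_ge0 // mulr_ge0 ?absC_ge0 // ltW.
have := mulr_ge0 (mulr_ge0 (ltW M0) (absC_ge0 y)) q0; nra.
Qed.

Lemma psumD c d N y : psum (fun k => c k + d k) N y = psum c N y + psum d N y.
Proof. by rewrite /psum -big_split; apply: eq_bigr => i _ /=; rewrite mulrDl. Qed.

Lemma psumZ (v : C) c N y : psum (fun k => v * c k) N y = v * psum c N y.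
Proof. by rewrite /psum mulr_sumr; apply: eq_bigr => i _ /=; rewrite mulrA. Qed.

Lemma taylorD f g a c d : taylor f a c -> taylor g a d ->
  taylor (fun x => f x + g x) a (fun k => c k + d k).
Proof.
move=> hf hg; have [M [Q [M0 Q1 [h1 h2] [h3 h4]]]] := taylor_common hf hg.
exists (2 * M), Q; split => //; first by lra.
  by move=> k; rewrite (_ : 2 * M * Q ^+ k = M * Q ^+ k + M * Q ^+ k) ?absCD_le //; ring.
move=> y hy N; rewrite psumD.
have -> : f (a + y) + g (a + y) - (psum c N y + psum d N y) =
  (f (a + y) - psum c N y) + (g (a + y) - psum d N y) by ring.
apply: (le_trans (absCD_le (h2 y hy N) (h4 y hy N))); lra.
Qed.

Lemma taylorZ (v : C) f a c : taylor f a c -> taylor (fun x => v * f x) a (fun k => v * c k).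
Proof.
move=> [M [Q [M0 Q1 hc hf]]]; exists ((absC v + 1) * M), Q.
have v0 := absC_ge0 v.
split => //; first by rewrite mulr_gt0 //; lra.
  by move=> k; rewrite absCM -mulrA ler_pM ?absC_ge0 //; lra.
move=> y hy N; rewrite psumZ -mulrBr absCM.
have := hf y hy N; have := absC_ge0 (f (a + y) - psum c N y).
set A := absC _; set q := (_ ^+ N) => A0 hA.
apply: (le_trans (ler_wpM2l v0 hA)).
have q0 : 0 <= q by rewrite exprn_ge0 // mulr_ge0 ?absC_ge0 //; lra.
have := mulr_ge0 (ltW M0) q0; nra.
Qed.

Definition conv c d (n : nat) : C := \sum_(k < n.+1) c k * d (n - k)%N.

(** The truncated Cauchy product pairs the term of degree [k] with the partial sum of order [N - k];
    the errors of the two factors then combine to a single power of exponent [N]. *)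
Lemma psum_conv c d N y :
  psum (conv c d) N y = \sum_(k < N) c k * y ^+ k * psum d (N - k) y.
Proof.
elim: N => [|N IH]; first by rewrite /psum !big_ord0.
rewrite psumS IH big_ord_recr /=.
have -> : psum d (N.+1 - N) y = d 0%N by rewrite subSnn /psum big_ord1 expr0 mulr1.
rewrite /conv mulr_suml big_ord_recr /= subnn addrA; congr (_ + _); last by ring.
rewrite -big_split; apply: eq_bigr => i _ /=.
rewrite subSn; last exact: ltnW.
rewrite psumS -[in y ^+ N](subnKC (ltnW (ltn_ord i))) exprD; ring.
Qed.

Lemma natr_le_pow (n : nat) : n.+1%:R <= (2 : R) ^+ n.
Proof. by rewrite -natrX ler_nat ltn_expl. Qed.

(** A coefficient of the product is a sum of [n.+1] terms; this number is absorbed by [2 ^+ n], at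
    the price of doubling [Q]. *)
Lemma taylorM f g a c d : taylor f a c -> taylor g a d ->
  taylor (fun x => f x * g x) a (conv c d).
Proof.
move=> hf hg; have [M [Q [M0 Q1 [h1 h2] [h3 h4]]]] := taylor_common hf hg.
have Q0 : 0 <= Q by lra.
have M20 : 0 < M * M by rewrite mulr_gt0.
exists (2 * (M * M)), (2 * Q); split; first by lra.
- by lra.
- move=> n; apply: (le_trans (absC_sum _ _ _)).
  apply: (@le_trans _ _ (\sum_(k < n.+1) M * M * Q ^+ n)).
    apply: ler_sum => k _; rewrite absCM -[in Q ^+ n](subnKC (leq_ord k)) exprD.
    rewrite (_ : M * M * _ = (M * Q ^+ k) * (M * Q ^+ (n - k))); last by ring.
    by rewrite ler_pM ?absC_ge0.
  rewrite sumr_const card_ord -[leLHS]mulr_natl exprMn.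
  have := natr_le_pow n; have : 0 <= M * M * Q ^+ n by rewrite mulr_ge0 ?exprn_ge0 // ltW.
  set A := M * M * Q ^+ n; set B := n.+1%:R; set D := 2 ^+ n => A0 BD.
  rewrite (_ : 2 * (M * M) * _ = 2 * (D * A)); last by rewrite /A; ring.
  have : 0 <= D by rewrite exprn_ge0.
  nra.
move=> y hy N; set q := Q * absC y.
have q0 : 0 <= q by rewrite mulr_ge0 ?absC_ge0.
have hq : q <= 1 / 2 by rewrite /q; lra.
have term k : absC (c k * y ^+ k) <= M * q ^+ k.
  by rewrite absCM absCX /q exprMn mulrA ler_wpM2r // exprn_ge0 // absC_ge0.
have hg0 : absC (g (a + y)) <= 2 * M.
  by have := h4 y hq 0%N; rewrite /psum big_ord0 subr0 expr0 mulr1.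
have -> : f (a + y) * g (a + y) - psum (conv c d) N y =
  (f (a + y) - psum c N y) * g (a + y) +
  \sum_(k < N) c k * y ^+ k * (g (a + y) - psum d (N - k) y).
  under [in RHS]eq_bigr do rewrite mulrBr.
  by rewrite sumrB -mulr_suml -psum_conv -/(psum c N y); ring.
apply: (@le_trans _ _ (2 * M * q ^+ N * (2 * M) + \sum_(k < N) 2 * (M * M) * q ^+ N)).
  apply: absCD_le; first by rewrite absCM ler_pM ?absC_ge0 // h2.
  apply: (le_trans (absC_sum _ _ _)); apply: ler_sum => k _.
  rewrite absCM -[in q ^+ N](subnKC (ltnW (ltn_ord k))) exprD.
  rewrite (_ : 2 * (M * M) * _ = (M * q ^+ k) * (2 * M * q ^+ (N - k))); last by ring.
  by rewrite ler_pM ?absC_ge0 // h4.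
have E : (2 * Q * absC y) ^+ N = 2 ^+ N * q ^+ N by rewrite -mulrA exprMn.
rewrite sumr_const card_ord -[X in _ + X]mulr_natl E.
have := natr_le_pow N; rewrite -natr1; set B := N%:R; set D := 2 ^+ N => BD.
have A0 : 0 <= M * M * q ^+ N by rewrite mulr_ge0 ?exprn_ge0 // ltW.
have := ler_wpM2r A0 BD; have : 0 <= B * (M * M * q ^+ N) by rewrite mulr_ge0.
lra.
Qed.

Lemma taylor_cst (v : C) a : taylor (fun=> v) a (fun k => if k is 0 then v else 0).
Proof.
have v0 := absC_ge0 v.
exists (absC v + 1), 1; split => //; first by lra.
  by case=> [|k]; rewrite expr1n mulr1 ?absC0; lra.
move=> y hy [|N]; first by rewrite /psum big_ord0 subr0 expr0 mulr1; lra.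
have -> : psum (fun k => if k is 0 then v else 0) N.+1 y = v.
  rewrite /psum big_ord_recl /= expr0 mulr1 big1 ?addr0 // => i _.
  by rewrite mul0r.
by rewrite subrr absC0 mulr_ge0 ?exprn_ge0 ?mulr_ge0 ?absC_ge0 //; lra.
Qed.

Lemma analyticM f g a : analytic_at f a -> analytic_at g a -> analytic_at (fun x => f x * g x) a.
Proof.
by move=> /analytic_taylor [c hc] /analytic_taylor [d hd]; apply: taylor_analytic (taylorM hc hd).
Qed.

Lemma analyticD f g a : analytic_at f a -> analytic_at g a -> analytic_at (fun x => f x + g x) a.
Proof.
by move=> /analytic_taylor [c hc] /analytic_taylor [d hd]; apply: taylor_analytic (taylorD hc hd).
Qed.

Lemma analytic_cst (v : C) a : analytic_at (fun=> v) a.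
Proof. exact: taylor_analytic (taylor_cst v a). Qed.

Lemma analyticZ (v : C) f a : analytic_at f a -> analytic_at (fun x => v * f x) a.
Proof. exact/analyticM/analytic_cst. Qed.

Lemma analyticB f g a : analytic_at f a -> analytic_at g a -> analytic_at (fun x => f x - g x) a.
Proof.
move=> /analytic_taylor [c hc] /analytic_taylor [d /(taylorZ (-1)) hd].
apply: (@taylor_analytic _ _ (fun k => c k + -1 * d k)); apply: taylor_ext (taylorD hc hd).
by exists 1 => // x _ /=; rewrite mulN1r.
Qed.

Lemma analytic_id a : analytic_at (fun x => x) a.
Proof.
apply: (taylor_analytic (c := fun k => (if k is k'.+1 then (if k' is 0 then 1 else 0) else 0)
    + (if k is 0 then a else 0))).
apply: taylor_ext (taylorD (taylor_shift (taylor_cst 1 a)) (taylor_cst a a)).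
by exists 1 => // x _ /=; rewrite mulr1 subrK.
Qed.

Lemma analytic_ext f g a : cnear a (fun x => f x = g x) -> analytic_at f a -> analytic_at g a.
Proof. by move=> h /analytic_taylor [c /(taylor_ext h) /taylor_analytic]. Qed.

End PowerSeries.

(** * Term by term differentiation; series solutions of the model equation *)

Section SeriesCalculus.
Variable R : realType.
Local Notation C := (CC R).
Local Notation cder := (gderiv (@id C)).
Local Notation cnear := (gnear (@id C)).
Implicit Types (f g : C -> C) (a b x y h : C) (c d : nat -> C).

Lemma geometric_half N : \sum_(k < N) (1 / 2 : R) ^+ k <= 2.
Proof.
suff : \sum_(k < N) (1 / 2 : R) ^+ k = 2 - 2 * (1 / 2) ^+ N.
  by move=> ->; rewrite lerBlDr lerDl mulr_ge0 // exprn_ge0 //; lra.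
elim: N => [|N IH]; first by rewrite big_ord0 expr0; lra.
by rewrite big_ord_recr /= IH exprS; lra.
Qed.

(** The remainder of order two of a power. Multiplying by [r ^+ 2] avoids the exponent [k - 2],
    which truncated subtraction would spoil. *)
Lemma pow_diff2 (r : R) y h k : 0 <= r -> absC y <= r -> absC (y + h) <= r ->
  absC ((y + h) ^+ k - y ^+ k - k%:R * y ^+ k.-1 * h) * r ^+ 2
    <= k%:R ^+ 2 * r ^+ k * absC h ^+ 2.
Proof.
move=> r0 yr yhr; elim: k => [|k IH].
  by rewrite !expr0 subrr !mul0r subr0 absC0 mul0r expr0n /= !mul0r.
have -> : (y + h) ^+ k.+1 - y ^+ k.+1 - k.+1%:R * y ^+ k * h =
  k%:R * y ^+ k.-1 * h ^+ 2 + (y + h) * ((y + h) ^+ k - y ^+ k - k%:R * y ^+ k.-1 * h).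
  case: k {IH} => [|k] /=; first by rewrite !expr0 !mul0r; ring.
  by rewrite !exprS -[k.+2%:R]natr1; ring.
set D := _ - _ in IH *.
have h1 : absC (k%:R * y ^+ k.-1 * h ^+ 2) * r ^+ 2 <= k%:R * r ^+ k.+1 * absC h ^+ 2.
  rewrite !absCM absC_nat !absCX.
  case: k {D IH} => [|k] /=; first by rewrite !mul0r.
  rewrite (_ : k.+1%:R * r ^+ k.+2 * absC h ^+ 2 = k.+1%:R * r ^+ k * absC h ^+ 2 * r ^+ 2); last first.
    by rewrite !exprS; ring.
  rewrite ler_wpM2r ?sqr_ge0 // ler_wpM2r ?sqr_ge0 // ler_wpM2l //.
  by rewrite lerXn2r ?nnegrE ?absC_ge0.
have h2 : absC ((y + h) * D) * r ^+ 2 <= k%:R ^+ 2 * r ^+ k.+1 * absC h ^+ 2.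
  rewrite absCM -mulrA (le_trans (ler_pM _ _ yhr IH)) ?absC_ge0 //.
    by rewrite mulr_ge0 ?absC_ge0 ?sqr_ge0.
  by rewrite (exprS r k); lra.
apply: (@le_trans _ _ ((absC (k%:R * y ^+ k.-1 * h ^+ 2) + absC ((y + h) * D)) * r ^+ 2)).
  by rewrite ler_wpM2r ?sqr_ge0 // absCD.
rewrite mulrDl; apply: (le_trans (lerD h1 h2)).
rewrite -natr1.
have : 0 <= r ^+ k.+1 * absC h ^+ 2 by rewrite mulr_ge0 ?sqr_ge0 ?exprn_ge0.
have : 0 <= k%:R :> R by rewrite ler0n.
nra.
Qed.

Lemma taylor_deriv f a c : taylor f a c -> exists f1,
  taylor f1 a (fun k => k.+1%:R * c k.+1) /\ cnear a (fun x => cder f x (f1 x)).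
Proof.
move=> hf; have [M [Q [M0 Q1 hc _]]] := hf.
have Q0 : 0 < Q by lra.
have [||k|f1 hf1] := @taylor_exists _ a (fun k => k.+1%:R * c k.+1) (M * Q) (2 * Q).
- by rewrite mulr_gt0.
- lra.
- rewrite absCM absC_nat (le_trans (ler_wpM2l (ler0n _ _) (hc _))) //.
  have w0 : 0 <= M * Q ^+ k.+1 by rewrite mulr_ge0 ?exprn_ge0 // ltW.
  apply: (le_trans (ler_wpM2r w0 (natr_le_pow R k))).
  by rewrite exprMn (exprS Q); lra.
exists f1; split => //.
have [r1 r10 cf] := taylor_cvg hf; have [r2 r20 cf1] := taylor_cvg hf1.
(* With [Q * r = 1 / 8] one factor [1 / 2] remains summable after two others have absorbed the
   [k%:R ^+ 2] of [pow_diff2]. *)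
pose r := (8 * Q)^-1; have r0 : 0 < r by rewrite invr_gt0 mulr_gt0.
have Qr : Q * r = 1 / 8 by rewrite /r; field; rewrite gt_eqF.
pose rho := Num.min r (Num.min r1 r2).
have rho0 : 0 < rho by rewrite !lt_min r0 r10.
have key y h : absC y < rho -> absC (y + h) < rho ->
    absC (f (a + (y + h)) - f (a + y) - f1 (a + y) * h) <= 2 * M / r ^+ 2 * absC h ^+ 2.
  rewrite !lt_min => /and3P[y1 y2 y3] /and3P[z1 z2 z3].
  have hh0 := absC_ge0 h.
  (* The partial sums for [f] at two points cost [e'] each, the one for [f1] costs [e' * absC h]. *)
  apply/ler_addgt0Pr => e e0; pose e' := e / (2 + absC h).
  have e'0 : 0 < e' by rewrite divr_gt0 //; lra.
  have [N1 hN1] := cf _ y2 _ e'0; have [N2 hN2] := cf _ z2 _ e'0.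
  have [N3 hN3] := cf1 _ y3 _ e'0.
  pose N := (N1 + N2 + N3)%N.
  have {}hN1 := hN1 N.+1 (leq_trans (leq_trans (leq_addr _ _) (leq_addr _ _)) (leqnSn N)).
  have {}hN2 := hN2 N.+1 (leq_trans (leq_trans (leq_addl _ _) (leq_addr _ _)) (leqnSn N)).
  have {}hN3 := hN3 N (leq_addl _ _).
  have E1 : psum (fun k => k.+1%:R * c k.+1) N y = \sum_(k < N.+1) c k * (k%:R * y ^+ k.-1).
    rewrite big_ord_recl /= mul0r mulr0 add0r; apply: eq_bigr => i _.
    by rewrite /bump /= add1n /=; ring.
  have E2 : psum c N.+1 (y + h) - psum c N.+1 y - psum (fun k => k.+1%:R * c k.+1) N y * h
    = \sum_(k < N.+1) c k * ((y + h) ^+ k - y ^+ k - k%:R * y ^+ k.-1 * h).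
    rewrite E1 /psum mulr_suml -!sumrB; apply: eq_bigr => i _; ring.
  have B : absC (psum c N.+1 (y + h) - psum c N.+1 y - psum (fun k => k.+1%:R * c k.+1) N y * h)
      <= 2 * M / r ^+ 2 * absC h ^+ 2.
    rewrite E2; apply: (le_trans (absC_sum _ _ _)).
    apply: (@le_trans _ _ (\sum_(k < N.+1) M / r ^+ 2 * absC h ^+ 2 * (1 / 2) ^+ k)).
      apply: ler_sum => k _; rewrite absCM.
      have := @pow_diff2 r y h k (ltW r0) (ltW y1) (ltW z1).
      rewrite -ler_pdivlMr ?exprn_gt0 // => hk.
      apply: (le_trans (ler_pM (absC_ge0 _) (absC_ge0 _) (hc k) hk)).
      rewrite (_ : M * Q ^+ k * _ = M / r ^+ 2 * absC h ^+ 2 * (k%:R ^+ 2 * (Q * r) ^+ k)); last first.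
        by rewrite exprMn; field; rewrite gt_eqF.
      rewrite ler_wpM2l //.
        by rewrite mulr_ge0 ?sqr_ge0 // divr_ge0 ?sqr_ge0 // ltW.
      rewrite Qr (_ : 1 / 8 = (1 / 2) * (1 / 2) * (1 / 2)); last by clear; lra.
      rewrite (exprMn k (1 / 2 * (1 / 2)) (1 / 2)) (exprMn k (1 / 2) (1 / 2)).
      have : k%:R <= (2 : R) ^+ k by rewrite -natrX ler_nat ltnW // ltn_expl.
      have : (2 : R) ^+ k * (1 / 2) ^+ k = 1.
        by rewrite -exprMn (_ : 2 * (1 / 2) = 1) ?expr1n //; clear; lra.
      have : 0 <= (1 / 2 : R) ^+ k by rewrite exprn_ge0 //; lra.
      have : 0 <= k%:R :> R by rewrite ler0n.
      set A := k%:R; set T := 2 ^+ k; set H := (1 / 2) ^+ k => A0 H0 TH AT.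
      have h1 : A * H <= 1 by rewrite -TH ler_wpM2r.
      have h2 : 0 <= A * H by rewrite mulr_ge0.
      rewrite (_ : A ^+ 2 * _ = (A * H) * (A * H) * H); last by ring.
      by rewrite ler_piMl // mulr_ile1.
    rewrite -mulr_sumr (_ : 2 * M / _ * _ = M / r ^+ 2 * absC h ^+ 2 * 2); last by ring.
    rewrite ler_wpM2l ?geometric_half //.
    by rewrite mulr_ge0 ?sqr_ge0 // divr_ge0 ?sqr_ge0 // ltW.
  have -> : f (a + (y + h)) - f (a + y) - f1 (a + y) * h =
     (psum c N.+1 (y + h) - psum c N.+1 y - psum (fun k => k.+1%:R * c k.+1) N y * h) +
     ((f (a + (y + h)) - psum c N.+1 (y + h)) - (f (a + y) - psum c N.+1 y)
     - (f1 (a + y) - psum (fun k => k.+1%:R * c k.+1) N y) * h) by ring.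
  apply: absCD_le => //.
  have -> : e = e' + e' + e' * absC h by rewrite /e'; field; rewrite gt_eqF //; move: hh0; clear; lra.
  rewrite (le_trans (absCBD _ _)) // lerD // ?absCM; last by rewrite ler_wpM2r // ltW.
  by apply: (le_trans (absCBD _ _)); exact: lerD (ltW hN2) (ltW hN1).
exists rho => // x /= hx e e0.
set K := 2 * M / r ^+ 2 in key.
have K0 : 0 < K by rewrite divr_gt0 ?exprn_gt0 // mulr_gt0.
exists (Num.min (rho - absC (x - a)) (e / K)).
  by rewrite lt_min subr_gt0 hx divr_gt0.
move=> z; rewrite lt_min => /andP[z1 z2].
have := @key (x - a) (z - x) hx.
rewrite (_ : x - a + (z - x) = z - a); last by ring.
rewrite (_ : a + (z - a) = z); last by ring.
rewrite (_ : a + (x - a) = x); last by ring.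
move=> /(_ _)/le_trans; apply.
  by rewrite (le_lt_trans (absC_tri _ x _)) // -ltrBrDr.
rewrite expr2 mulrA ler_wpM2r ?absC_ge0 // mulrC -ler_pdivlMr //.
exact: ltW.
Qed.

Lemma analytic_deriv f a : analytic_at f a -> exists f1,
  analytic_at f1 a /\ cnear a (fun x => cder f x (f1 x)).
Proof.
move=> /analytic_taylor [c /taylor_deriv [f1 [/taylor_analytic h1 h2]]].
by exists f1.
Qed.

Lemma analytic_cont f a : analytic_at f a -> gcont id f a.
Proof.
by move=> h; have [f1 [_ h1]] := analytic_deriv h; exact: gderiv_cont (gnear_at h1).
Qed.

Section ModelSeries.
Variables (p q e x0 f0 : C).

(* The pair (c_k, c_(k-1)) of coefficients of the power series at x0 of the
   solution of (x^2 - e) f' = (p + q x) f with value f0 at x0. *)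
Fixpoint model_coefs (k : nat) : C * C :=
  if k is k'.+1 then
    let: (c, c') := model_coefs k' in
    (((p + q * x0 - 2 * x0 * k'%:R) * c + (q - k'%:R + 1) * c')
       / ((x0 ^+ 2 - e) * k'.+1%:R), c)
  else (f0, 0).

Lemma model_coefs_snd k : (model_coefs k.+1).2 = (model_coefs k).1.
Proof. by rewrite /=; case: (model_coefs k). Qed.

Hypothesis x0e : x0 ^+ 2 - e != 0.

Lemma model_coefs_rec k : (x0 ^+ 2 - e) * k.+1%:R * (model_coefs k.+1).1 =
  (p + q * x0 - 2 * x0 * k%:R) * (model_coefs k).1 + (q - k%:R + 1) * (model_coefs k).2.
Proof.
rewrite /=; case: (model_coefs k) => [u v] /=.
by rewrite mulrC divfK // mulf_neq0 // pnatr_eq0.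
Qed.

(** Dividing the recurrence by [k.+1%:R] leaves coefficients bounded independently of [k]. Being of
    order two, it needs the bound for two consecutive coefficients at once, hence the statement on
    both components. *)
Lemma model_coefs_bound : exists M Q : R, [/\ 0 < M, 1 <= Q &
  forall k, absC (model_coefs k).1 <= M * Q ^+ k].
Proof.
pose A := absC (p + q * x0) + absC (2 * x0) + absC q + 2.
pose K := A / absC (x0 ^+ 2 - e).
have a0 : 0 < absC (x0 ^+ 2 - e) by rewrite absC_gt0.
have A0 : 0 < A by rewrite ltr_wpDl // !addr_ge0 ?absC_ge0.
have K0 : 0 < K by rewrite divr_gt0.
pose M := absC f0 + 1; pose Q := 2 * K + 1.
have M0 : 0 < M by rewrite ltr_wpDl ?absC_ge0.
have Q1 : 1 <= Q by rewrite /Q; lra.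
exists M, Q; split => //.
suff H k : absC (model_coefs k).1 <= M * Q ^+ k /\ absC (model_coefs k).2 <= M * Q ^+ k.
  by move=> k; have [] := H k.
elim: k => [|k [IH1 IH2]].
  split; rewrite expr0 mulr1; first by change (absC f0 <= M); rewrite /M; lra.
  by change (absC (0 : C) <= M); rewrite absC0 ltW.
have MQ0 : 0 <= M * Q ^+ k by rewrite mulr_ge0 ?exprn_ge0 //; lra.
have QS : M * Q ^+ k.+1 = Q * (M * Q ^+ k) by rewrite exprS; ring.
rewrite model_coefs_snd; split; last first.
  by rewrite (le_trans IH1) // QS ler_peMl.
have k1 : 0 < k.+1%:R :> R by rewrite ltr0n.
have := model_coefs_rec k; set u := (model_coefs k.+1).1.
move=> /(congr1 (@absC R)); rewrite !absCM absC_nat => hu.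
have hk0 : 0 <= k%:R :> R by rewrite ler0n.
have hb : absC (x0 ^+ 2 - e) * k.+1%:R * absC u <= 2 * A * k.+1%:R * (M * Q ^+ k).
  rewrite hu; apply: (@le_trans _ _ (A * k.+1%:R * (M * Q ^+ k) + A * k.+1%:R * (M * Q ^+ k))); last by lra.
  apply: absCD_le; rewrite absCM ler_pM ?absC_ge0 //.
    rewrite (le_trans (absCBD _ _)) // [absC (2 * x0 * _)]absCM absC_nat /A -natr1.
    have := absC_ge0 (p + q * x0); have := absC_ge0 (2 * x0); have := absC_ge0 q.
    set a1 := absC (p + _); set a2 := absC (2 * x0); set a3 := absC q; set kk := k%:R => *; nra.
  rewrite -addrA (le_trans (absCD _ _)) //.
  have : absC (- k%:R + 1 : C) <= k%:R + 1.
    by rewrite (le_trans (absCD _ _)) // absCN absC_nat absC1.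
  rewrite /A -natr1.
  have := absC_ge0 (p + q * x0); have := absC_ge0 (2 * x0); have := absC_ge0 q.
  set a1 := absC (p + _); set a2 := absC (2 * x0); set a3 := absC q; set kk := k%:R => *; nra.
have : absC u <= 2 * K * (M * Q ^+ k).
  rewrite -(ler_pM2l (mulr_gt0 a0 k1)) (le_trans hb) //.
  rewrite (_ : absC (x0 ^+ 2 - e) * k.+1%:R * _ = (absC (x0 ^+ 2 - e) * K) * (2 * k.+1%:R * (M * Q ^+ k))); last by ring.
  rewrite /K [absC _ * (A / _)]mulrC divfK ?gt_eqF //; lra.
by move/le_trans; apply; rewrite QS ler_wpM2r // /Q; lra.
Qed.

End ModelSeries.

(** A solution built from exponentials and logarithms has no power series at hand. The recurrence
    provides one that solves the same equation with the same initial value, and [ode_unique]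
    identifies the two. *)
Lemma model_analytic (p q e x0 : C) f : x0 ^+ 2 - e != 0 ->
  cnear x0 (fun x => cder f x ((p + q * x) / (x ^+ 2 - e) * f x)) ->
  f x0 != 0 -> analytic_at f x0.
Proof.
move=> x0e hf f0.
have [M [Q [M0 Q1 hc]]] := model_coefs_bound p q (f x0) x0e.
set c := fun k => (model_coefs p q e x0 (f x0) k).1 in hc.
have [S hS] := taylor_exists x0 M0 Q1 hc.
have [S1 [hS1 dS]] := taylor_deriv hS.
(* The Taylor coefficients at [x0] of [(x^2 - e) S' - (p + q x) S], after writing [x^2 - e] as
   [(x0^2 - e) + 2 x0 (x - x0) + (x - x0)^2]. *)
have zero : (fun k => (x0 ^+ 2 - e) * (k.+1%:R * c k.+1)
   + 2 * x0 * (if k is k'.+1 then k'.+1%:R * c k'.+1 else 0)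
   + (if k is k'.+1 then (if k' is k''.+1 then k''.+1%:R * c k''.+1 else 0) else 0)
   + - (p + q * x0) * c k + - q * (if k is k'.+1 then c k' else 0)) = (fun=> 0 : C).
  apply/funext => k; rewrite mulrA model_coefs_rec //.
  case: k => [|k]; first by rewrite /= /c /=; ring.
  rewrite model_coefs_snd -/(c k) -/(c k.+1).
  by case: k => [|k]; ring.
have hz := taylorD (taylorD (taylorD (taylorD (taylorZ (x0 ^+ 2 - e) hS1)
  (taylorZ (2 * x0) (taylor_shift hS1))) (taylor_shift (taylor_shift hS1)))
  (taylorZ (- (p + q * x0)) hS)) (taylorZ (- q) (taylor_shift hS)).
rewrite zero in hz; move/taylor_zero in hz.
have cx : gcont id (fun x : C => x ^+ 2 - e) x0.
  apply: gcontB; last exact: gcont_cst.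
  by apply: (@gcont_ext _ _ _ (fun x : C => x * x)); [exists 1|apply: gcontM; exact: (gderiv_cont (gderiv_io _ _))].
have xn0 := gcont_near_neq0 cx x0e.
have hS' : cnear x0 (fun x => cder S x ((p + q * x) / (x ^+ 2 - e) * S x)).
  apply: gnear_imp (gnear_and (gnear_and hz dS) xn0) => x [[h1 h2] h3].
  apply: gderiv_eq h2; apply: (mulIf h3); rewrite [RHS]mulrAC divfK //.
  apply/eqP; rewrite -subr_eq0 -[X in _ == X]h1; apply/eqP; ring.
have S0 : S x0 = f x0.
  have [r r0 /(_ 0)] := taylor_cvg hS; rewrite absC0 => /(_ r0) H.
  apply/eqP; rewrite -subr_eq0; apply/eqP/absC_le0_eq => d /H [N hN].
  have := hN N.+1 (leqnSn N); rewrite addr0 /psum big_ord_recl /= expr0 mulr1.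
  rewrite big1 ?addr0 => [/ltW //|i _]; by rewrite expr0n /= mulr0.
apply: analytic_ext (taylor_analytic hS).
apply: gnear_imp (ode_unique hS' hf f0) => x ->.
by rewrite S0 divff // mul1r.
Qed.

End SeriesCalculus.

(** * Analytic functions of two variables *)

Section TwoVariables.
Variable R : realType.
Local Notation C := (CC R).

Lemma analytic2_slice (f : C -> C -> C) (a b : C) : analytic2_at f a b -> analytic_at (f a) b.
Proof.
move=> [c [d [M [d0 hc hf]]]]; exists (c 0%N), d; split => // x hx.
have := hf a x; rewrite subrr absC0 => /(_ d0 hx) /cvg_absC h.
apply/cvg_absC => e e0; have [N0 _ hN] := h e e0.
(* The square partial sum must be nonempty to contain the row [k = 0], the only one that survives
   when the first variable equals [a]. *)
exists N0.+1 => // -[|N] //= hN1; have := hN N.+1 (ltnW hN1).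
rewrite /=.
have -> : \sum_(i < N.+1) \sum_(j < N.+1) c i j * 0 ^+ i * (x - b) ^+ j =
    \sum_(j < N.+1) c 0%N j * (x - b) ^+ j.
  rewrite big_ord_recl [X in _ + X]big1 ?addr0 => [|i _].
    by apply: eq_bigr => j _; rewrite expr0 mulr1.
  by rewrite big1 // => j _; rewrite /= expr0n mulr0 mul0r.
by rewrite /series /= big_mkord.
Qed.

Lemma pow_diff1 (r : R) (y z : C) k : 0 <= r -> absC y <= r -> absC z <= r ->
  absC (y ^+ k - z ^+ k) * r <= k%:R * r ^+ k * absC (y - z).
Proof.
move=> r0 yr zr; elim: k => [|k IH]; first by rewrite !expr0 subrr absC0 !mul0r.
have -> : y ^+ k.+1 - z ^+ k.+1 = y * (y ^+ k - z ^+ k) + z ^+ k * (y - z).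
  by rewrite !exprS; ring.
apply: (@le_trans _ _ ((absC y * absC (y ^+ k - z ^+ k) + absC z ^+ k * absC (y - z)) * r)).
  by rewrite ler_wpM2r // -absCX -!absCM absCD.
have h1 : absC z ^+ k <= r ^+ k by rewrite lerXn2r ?nnegrE ?absC_ge0.
have h2 : absC z ^+ k * absC (y - z) <= r ^+ k * absC (y - z) by rewrite ler_wpM2r ?absC_ge0.
have h3 : absC y * (absC (y ^+ k - z ^+ k) * r) <= r * (k%:R * r ^+ k * absC (y - z)).
  by rewrite ler_pM ?absC_ge0 // mulr_ge0 ?absC_ge0.
have h4 := ler_wpM2r r0 h2.
by rewrite exprS -natr1; lra.
Qed.

Lemma double_half N : \sum_(k < N) \sum_(l < N) (1 / 2 : R) ^+ k * (1 / 2) ^+ l <= 4.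
Proof.
under eq_bigr do rewrite -mulr_sumr.
rewrite -mulr_suml (_ : 4 = 2 * 2); last by ring.
by rewrite ler_pM ?geometric_half // sumr_ge0 // => i _; rewrite exprn_ge0 //; lra.
Qed.

Lemma analytic2_lipschitz (f : C -> C -> C) : analytic2_at f 0 0 -> exists r L : R,
  [/\ 0 < r, 0 < L, forall e x, absC e <= r -> absC x <= r -> absC (f e x) <= L &
   forall e x e' x', absC e <= r -> absC x <= r -> absC e' <= r -> absC x' <= r ->
     absC (f e x - f e' x') <= L * (absC (e - e') + absC (x - x'))].
Proof.
move=> [c [d [M0 [d0 hc0 hf]]]].
pose M := Num.max 1 M0; have M1 : 0 < M by rewrite lt_max ltr01.
have hc k l : absC (c k l) * d ^+ (k + l) <= M by rewrite (le_trans (hc0 k l)) // le_max lexx orbT.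
(* On this polydisc the terms decay like [4^-(k + l)]: one factor [2^-k] or [2^-l] absorbs the
   degree produced by a difference of powers, and what is left still sums to at most 4. *)
pose r := d / 4; have r0 : 0 < r by rewrite divr_gt0.
have rd : r < d by rewrite /r; lra.
have hcr k l : absC (c k l) * r ^+ k * r ^+ l <= M * ((1 / 4) ^+ k * (1 / 4) ^+ l).
  rewrite -mulrA -!exprD.
  have -> : r ^+ (k + l) = d ^+ (k + l) * (1 / 4) ^+ (k + l).
    by rewrite -exprMn; congr (_ ^+ _); rewrite /r; lra.
  by rewrite mulrA ler_wpM2r // exprn_ge0 //; lra.
have q4 k : (1 / 4 : R) ^+ k = (1 / 2) ^+ k * (1 / 2) ^+ k.
  by rewrite -exprMn; congr (_ ^+ k); lra.
have H0 k : 0 <= (1 / 2 : R) ^+ k by rewrite exprn_ge0 //; lra.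
have H1 k : (1 / 2 : R) ^+ k <= 1 by rewrite exprn_ile1 //; lra.
have kH k : k%:R * (1 / 2 : R) ^+ k <= 1.
  have : k%:R <= (2 : R) ^+ k by rewrite -natrX ler_nat ltnW // ltn_expl.
  move=> /(ler_wpM2r (H0 k)) /le_trans; apply.
  by rewrite -exprMn (_ : 2 * (1 / 2) = 1) ?expr1n //; clear; lra.
pose S N e x := \sum_(k < N) \sum_(l < N) c k l * (e - 0) ^+ k * (x - 0) ^+ l.
have hS e x : absC e <= r -> absC x <= r -> (fun N => S N e x) @ \oo --> f e x.
  by move=> he hx; apply: hf; rewrite subr0 (le_lt_trans _ rd).
have SB N e x : absC e <= r -> absC x <= r -> absC (S N e x) <= 4 * M.
  move=> he hx; apply: (le_trans (absC_sum _ _ _)).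
  apply: (@le_trans _ _ (\sum_(k < N) \sum_(l < N) M * ((1 / 2) ^+ k * (1 / 2) ^+ l))).
    apply: ler_sum => k _; apply: (le_trans (absC_sum _ _ _)); apply: ler_sum => l _.
    rewrite !subr0 !absCM !absCX.
    apply: (@le_trans _ _ (absC (c k l) * r ^+ k * r ^+ l)).
      by rewrite !ler_pM ?mulr_ge0 ?exprn_ge0 ?absC_ge0 // lerXn2r ?nnegrE ?absC_ge0 // ltW.
    rewrite (le_trans (hcr k l)) // ler_pM2l // !q4.
    by rewrite ler_pM ?mulr_ge0 // ler_piMl.
  under eq_bigr do rewrite -mulr_sumr.
  by rewrite -mulr_sumr mulrC ler_pM2r // double_half.
have SL N e x e' x' : absC e <= r -> absC x <= r -> absC e' <= r -> absC x' <= r ->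
    absC (S N e x - S N e' x') <= 4 * M / r * (absC (e - e') + absC (x - x')).
  move=> he hx he' hx'.
  rewrite /S -sumrB; apply: (le_trans (absC_sum _ _ _)).
  set D := absC (e - e') + absC (x - x').
  have D0 : 0 <= D by rewrite addr_ge0 ?absC_ge0.
  apply: (@le_trans _ _ (\sum_(k < N) \sum_(l < N) M / r * D * ((1 / 2) ^+ k * (1 / 2) ^+ l))).
    apply: ler_sum => k _; rewrite -sumrB; apply: (le_trans (absC_sum _ _ _)); apply: ler_sum => l _.
    rewrite !subr0 -!mulrA -mulrBr absCM.
    have E : e ^+ k * x ^+ l - e' ^+ k * x' ^+ l = (e ^+ k - e' ^+ k) * x ^+ l + e' ^+ k * (x ^+ l - x' ^+ l).
      by ring.
    have p1 := pow_diff1 k (ltW r0) he he'; have p2 := pow_diff1 l (ltW r0) hx hx'.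
    have xl : absC x ^+ l <= r ^+ l by rewrite lerXn2r ?nnegrE ?absC_ge0 // ltW.
    have ek : absC e' ^+ k <= r ^+ k by rewrite lerXn2r ?nnegrE ?absC_ge0 // ltW.
    have E2 : absC (e ^+ k * x ^+ l - e' ^+ k * x' ^+ l) * r <=
        (k%:R * absC (e - e') + l%:R * absC (x - x')) * (r ^+ k * r ^+ l).
      rewrite E (le_trans (ler_wpM2r (ltW r0) (absCD _ _))) // !absCM !absCX mulrDl.
      have := ler_pM (mulr_ge0 (absC_ge0 _) (ltW r0)) (exprn_ge0 l (absC_ge0 x)) p1 xl.
      have := ler_pM (exprn_ge0 k (absC_ge0 e')) (mulr_ge0 (absC_ge0 _) (ltW r0)) ek p2.
      lra.
    rewrite -(ler_pM2r r0) -mulrA (le_trans (ler_wpM2l (absC_ge0 _) E2)) //.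
    rewrite (_ : absC (c k l) * _ = (k%:R * absC (e - e') + l%:R * absC (x - x')) * (absC (c k l) * r ^+ k * r ^+ l)); last by ring.
    have F0 : 0 <= k%:R * absC (e - e') + l%:R * absC (x - x').
      by rewrite addr_ge0 // mulr_ge0 ?ler0n ?absC_ge0.
    rewrite (le_trans (ler_wpM2l F0 (hcr k l))) //.
    rewrite (_ : M * _ * r = M * (D * ((1 / 2) ^+ k * (1 / 2) ^+ l))); last by field; rewrite gt_eqF.
    rewrite mulrCA ler_pM2l // !q4.
    rewrite (_ : (k%:R * absC (e - e') + l%:R * absC (x - x')) * _ = (k%:R * (1 / 2) ^+ k * (1 / 2) ^+ l * absC (e - e') +
       (1 / 2) ^+ k * (l%:R * (1 / 2) ^+ l) * absC (x - x')) * ((1 / 2) ^+ k * (1 / 2) ^+ l)); last by ring.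
    rewrite ler_wpM2r ?mulr_ge0 // /D lerD // ler_piMl ?absC_ge0 // mulr_ile1 ?mulr_ge0 //.
  under eq_bigr do rewrite -mulr_sumr.
  rewrite -mulr_sumr (_ : 4 * M / r * D = M / r * D * 4); last by ring.
  by rewrite ler_wpM2l ?double_half // mulr_ge0 // divr_ge0 // ltW.
exists r, (4 * M + 4 * M / r); split => //.
- by rewrite addr_gt0 ?divr_gt0 // mulr_gt0.
- move=> e x he hx; apply/ler_addgt0Pr => t t0.
  have [N0 _ hN] := (cvg_absC _ _ _).1 (hS e x he hx) t t0.
  have := hN N0 (leqnn _); rewrite /= => h1.
  have -> : f e x = S N0 e x + - (S N0 e x - f e x) by ring.
  rewrite -absCN in h1; apply: (le_trans (absCD_le (SB N0 e x he hx) (ltW h1))).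
  have : 0 <= 4 * M / r by rewrite divr_ge0 ?mulr_ge0 // ltW.
  lra.
move=> e x e' x' he hx he' hx'; apply/ler_addgt0Pr => t t0.
have t2 : 0 < t / 2 by rewrite divr_gt0.
have [N1 _ hN1] := (cvg_absC _ _ _).1 (hS e x he hx) _ t2.
have [N2 _ hN2] := (cvg_absC _ _ _).1 (hS e' x' he' hx') _ t2.
have h1 := hN1 (N1 + N2)%N (leq_addr _ _); have h2 := hN2 (N1 + N2)%N (leq_addl _ _).
have -> : f e x - f e' x' = (S (N1 + N2)%N e x - S (N1 + N2)%N e' x') +
  (- (S (N1 + N2)%N e x - f e x) + (S (N1 + N2)%N e' x' - f e' x')) by ring.
apply: absCD_le.
  apply: (le_trans (SL _ _ _ _ _ he hx he' hx')).
  by rewrite ler_wpM2r ?addr_ge0 ?absC_ge0 // lerDr mulr_ge0 // ltW.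
by rewrite [leRHS]splitr absCD_le ?absCN // ltW.
Qed.

End TwoVariables.

(** * Perturbed diagonal systems on the line *)

Section ColumnSystems.
Variable R : realType.
Local Notation C := (CC R).
Local Notation rder := (gderiv (@ofR R)).
Local Notation rcont := (gcont (@ofR R)).
Variable n : nat.

Lemma rcont_bounded (y : R -> C) (a b : R) : a <= b ->
  (forall u, a <= u <= b -> rcont y u) ->
  exists2 S : R, 0 <= S & forall u, a <= u <= b -> absC (y u) <= S.
Proof.
move=> ab hy.
have cf : {within `[a, b], continuous (fun u => absC (y u))}.
  apply: continuous_in_subspaceT => u; rewrite inE /= in_itv /= => hu.
  apply/cvgrPdist_lt => e e0; have [d d0 hd] := hy u hu e e0.
  apply/nbhs_ballP; exists d => //= v; rewrite /ball /= => hv.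
  have := hd v; rewrite ofR_dist distrC => /(_ hv) h.
  rewrite ltr_norml; apply/andP; split.
    by rewrite ltrNl opprB (le_lt_trans (absC_subD _ _)).
  by rewrite (le_lt_trans (absC_subD _ _)) // absCB.
have [c _ hc] := EVT_max ab cf.
exists (absC (y c)); first exact: absC_ge0.
by move=> u hu; apply: hc; rewrite in_itv.
Qed.

(** Compactness gives some finite bound [S]; iterating [S |-> B + S / 2] brings it down to [2 * B]
    in the limit. This replaces a fixed point argument for the perturbed systems. *)
Lemma sup_absorb (y : 'I_n -> R -> C) (a b B : R) : a <= b -> 0 <= B ->
  (forall i u, a <= u <= b -> rcont (y i) u) ->
  (forall S, 0 <= S -> (forall i u, a <= u <= b -> absC (y i u) <= S) ->
     forall i u, a <= u <= b -> absC (y i u) <= B + S / 2) ->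
  forall i u, a <= u <= b -> absC (y i u) <= 2 * B.
Proof.
move=> ab B0 hy hS.
have bd i : exists S : R, 0 <= S /\ forall u, a <= u <= b -> absC (y i u) <= S.
  by have [S S0 h] := rcont_bounded ab (hy i); exists S.
have [s hs] := choice bd.
pose S := \sum_(i < n) s i.
have S0 : 0 <= S by rewrite sumr_ge0 // => i _; exact: (hs i).1.
have h0 i u : a <= u <= b -> absC (y i u) <= S.
  move=> hu; rewrite (le_trans ((hs i).2 u hu)) // /S (bigD1 i) //= lerDl.
  by rewrite sumr_ge0 // => j _; exact: (hs j).1.
have H m i u : a <= u <= b -> absC (y i u) <= 2 * B + S * (1 / 2) ^+ m.
  elim: m i u => [|m IH] i u hu.
    by rewrite expr0 mulr1 (le_trans (h0 i u hu)) // lerDr mulr_ge0.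
  have p0 : 0 <= S * (1 / 2) ^+ m by rewrite mulr_ge0 // exprn_ge0 //; lra.
  have S'0 : 0 <= 2 * B + S * (1 / 2) ^+ m by lra.
  by rewrite (le_trans (hS _ S'0 IH i u hu)) // exprS; lra.
move=> i u hu; rewrite -subr_le0; apply: (@pow_le0 _ _ S) => // m.
by have := H m i u hu; lra.
Qed.

Variable T : R.
Hypothesis T1 : 1 <= T.

(** The order of magnitude of [x^2 - eps] along the path; its antiderivative [primitive] has
    oscillation at most [2 / T] on the whole line, which is the source of all smallness. *)
Definition weight (u : R) : R := ((T + `|u|) ^+ 2)^-1.
Definition primitive (u : R) : R := u / (T * (T + `|u|)).

Lemma weight_ge0 u : 0 <= weight u.
Proof. by rewrite invr_ge0 sqr_ge0. Qed.

Lemma weight_le u U : 0 <= U <= `|u| -> weight u <= ((T + U) ^+ 2)^-1.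
Proof.
move=> /andP[U0 h]; rewrite /weight lef_pV2 ?posrE ?exprn_gt0 //; last 2 first.
- by have := normr_ge0 u; have := T1; lra.
- by have := T1; lra.
by rewrite lerXn2r ?nnegrE; have := normr_ge0 u; have := T1; lra.
Qed.

Lemma rcont_norm u : rcont (fun v => ofR `|v|) u.
Proof.
move=> e e0; exists e => // v; rewrite !ofR_dist => h.
by rewrite (le_lt_trans (ler_dist_dist _ _)).
Qed.

Lemma primitiveE v : ofR (primitive v) = ofR v * (ofR T * (ofR T + ofR `|v|))^-1.
Proof. by rewrite /primitive !(ofRM, ofRV, ofRD). Qed.

Lemma TDn0 (v : R) : ofR T * (ofR T + ofR `|v|) != 0.
Proof.
rewrite -ofRD -ofRM -absC_gt0 absC_ofR normr_gt0 mulf_neq0 // gt_eqF //;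
  by have := normr_ge0 v; have := T1; lra.
Qed.

Lemma rcont_primitive u : rcont (fun v => ofR (primitive v)) u.
Proof.
apply: (@gcont_ext _ _ _ (fun v => ofR v * (ofR T * (ofR T + ofR `|v|))^-1)).
  by exists 1 => // v _; rewrite primitiveE.
apply: gcontM; first exact: gderiv_cont (gderiv_io _ _).
apply: (gcont_comp (f := fun w : C => w^-1)); first exact/gcont_inv/TDn0.
apply: gcontM; first exact: gcont_cst.
by apply: gcontD; [exact: gcont_cst|exact: rcont_norm].
Qed.

Lemma rder_primitive u : u != 0 -> rder (fun v => ofR (primitive v)) u (ofR (weight u)).
Proof.
move=> u0; pose sg := Num.sg u.
have nE v : `|v - u| < `|u| -> `|v| = sg * v.
  move=> h; rewrite /sg; case: (ltgtP u 0) u0 => // hu _.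
    rewrite ltr0_sg // mulN1r ltr0_norm //.
    by rewrite (ltr0_norm hu) ltr_norml in h; case/andP: h; lra.
  rewrite gtr0_sg // mul1r gtr0_norm //.
  by rewrite (gtr0_norm hu) ltr_norml in h; case/andP: h; lra.
have hu : `|u| = sg * u by apply: nE; rewrite subrr normr0 normr_gt0.
apply: (@gderiv_ext _ _ _ (fun v => ofR v * (ofR T * (ofR T + ofR sg * ofR v))^-1)).
  exists `|u|; rewrite ?normr_gt0 // => v; rewrite ofR_dist => /nE h.
  by rewrite primitiveE h ofRM.
have d0 := TDn0 u; rewrite hu ofRM in d0.
have Dd : rder (fun v => ofR T * (ofR T + ofR sg * ofR v)) u (ofR T * (0 + ofR sg * 1)).
  by apply: gderivZ; apply: gderivD; [exact: gderiv_cst|apply: gderivZ; exact: gderiv_io].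
have H := gderivM (gderiv_io _ u) (gderiv_comp (f := fun w : C => w^-1)
  (g := fun v => ofR T * (ofR T + ofR sg * ofR v)) (gderiv_inv d0) Dd).
apply: (gderiv_eq _ H).
rewrite /weight hu ofRV expr2 !(ofRM, ofRD).
move: d0; rewrite mulf_eq0 negb_or => /andP[t0 d0].
by field; rewrite t0 d0.
Qed.

Lemma primitive_bound u : `|primitive u| <= T^-1.
Proof.
have u0 := normr_ge0 u; have TT := T1.
have p0 : 0 < T * (T + `|u|) by apply: mulr_gt0; lra.
rewrite /primitive normrM normfV (gtr0_norm p0) ler_pdivrMr // mulKf ?gt_eqF; lra.
Qed.

Lemma primitive_tail u : u <= 0 -> primitive u + T^-1 = (T + `|u|)^-1.
Proof.
move=> u0; rewrite /primitive ler0_norm //; have := T1 => TT.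
by field; rewrite !gt_eqF //; lra.
Qed.

Variables (k : 'I_n) (c K : R).
Hypotheses (c0 : 0 < c) (K0 : 0 <= K).

Section Components.
Variables (s : seq R) (y al be : 'I_n -> R -> C) (a b E S eta : R) (d : C).
Hypotheses (ab : a <= b) (E0 : 0 <= E) (S0 : 0 <= S) (eta0 : 0 <= eta).
Hypothesis hy : forall i u, a <= u <= b -> rcont (y i) u.
Hypothesis hd : forall i u, a < u < b -> u \notin s ->
  rder (y i) u (al i u * y i u + be i u).
Hypothesis hst : forall (i : 'I_n) u, a < u < b -> u \notin s -> (k < i)%N -> reC (al i u) <= - c.
Hypothesis hun : forall (i : 'I_n) u, a < u < b -> u \notin s -> (i < k)%N -> c <= reC (al i u).
Hypothesis h0 : forall u, a < u < b -> u \notin s -> al k u = 0.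

(** Below the diagonal the component is damped from left to right, above it from right to left; each
    is therefore controlled from the end where its bound is known. *)
Lemma offdiag_component (i : 'I_n) (M : R) : i != k ->
  (forall u, a < u < b -> u \notin s -> absC (be i u) <= c * M) ->
  ((k < i)%N -> absC (y i a) <= M) -> ((i < k)%N -> absC (y i b) <= M) ->
  forall u, a <= u <= b -> absC (y i u) <= M.
Proof.
move=> ik hbe ha hb.
case: (ltngtP i k) => [ltik|ltki|/val_inj eqik]; last by rewrite eqik eqxx in ik.
  apply: (unstable_bound (s := s) c0 (hy i)); last exact: hb.
  move=> u hu us; exists (al i u), (be i u); split; [exact: hd|exact: hun|exact: hbe].
apply: (stable_bound (s := s) c0 (hy i)); last exact: ha.
by move=> u hu us; exists (al i u), (be i u); split; [exact: hd|exact: hst|exact: hbe].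
Qed.

Lemma diag_component :
  (forall u, a < u < b -> u \notin s -> absC (be k u) <= S * weight u + eta) ->
  forall u, a <= u <= b ->
  absC (y k u - y k a) <= S * (primitive u - primitive a) + eta * (u - a).
Proof.
move=> hbe u /andP[au ub].
have -> : S * (primitive u - primitive a) + eta * (u - a) =
   (S * primitive u + eta * u) - (S * primitive a + eta * a) by ring.
apply: (@curve_bound _ (0 :: s) (y k) (fun v => S * primitive v + eta * v)) => //.
- by move=> v /andP[h1 h2]; apply: hy; rewrite h1 (le_trans h2).
- move=> v _; apply: (@gcont_ext _ _ _ (fun v => ofR S * ofR (primitive v) + ofR eta * ofR v)).
    by exists 1 => // w _; rewrite ofRD !ofRM.
  apply: gcontD; apply: gcontM; try exact: gcont_cst; first exact: rcont_primitive.
  exact: gderiv_cont (gderiv_io _ _).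
- move=> v /andP[h1 h2]; rewrite inE negb_or => /andP[v0 vs].
  have hv : a < v < b by rewrite h1 (lt_le_trans h2).
  exists (be k v), (S * weight v + eta); split; last exact: hbe.
    by apply: (gderiv_eq _ (hd k hv vs)); rewrite h0 // mul0r add0r.
  apply: (@gderiv_ext _ _ _ (fun v => ofR S * ofR (primitive v) + ofR eta * ofR v)).
    by exists 1 => // w _; rewrite ofRD !ofRM.
  apply: (gderiv_eq (v := ofR S * ofR (weight v) + ofR eta * 1)).
    by rewrite ofRD ofRM mulr1.
  by apply: gderivD; apply: gderivZ; [exact: rder_primitive|exact: gderiv_io].
Qed.

(** One bound serves the three kinds of components: off the diagonal the forcing is divided by the
    rate [c], on the diagonal it is integrated. The part [eta] is a non-integrable error on a
    bounded window. *)
Lemma components_bound :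
  (forall i u, a < u < b -> u \notin s -> absC (be i u) <= S * weight u + eta) ->
  (forall i : 'I_n, (k < i)%N -> absC (y i a) <= E) ->
  (forall i : 'I_n, (i < k)%N -> absC (y i b) <= E) ->
  absC (y k a - d) <= E ->
  forall i u, a <= u <= b -> absC (y i u - (i == k)%:R * d) <=
    E + S * (c^-1 + 2) / T + eta * (c^-1 + (b - a)).
Proof.
move=> hbe ha hb hk i u hu; have TT := T1; have ci : 0 < c^-1 by rewrite invr_gt0.
have [->|ik] := eqVneq i k.
  have -> : y k u - 1%:R * d = (y k u - y k a) + (y k a - d) by ring.
  rewrite (le_trans (absCD_le (diag_component (hbe k) hu) hk)) //.
  have := primitive_bound u; have := primitive_bound a; rewrite !ler_norml => /andP[p1 p2] /andP[p3 p4].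
  have : S * (primitive u - primitive a) <= S * (2 * T^-1) by rewrite ler_wpM2l //; lra.
  have : eta * (u - a) <= eta * (b - a) by rewrite ler_wpM2l //; case/andP: hu; lra.
  have : 0 <= S * c^-1 / T by rewrite divr_ge0 ?mulr_ge0 ?(ltW ci) //; lra.
  have : 0 <= eta * c^-1 by rewrite mulr_ge0 // ltW.
  lra.
rewrite mul0r subr0.
have e1 : 0 <= S * c^-1 / T by rewrite divr_ge0 ?mulr_ge0 ?(ltW ci) //; lra.
have e3 : 0 <= S * 2 / T by rewrite divr_ge0 ?mulr_ge0 //; lra.
have e2 : 0 <= eta * c^-1 by rewrite mulr_ge0 // ltW.
have e4 : 0 <= eta * (b - a) by rewrite mulr_ge0 // subr_ge0.
apply: offdiag_component => //.
- move=> v hv vs; apply: (le_trans (hbe i v hv vs)).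
  (* The square in the weight is only used through [T >= 1]. *)
  have wT : weight v <= T^-1.
    apply: (@le_trans _ _ ((T + 0) ^+ 2)^-1); first by apply: weight_le; rewrite lexx normr_ge0.
    rewrite addr0 lef_pV2 ?posrE ?exprn_gt0; try lra.
    by rewrite expr2 ler_peMl //; lra.
  have := ler_wpM2l S0 wT.
  have cE : 0 <= c * E by rewrite mulr_ge0 // ltW.
  rewrite (_ : c * _ = c * E + S / T + 2 * c * S / T + eta + c * (eta * (b - a))); last first.
    by field; rewrite !gt_eqF //; lra.
  have := mulr_ge0 (ltW c0) e4; have := mulr_ge0 (ltW c0) e3; lra.
- by move/ha; lra.
- by move/hb; lra.
Qed.

End Components.

End ColumnSystems.

(** * Columns on the whole line: bounds, tails and stability *)

Section GlobalColumns.
Variable R : realType.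
Local Notation C := (CC R).
Local Notation rder := (gderiv (@ofR R)).
Local Notation rcont := (gcont (@ofR R)).
Variables (n : nat) (T : R) (k : 'I_n) (c K : R).
Hypotheses (T1 : 1 <= T) (c0 : 0 < c) (K0 : 0 <= K).

(* The k-th column of the normalizing matrix along a path running from x_R
   (u -> -oo) to x_L (u -> +oo): entries below the diagonal are determined
   from the left end, those above the diagonal from the right end. *)
Record column_system (s : seq R) (al : 'I_n -> R -> C) (rho : 'I_n -> 'I_n -> R -> C)
    (y : 'I_n -> R -> C) (d : C) : Prop := ColumnSystem {
  cs_cont : forall i u, rcont (y i) u;
  cs_der : forall i u, u \notin s ->
    rder (y i) u (al i u * y i u + \sum_(m < n) rho i m u * y m u);
  cs_stable : forall (i : 'I_n) u, u \notin s -> (k < i)%N -> reC (al i u) <= - c;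
  cs_unstable : forall (i : 'I_n) u, u \notin s -> (i < k)%N -> c <= reC (al i u);
  cs_neutral : forall u, al k u = 0;
  cs_small : forall i m u, u \notin s -> absC (rho i m u) <= K * weight T u;
  cs_left : forall e : R, 0 < e -> exists V : R, forall u, u <= - V ->
    absC (y k u - d) <= e /\ forall i : 'I_n, (k < i)%N -> absC (y i u) <= e;
  cs_right : forall e : R, 0 < e -> exists V : R, forall u, V <= u ->
    forall i : 'I_n, (i < k)%N -> absC (y i u) <= e }.

Let A := n%:R * K.
(** The contraction condition: feeding a bound [S] into the perturbation returns at most [S / 2], as
    [sup_absorb] requires. *)
Hypothesis T_large : A * (c^-1 + 2) / T <= 1 / 2.

Let A0 : 0 <= A. Proof. by rewrite mulr_ge0 ?ler0n. Qed.

Lemma row_sum_bound (rho y : 'I_n -> C) (w S : R) : 0 <= S -> 0 <= w ->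
  (forall m, absC (rho m) <= w) -> (forall m, absC (y m) <= S) ->
  absC (\sum_(m < n) rho m * y m) <= n%:R * w * S.
Proof.
move=> S0 w0 hr hy; apply: (le_trans (absC_sum _ _ _)).
apply: (@le_trans _ _ (\sum_(m < n) w * S)).
  by apply: ler_sum => m _; rewrite absCM ler_pM ?absC_ge0.
by rewrite sumr_const card_ord -[leLHS]mulr_natl mulrA.
Qed.

Section OneSystem.
Variables (s : seq R) (al : 'I_n -> R -> C) (rho : 'I_n -> 'I_n -> R -> C).
Variables (y : 'I_n -> R -> C) (d : C).
Hypothesis hs : column_system s al rho y d.

Lemma perturbation_bound S u i : 0 <= S -> u \notin s -> (forall m, absC (y m u) <= S) ->
  absC (\sum_(m < n) rho i m u * y m u) <= A * S * weight T u.
Proof.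
move=> S0 us hy; rewrite (_ : A * S * _ = n%:R * (K * weight T u) * S); last by rewrite /A; ring.
apply: row_sum_bound => //; first by rewrite mulr_ge0 ?weight_ge0.
by move=> m; apply: (cs_small hs).
Qed.

(** The conditions at infinity are replaced by approximate conditions at both ends of a finite
    window around [u]; the error [eta] is removed at the end of each argument. *)
Lemma column_window (eta u : R) : 0 < eta -> exists V : R, [/\ 0 < V, - V <= u <= V,
  absC (y k (- V) - d) <= eta,
  (forall i : 'I_n, (k < i)%N -> absC (y i (- V)) <= eta) &
  (forall i : 'I_n, (i < k)%N -> absC (y i V) <= eta)].
Proof.
move=> eta0; have [V1 h1] := cs_left hs eta0; have [V2 h2] := cs_right hs eta0.
pose V := Num.max (`|u| + 1) (Num.max V1 V2).
have V0 : `|u| + 1 <= V by rewrite le_max lexx.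
have [|h3 h4] := h1 (- V); first by rewrite lerN2 /V !le_max lexx !orbT.
exists V; split => //; last by apply: h2; rewrite /V !le_max lexx !orbT.
  by have := normr_ge0 u; lra.
by rewrite -ler_norml; lra.
Qed.

Lemma column_bound i u : absC (y i u) <= 2 * absC d.
Proof.
apply/ler_addgt0Pr => e e0; have eta0 : 0 < e / 2 by rewrite divr_gt0.
have [V [V0 uV hk hl hr]] := column_window u eta0.
have VV : - V <= V by lra.
have B0 : 0 <= absC d + e / 2 by rewrite addr_ge0 ?absC_ge0 // ltW.
have := @sup_absorb R n y (- V) V (absC d + e / 2) VV B0 (fun i u _ => cs_cont hs i u).
move=> H; have -> : 2 * absC d + e = 2 * (absC d + e / 2) by lra.
apply: H => // S S0 hS j v hv.
have := @components_bound R n T T1 k c c0 s y al (fun i u => \sum_(m < n) rho i m u * y m u)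
  (- V) V (e / 2) (A * S) 0 d VV (ltW eta0) (mulr_ge0 A0 S0) (lexx _)
  (fun i u _ => cs_cont hs i u) (fun i u _ us => cs_der hs i us)
  (fun i u _ us => @cs_stable _ _ _ _ _ hs i u us) (fun i u _ us => @cs_unstable _ _ _ _ _ hs i u us)
  (fun u _ _ => cs_neutral hs u).
move=> /(_ _ hl hr hk j v hv) => H.
have {}H : absC (y j v - (j == k)%:R * d) <= e / 2 + A * S * (c^-1 + 2) / T + 0 * (c^-1 + (V - - V)).
  apply: H => i' w /andP[w1 w2] ws; rewrite addr0; apply: perturbation_bound => // m.
  by apply: hS; rewrite !ltW.
have : A * S * (c^-1 + 2) / T <= S / 2.
  rewrite (_ : A * S * _ / _ = (A * (c^-1 + 2) / T) * S); last by ring.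
  by rewrite (le_trans (ler_wpM2r S0 T_large)) //; lra.
have : absC ((j == k)%:R * d) <= absC d.
  by case: eqP => _; rewrite ?mul1r // mul0r absC0 absC_ge0.
have := absC_subD (y j v) ((j == k)%:R * d); lra.
Qed.

(** With the bound of [column_bound] known, the perturbation moves the column away from [d] times a
    basis vector by [O(1 / T)] only. This yields invertibility of the limit. *)
Lemma column_near i u :
  absC (y i u - (i == k)%:R * d) <= 2 * (A * (c^-1 + 2) / T) * absC d.
Proof.
apply/ler_addgt0Pr => e e0.
have [V [V0 uV hk hl hr]] := column_window u e0.
have VV : - V <= V by lra.
have S0 : 0 <= 2 * absC d by rewrite mulr_ge0 ?absC_ge0.
have := @components_bound R n T T1 k c c0 s y al (fun i u => \sum_(m < n) rho i m u * y m u)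
  (- V) V e (A * (2 * absC d)) 0 d VV (ltW e0) (mulr_ge0 A0 S0) (lexx _)
  (fun i u _ => cs_cont hs i u) (fun i u _ us => cs_der hs i us)
  (fun i u _ us => @cs_stable _ _ _ _ _ hs i u us) (fun i u _ us => @cs_unstable _ _ _ _ _ hs i u us)
  (fun u _ _ => cs_neutral hs u).
move=> /(_ _ hl hr hk i u uV) => H.
apply: le_trans (H _) _; last by lra.
move=> i' w _ ws; rewrite addr0; apply: perturbation_bound => // m.
exact: column_bound.
Qed.

(** What the perturbation can still do beyond [|u| = U]. It tends to 0 as [U] grows, uniformly for
    [d] in a bounded set, and so supplies boundary values when two columns are compared on
    [[-U, U]]. *)
Definition tail (U : R) : R := 2 * A * (c^-1 + 1) * absC d / (T + U).

Lemma column_tail (U : R) : 0 <= U ->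
  [/\ forall (i : 'I_n) u, (k < i)%N -> u <= - U -> absC (y i u) <= tail U,
      forall u, u <= - U -> absC (y k u - d) <= tail U &
      forall (i : 'I_n) u, (i < k)%N -> U <= u -> absC (y i u) <= tail U].
Proof.
move=> U0; have TT := T1; have d0 := absC_ge0 d.
have ci : 0 < c^-1 by rewrite invr_gt0.
have S0 : 0 <= A * (2 * absC d) by rewrite !mulr_ge0.
have TU : (T + U)^-1 ^+ 2 <= (T + U)^-1.
  by rewrite expr2 ler_piMl ?invr_ge0 ?invf_le1; lra.
have TU0 : 0 <= (T + U)^-1 by rewrite invr_ge0; lra.
have pert i u : U <= `|u| -> u \notin s ->
    absC (\sum_(m < n) rho i m u * y m u) <= A * (2 * absC d) * (T + U)^-1.
  move=> hu us.
  apply: (@le_trans _ _ (A * (2 * absC d) * weight T u)).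
    by apply: perturbation_bound; rewrite ?mulr_ge0 // => m; exact: column_bound.
  rewrite ler_wpM2l // (le_trans (weight_le T1 (_ : 0 <= U <= `|u|))) ?U0 //.
  by rewrite -exprVn.
have E : tail U = A * (2 * absC d) * (T + U)^-1 * c^-1 + A * (2 * absC d) * (T + U)^-1.
  by rewrite /tail; ring.
have W0 : 0 <= A * (2 * absC d) * (T + U)^-1 by rewrite mulr_ge0.
have W1 : 0 <= A * (2 * absC d) * (T + U)^-1 * c^-1 by rewrite mulr_ge0 // ltW.
have side (i : 'I_n) u : i != k -> ((k < i)%N -> u <= - U) -> ((i < k)%N -> U <= u) ->
   absC (y i u) <= tail U.
  move=> ik h1 h2; apply/ler_addgt0Pr => e e0.
  have [V [V0 uV hk hl hr]] := column_window u e0.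
  have /andP[uV1 uV2] := uV.
  (* The segment joins [u] to the end from which the component is controlled, and stays outside
     []-U, U[]. *)
  pose a := if (k < i)%N then - V else u; pose b := if (k < i)%N then u else V.
  have ab : a <= b by rewrite /a /b; case: ifP.
  have hab v : a < v < b -> U <= `|v|.
    rewrite /a /b; case: ltnP => [ki|ik2] /andP[v1 v2].
      have := h1 ki; rewrite ler_normr => ?; apply/orP; right; lra.
    have ik3 : (i < k)%N by rewrite ltn_neqAle ik2 andbT.
    have := h2 ik3; rewrite ler_normr => ?; apply/orP; left; lra.
  apply: (@offdiag_component R n k c c0 s y al (fun i u => \sum_(m < n) rho i m u * y m u) a b
    (fun i u _ => cs_cont hs i u) (fun i u _ us => cs_der hs i us)
    (fun i u _ us => @cs_stable _ _ _ _ _ hs i u us) (fun i u _ us => @cs_unstable _ _ _ _ _ hs i u us)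
    i _ ik).
  - move=> v hv vs; rewrite (le_trans (pert i v (hab v hv) vs)) // E !mulrDr.
    have -> : c * (A * (2 * absC d) * (T + U)^-1 * c^-1) = A * (2 * absC d) * (T + U)^-1.
      by field; rewrite !gt_eqF //; lra.
    by have := mulr_ge0 (ltW c0) W0; have := mulr_gt0 c0 e0; lra.
  - by move=> ki; rewrite /a ki; have := hl i ki; lra.
  - by move=> lik; rewrite /b ltnNge (ltnW lik) /=; have := hr i lik; lra.
  - by rewrite /a /b; case: ifP => _; rewrite lexx ?uV1 ?uV2.
split.
- move=> i u ki hu; apply: side => //; first by rewrite gt_eqF.
  by rewrite ltnNge (ltnW ki).
- move=> u hu; apply/ler_addgt0Pr => e e0.
  have [V [V0 /andP[uV1 uV2] hk hl hr]] := column_window u e0.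
  have hbe v : - V < v < u -> v \notin s ->
      absC (\sum_(m < n) rho k m v * y m v) <= A * (2 * absC d) * weight T v + 0.
    move=> _ vs; rewrite addr0; apply: perturbation_bound => //; first by rewrite mulr_ge0.
    by move=> m; exact: column_bound.
  have := @diag_component R n T T1 k s y al (fun i u => \sum_(m < n) rho i m u * y m u) (- V) u
    (A * (2 * absC d)) 0 (fun i u _ => cs_cont hs i u) (fun i u _ us => cs_der hs i us)
    (fun u _ _ => cs_neutral hs u) hbe u.
  rewrite uV1 lexx => /(_ isT) h.
  have -> : y k u - d = (y k u - y k (- V)) + (y k (- V) - d) by ring.
  apply: absCD_le => //; apply: (le_trans h).
  have u0 : u <= 0 by lra.
  have := primitive_tail T1 u0; have := primitive_bound T1 (- V).
  rewrite ler_norml => /andP[p1 _] p2.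
  have : (T + `|u|)^-1 <= (T + U)^-1.
    by rewrite lef_pV2 ?posrE; rewrite ?ler0_norm //; lra.
  move=> p3; have : A * (2 * absC d) * (primitive T u - primitive T (- V)) <= A * (2 * absC d) * (T + U)^-1.
    by rewrite ler_wpM2l //; lra.
  by rewrite E; lra.
- move=> i u ik hu; apply: side => //; first by rewrite lt_eqF.
  by rewrite ltnNge (ltnW ik).
Qed.

End OneSystem.

(** Continuous dependence: the difference solves the first system with a forcing that is small on
    [[-U, U]]; outside, the coefficients need not be close, and the tails provide its boundary
    values. *)
Lemma column_diff s al al' rho rho' y y' d d' (U eta : R) :
  column_system s al rho y d -> column_system s al' rho' y' d' -> 0 <= U -> 0 <= eta ->
  (forall i u, - U <= u <= U -> u \notin s -> absC (al i u - al' i u) <= eta) ->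
  (forall i m u, - U <= u <= U -> u \notin s -> absC (rho i m u - rho' i m u) <= eta) ->
  forall i u, - U <= u <= U -> absC (y i u - y' i u) <=
    2 * (tail d U + tail d' U + absC (d - d') +
         eta * ((1 + n%:R) * (2 * absC d')) * (c^-1 + 2 * U)).
Proof.
move=> hs hs' U0 eta0 hal hrho.
have ci : 0 < c^-1 by rewrite invr_gt0.
have TT := T1.
have d'0 : 0 <= 2 * absC d' by rewrite mulr_ge0 ?absC_ge0.
have tail0 (w : C) : 0 <= tail w U.
  rewrite /tail divr_ge0 ?mulr_ge0 ?absC_ge0 //; lra.
set E := tail d U + tail d' U + absC (d - d').
have E0 : 0 <= E by rewrite !addr_ge0 ?absC_ge0.
set eta' := eta * ((1 + n%:R) * (2 * absC d')).
have eta'0 : 0 <= eta' by rewrite mulr_ge0 // mulr_ge0 // addr_ge0.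
have UU : - U <= U by lra.
pose w i u := y i u - y' i u.
have hw i u : rcont (w i) u by apply: gcontB; [exact: cs_cont hs i u|exact: cs_cont hs' i u].
apply: (@sup_absorb R n w (- U) U) => //; first by rewrite addr_ge0 // mulr_ge0 //; lra.
move=> S S0 hS i u hu.
(* The forcing collects the differences of coefficients applied to the second solution, which
   [column_bound] keeps below [2 * absC d']. *)
pose g i u := (al i u - al' i u) * y' i u + \sum_(m < n) (rho i m u - rho' i m u) * y' m u.
pose be i u := \sum_(m < n) rho i m u * w m u + g i u.
have [t1 t2 t3] := column_tail hs U0; have [t1' t2' t3'] := column_tail hs' U0.
have hg j v : - U <= v <= U -> v \notin s -> absC (g j v) <= eta'.
  move=> hv vs; rewrite /eta' (_ : eta * _ = eta * (2 * absC d') + n%:R * eta * (2 * absC d')); last by ring.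
  apply: absCD_le.
    by rewrite absCM ler_pM ?absC_ge0 // ?hal // (column_bound hs').
  by apply: row_sum_bound => // m; [exact: hrho|exact: (column_bound hs')].
have := @components_bound R n T T1 k c c0 s w al be (- U) U E (A * S) eta' 0 UU E0 (mulr_ge0 A0 S0) eta'0
  (fun i u _ => hw i u) _ (fun i u _ us => @cs_stable _ _ _ _ _ hs i u us)
  (fun i u _ us => @cs_unstable _ _ _ _ _ hs i u us) (fun u _ _ => cs_neutral hs u).
move=> H; rewrite -[w i u]subr0 -[X in _ - X](mulr0 (i == k)%:R).
apply: le_trans (H _ _ _ _ _ i u hu) _.
- move=> j v _ vs; apply: (gderiv_eq _ (gderivB (cs_der hs j vs) (cs_der hs' j vs))).
  rewrite /be /g /w.
  have -> : \sum_(m < n) rho j m v * (y m v - y' m v) =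
     \sum_(m < n) rho j m v * y m v - \sum_(m < n) rho j m v * y' m v.
    by rewrite -sumrB; apply: eq_bigr => m _; rewrite mulrBr.
  have -> : \sum_(m < n) (rho j m v - rho' j m v) * y' m v =
     \sum_(m < n) rho j m v * y' m v - \sum_(m < n) rho' j m v * y' m v.
    by rewrite -sumrB; apply: eq_bigr => m _; rewrite mulrBl.
  ring.
- move=> j v /andP[v1 v2] vs; have hv : - U <= v <= U by rewrite !ltW.
  apply: absCD_le; last exact: hg.
  rewrite (_ : A * S * _ = n%:R * (K * weight T v) * S); last by rewrite /A; ring.
  apply: row_sum_bound => //; first by rewrite mulr_ge0 ?weight_ge0.
    by move=> m; apply: (cs_small hs).
  by move=> m; apply: hS.
- move=> j kj; rewrite (le_trans (absCBD _ _)) // /E.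
  by have := t1 j _ kj (lexx _); have := t1' j _ kj (lexx _); have := absC_ge0 (d - d'); lra.
- move=> j jk; rewrite (le_trans (absCBD _ _)) // /E.
  by have := t3 j _ jk (lexx _); have := t3' j _ jk (lexx _); have := absC_ge0 (d - d'); lra.
- rewrite subr0 /w /E.
  have -> : y k (- U) - y' k (- U) = (y k (- U) - d) - (y' k (- U) - d') + (d - d') by ring.
  apply: absCD_le => //; rewrite (le_trans (absCBD _ _)) // lerD ?t2 ?t2' //.
have : A * S * (c^-1 + 2) / T <= S / 2.
  rewrite (_ : A * S * _ / _ = (A * (c^-1 + 2) / T) * S); last by ring.
  by rewrite (le_trans (ler_wpM2r S0 T_large)) //; lra.
rewrite opprK; lra.
Qed.

End GlobalColumns.

(** * Geometry of the sheets *)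

Section Hyperbolic.
Variable R : realType.
Local Notation C := (CC R).
Local Notation cder := (gderiv (@id C)).
Implicit Types (x y z w t : C).

Lemma ccosh_sub_csinh x : ccosh x - csinh x = cexp (- x).
Proof. by rewrite /ccosh /csinh; field. Qed.
Lemma ccosh_add_csinh x : ccosh x + csinh x = cexp x.
Proof. by rewrite /ccosh /csinh; field. Qed.
Lemma ccosh2_csinh2 x : ccosh x ^+ 2 - csinh x ^+ 2 = 1.
Proof. by rewrite subr_sqr ccosh_sub_csinh ccosh_add_csinh cexpN_mul. Qed.
Lemma csinhN x : csinh (- x) = - csinh x.
Proof. by rewrite /csinh opprK; field. Qed.

Lemma half_pair (a b : C) (e : R) : absC a <= e -> absC b <= e -> absC ((a + b) / 2) <= e.
Proof.
move=> ha hb; rewrite absCf absC_nat ler_pdivrMr // mulr_natr mulr2n.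
exact: absCD_le.
Qed.

Lemma csinh_quad x : absC x <= 1 / 2 -> absC (csinh x - x) <= 10 * absC x ^+ 2.
Proof.
move=> hx; have hx' : absC (- x) <= 1 / 2 by rewrite absCN.
have := cexp_quad hx; have := cexp_quad hx'; rewrite absCN => h1 h2.
have -> : csinh x - x = ((cexp x - 1 - x) + - (cexp (- x) - 1 - - x)) / 2.
  by rewrite /csinh; field.
by apply: half_pair; rewrite ?absCN.
Qed.

Lemma ccosh_quad x : absC x <= 1 / 2 -> absC (ccosh x - 1) <= 10 * absC x ^+ 2.
Proof.
move=> hx; have hx' : absC (- x) <= 1 / 2 by rewrite absCN.
have := cexp_quad hx; have := cexp_quad hx'; rewrite absCN => h1 h2.
have -> : ccosh x - 1 = ((cexp x - 1 - x) + (cexp (- x) - 1 - - x)) / 2.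
  by rewrite /ccosh; field.
exact: half_pair.
Qed.

Lemma csinh_lower x : absC x <= 1 / 20 -> absC x / 2 <= absC (csinh x).
Proof.
move=> hx; have h2 : absC x <= 1 / 2 by lra.
have := csinh_quad h2; have := absC_subD x (x - csinh x).
rewrite subKr (absCB x); have := absC_ge0 x; nra.
Qed.

Lemma csinh_lower_re x : `|reC x| / 2 <= absC (csinh x).
Proof.
wlog h : x / 0 <= reC x.
  move=> H; have [/H //|/ltW h] := leP 0 (reC x).
  by rewrite -normrN -reCN -absCN -csinhN; apply: H; rewrite reCN oppr_ge0.
rewrite ger0_norm // /csinh absCf absC_nat ler_pM2r ?invr_gt0 //.
apply: (le_trans _ (absC_subD _ _)); rewrite !absC_cexp reCN.
have h1 : expR (- reC x) <= 1 by rewrite -expR0 ler_expR oppr_le0.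
have := expR_ge1Dx (reC x); lra.
Qed.

Lemma ccosh_upper x : absC (ccosh x) <= 1 + absC (csinh x).
Proof.
have h0 := absC_ge0 (csinh x).
rewrite -(ler_pXn2r (n := 2)) ?nnegrE ?absC_ge0 //; last by lra.
rewrite -absCX.
have -> : ccosh x ^+ 2 = 1 + csinh x ^+ 2 by rewrite -(ccosh2_csinh2 x) subrK.
rewrite (le_trans (absCD _ _)) // absC1 absCX; nra.
Qed.

Lemma cder_cexp_lin (a x : C) : cder (fun t => cexp (a * t)) x (a * cexp (a * x)).
Proof.
apply: (gderiv_eq (v := cexp (a * x) * (a * 1))); first by ring.
apply: (gderiv_comp (f := @cexp R)); first exact: gderiv_cexp.
by apply: gderivZ; exact: gderiv_io.
Qed.

Lemma cder_ccosh (a x : C) : cder (fun t => ccosh (a * t)) x (a * csinh (a * x)).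
Proof.
apply: (gderiv_eq (v := 2^-1 * (a * cexp (a * x) + - a * cexp (- a * x)))).
  by rewrite /csinh -mulNr; field.
apply: (gderiv_ext (f := fun t => 2^-1 * (cexp (a * t) + cexp (- a * t)))).
  by exists 1 => // t _; rewrite /ccosh mulNr mulrC.
by apply: gderivZ; apply: gderivD; exact: cder_cexp_lin.
Qed.

Lemma cder_csinh (a x : C) : cder (fun t => csinh (a * t)) x (a * ccosh (a * x)).
Proof.
apply: (gderiv_eq (v := 2^-1 * (a * cexp (a * x) - - a * cexp (- a * x)))).
  by rewrite /ccosh [- a * x]mulNr; field.
apply: (gderiv_ext (f := fun t => 2^-1 * (cexp (a * t) - cexp (- a * t)))).
  by exists 1 => // t _; rewrite /csinh mulNr mulrC.
by apply: gderivZ; apply: gderivB; exact: cder_cexp_lin.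
Qed.

Lemma sqrt_eps_sqr z : sqrt_eps z ^+ 2 = eps z.
Proof. by rewrite /sqrt_eps /eps expr2 -cexpD; congr cexp; field. Qed.
Lemma sqrt_eps_neq0 z : sqrt_eps z != 0. Proof. exact: cexp_neq0. Qed.

Lemma xt_sub z t l : csinh (sqrt_eps z * t) != 0 ->
  xt z t - xhat l z = match l with
    | SdL => - (sqrt_eps z * cexp (sqrt_eps z * t) / csinh (sqrt_eps z * t))
    | SdR => - (sqrt_eps z * cexp (- (sqrt_eps z * t)) / csinh (sqrt_eps z * t)) end.
Proof.
move=> h; rewrite /xt; case: l => /=.
  by rewrite -ccosh_add_csinh; field.
by rewrite -ccosh_sub_csinh; field.
Qed.

Lemma xt_sqr z t : csinh (sqrt_eps z * t) != 0 ->
  xt z t ^+ 2 - eps z = eps z / csinh (sqrt_eps z * t) ^+ 2.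
Proof.
move=> h; rewrite /xt -sqrt_eps_sqr; have := ccosh2_csinh2 (sqrt_eps z * t).
set c := ccosh _; set s := csinh _ in h *; set e := sqrt_eps z => E.
have -> : e ^+ 2 / s ^+ 2 = e ^+ 2 * (c ^+ 2 - s ^+ 2) / s ^+ 2 by rewrite E mulr1.
by field.
Qed.

Lemma xt_neq z t : csinh (sqrt_eps z * t) != 0 -> xt z t ^+ 2 - eps z != 0.
Proof. by move=> h; rewrite xt_sqr // mulf_neq0 ?cexp_neq0 // invr_neq0 // expf_neq0. Qed.

Lemma cder_xt z t : csinh (sqrt_eps z * t) != 0 -> cder (xt z) t (xt z t ^+ 2 - eps z).
Proof.
move=> h; rewrite xt_sqr //.
have H := gderivM (gderivZ (- sqrt_eps z) (cder_ccosh (sqrt_eps z) t))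
  (gderiv_comp (f := fun w : C => w^-1) (g := fun t => csinh (sqrt_eps z * t))
    (gderiv_inv h) (cder_csinh (sqrt_eps z) t)).
apply: (gderiv_eq _ H); rewrite -sqrt_eps_sqr; have := ccosh2_csinh2 (sqrt_eps z * t).
set c := ccosh _; set s := csinh _ in h *; set e := sqrt_eps z => E.
have -> : e ^+ 2 / s ^+ 2 = e ^+ 2 * (c ^+ 2 - s ^+ 2) / s ^+ 2 by rewrite E mulr1.
by field.
Qed.

End Hyperbolic.

(** * The path in the time plane and its estimates *)

Section Path.
Variable R : realType.
Local Notation C := (CC R).
Local Notation rder := (gderiv (@ofR R)).
Local Notation rcont := (gcont (@ofR R)).
Variables (g : geometry R) (z : C) (T m : R).

(** A lower bound of [- cos (arg sqrt(eps) + theta_hat)] over the whole parameter sector; the angle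
    [2 * gam ^+ 2 / pi] is [angle_of gam - gam]. *)
Definition beta_of (gam : R) : R := sin (2 * gam ^+ 2 / pi).
Definition angle_of (gam : R) : R := gam * (1 + 2 * gam / pi).

Lemma pi_neq0 : (pi : R) != 0.
Proof. by rewrite gt_eqF // pi_gt0. Qed.

Lemma angleE (gam : R) : 2 * gam ^+ 2 / pi = angle_of gam - gam.
Proof. by rewrite /angle_of; move: (pi : R) pi_neq0 => p p0; field. Qed.

Lemma angle_facts (gam : R) : 0 < gam -> angle_of gam < pi / 2 ->
  [/\ gam < pi / 2, 0 < angle_of gam, 0 < beta_of gam, beta_of gam <= 1 & 0 < tan (angle_of gam)].
Proof.
move=> g0 ha; have p0 := pi_gt0 R.
have gp : 0 < 2 * gam / pi by rewrite divr_gt0 // mulr_gt0.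
have a0 : 0 < angle_of gam by rewrite mulr_gt0 //; lra.
have g2 : gam < pi / 2 by move: ha; rewrite /angle_of; nra.
have E := angleE gam.
split => //; last 1 first.
- have h1 : 0 < angle_of gam < pi / 2 by rewrite a0.
  have h2 : - (pi / 2) < angle_of gam < pi / 2 by apply/andP; split; lra.
  by rewrite /tan divr_gt0 ?sin_gt0_pihalf ?cos_gt0_pihalf.
- rewrite /beta_of E sin_gt0_pihalf //; apply/andP; split; last by lra.
  by rewrite -E divr_gt0 // mulr_gt0 // exprn_gt0.
- exact: sin_le1.
Qed.

Hypotheses (gam0 : 0 < gamma g) (angle_lt : angle_of (gamma g) < pi / 2).
Hypothesis zS : sectorS g z.

Let s := expR (reC z / 2).
Let phi := imC z / 2.
Let th := theta_hat g z.
Let bt := beta_of (gamma g).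

Lemma sqrt_eps_polar : sqrt_eps z = ofR s * cexp (iC R * ofR phi).
Proof.
rewrite /sqrt_eps; have -> : z / 2 = ofR (reC z / 2) + iC R * ofR phi.
  rewrite {1}[z]complexE2 /phi !(ofRM, ofRV, ofR_nat) mulrDl; ring.
rewrite cexpD; congr (_ * _); apply: ceqP; rewrite ?reC_cexp ?imC_cexp !(reC_ofR, imC_ofR).
  by rewrite cos0 mulr1.
by rewrite sin0 mulr0.
Qed.

Lemma absC_sqrt_eps : absC (sqrt_eps z) = s.
Proof. by rewrite absC_cexp; congr expR; rewrite -ofR_nat -ofRV mulrC reC_ofRM mulrC. Qed.

Lemma s_gt0 : 0 < s. Proof. exact: expR_gt0. Qed.

Lemma absC_eps : absC (eps z) = s ^+ 2.
Proof. by rewrite -sqrt_eps_sqr absCX absC_sqrt_eps. Qed.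

Lemma sqrt_absC_eps : Num.sqrt (absC (eps z)) = s.
Proof. by rewrite absC_eps sqrtr_sqr gtr0_norm // s_gt0. Qed.

(** In [S] the argument of [sqrt_eps z] differs from [pi] by less than [pi / 2 + gamma]; times
    [2 * gamma / pi] this is [angle_of]. *)
Lemma theta_bound : `|th| <= angle_of (gamma g).
Proof.
have p0 := pi_gt0 R; have [_ /andP[h1 h2]] := zS.
have gp : 0 < 2 * gamma g / pi by rewrite divr_gt0 // mulr_gt0.
have -> : angle_of (gamma g) = 2 * gamma g / pi * (pi / 2 + gamma g).
  by rewrite /angle_of; move: (pi : R) pi_neq0 => p pn0; field.
rewrite /th /theta_hat normrM (gtr0_norm gp) ler_pM2l // ler_norml; apply/andP; split; lra.
Qed.

Lemma cos_th_gt0 : 0 < cos th.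
Proof.
apply: cos_gt0_pihalf; have := angle_lt; have := theta_bound; rewrite ler_norml => /andP[h1 h2] h3.
by apply/andP; split; lra.
Qed.

(** The angle [phi + th - pi] equals [(1 - 2 * gamma / pi) * (phi - pi)], so its modulus is at most
    [pi / 2 - 2 * gamma ^+ 2 / pi]. Tilting the sheets by [theta_hat] is what keeps it away from
    [pi / 2], although [phi - pi] may exceed [pi / 2]. *)
Lemma cos_phi_th : cos (phi + th) <= - bt.
Proof.
have p0 := pi_gt0 R; have [_ /andP[h1 h2]] := zS.
have [g2 _ _ _ _] := angle_facts gam0 angle_lt.
set x := phi + th - pi.
have -> : cos (phi + th) = - cos x.
  by rewrite -[phi + th](subrK pi) cosDpi.
have q0 : 0 < 1 - 2 * gamma g / pi.
  rewrite subr_gt0 ltr_pdivrMr //; lra.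
have xE : x = (1 - 2 * gamma g / pi) * (phi - pi).
  by rewrite /x /th /theta_hat /phi; move: (pi : R) pi_neq0 => p pn0; field.
have xb : `|x| <= pi / 2 - 2 * gamma g ^+ 2 / pi.
  rewrite (_ : pi / 2 - _ = (1 - 2 * gamma g / pi) * (pi / 2 + gamma g)); last by move: (pi : R) pi_neq0 => p pn0; field.
  rewrite xE normrM (gtr0_norm q0) ler_pM2l // ler_norml /phi; apply/andP; split; lra.
rewrite lerN2 /bt /beta_of -cos_norm.
have -> : sin (2 * gamma g ^+ 2 / pi) = cos (pi / 2 - 2 * gamma g ^+ 2 / pi).
  by rewrite cosB cos_pihalf sin_pihalf mul0r mul1r add0r.
have g20 : 0 < 2 * gamma g ^+ 2 / pi by rewrite divr_gt0 // mulr_gt0 // exprn_gt0.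
move: xb; rewrite le_eqVlt => /predU1P[->//|xb].
have x0 := normr_ge0 x.
have i1 : `|x| \in `[0, pi] by rewrite in_itv /=; apply/andP; split; lra.
have i2 : pi / 2 - 2 * gamma g ^+ 2 / pi \in `[0, pi].
  by rewrite in_itv /=; apply/andP; split; lra.
by apply: ltW; rewrite ltr_cos.
Qed.

Let a := c0 g / s.

(** A tent of height [T] supported on [[-T, T]], written with absolute values so that its derivative
    is a combination of signs. *)
Definition bump_fun (u : R) : R := (`|u - T| + `|u + T|) / 2 - `|u|.

Lemma sigmaE (u : R) : 0 < c0 g ->
  sigma g z u = tan th * (u + (`|u - a| - `|u + a|) / 2).
Proof.
move=> c0p; have a0 : 0 < a by rewrite divr_gt0 // s_gt0.
rewrite /sigma sqrt_absC_eps -/a -/th; case: ifPn => [|].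
  rewrite ler_norml => /andP[h1 h2].
  have -> : `|u - a| = a - u by rewrite ler0_norm; lra.
  have -> : `|u + a| = u + a by rewrite ger0_norm; lra.
  by rewrite (_ : u + _ = 0) ?mulr0 //; lra.
rewrite -ltNge lter_normr => /orP[h|h].
  rewrite gtr0_sg; last by lra.
  have -> : `|u - a| = u - a by rewrite ger0_norm; lra.
  have -> : `|u + a| = u + a by rewrite ger0_norm; lra.
  by rewrite mulrC; congr (_ * _); lra.
rewrite ltr0_sg; last by lra.
have -> : `|u - a| = a - u by rewrite ler0_norm; lra.
have -> : `|u + a| = - (u + a) by rewrite ler0_norm; lra.
by rewrite mulrC; congr (_ * _); lra.
Qed.

(* The path follows the common edge sigma of the two sheets; for |u| < T it is
   pushed around the excluded set N, below it on the sheet D (sg = -1) and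
   above it on the sheet U (sg = 1). *)
Definition height (sg u : R) : R := sg * (m * bump_fun u) + sigma g z u.
Definition tpath (sg u : R) : C := ofR u + iC R * ofR (height sg u).

Lemma reC_tpath sg u : reC (tpath sg u) = u.
Proof. by rewrite reCD reC_iM reC_ofR imC_ofR oppr0 addr0. Qed.
Lemma imC_tpath sg u : imC (tpath sg u) = height sg u.
Proof. by rewrite imCD imC_iM reC_ofR imC_ofR add0r. Qed.

(** The constant in [|sinh tau| >= bF * |tau|] along the path. *)
Definition bF : R := bt / 8.

Hypotheses (T1 : 1 <= T) (m0 : 0 < m) (m1 : m <= 1) (mtan : m <= tan (angle_of (gamma g))).
Hypotheses (c0p : 0 < c0 g) (c0small : c0 g * (1 + 2 / bt) <= 1 / 40).
Hypotheses (sT : s * T <= c0 g) (hgt0 : 0 < hgt g).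

Let bt0 : 0 < bt. Proof. by have [] := angle_facts gam0 angle_lt. Qed.
Let bt1 : bt <= 1. Proof. by have [] := angle_facts gam0 angle_lt. Qed.
Let bF0 : 0 < bF. Proof. by rewrite divr_gt0. Qed.
Let s0 := s_gt0.

Lemma a_gt0 : 0 < a. Proof. by rewrite divr_gt0. Qed.
Lemma sa : s * a = c0 g. Proof. by rewrite /a mulrC divfK // gt_eqF. Qed.
Lemma Ta : T <= a. Proof. by rewrite ler_pdivlMr // mulrC. Qed.
Lemma c0b : 40 * (c0 g * (2 / bt)) + 40 * c0 g <= 1.
Proof. by move: c0small; lra. Qed.
Lemma c0bt : 80 * c0 g <= bt.
Proof.
have h := c0b; have c0p' := c0p; have : 40 * (c0 g * (2 / bt)) <= 1 by lra.
rewrite (_ : 40 * _ = 80 * c0 g / bt) ?ler_pdivrMr ?mul1r //; by ring.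
Qed.

Lemma bump_in u : `|u| <= T -> bump_fun u = T - `|u|.
Proof.
rewrite ler_norml /bump_fun => /andP[h1 h2].
by rewrite (@ler0_norm _ (u - T)) ?(@ger0_norm _ (u + T)); lra.
Qed.
Lemma bump_out u : T <= `|u| -> bump_fun u = 0.
Proof.
have TT := T1; rewrite ler_normr /bump_fun => /orP[h|h].
  by rewrite !ger0_norm; lra.
by rewrite !ler0_norm; lra.
Qed.
Lemma bump_bound u : 0 <= bump_fun u <= T.
Proof.
have [h|/ltW h] := leP `|u| T; last by rewrite bump_out // lexx; have := T1; lra.
by rewrite bump_in //; have := normr_ge0 u; lra.
Qed.

Variable sg : R.
Hypothesis sg1 : `|sg| = 1.

Lemma sg_bump u : `|sg * (m * bump_fun u)| <= m * T.
Proof.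
have /andP[b0 bT] := bump_bound u.
by rewrite normrM sg1 mul1r ger0_norm ?mulr_ge0 ?ler_pM2l // ltW.
Qed.

Lemma sigma_in u : `|u| <= a -> sigma g z u = 0.
Proof. by rewrite /sigma sqrt_absC_eps -/a => ->. Qed.

Lemma tpath_out u : a < `|u| ->
  tpath sg u = ofR (Num.sg u) * (ofR a + ofR (`|u| - a) * (1 + iC R * ofR (tan th))).
Proof.
move=> h; have Tu : T <= `|u| by rewrite (le_trans Ta) // ltW.
rewrite /tpath /height bump_out // mulr0 mulr0 add0r /sigma sqrt_absC_eps -/a -/th leNgt h /=.
have E : ofR u = ofR (Num.sg u) * ofR `|u| by rewrite -ofRM -numEsg.
by rewrite !(ofRM, ofRB) E; ring.
Qed.

(** [v] is the length run along the tilted half-line after multiplication by [sqrt_eps z]. The real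
    part then moves at rate at least [bt] while the modulus grows at rate at most 1. *)
Lemma out_estimate u : a < `|u| -> exists v : R, [/\ 0 <= v,
  Num.sg u * reC (sqrt_eps z * tpath sg u) <= c0 g - bt * v &
  absC (sqrt_eps z * tpath sg u) <= c0 g + v].
Proof.
move=> h; have ct := cos_th_gt0; pose v := s * (`|u| - a) / cos th.
have v0 : 0 <= v by rewrite divr_ge0 ?mulr_ge0 //; [rewrite ltW|lra|rewrite ltW].
have u0 : u != 0 by rewrite -normr_gt0 (lt_trans a_gt0).
exists v; split => //.
  have EQ : reC (ofR s * cexp (iC R * ofR phi) * (ofR a + ofR (`|u| - a) * (1 + iC R * ofR (tan th))))
     = s * a * cos phi + v * cos (phi + th).
    rewrite -mulrA reC_ofRM reCM reC_cexp imC_cexp.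
    rewrite !(reCD, imCD, reC_ofRM, imC_ofRM, reC_iM, imC_iM, reC_ofR, imC_ofR, reC1, imC1).
    by rewrite oppr0 expR0 cosD /v /tan; field; rewrite gt_eqF.
  rewrite tpath_out // mulrCA reC_ofRM mulrA -expr2 sqr_sg u0 mul1r sqrt_eps_polar.
  rewrite EQ sa; have := ler_wpM2l v0 cos_phi_th.
  have : c0 g * cos phi <= c0 g by rewrite ler_piMr ?cos_le1 // ltW.
  lra.
rewrite tpath_out // !absCM absC_sqrt_eps absC_ofR normr_sg u0 mul1r.
have n1 : absC (1 + iC R * ofR (tan th)) = (cos th)^-1.
  rewrite absCE !(reCD, imCD, reC_iM, imC_iM, reC_ofR, imC_ofR, reC1, imC1) oppr0 addr0 add0r expr1n.
  by rewrite -cos2_tan2 ?gt_eqF // -exprVn sqrtr_sqr gtr0_norm // invr_gt0.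
apply: (@le_trans _ _ (s * (a + (`|u| - a) * (cos th)^-1))).
  rewrite ler_pM2l // (le_trans (absCD _ _)) // absC_ofR (gtr0_norm a_gt0) lerD2l.
  by rewrite absCM n1 absC_ofR ger0_norm // subr_ge0 ltW.
by rewrite mulrDr sa /v mulrA.
Qed.

Lemma in_estimate u : `|u| <= a -> absC (sqrt_eps z * tpath sg u) <= 1 / 20.
Proof.
move=> h; rewrite absCM absC_sqrt_eps /tpath /height sigma_in // addr0.
have h1 : absC (ofR u + iC R * ofR (sg * (m * bump_fun u))) <= a + T.
  apply: absCD_le; first by rewrite absC_ofR.
  rewrite absCM absC_i mul1r absC_ofR (le_trans (sg_bump u)) // ler_piMl //.
  by have := T1; lra.
apply: (le_trans (ler_wpM2l (ltW s0) h1)); rewrite mulrDr sa.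
have : 0 <= c0 g * (2 / bt) by rewrite mulr_ge0 ?divr_ge0 // ltW.
have := c0b; have := sT; lra.
Qed.

(** Close to the origin [sinh tau] is comparable with [tau]; once [v > 2 * c0 / bt] the real part of
    [tau] is large enough for [csinh_lower_re]. The size imposed on [c0] makes the two ranges
    overlap. *)
Lemma csinh_path u : bF * absC (sqrt_eps z * tpath sg u) <= absC (csinh (sqrt_eps z * tpath sg u)).
Proof.
set tau := sqrt_eps z * _; have tau0 := absC_ge0 tau.
have b0 := bt0; have b1 := bt1.
have small : absC tau <= 1 / 20 -> bF * absC tau <= absC (csinh tau).
  move=> h; apply: le_trans (csinh_lower h); rewrite mulrC ler_wpM2l // /bF; lra.
have [h|h] := leP `|u| a; first exact/small/in_estimate.
have [v [v0 h1 h2]] := out_estimate h; rewrite -/tau in h1 h2.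
have u0 : u != 0 by rewrite -normr_gt0 (lt_trans a_gt0).
have [hv|hv] := leP v (2 * c0 g / bt).
  apply: small; apply: (le_trans h2).
  have := c0b; rewrite (_ : c0 g * (2 / bt) = 2 * c0 g / bt); last by ring.
  by have := c0p; lra.
apply: le_trans (csinh_lower_re tau).
have hre : bt * v - c0 g <= `|reC tau|.
  rewrite -[`|reC tau|]mul1r -[1](_ : `|Num.sg u| = 1); last by rewrite normr_sg u0.
  rewrite -normrM ler_normr; apply/orP; right; lra.
move: hv; rewrite ltr_pdivrMr // => hv.
have hb : bF * absC tau <= bt / 8 * (c0 g + v) by rewrite ler_wpM2l // ltW.
have : bt * c0 g <= c0 g by rewrite ler_piMl // ltW.
have := c0p; lra.
Qed.

(** For [|u| >= T / 2] the real part suffices; for smaller [|u|] the tent keeps the path at height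
    at least [m * T / 2]. *)
Lemma tpath_lower u : m / 4 * (T + `|u|) <= absC (tpath sg u).
Proof.
have TT := T1; have u0 := normr_ge0 u; have mm0 := m0; have mm1 := m1.
have [h|h] := leP (T / 2) `|u|.
  apply: (@le_trans _ _ `|u|); first by nra.
  by rewrite -{1}(reC_tpath sg u) abs_reC.
have uT : `|u| <= T by lra.
apply: (@le_trans _ _ `|imC (tpath sg u)|); last exact: abs_imC.
rewrite imC_tpath /height sigma_in; last by rewrite (le_trans uT) // Ta.
rewrite addr0 bump_in // normrM sg1 mul1r ger0_norm; last by rewrite mulr_ge0 ?ltW //; lra.
nra.
Qed.

Lemma tpath_gt0 u : 0 < absC (tpath sg u).
Proof.
apply: lt_le_trans (tpath_lower u); rewrite mulr_gt0 ?divr_gt0 //.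
by have := normr_ge0 u; have := T1; lra.
Qed.

Lemma csinh_path_neq0 u : csinh (sqrt_eps z * tpath sg u) != 0.
Proof.
rewrite -absC_gt0; apply: lt_le_trans (csinh_path u).
by rewrite mulr_gt0 // absCM absC_sqrt_eps mulr_gt0 // tpath_gt0.
Qed.

Lemma csinh_ratio u : s / absC (csinh (sqrt_eps z * tpath sg u)) <= 4 / (bF * m) / (T + `|u|).
Proof.
have h1 := csinh_path u; have h2 := tpath_lower u.
rewrite absCM absC_sqrt_eps in h1.
have p1 : 0 < absC (csinh (sqrt_eps z * tpath sg u)) by rewrite absC_gt0 csinh_path_neq0.
have p2 : 0 < T + `|u| by have := normr_ge0 u; have := T1; lra.
have p3 : 0 < bF * m * (T + `|u|) by rewrite !mulr_gt0.
rewrite ler_pdivrMr // (_ : 4 / (bF * m) / (T + `|u|) * _ =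
  4 * absC (csinh (sqrt_eps z * tpath sg u)) / (bF * m * (T + `|u|))); last first.
  by field; rewrite !gt_eqF.
rewrite ler_pdivlMr //.
have h3 : bF * (s * (m / 4 * (T + `|u|))) <= absC (csinh (sqrt_eps z * tpath sg u)).
  by apply: (le_trans _ h1); rewrite ler_pM2l // ler_pM2l.
lra.
Qed.

Lemma xt_path_deriv_bound u :
  absC (xt z (tpath sg u) ^+ 2 - eps z) <= (4 / (bF * m)) ^+ 2 * weight T u.
Proof.
have -> : (4 / (bF * m)) ^+ 2 * weight T u = (4 / (bF * m) / (T + `|u|)) ^+ 2.
  by rewrite /weight [RHS]exprMn exprVn.
rewrite xt_sqr ?csinh_path_neq0 // absCf absCX absC_eps -expr_div_n.
have h := csinh_ratio u.
have h0 : 0 <= s / absC (csinh (sqrt_eps z * tpath sg u)) by rewrite divr_ge0 ?absC_ge0 // ltW.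
by rewrite lerXn2r ?nnegrE // (le_trans h0 h).
Qed.

Lemma xt_path_bound u : absC (xt z (tpath sg u)) <= s + 4 / (bF * m) / T.
Proof.
have p1 : 0 < absC (csinh (sqrt_eps z * tpath sg u)) by rewrite absC_gt0 csinh_path_neq0.
rewrite /xt absCf absCM absCN absC_sqrt_eps.
apply: (@le_trans _ _ (s * (1 + absC (csinh (sqrt_eps z * tpath sg u))) /
   absC (csinh (sqrt_eps z * tpath sg u)))).
  by rewrite ler_pM2r ?invr_gt0 // ler_pM2l // ccosh_upper.
rewrite mulrDr mulr1 mulrDl mulfK ?gt_eqF // addrC lerD2l (le_trans (csinh_ratio u)) //.
have TT := T1; apply: ler_wpM2l; first by rewrite divr_ge0 ?mulr_ge0 // ltW.
by rewrite lef_pV2 ?posrE; have := normr_ge0 u; lra.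
Qed.

(** The difference is [sqrt_eps z] times an exponential over [csinh], and past the bend the real
    part of the exponent is at most [c0 <= 1]. The rate [1 / (T + |u|)] is enough for convergence to
    the singular point. *)
Lemma xt_path_end l u : match l with SdL => a < u | SdR => u < - a end ->
  absC (xt z (tpath sg u) - xhat l z) <= expR 1 * (4 / (bF * m)) / (T + `|u|).
Proof.
move=> hl; have a0 := a_gt0.
have au : a < `|u| by rewrite ltr_normr; case: l hl => ?; apply/orP; [left|right]; lra.
have [v [v0 h1 _]] := out_estimate au; set tau := sqrt_eps z * _ in h1.
have c1 : c0 g <= 1.
  have := c0b; have : 0 <= c0 g * (2 / bt) by rewrite mulr_ge0 ?divr_ge0 // ltW.
  lra.
have bv : 0 <= bt * v by rewrite mulr_ge0 // ltW.
rewrite xt_sub ?csinh_path_neq0 //.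
suff [w [hw ->]] : exists w : C, reC w <= 1 /\ match l with
    | SdL => - (sqrt_eps z * cexp tau / csinh tau)
    | SdR => - (sqrt_eps z * cexp (- tau) / csinh tau) end
      = - (sqrt_eps z * cexp w / csinh tau).
  rewrite absCN absCf absCM absC_sqrt_eps absC_cexp mulrAC mulrC -mulrA.
  rewrite ler_pM ?expR_ge0 ?divr_ge0 ?absC_ge0 ?(ltW s0) ?ler_expR //.
  by rewrite (le_trans (csinh_ratio u)).
case: l hl => hl.
  exists tau; split => //; move: h1; rewrite gtr0_sg; last by lra.
  by rewrite mul1r; lra.
exists (- tau); split => //; move: h1; rewrite ltr0_sg; last by lra.
by rewrite mulN1r reCN; lra.
Qed.

(** The signed distance to the line of direction [theta_hat] through 0: the ends of the path run
    parallel to the lines that bound the sheets. *)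
Lemma rotated_height u : `|height sg u * cos th - u * sin th| <= T + a.
Proof.
have a0 := a_gt0; have ct := cos_th_gt0; have TT := T1.
have E : `|sigma g z u * cos th - u * sin th| <= a.
  rewrite /sigma sqrt_absC_eps -/a -/th; case: ifPn => [h|].
    by rewrite mul0r sub0r normrN normrM (le_trans _ h) // ler_piMr // sin_max.
  rewrite -ltNge => h; have u0 : u != 0 by rewrite -normr_gt0 (lt_trans a0).
  rewrite (_ : _ - _ = - (Num.sg u * a * sin th)); last by rewrite /tan; field; rewrite gt_eqF.
  by rewrite normrN (normrM (Num.sg u * a)) (normrM (Num.sg u)) normr_sg u0 mul1r (gtr0_norm a0) ler_piMr ?(ltW a0) ?sin_max.
rewrite /height mulrDl -addrA (le_trans (ler_normD _ _)) // lerD //.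
rewrite normrM (ger0_norm (ltW ct)) (le_trans _ (_ : m * T <= T)) ?ler_piMl //; last by lra.
by rewrite -[m * T]mulr1 ler_pM ?cos_le1 ?sg_bump // ltW.
Qed.

Lemma imC_rotated (t : C) :
  imC (t * cexp (- (iC R * ofR th))) = imC t * cos th - reC t * sin th.
Proof.
rewrite imCM reC_cexp imC_cexp reCN imCN reC_iM imC_iM reC_ofR imC_ofR !oppr0 expR0 !mul1r cosN sinN; ring.
Qed.

Lemma imC_period : imC (period z * cexp (- (iC R * ofR th))) = - (pi / s * cos (phi + th)).
Proof.
rewrite /period sqrt_eps_polar.
have -> : - (ofR pi * iC R) / (ofR s * cexp (iC R * ofR phi)) * cexp (- (iC R * ofR th))
  = - (ofR (pi / s) * (iC R * cexp (- (iC R * ofR (phi + th))))).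
  rewrite (ofRD phi th) mulrDr opprD cexpD [cexp (- (iC R * ofR phi))]cexpN !(ofRM, ofRV); field.
  by rewrite cexp_neq0 /= -absC_gt0 absC_ofR gtr0_norm.
rewrite imCN imC_ofRM imC_iM reC_cexp reCN imCN reC_iM imC_iM reC_ofR imC_ofR !oppr0 expR0 mul1r cosN.
by [].
Qed.

Lemma period_lower : pi / s * bt <= imC (period z * cexp (- (iC R * ofR th))).
Proof.
rewrite imC_period -mulrN ler_pM2l ?divr_gt0 ?pi_gt0 //.
by have := cos_phi_th; lra.
Qed.

(** The path avoids [Nset] because [|x(t)| < r] along it, stays on the right side of [sigma] by the
    sign of the tent, and does not reach the line shifted by half a period, which is far away when
    hat-epsilon is small. *)
Lemma tpath_Gam (kap0 : 0 < kappa g) (sh : sheet) u :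
  sg = match sh with ShD => -1 | ShU => 1 end ->
  s + 4 / (bF * m) / T < Defs.rad g -> Defs.Gam g sh z (tpath sg u).
Proof.
move=> hsg hr; have a0 := a_gt0; have TT := T1.
have hN : ~ Nset g z (tpath sg u).
  move=> /connected_component_sub h0.
  have : Defs.rad g * absC (csinh (sqrt_eps z * tpath sg u)) <=
    absC (sqrt_eps z * ccosh (sqrt_eps z * tpath sg u)) := h0.
  rewrite absCM absC_sqrt_eps => h; have := xt_path_bound u.
  have p1 : 0 < absC (csinh (sqrt_eps z * tpath sg u)) by rewrite absC_gt0 csinh_path_neq0.
  rewrite /xt absCf absCM absCN absC_sqrt_eps ler_pdivrMr // => h2.
  have := ltr_pM2r p1 _ (Defs.rad g); move: (s + _) hr h2 => q hr h2.
  have : q * absC (csinh (sqrt_eps z * tpath sg u)) < Defs.rad g * absC (csinh (sqrt_eps z * tpath sg u)).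
    by rewrite ltr_pM2r.
  by lra.
have bump0 : 0 <= m * bump_fun u by rewrite mulr_ge0 ?(ltW m0) //; case/andP: (bump_bound u).
have PH : (1 / 2) * (pi / s * bt) <= imC (halfP g z * cexp (- (iC R * ofR th))).
  rewrite /halfP -[X in imC X]mulrA imC_ofRM.
  have := period_lower; have : 0 <= pi / s * bt by rewrite mulr_ge0 ?divr_ge0 ?pi_ge0 // ltW.
  set P := imC _; set q := pi / s * bt => q0 hq.
  have : kappa g * P >= 0 by rewrite mulr_ge0 ?(ltW kap0) // (le_trans q0).
  lra.
(* After multiplication by [s] the left side is at most [2 * c0], a small fraction of [bt]. *)
have Ta' : T + a < (1 / 2) * (pi / s * bt).
  rewrite (_ : _ * (pi / s * bt) = (pi * bt / 2) / s); last by ring.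
  rewrite ltr_pdivlMr // mulrDl [T * s]mulrC [a * s]mulrC sa.
  have : 2 * bt <= pi * bt by rewrite ler_wpM2r ?pi_ge2 // ltW.
  have := sT; have := c0bt; have := bt0; lra.
have := rotated_height u; rewrite ler_norml => /andP[r1 r2].
case: sh hsg => hsg; split => //.
- by rewrite reC_tpath imC_tpath /height hsg; have := hgt0; lra.
- rewrite mulrDl imCD -/th imC_rotated reC_tpath imC_tpath; lra.
- by rewrite reC_tpath imC_tpath /height hsg; have := hgt0; lra.
- rewrite mulrBl imCB -/th imC_rotated reC_tpath imC_tpath; lra.
Qed.

Lemma tpath_T sg' u : `|u| = T -> tpath sg' u = ofR u.
Proof.
move=> h; rewrite /tpath /height bump_out ?h // mulr0 mulr0 add0r sigma_in ?h ?Ta //.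
by rewrite ofR0 mulr0 addr0.
Qed.

(** The limiting flow is [-1 / t]. The two quadratic remainders make the error [O(s)] uniformly on
    the flat part, so paths of two small parameters are close there. *)
Lemma xt_path_limit u : `|u| <= a -> absC (xt z (tpath sg u) + (tpath sg u)^-1) <= 40 * s.
Proof.
move=> h; have h1 := in_estimate h; set tau := sqrt_eps z * _ in h1.
have t0 := tpath_gt0 u; have tn0 : tpath sg u != 0 by rewrite -absC_gt0.
have h2 : absC tau <= 1 / 2 by lra.
have tE : absC tau = s * absC (tpath sg u) by rewrite absCM absC_sqrt_eps.
have tau0 : 0 < absC tau by rewrite tE mulr_gt0.
have sh := csinh_lower h1.
have sh0 : csinh tau != 0 by rewrite -absC_gt0; lra.
have -> : xt z (tpath sg u) + (tpath sg u)^-1 =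
   ((csinh tau - tau) - tau * (ccosh tau - 1)) / (tpath sg u * csinh tau).
  by move: sh0; rewrite /xt /tau => sh0; field; rewrite tn0 sh0.
rewrite absCf absCM ler_pdivrMr; last by rewrite mulr_gt0 // absC_gt0.
apply: (@le_trans _ _ (20 * absC tau ^+ 2)).
  rewrite (le_trans (absCBD _ _)) // (_ : 20 * _ = 10 * absC tau ^+ 2 + 1 * (10 * absC tau ^+ 2)); last by ring.
  rewrite lerD ?csinh_quad // absCM ler_pM ?absC_ge0 ?ccosh_quad //; lra.
apply: (@le_trans _ _ (40 * s * (absC (tpath sg u) * (absC tau / 2)))).
  have E : 40 * s * (absC (tpath sg u) * (absC tau / 2)) = 20 * (s * absC (tpath sg u)) * absC tau by field.
  by rewrite E -tE expr2 mulrA.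
rewrite ler_pM2l ?mulr_gt0 // ler_pM2l //.
Qed.

(* The abscissas of the vertices of the piecewise affine path. *)
Definition kinks : seq R := [:: 0; T; - T; a; - a].

Lemma rcont_dist (c u : R) : rcont (fun v => ofR `|v - c|) u.
Proof.
move=> e e0; exists e => // v; rewrite !ofR_dist => h.
by rewrite (le_lt_trans (ler_dist_dist _ _)) // opprB addrA subrK.
Qed.

Lemma rder_dist (c u : R) : u != c -> rder (fun v => ofR `|v - c|) u (ofR (Num.sg (u - c))).
Proof.
move=> uc; have h0 : 0 < `|u - c| by rewrite normr_gt0 subr_eq0.
apply: (@gderiv_ext _ _ _ (fun v => ofR (Num.sg (u - c)) * (ofR v - ofR c))).
  exists `|u - c| => // v; rewrite ofR_dist -ofRB -ofRM => hv; congr ofR.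
  rewrite ltr_norml in hv; case: (ltgtP u c) uc => // h _ in h0 hv *.
    by rewrite ltr0_sg ?subr_lt0 // ler0_norm; rewrite (ltr0_norm (_ : u - c < 0)) ?subr_lt0 // in hv; lra.
  by rewrite gtr0_sg ?subr_gt0 // ger0_norm; rewrite (gtr0_norm (_ : 0 < u - c)) ?subr_gt0 // in hv; lra.
apply: (gderiv_eq (v := ofR (Num.sg (u - c)) * (1 - 0))); first by rewrite subr0 mulr1.
by apply: gderivZ; apply: gderivB; [exact: gderiv_io|exact: gderiv_cst].
Qed.

Lemma tpathE v : tpath sg v = ofR v + iC R * (ofR (sg * m) *
     (2^-1 * (ofR `|v - T| + ofR `|v - - T|) - ofR `|v - 0|)
   + ofR (tan th) * (ofR v + 2^-1 * (ofR `|v - a| - ofR `|v - - a|))).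
Proof.
rewrite /tpath /height sigmaE // /bump_fun !opprK subr0.
by rewrite !(ofRD, ofRM, ofRN, ofRV, ofR_nat); ring.
Qed.

Lemma rcont_tpath u : rcont (tpath sg) u.
Proof.
apply: (@gcont_ext _ _ _ (fun v => ofR v + iC R * (ofR (sg * m) *
     (2^-1 * (ofR `|v - T| + ofR `|v - - T|) - ofR `|v - 0|)
   + ofR (tan th) * (ofR v + 2^-1 * (ofR `|v - a| - ofR `|v - - a|))))).
  by exists 1 => // v _; rewrite tpathE.
have ci := gderiv_cont (gderiv_io (@ofR R) u).
have cd c := rcont_dist c u.
have cZ w f : rcont f u -> rcont (fun v => w * f v) u.
  by move=> hf; apply: gcontM => //; exact: gcont_cst.
apply: gcontD; first exact: ci.
apply: (cZ); apply: gcontD; apply: (cZ).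
  by apply: gcontB; [apply: (cZ); apply: gcontD|]; apply: (cd).
by apply: gcontD; [exact: ci|apply: (cZ); apply: gcontB; apply: (cd)].
Qed.

Lemma tan_th_bound : `|tan th| <= tan (angle_of (gamma g)).
Proof.
have al := angle_lt; have hb := theta_bound; have := hb; rewrite ler_norml => /andP[h1 h2].
have [_ a0 _ _ _] := angle_facts gam0 angle_lt; have p0 := pi_gt0 R.
have mono (x y : R) : - (pi / 2) < x -> x <= y -> y < pi / 2 -> tan x <= tan y.
  move=> h3 h4 h5; move: h4; rewrite le_eqVlt => /predU1P[->//|h4].
  by rewrite ltW // ltr_tan // in_itv /=; apply/andP; split; lra.
rewrite ler_norml -tanN; apply/andP; split; apply: mono; lra.
Qed.

(** The derivative of the tent part of the height, which is the whole slope where [sigma] is flat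
    and hence does not depend on hat-epsilon there. *)
Definition inner_slope u : R :=
  sg * m * (2^-1 * (Num.sg (u - T) + Num.sg (u - - T)) - Num.sg (u - 0)).
Definition slope u : R :=
  inner_slope u + tan th * (1 + 2^-1 * (Num.sg (u - a) - Num.sg (u - - a))).

Lemma slope_in u : `|u| < a -> slope u = inner_slope u.
Proof.
rewrite ltr_norml => /andP[h1 h2].
rewrite /slope (ltr0_sg (_ : u - a < 0)) ?(gtr0_sg (_ : 0 < u - - a)); lra.
Qed.

Lemma slope_bound u : u \notin kinks -> `|slope u| <= tan (angle_of (gamma g)).
Proof.
rewrite /kinks !inE !negb_or => /and5P[u0 uT uNT ua uNa].
have tb := tan_th_bound; have Ta' := Ta; have TT := T1; have a0 := a_gt0.
have [h|h] := ltP `|u| a.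
  rewrite slope_in // /inner_slope.
  rewrite normrM normrM sg1 mul1r gtr0_norm //; apply: (le_trans _ mtan).
  rewrite -[leRHS]mulr1 ler_pM2l //.
    case: (ltgtP u 0) u0 => // hu _; case: (ltgtP u T) uT => // h1 _; case: (ltgtP u (- T)) uNT => // h2 _; try lra.
    + rewrite (ltr0_sg (_ : u - T < 0)) ?(ltr0_sg (_ : u - - T < 0)) ?(ltr0_sg (_ : u - 0 < 0)); try lra.
      by rewrite ler_norml; apply/andP; split; lra.
    + rewrite (ltr0_sg (_ : u - T < 0)) ?(gtr0_sg (_ : 0 < u - - T)) ?(ltr0_sg (_ : u - 0 < 0)); try lra.
      by rewrite ler_norml; apply/andP; split; lra.
    + rewrite (ltr0_sg (_ : u - T < 0)) ?(gtr0_sg (_ : 0 < u - - T)) ?(gtr0_sg (_ : 0 < u - 0)); try lra.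
      by rewrite ler_norml; apply/andP; split; lra.
    + rewrite (gtr0_sg (_ : 0 < u - T)) ?(gtr0_sg (_ : 0 < u - - T)) ?(gtr0_sg (_ : 0 < u - 0)); try lra.
      by rewrite ler_norml; apply/andP; split; lra.
have -> : slope u = tan th.
    rewrite /slope /inner_slope; case: (ltgtP u 0) u0 => // hu _.
      have hu2 : u < - a.
        by rewrite ltr0_norm // in h; case: (ltgtP u (- a)) uNa => // h3 _; lra.
      rewrite (ltr0_sg (_ : u - T < 0)) ?(ltr0_sg (_ : u - - T < 0)) ?(ltr0_sg (_ : u - 0 < 0)); try lra.
      rewrite (ltr0_sg (_ : u - a < 0)) ?(ltr0_sg (_ : u - - a < 0)); lra.
    have hu2 : a < u.
      by rewrite gtr0_norm // in h; case: (ltgtP u a) ua => // h3 _; lra.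
    rewrite (gtr0_sg (_ : 0 < u - T)) ?(gtr0_sg (_ : 0 < u - - T)) ?(gtr0_sg (_ : 0 < u - 0)); try lra.
    rewrite (gtr0_sg (_ : 0 < u - a)) ?(gtr0_sg (_ : 0 < u - - a)); lra.
exact: tb.
Qed.

Lemma rder_tpath u : u \notin kinks -> rder (tpath sg) u (1 + iC R * ofR (slope u)).
Proof.
rewrite /kinks !inE !negb_or => /and5P[u0 uT uNT ua uNa].
apply: (@gderiv_ext _ _ _ (fun v => ofR v + iC R * (ofR (sg * m) *
     (2^-1 * (ofR `|v - T| + ofR `|v - - T|) - ofR `|v - 0|)
   + ofR (tan th) * (ofR v + 2^-1 * (ofR `|v - a| - ofR `|v - - a|))))).
  by exists 1 => // v _; rewrite tpathE.
apply: (gderiv_eq (v := 1 + iC R * (ofR (sg * m) *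
     (2^-1 * (ofR (Num.sg (u - T)) + ofR (Num.sg (u - - T))) - ofR (Num.sg (u - 0)))
   + ofR (tan th) * (1 + 2^-1 * (ofR (Num.sg (u - a)) - ofR (Num.sg (u - - a))))))).
  by rewrite /slope /inner_slope !(ofRB, ofRD, ofRM, ofRV, ofR_nat).
have di := gderiv_io (@ofR R) u.
by apply: gderivD => //; apply: gderivZ; apply: gderivD; apply: gderivZ;
  [apply: gderivB; [apply: gderivZ; apply: gderivD|]|apply: gderivD => //; apply: gderivZ; apply: gderivB];
  apply: rder_dist.
Qed.

End Path.

(** * Local properties and their translation to filters *)

Section Neighbourhoods.
Variable R : realType.
Local Notation C := (CC R).
Local Notation cder := (gderiv (@id C)).
Local Notation cnear := (gnear (@id C)).

Lemma cnear_nbhs (x : C) (P : C -> Prop) : cnear x P <-> \forall y \near x, P y.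
Proof. by split=> [|/nbhs_absC] //; move=> h; apply/nbhs_absC. Qed.

Lemma gnear_all (T : Type) (io : T -> C) (I : finType) (x : T) (P : I -> T -> Prop) :
  (forall i, gnear io x (P i)) -> gnear io x (fun y => forall i, P i y).
Proof.
move=> h; suff H (s : seq I) : gnear io x (fun y => forall i, i \in s -> P i y).
  by apply: gnear_imp (H (enum I)) => y hy i; apply: hy; rewrite mem_enum.
elim: s => [|j s IH]; first by exists 1.
apply: gnear_imp (gnear_and (h j) IH) => y [h1 h2] i.
by rewrite inE => /predU1P[->|/h2].
Qed.

Lemma gcont_near (T : Type) (io : T -> C) (f : T -> C) (x : T) (P : C -> Prop) :
  gcont io f x -> cnear (f x) P -> gnear io x (fun y => P (f y)).
Proof. by move=> hf [e /hf [d d0 h] hP]; exists d => // y /h /hP. Qed.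

Lemma gcont_lt (T : Type) (io : T -> C) (f : T -> R) (x : T) :
  gcont io (fun y => ofR (f y)) x -> 0 < f x -> gnear io x (fun y => 0 < f y).
Proof.
move=> hf /hf [d d0 h]; exists d => // y /h; rewrite ofR_dist ltr_norml => /andP[].
by rewrite ltrBrDl addrN.
Qed.

Lemma gcont_reC_ofR (T : Type) (io : T -> C) (f : T -> C) (x : T) :
  gcont io f x -> gcont io (fun y => ofR (reC (f y))) x.
Proof.
move=> hf e /hf [d d0 h]; exists d => // y /h; rewrite ofR_dist -reCB.
exact: le_lt_trans (abs_reC _).
Qed.

Lemma gcont_imC_ofR (T : Type) (io : T -> C) (f : T -> C) (x : T) :
  gcont io f x -> gcont io (fun y => ofR (imC (f y))) x.
Proof.
move=> hf e /hf [d d0 h]; exists d => // y /h; rewrite ofR_dist -imCB.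
exact: le_lt_trans (abs_imC _).
Qed.

Lemma gcont_absC_ofR (T : Type) (io : T -> C) (f : T -> C) (x : T) :
  gcont io f x -> gcont io (fun y => ofR (absC (f y))) x.
Proof.
move=> hf e /hf [d d0 h]; exists d => // y /h; rewrite ofR_dist; apply: le_lt_trans.
rewrite ler_norml; apply/andP; split; last exact: absC_subD.
by rewrite lerNl opprB absCB absC_subD.
Qed.

Lemma gderiv_unique (f : C -> C) (x v w : C) : cder f x v -> cder f x w -> v = w.
Proof.
move=> hv hw; apply/eqP; rewrite -subr_eq0; apply/eqP/absC_le0_eq => e e0.
have e2 : 0 < e / 2 by rewrite divr_gt0.
have [d d0 h] := gnear_and (hv _ e2) (hw _ e2).
have d2 : 0 < d / 2 by rewrite divr_gt0.
have E : x + ofR (d / 2) - x = ofR (d / 2) by ring.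
have := h (x + ofR (d / 2)); rewrite /= E absC_ofR gtr0_norm // => -[|h1 h2]; first by lra.
rewrite -(ler_pM2r d2) -[X in _ * X <= _](gtr0_norm d2) -absC_ofR -absCM.
have -> : (v - w) * ofR (d / 2) = (f (x + ofR (d / 2)) - f x - w * ofR (d / 2))
  - (f (x + ofR (d / 2)) - f x - v * ofR (d / 2)) by ring.
rewrite (_ : e * (d / 2) = e / 2 * (d / 2) + e / 2 * (d / 2)); last by field.
by apply: absCD_le; rewrite ?absCN.
Qed.

Lemma within_slice (A : set (C * C)) (f : C * C -> C) (z t : C) :
  {within A, continuous f} -> A (z, t) -> cnear t (fun y => A (z, y)) ->
  gcont id (fun y => f (z, y)) t.
Proof.
move=> hf Azt [d d0 hd] e e0.
have /cvg_absC /(_ e e0) H := hf (z, t).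
have [[U V] /= [hU hV] hUV] : (within A (nbhs (z, t))) [set q | absC (f q - f (z, t)) < e].
  by rewrite nbhs_subspace_in.
have [d1 d10 hd1] := (nbhs_absC _ _).1 hV.
exists (Num.min d d1); first by rewrite lt_min d0.
move=> y; rewrite lt_min => /andP[/hd h1 /hd1 h2].
have [d2 d20 hd2] := (nbhs_absC _ _).1 hU.
have Uz : U z by apply: hd2; rewrite subrr absC0.
have := hUV (z, y) (conj Uz h2); apply; exact: h1.
Qed.

Lemma within01 (L : R -> C) (u : R) : {within `[0, 1], continuous L} -> 0 <= u <= 1 ->
  forall e : R, 0 < e -> exists2 d : R, 0 < d &
    forall v, 0 <= v <= 1 -> `|v - u| < d -> absC (L v - L u) < e.
Proof.
move=> hL hu e e0.
have hin : [set` `[0, 1]] u by rewrite /= in_itv.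
have /cvg_absC /(_ e e0) H := hL u.
have : (within [set` `[0, 1]] (nbhs u)) [set v | absC (L v - L u) < e].
  by rewrite nbhs_subspace_in.
move=> /nbhs_ballP [d /= d0 hd].
exists d => // v hv hvu; apply: hd; last by rewrite /= in_itv.
by rewrite /ball /= distrC.
Qed.

Lemma within01_near (P : R -> Prop) (u : R) : 0 <= u <= 1 ->
  (\forall v \near within `[0, 1]%classic (nbhs u), P v) ->
  exists2 d : R, 0 < d & forall v, 0 <= v <= 1 -> `|v - u| < d -> P v.
Proof.
move=> hu /nbhs_ballP [d /= d0 hd]; exists d => // v hv hvu.
by apply: hd; [rewrite /ball /= distrC|rewrite /= in_itv].
Qed.

Lemma near_within01 (P : R -> Prop) (u d : R) : 0 < d ->
  (forall v, 0 <= v <= 1 -> `|v - u| < d -> P v) ->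
  \forall v \near within `[0, 1]%classic (nbhs u), P v.
Proof.
move=> d0 h; apply/nbhs_ballP; exists d => // v; rewrite /ball /= => hv hin.
by apply: h; [move: hin; rewrite /= in_itv|rewrite distrC].
Qed.

End Neighbourhoods.

(** * Local inversion of the flow *)

Section LocalTime.
Variable R : realType.
Local Notation C := (CC R).
Local Notation cder := (gderiv (@id C)).
Local Notation cnear := (gnear (@id C)).
Implicit Types (x z t : C).

Lemma eps_neq_sqr z x : x ^+ 2 - eps z != 0 -> (x - sqrt_eps z != 0) /\ (x + sqrt_eps z != 0).
Proof.
by rewrite -sqrt_eps_sqr subr_sqr mulf_eq0 negb_or => /andP[].
Qed.

(** The time determines [x] through a Moebius map of [cexp (2 * (sqrt_eps z * t))]; inverting the
    flow amounts to taking a logarithm. *)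
Lemma cexp_time z t : csinh (sqrt_eps z * t) != 0 ->
  cexp (2 * (sqrt_eps z * t)) = (xt z t - sqrt_eps z) / (xt z t + sqrt_eps z).
Proof.
move=> h; have [h1 h2] := eps_neq_sqr (xt_neq h).
have r0 := sqrt_eps_neq0 z.
rewrite mulr_natl mulr2n cexpD; move: h h1 h2; rewrite /xt /csinh /ccosh !cexpN.
set tau := sqrt_eps z * t; have e0 := cexp_neq0 tau.
move: (cexp tau) (sqrt_eps z) e0 r0 => e r e0 r0 h h1 h2.
have s0 : e ^+ 2 - 1 != 0.
  have Es : (e - e^-1) / 2 = (e ^+ 2 - 1) / (2 * e) by field.
  by apply: contra h => /eqP E; rewrite Es E mul0r.
have E1 : - r * ((e + e^-1) / 2) / ((e - e^-1) / 2) = - r * (e ^+ 2 + 1) / (e ^+ 2 - 1).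
  by field; rewrite e0 s0.
rewrite E1 (_ : - r * (e ^+ 2 + 1) / (e ^+ 2 - 1) - r = - 2 * r * e ^+ 2 / (e ^+ 2 - 1)); last by field.
rewrite (_ : - r * (e ^+ 2 + 1) / (e ^+ 2 - 1) + r = - 2 * r / (e ^+ 2 - 1)); last by field.
by field; rewrite r0 s0.
Qed.

Lemma xt_of_cexp z t x : x ^+ 2 - eps z != 0 ->
  cexp (2 * (sqrt_eps z * t)) = (x - sqrt_eps z) / (x + sqrt_eps z) ->
  csinh (sqrt_eps z * t) != 0 /\ xt z t = x.
Proof.
move=> /eps_neq_sqr [h1 h2]; rewrite mulr_natl mulr2n cexpD /xt /csinh /ccosh !cexpN.
have r0 := sqrt_eps_neq0 z.
set tau := sqrt_eps z * t; have e0 := cexp_neq0 tau.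
move: (cexp tau) (sqrt_eps z) e0 r0 h1 h2 => e r e0 r0 h1 h2 E.
have E1 : e ^+ 2 - 1 = - 2 * r / (x + r) by rewrite expr2 E; field.
have E2 : e ^+ 2 + 1 = 2 * x / (x + r) by rewrite expr2 E; field.
have s0 : e ^+ 2 - 1 != 0 by rewrite E1 !mulf_neq0 ?invr_neq0 ?oppr_eq0 ?pnatr_eq0.
have -> : (e - e^-1) / 2 = (e ^+ 2 - 1) / (2 * e) by field.
have -> : (e + e^-1) / 2 = (e ^+ 2 + 1) / (2 * e) by field.
split; first by rewrite !mulf_neq0 ?invr_neq0 ?mulf_neq0 ?pnatr_eq0.
rewrite E1 E2; field; rewrite r0 e0 h2 //.
Qed.

(* T x = log ((x - sqrt eps) / (x + sqrt eps)) / (2 sqrt eps). *)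
Lemma local_time z t0 : csinh (sqrt_eps z * t0) != 0 -> exists T : C -> C,
  T (xt z t0) = t0 /\ cnear (xt z t0) (fun x =>
    [/\ cder T x (x ^+ 2 - eps z)^-1, csinh (sqrt_eps z * T x) != 0 & xt z (T x) = x]).
Proof.
move=> h; set x0 := xt z t0; have x0e := xt_neq h; rewrite -/x0 in x0e.
have [h1 h2] := eps_neq_sqr x0e; have r0 := sqrt_eps_neq0 z.
set r := sqrt_eps z in h1 h2 r0 *.
pose T x := t0 + (2 * r)^-1 * (cLog ((x - r) / (x0 - r)) - cLog ((x - - r) / (x0 - - r))).
exists T; split.
  by rewrite /T !divff ?opprK // subrr mulr0 addr0.
have n1 : x0 != r by rewrite -subr_eq0.
have n2 : x0 != - r by rewrite -subr_eq0 opprK.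
have cx : gcont id (fun x : C => x ^+ 2 - eps z) x0.
  apply: gcontB; last exact: gcont_cst.
  by apply: (@gcont_ext _ _ _ (fun x : C => x * x)); [exists 1|apply: gcontM; exact: (gderiv_cont (gderiv_io _ _))].
have [d d0 hd] := gcont_near_neq0 cx x0e.
exists (Num.min d (Num.min (absC (x0 - r)) (absC (x0 - - r)))).
  by rewrite !lt_min d0 !absC_gt0 h1 opprK h2.
move=> x; rewrite !lt_min => /and3P[/hd hx hx1 hx2].
have [g1 g2] := eps_neq_sqr hx; rewrite -/r in g1 g2.
have [k1 k2] : csinh (sqrt_eps z * T x) != 0 /\ xt z (T x) = x.
  apply: xt_of_cexp => //; rewrite -/r.
  have -> : 2 * (r * T x) = 2 * (r * t0) + (cLog ((x - r) / (x0 - r)) - cLog ((x - - r) / (x0 - - r))).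
    by rewrite /T; field.
  rewrite cexpD cexpB !cexp_cLog ?reC_pos_ratio // cexp_time // -/x0 -/r opprK.
  by field; rewrite g2 h1 h2.
split => //.
apply: (gderiv_eq (v := 0 + (2 * r)^-1 * ((x - r)^-1 - (x - - r)^-1))).
  by rewrite -sqrt_eps_sqr -/r subr_sqr opprK; field; rewrite g1 g2.
apply: gderivD; first exact: gderiv_cst.
by apply: gderivZ; apply: gderivB; apply: gderiv_cLog_ratio.
Qed.

Lemma xt_image_near z t0 (P : C -> Prop) : csinh (sqrt_eps z * t0) != 0 ->
  cnear t0 P -> cnear (xt z t0) (fun x => exists2 t, P t & xt z t = x).
Proof.
move=> h hP; have [T [T0 hT]] := local_time h.
have [dT _ _] := gnear_at hT.
have hPT : cnear (xt z t0) (fun x => P (T x)).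
  by apply: (gcont_near (f := T)); [exact: gderiv_cont dT|rewrite T0].
by apply: gnear_imp (gnear_and hT hPT) => x [[_ _ E] Px]; exists (T x).
Qed.

End LocalTime.

(** * Openness of the sheets; the model solution on Omega_D *)

Section Sheets.
Variable R : realType.
Local Notation C := (CC R).
Local Notation cder := (gderiv (@id C)).
Local Notation cnear := (gnear (@id C)).
Variables (g : geometry R) (z : C).
Hypotheses (gam0 : 0 < gamma g) (angle_lt : angle_of (gamma g) < pi / 2).
Hypothesis zS : sectorS g z.
Hypothesis c0p : 0 < c0 g.
Let s := expR (reC z / 2).
Let th := theta_hat g z.
Let bt := beta_of (gamma g).

Lemma Nset_closed : closed (Nset g z).
Proof.
apply: component_closed; set A := [set _ | _].
rewrite -[A]setCK; apply: open_closedC; rewrite openE => t /= ht.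
apply/nbhs_absC.
have cont c : gcont id (fun t : C => sqrt_eps z * t) c by apply: gderiv_cont (gderivZ _ (gderiv_io _ _)).
have c1 : gcont id (fun t => ofR (Defs.rad g * absC (csinh (sqrt_eps z * t)) -
    absC (sqrt_eps z * ccosh (sqrt_eps z * t)))) t.
  apply: (@gcont_ext _ _ _ (fun t => ofR (Defs.rad g) * ofR (absC (csinh (sqrt_eps z * t)))
     - ofR (absC (sqrt_eps z * ccosh (sqrt_eps z * t))))).
    by exists 1 => // y _; rewrite ofRB ofRM.
  apply: gcontB; first apply: gcontM; first exact: gcont_cst.
    by apply: gcont_absC_ofR; apply: gderiv_cont (cder_csinh _ _).
  by apply: gcont_absC_ofR; apply: gcontM; [exact: gcont_cst|apply: gderiv_cont (cder_ccosh _ _)].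
have : 0 < Defs.rad g * absC (csinh (sqrt_eps z * t)) - absC (sqrt_eps z * ccosh (sqrt_eps z * t)).
  by rewrite subr_gt0 ltNge; apply/negP => h; apply: ht.
move=> /(gcont_lt c1) [d d0 hd]; exists d => // y /hd h Ay.
by move: h; rewrite subr_gt0 ltNge => /negP; apply; exact: Ay.
Qed.

Lemma gcont_sigma (t : C) : gcont id (fun t => ofR (sigma g z (reC t))) t.
Proof.
have c1 : gcont id (fun t => ofR (reC t)) t by apply: (gcont_reC_ofR (f := id)); exact: gderiv_cont (gderiv_io _ _).
have cd (c : R) : gcont id (fun t : C => ofR `|reC t - c|) t.
  apply: (@gcont_ext _ _ _ (fun t : C => ofR (absC (ofR (reC t) - ofR c)))).
    by exists 1 => // y _; rewrite ofR_dist.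
  by apply: gcont_absC_ofR; apply: gcontB => //; exact: gcont_cst.
apply: (@gcont_ext _ _ _ (fun t : C => ofR (tan th) * (ofR (reC t) +
   2^-1 * (ofR `|reC t - c0 g / s| - ofR `|reC t - - (c0 g / s)|)))).
  exists 1 => // y _; rewrite sigmaE // !opprK ofRM; congr (_ * _); rewrite ofRD; congr (_ + _).
  by rewrite ofRM ofRB ofRV ofR_nat mulrC.
apply: gcontM; first exact: gcont_cst.
apply: gcontD => //; apply: gcontM; first exact: gcont_cst.
by apply: gcontB; apply: (cd).
Qed.

Lemma Gam_open sh t : Defs.Gam g sh z t -> cnear t (Defs.Gam g sh z).
Proof.
have cN : ~ Nset g z t -> cnear t (fun y => ~ Nset g z y).
  move=> h; apply/cnear_nbhs; have := closed_openC Nset_closed.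
  by rewrite openE => /(_ t h).
have ci : gcont id (fun t => ofR (imC t)) t by apply: (gcont_imC_ofR (f := id)); exact: gderiv_cont (gderiv_io _ _).
have cs := gcont_sigma t.
have crot (c : C) : gcont id (fun t => ofR (imC ((t + c) * cexp (- (iC R * ofR th))))) t.
  apply: gcont_imC_ofR; apply: gcontM; last exact: gcont_cst.
  by apply: gcontD; [exact: gderiv_cont (gderiv_io _ _)|exact: gcont_cst].
case: sh => -[/cN h1 h2 h3].
  have k2 : cnear t (fun y => 0 < hgt g + sigma g z (reC y) - imC y).
    apply: gcont_lt; last by rewrite subr_gt0.
    apply: (@gcont_ext _ _ _ (fun y => ofR (hgt g) + ofR (sigma g z (reC y)) - ofR (imC y))).
      by exists 1 => // y _; rewrite ofRB ofRD.
    by apply: gcontB => //; apply: gcontD => //; exact: gcont_cst.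
  have k3 := gcont_lt (crot (halfP g z)) h3.
  apply: gnear_imp (gnear_and h1 (gnear_and k2 k3)) => y [a1 [a2 a3]].
  by split => //; rewrite -subr_gt0.
have k2 : cnear t (fun y => 0 < imC y - (- hgt g + sigma g z (reC y))).
  apply: gcont_lt; last by rewrite subr_gt0.
  apply: (@gcont_ext _ _ _ (fun y => ofR (imC y) - (ofR (- hgt g) + ofR (sigma g z (reC y))))).
    by exists 1 => // y _; rewrite ofRB ofRD.
  by apply: gcontB => //; apply: gcontD => //; exact: gcont_cst.
have k3 : cnear t (fun y => 0 < - imC ((y - halfP g z) * cexp (- (iC R * ofR th)))).
  apply: gcont_lt; last by rewrite oppr_gt0.
  apply: (@gcont_ext _ _ _ (fun y => - ofR (imC ((y - halfP g z) * cexp (- (iC R * ofR th)))))).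
    by exists 1 => // y _; rewrite ofRN.
  by apply: gcontN; exact: crot.
apply: gnear_imp (gnear_and h1 (gnear_and k2 k3)) => y [a1 [a2 a3]].
by split => //; [rewrite -subr_gt0|rewrite -oppr_gt0].
Qed.

Hypotheses (kap0 : 0 < kappa g) (kap1 : kappa g < 1 / 2) (hgt0 : 0 < hgt g).
Hypotheses (sh_small : s * hgt g <= bt) (c0_small : c0 g <= bt / 2).

Lemma sigma_rotated (u : R) : `|sigma g z u * cos th - u * sin th| <= c0 g / s.
Proof.
have s0 : 0 < s := s_gt0 z.
have a0 : 0 < c0 g / s by rewrite divr_gt0.
have ct := cos_th_gt0 gam0 angle_lt zS.
rewrite /sigma sqrt_absC_eps -/s -/th; case: ifPn => [h|].
  by rewrite mul0r sub0r normrN normrM (le_trans _ h) // ler_piMr // sin_max.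
rewrite -ltNge => h; have u0 : u != 0 by rewrite -normr_gt0 (lt_trans a0).
rewrite (_ : _ - _ = - (Num.sg u * (c0 g / s) * sin th)); last by rewrite /tan; field; rewrite !gt_eqF.
by rewrite normrN (normrM (Num.sg u * (c0 g / s))) (normrM (Num.sg u)) normr_sg u0 mul1r (gtr0_norm a0) ler_piMr ?(ltW a0) ?sin_max.
Qed.

(** The zeros of [csinh] are the integer multiples [j] of the period. Negative [j] lie below the
    lower line, [j = 0] belongs to [Nset], and positive [j] lie above the upper edge, which is close
    to the line of direction [theta_hat] through 0. *)
Lemma Gam_no_pole t : Defs.Gam g ShD z t -> csinh (sqrt_eps z * t) != 0.
Proof.
case=> hN h1 h2; apply/negP => /eqP h.
have s0 : 0 < s := s_gt0 z.
have bt0 : 0 < bt by have [] := angle_facts gam0 angle_lt.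
have p2 := pi_ge2 R.
have E : cexp (2 * (sqrt_eps z * t)) = 1.
  have : cexp (sqrt_eps z * t) = cexp (- (sqrt_eps z * t)).
    apply/eqP; rewrite -subr_eq0; move/eqP: h; rewrite /csinh mulf_eq0 invr_eq0 pnatr_eq0 orbF.
    by [].
  by rewrite mulr_natl mulr2n cexpD => {2}->; rewrite mulrC cexpN_mul.
have [k hk] := cexp_eq1 E.
have tE : t = ofR (- k%:~R) * period z.
  have r0 := sqrt_eps_neq0 z.
  rewrite /period ofRN ofR_int; apply: (mulfI (x := 2 * sqrt_eps z)).
    by rewrite mulf_neq0 // pnatr_eq0.
  by rewrite -[LHS]mulrA hk; field.
set j : R := - k%:~R in tE.
set q := imC (period z * cexp (- (iC R * ofR th))).
have hq : pi / s * bt <= q := period_lower gam0 angle_lt zS.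
have q0 : 0 < q by apply: lt_le_trans hq; rewrite mulr_gt0 // divr_gt0 // pi_gt0.
have h2' : 0 < (j + (1 / 2 + kappa g)) * q.
  move: h2; rewrite -/th /halfP tE -mulrDl -ofRD -mulrA imC_ofRM //.
(* This is where [kappa < 1 / 2] enters. *)
have jm : -1 < j by move: h2'; rewrite pmulr_lgt0 //; have := kap1; lra.
have jint : j = (- k)%:~R by rewrite /j mulrNz.
have : (- 1 < - k) by rewrite -(ltr_int R) -jint.
rewrite -lezD1 addNr le_eqVlt eq_sym -lezD1 add0r.
case/orP => [/eqP k0|k1].
  apply: hN; rewrite tE jint k0 ofR0 mul0r.
  have c00 : csinh (sqrt_eps z * 0) = 0 by rewrite mulr0 /csinh oppr0 subrr mul0r.
  apply: connected_component_refl.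
  by change (Defs.rad g * absC (csinh (sqrt_eps z * 0)) <= absC (sqrt_eps z * ccosh (sqrt_eps z * 0)));
    rewrite c00 absC0 mulr0 absC_ge0.
have j1 : 1 <= j by rewrite jint -[1]/(1%:~R) ler_int.
have ct := cos_th_gt0 gam0 angle_lt zS.
have E1 : imC t * cos th - reC t * sin th = j * q.
  by rewrite -imC_rotated tE -mulrA imC_ofRM.
have := ltr_pM2r ct (imC t) (hgt g + sigma g z (reC t)); rewrite h1.
rewrite mulrDl => h3.
have := sigma_rotated (reC t); rewrite ler_norml => /andP[_ h4].
have h5 : q <= j * q by rewrite ler_peMl // ltW.
have h6 : hgt g * cos th <= hgt g by rewrite ler_piMr ?cos_le1 // ltW.
have h7 : pi / s * bt < hgt g + c0 g / s by lra.
have : pi * bt < s * hgt g + c0 g.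
  move: h7; rewrite -(ltr_pM2r s0) (_ : pi / s * bt * s = pi * bt); last by rewrite mulrAC divfK ?gt_eqF.
  by have -> : (hgt g + c0 g / s) * s = s * hgt g + c0 g by field; rewrite gt_eqF.
have : 2 * bt <= pi * bt by rewrite ler_wpM2r // ltW.
have := sh_small; have := c0_small; lra.
Qed.

Lemma OmegaD_open x : Omega g ShD z x -> cnear x (Omega g ShD z).
Proof.
move=> [t ht <-]; apply: gnear_imp (xt_image_near (Gam_no_pole ht) (Gam_open ht)).
by move=> y [t' h1 h2]; exists t'.
Qed.

Lemma OmegaC_open x : Omega_C g z x -> cnear x (Omega_C g z).
Proof.
move=> [t [h1 h2] <-].
have hU : cnear t (fun y => Defs.Gam g ShU z (y + period z)).
  apply: (gcont_near (f := fun y => y + period z)); last exact: Gam_open.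
  by apply: gcontD; [exact: gderiv_cont (gderiv_io _ _)|exact: gcont_cst].
apply: gnear_imp (xt_image_near (Gam_no_pole h1) (gnear_and (Gam_open h1) hU)).
by move=> y [t' k1 k2]; exists t'.
Qed.

Lemma Omega_side_open l x : Omega_side g l z x -> cnear x (Omega_side g l z).
Proof.
move=> [t [h1 h2 h3] <-].
have cr : gcont id (fun t => ofR (reC t)) t by apply: (gcont_reC_ofR (f := id)); exact: gderiv_cont (gderiv_io _ _).
have hr : cnear t (fun y => match l with SdL => 0 < reC y | SdR => reC y < 0 end).
  case: l h3 => h3; first exact: (gcont_lt cr).
  have : cnear t (fun y => 0 < - reC y).
    apply: gcont_lt; last by rewrite oppr_gt0.
    by apply: (@gcont_ext _ _ _ (fun y => - ofR (reC y))); [exists 1 => // y _; rewrite ofRN|apply: gcontN].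
  by apply: gnear_imp => y; rewrite oppr_gt0.
apply: gnear_imp (xt_image_near (Gam_no_pole h1) (gnear_and (Gam_open h1) (gnear_and (Gam_open h2) hr))).
by move=> y [t' [k1 [k2 k3]] k4]; exists t'.
Qed.

Lemma Omega_side_sub l x : Omega_side g l z x -> Omega g ShD z x /\ Omega g ShU z x.
Proof. by move=> [t [h1 h2 _] <-]; split; exists t. Qed.

Lemma Omega_C_sub x : Omega_C g z x -> Omega g ShD z x.
Proof. by move=> [t [h1 _] <-]; exists t. Qed.

Section ModelFD.
Variables (n : nat) (sys : linear_family R n) (FD : C -> C -> 'M[C]_n).
Hypothesis hFD : is_FD sys g FD.

(** [FD] is prescribed in terms of the time. Composing with a local inverse [T] of the flow gives
    exponents in [x], and the branch [Lg] is differentiable as a continuous logarithm of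
    [x^2 - eps]. *)
Lemma FD_local x0 : Omega g ShD z x0 -> exists G : 'I_n -> C -> C,
  cnear x0 (fun x => FD z x = diag_mx (\row_i cexp (G i x)) /\
    forall i, cder (G i) x (lam sys (eps z) x i / (x ^+ 2 - eps z))).
Proof.
move=> [t0 ht0 <-]; have np := Gam_no_pole ht0.
have [Lg [hc hL _ hF]] := hFD.
have [T [T0 hT]] := local_time np.
pose G i x := T x * Lam0 sys (eps z) 0 i + Lam1 sys (eps z) 0 i / 2 * Lg z (T x).
exists G; have [dT _ _] := gnear_at hT.
have hG : cnear (xt z t0) (fun x => Defs.Gam g ShD z (T x)).
  by apply: (gcont_near (f := T)); [exact: gderiv_cont dT|rewrite T0; exact: Gam_open].
have hnn := gnear_near (gnear_and hT hG).
apply: gnear_imp hnn => x hx.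
have [[hdT hs hxt] hGx] := gnear_at hx.
split; first by rewrite -{1}hxt hF.
move=> i.
have cL : gcont id (fun y => Lg z (T y)) x.
  apply: (gcont_comp (f := Lg z)); last exact: gderiv_cont hdT.
  apply: (@within_slice _ [set p : C * C | sectorS g p.1 /\ Defs.Gam g ShD p.1 p.2] (fun p => Lg p.1 p.2)) => //.
  by apply: gnear_imp (Gam_open hGx).
have dL : cder (fun y => Lg z (T y)) x (2 * x / (x ^+ 2 - eps z)).
  apply: (gderiv_log (f := fun y => y ^+ 2 - eps z)) => //.
    by apply: gnear_imp hx => y [[_ _ Ey] Gy]; rewrite hL // Ey.
  apply: (gderiv_eq (v := 1 * x + x * 1 - 0)); first by ring.
  apply: gderivB; last exact: gderiv_cst.
  by apply: (gderiv_ext (f := fun y : C => y * y)); [exists 1|apply: gderivM; exact: gderiv_io].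
have xe : x ^+ 2 - eps z != 0 by rewrite -hxt xt_neq.
apply: (gderiv_eq (v := (x ^+ 2 - eps z)^-1 * Lam0 sys (eps z) 0 i + T x * 0
   + Lam1 sys (eps z) 0 i / 2 * (2 * x / (x ^+ 2 - eps z)))).
  by rewrite /lam; field.
apply: gderivD; first by apply: gderivM => //; exact: gderiv_cst.
exact: gderivZ.
Qed.

Lemma FD_model x : Omega g ShD z x -> forall i k,
  cder (fun y => FD z y i k) x (lam sys (eps z) x i / (x ^+ 2 - eps z) * FD z x i k).
Proof.
move=> hx i k; have [G hG] := FD_local hx.
have [E dG] := gnear_at hG.
apply: (gderiv_ext (f := fun y => cexp (G i y) *+ (i == k))).
  by apply: gnear_imp hG => y [-> _]; rewrite !mxE.
rewrite E !mxE; case: eqP => _; last first.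
  by apply: (gderiv_eq (v := 0)); [rewrite mulr0n mulr0|exact: gderiv_cst].
rewrite !mulr1n mulrC; apply: (gderiv_comp (f := @cexp R)); [exact: gderiv_cexp|exact: dG].
Qed.

Lemma FD_diag x : Omega g ShD z x -> exists v : 'I_n -> C,
  (forall i, v i != 0) /\ FD z x = diag_mx (\row_i v i).
Proof.
move=> hx; have [G hG] := FD_local hx; have [E _] := gnear_at hG.
by exists (fun i => cexp (G i x)); split => // i; exact: cexp_neq0.
Qed.

End ModelFD.

End Sheets.

(** * The normalizing matrices along a path *)

Section NormalizedSystem.
Variable R : realType.
Local Notation C := (CC R).
Local Notation cder := (gderiv (@id C)).
Local Notation cnear := (gnear (@id C)).
Local Notation rder := (gderiv (@ofR R)).
Local Notation rcont := (gcont (@ofR R)).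
Variables (n : nat) (sys : linear_family R n) (g : geometry R).
Variables (FD FU : C -> C -> 'M[C]_n) (H : sheet -> C -> C -> 'M[C]_n).
Hypothesis hH : normalizing sys g FD FU H.

Definition model_solution (z : C) (F : C -> 'M[C]_n) (x : C) : Prop := forall i k,
  cder (fun y => F y i k) x (lam sys (eps z) x i / (x ^+ 2 - eps z) * F x i k).

Lemma H_slice s z x : sectorS g z -> Omega g s z x ->
  forall i k, analytic_at (fun y => H s z y i k) x.
Proof. by move=> zS hx i k; exact: analytic2_slice (H_analytic hH i k zS hx). Qed.

(** Differentiating [H F] and cancelling the invertible [F] leaves
    [(x^2 - eps) H' = B H - H Lambda]; the part [Lambda] of [B] turns into differences of
    eigenvalues. *)
Lemma H_ode s z x : sectorS g z -> Omega g s z x -> x ^+ 2 - eps z != 0 ->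
  model_solution z (Fsheet FD FU s z) x -> forall i k,
  cder (fun y => H s z y i k) x
    ((lam sys (eps z) x i - lam sys (eps z) x k) / (x ^+ 2 - eps z) * H s z x i k
     + \sum_(m < n) Rem sys (eps z) x i m * H s z x m k).
Proof.
move=> zS hx xe hF.
have dHex (i : 'I_n) : exists f : 'I_n -> C, forall k, cder (fun y => H s z y i k) x (f k).
  have hk k : exists v, cder (fun y => H s z y i k) x v.
    have [f1 [_ h1]] := analytic_deriv (H_slice zS hx i k).
    by exists (f1 x); exact: gnear_at h1.
  by have [f hf] := choice hk; exists f.
have [dH hdH] := choice dHex.
pose D : 'M[C]_n := \matrix_(i, k) dH i k.
set F := Fsheet FD FU s in hF *; set e := x ^+ 2 - eps z in xe hF *.
have [Wu Wd We] := H_fundamental hH zS hx.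
have Fu : F z x \in unitmx by move: Wu; rewrite unitmx_mul => /andP[].
have dW LF : LF = Lam sys (eps z) x *m F z x ->
    \matrix_(i, k) 'D_1 (fun y : C => (H s z y *m F z y) i k : C) x =
    D *m F z x + e^-1 *: (H s z x *m LF).
  move=> LFd; have LFE j k : LF j k = lam sys (eps z) x j * F z x j k.
    by rewrite LFd mul_diag_mx !mxE.
  apply/matrixP => i k; rewrite !mxE.
  apply: gderiv_unique (gderiv_derive (Wd i k)) _.
  apply: (gderiv_ext (f := fun y => \sum_(m < n) H s z y i m * F z y m k)).
    by exists 1 => // y _; rewrite mxE.
  apply: (gderiv_eq (v := \sum_(m < n) (dH i m * F z x m k + H s z x i m *
     (lam sys (eps z) x m / e * F z x m k)))).
    rewrite big_split /= mulr_sumr; congr (_ + _); apply: eq_bigr => m _; first by rewrite mxE.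
    by rewrite LFE; ring.
  by apply: gderiv_sum => m; apply: gderivM; [exact: hdH|exact: hF].
have key : e *: D = Bmx sys (eps z) x *m H s z x - H s z x *m Lam sys (eps z) x.
  apply: (can_inj (mulmxK Fu)).
  rewrite mulmxBl -!mulmxA -We (dW _ erefl) scalerDr scalerA mulfV // scale1r.
  by rewrite -scalemxAl addrK.
move=> i k; apply: gderiv_eq (hdH i k).
have := congr1 (fun A : 'M[C]_n => A i k) key.
rewrite mulmxDl -scalemxAl mul_diag_mx mul_mx_diag !mxE => E.
rewrite -/e in E; apply: (mulfI xe); rewrite E.
move: (lam sys (eps z) x i) (lam sys (eps z) x k) (\sum_(j < n) _) => li lk S.
by move: e xe {E We dW key hF} => e xe; field; rewrite xe.
Qed.

Section OnPath.
Variables (z : C) (T m : R).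
Let s := expR (reC z / 2).
Let bt := beta_of (gamma g).
Hypotheses (gam0 : 0 < gamma g) (angle_lt : angle_of (gamma g) < pi / 2).
Hypothesis zS : sectorS g z.
Hypotheses (T1 : 1 <= T) (m0 : 0 < m) (m1 : m <= 1) (mtan : m <= tan (angle_of (gamma g))).
Hypotheses (c0p : 0 < c0 g) (c0small : c0 g * (1 + 2 / bt) <= 1 / 40).
Hypotheses (sT : s * T <= c0 g) (hgt0 : 0 < hgt g).
Hypotheses (kap0 : 0 < kappa g) (kap1 : kappa g < 1 / 2).
Hypotheses (sh_small : s * hgt g <= bt) (hr : s + 4 / (bF g * m) / T < Defs.rad g).
Hypotheses (hFD : is_FD sys g FD) (hFU : is_FU g FD FU).

Definition sheet_sign (sh : sheet) : R := match sh with ShD => -1 | ShU => 1 end.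
Definition xpath (sg u : R) : C := xt z (tpath g z T m sg u).

Lemma sheet_sign1 sh : `|sheet_sign sh| = 1.
Proof. by case: sh; rewrite /= ?normrN normr1. Qed.

Lemma c0_half : c0 g <= bt / 2.
Proof.
have [_ _ b0 b1 _] := angle_facts gam0 angle_lt.
have h : 80 * c0 g <= bt by apply: (c0bt).
by have := c0p; lra.
Qed.

Lemma xpath_Gam sh u : Defs.Gam g sh z (tpath g z T m (sheet_sign sh) u).
Proof. by apply: tpath_Gam => //; exact: sheet_sign1. Qed.

Lemma xpath_Omega sh u : Omega g sh z (xpath (sheet_sign sh) u).
Proof. by eexists; [exact: xpath_Gam|]. Qed.

Lemma xpath_neq sh u : xpath (sheet_sign sh) u ^+ 2 - eps z != 0.
Proof. by apply: xt_neq; apply: csinh_path_neq0 => //; exact: sheet_sign1. Qed.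

Lemma cder_xpath sh u : cder (xt z) (tpath g z T m (sheet_sign sh) u)
  (xpath (sheet_sign sh) u ^+ 2 - eps z).
Proof. by apply: cder_xt; apply: csinh_path_neq0 => //; exact: sheet_sign1. Qed.

Lemma rcont_xpath sh u : rcont (xpath (sheet_sign sh)) u.
Proof.
apply: (gcont_comp (f := xt z)); first exact: gderiv_cont (cder_xpath sh u).
exact: rcont_tpath.
Qed.

Lemma tpath_far sg u : T <= `|u| -> tpath g z T m sg u = tpath g z T m (-1) u.
Proof. by move=> h; rewrite /tpath /height bump_out // !mulr0. Qed.

(** For [|u| >= T] the tent vanishes and the paths of the two sheets coincide, so these points lie
    on both sheets. *)
Lemma xpath_side l u : match l with SdL => T <= u | SdR => u <= - T end ->
  Omega_side g l z (xpath (-1) u).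
Proof.
move=> hl; exists (tpath g z T m (-1) u) => //; split.
- exact: (xpath_Gam ShD).
- rewrite -(tpath_far 1); first exact: (xpath_Gam ShU).
  by have := T1; rewrite ler_normr; case: l hl => h T1'; apply/orP; [left|right]; lra.
- by have := T1; rewrite reC_tpath; case: l hl; lra.
Qed.

Lemma FD_model_path u : model_solution z (FD z) (xpath (-1) u).
Proof.
move=> i k; apply: (FD_model gam0 angle_lt zS) => //; first exact: c0_half.
exact: (xpath_Omega ShD).
Qed.

(** Nearby parameters give distinct points, as the method of isolated zeros requires. Equal points
    have equal [cexp (2 * (sqrt_eps z * t))], and the real part of [t] is the parameter. *)
Lemma xpath_inj u : exists2 d : R, 0 < d & forall v, `|v - u| < d ->
  xpath 1 v = xpath 1 u -> v = u.
Proof.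
have r0 := sqrt_eps_neq0 z.
have cl : rcont (fun v => 2 * (sqrt_eps z * tpath g z T m 1 v)) u.
  by apply: gcontM; [exact: gcont_cst|apply: gcontM; [exact: gcont_cst|exact: rcont_tpath]].
have [d d0 hd] := cl (1 / 10) (divr_gt0 ltr01 (ltr0n R 10)).
exists d => // v hv E.
have np w : csinh (sqrt_eps z * tpath g z T m 1 w) != 0.
  by apply: csinh_path_neq0 => //; rewrite normr1.
have /cexp_small_eq1 : cexp (2 * (sqrt_eps z * tpath g z T m 1 v) - 2 * (sqrt_eps z * tpath g z T m 1 u)) = 1.
  have := cexp_time (np v); have := cexp_time (np u); rewrite -!/(xpath 1 _) E => E1 E2.
  by rewrite cexpB E2 E1 divff // -E1 cexp_neq0.
have := hd v; rewrite ofR_dist => /(_ hv) hdv /(_ hdv).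
rewrite -mulrBr -mulrBr => /eqP; rewrite !mulf_eq0 pnatr_eq0 (negbTE r0) /= subr_eq0 => /eqP.
by move/(congr1 (@reC R)); rewrite !reC_tpath.
Qed.

(** The equation is inherited from [FD] on Omega_R only. The parameters near whose points it holds
    form a set that is open, and closed because the defect of the equation is analytic and its zeros
    would accumulate. *)
Lemma FU_model_path u : model_solution z (FU z) (xpath 1 u).
Proof.
have c0h := c0_half.
(* The propagation starts at [- V], which is at most [- T] and so lies on Omega_R, and covers
   [u]. *)
pose V := Num.max T `|u|.
have VT : T <= V by rewrite le_max lexx.
have Vu : - V <= u <= V by rewrite -ler_norml le_max lexx orbT.
have xc v : rcont (xpath 1) v by apply: (rcont_xpath ShU).
have FUa v i k : analytic_at (fun y => FU z y i k) (xpath 1 v).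
  by apply: (hFU zS).1; exact: (xpath_Omega ShU).
pose P v := cnear (xpath 1 v) (model_solution z (FU z)).
suff Pu : P u by exact: gnear_at Pu.
apply: (itv_connected (a := - V) (b := V) (P := P)) => //.
- by have /andP[h1 h2] := Vu; lra.
- have hs : Omega_side g SdR z (xpath 1 (- V)).
    rewrite /xpath tpath_far; first by apply: xpath_side; rewrite lerN2.
    by rewrite normrN (le_trans VT) // ler_norm.
  have s1 : cnear (xpath 1 (- V)) (fun y => cnear y (Omega_side g SdR z)).
    by apply: gnear_near; apply: (Omega_side_open gam0 angle_lt zS).
  apply: gnear_imp s1 => y hy i k.
  have hy0 := gnear_at hy.
  apply: (gderiv_ext (f := fun w => FD z w i k)).
    by apply: gnear_imp hy => w /((hFU zS).2) ->.
  rewrite (hFU zS).2 //; apply: (FD_model gam0 angle_lt zS) => //.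
  exact: (Omega_side_sub hy0).1.
- move=> v _ Pv.
  have [d d0 hd] := gcont_near (xc v) (gnear_near Pv).
  by exists d => // w _ hw; apply: hd; rewrite ofR_dist.
move=> v hv Pclose; set x := xpath 1 v.
have xe : cnear x (fun y => y ^+ 2 - eps z != 0).
  apply: (@gcont_near_neq0 _ _ _ (fun y : C => y ^+ 2 - eps z) x _ (xpath_neq ShU v)).
  apply: gcontB; last exact: gcont_cst.
  by apply: (@gcont_ext _ _ _ (fun x : C => x * x)); [exists 1|apply: gcontM; exact: (gderiv_cont (gderiv_io _ _))].
have ik i k : cnear x (fun y => cder (fun w => FU z w i k) y
    (lam sys (eps z) y i / (y ^+ 2 - eps z) * FU z y i k)).
  have [F1 [F1a hF1]] := analytic_deriv (FUa v i k).
  pose G y := (y ^+ 2 - eps z) * F1 y - lam sys (eps z) y i * FU z y i k.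
  have a1 : analytic_at (fun y => y ^+ 2 - eps z) x.
    have a0 : analytic_at (fun y : C => y ^+ 2) x.
      by apply: (@analytic_ext _ (fun y : C => y * y)); [exists 1|exact: (analyticM (analytic_id x) (analytic_id x))].
    exact: (analyticB a0 (analytic_cst _ _)).
  have a2 : analytic_at (fun y => lam sys (eps z) y i) x.
    exact: (analyticD (analytic_cst _ _) (analyticZ _ (analytic_id x))).
  have Ga : analytic_at G x := analyticB (analyticM a1 F1a) (analyticM a2 (FUa v i k)).
  (* If the property fails at [v], the approximating parameters differ from [v], so by [xpath_inj]
     the zeros they give differ from [x]. *)
  have [Pv|nPv] := pselect (P v).
    by apply: gnear_imp Pv => y; apply.
  have G0 : cnear x (fun y => G y = 0).
    apply: analytic_isolated => // d d0.
    have [d1 d10 hd1] := xc v d d0.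
    have [d2 d20 hd2] := xpath_inj v.
    have [d3 d30 hd3] := gcont_near (xc v) (gnear_and xe hF1).
    have [|w [hw1 hw2 Pw]] := Pclose (Num.min d1 (Num.min d2 d3)); first by rewrite !lt_min d10 d20.
    move: hw2; rewrite !lt_min => /and3P[k1 k2 k3].
    exists (xpath 1 w); split.
    - apply/eqP => /(hd2 w k2) wv; apply: nPv.
      by rewrite -wv.
    - by apply: hd1; rewrite ofR_dist.
    - have [|e1 e2] := hd3 w; first by rewrite ofR_dist.
      rewrite /G (gderiv_unique e2 (gnear_at Pw i k)) mulrA [(_ - _) * _]mulrC divfK // subrr //.
  apply: gnear_imp (gnear_and (gnear_and G0 hF1) xe) => y [[g0 h1] h2].
  apply: gderiv_eq h1; apply: (mulfI h2); rewrite mulrA [_ * (_ / _)]mulrC divfK //.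
  by apply/eqP; rewrite -subr_eq0; apply/eqP.
by apply: gnear_all => i; apply: gnear_all => k; exact: ik.
Qed.

Lemma F_model_path sh u : model_solution z (Fsheet FD FU sh z) (xpath (sheet_sign sh) u).
Proof. by case: sh; [exact: FD_model_path|exact: FU_model_path]. Qed.

Variables (c L : R) (d : side -> C -> 'rV[C]_n).
Hypotheses (cpos : 0 < c) (L0 : 0 <= L).
Hypothesis gap : forall sh u sl (q j : 'I_n), `|sl| <= tan (angle_of (gamma g)) -> (q < j)%N ->
  c <= reC ((1 + iC R * ofR sl) *
   (lam sys (eps z) (xpath (sheet_sign sh) u) q - lam sys (eps z) (xpath (sheet_sign sh) u) j)).
Hypothesis RemL : forall sh u i j, absC (Rem sys (eps z) (xpath (sheet_sign sh) u) i j) <= L.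
Hypothesis hends : forall l sh i k,
  H sh z x i k @[x --> within (Omega g sh z) (nbhs (xhat l z))] --> (diag_mx (d l z) i k : C).

Definition speed (sg u : R) : C := 1 + iC R * ofR (slope g z T m sg u).
Definition col_al (sg : R) (k i : 'I_n) (u : R) : C :=
  speed sg u * (lam sys (eps z) (xpath sg u) i - lam sys (eps z) (xpath sg u) k).
Definition col_rho (sg : R) (i j : 'I_n) (u : R) : C :=
  speed sg u * ((xpath sg u ^+ 2 - eps z) * Rem sys (eps z) (xpath sg u) i j).
Definition col_K : R := (1 + tan (angle_of (gamma g))) * ((4 / (bF g * m)) ^+ 2 * L).

Lemma H_end sh l i k (e : R) : 0 < e -> exists V : R, forall u,
  match l with SdL => V <= u | SdR => u <= - V end ->
  absC (H sh z (xpath (sheet_sign sh) u) i k - diag_mx (d l z) i k) <= e.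
Proof.
move=> e0; have := @hends l sh i k; move=> /cvg_absC /(_ e e0).
rewrite /within /= => /nbhs_absC [dl dl0 hdl].
set B := expR 1 * (4 / (bF g * m)).
have [_ _ b0 _ _] := angle_facts gam0 angle_lt.
have B0 : 0 < B by rewrite mulr_gt0 ?expR_gt0 // divr_gt0 // mulr_gt0 // divr_gt0.
have a0 : 0 < c0 g / s by rewrite divr_gt0 // expR_gt0.
exists (Num.max (c0 g / s + 1) (B / dl)) => u hu.
have [hu1 hu2] : match l with SdL => c0 g / s < u | SdR => u < - (c0 g / s) end /\ B / dl <= `|u|.
  have m1' : c0 g / s + 1 <= Num.max (c0 g / s + 1) (B / dl) by rewrite le_max lexx.
  have m2' : B / dl <= Num.max (c0 g / s + 1) (B / dl) by rewrite le_max lexx orbT.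
  by case: l hu {hdl} => hu; split; try lra; rewrite ler_normr; apply/orP; [left|right]; lra.
apply: ltW; apply: hdl; last exact: xpath_Omega.
have hx : absC (xpath (sheet_sign sh) u - xhat l z) <= B / (T + `|u|).
  by apply: xt_path_end => //; [exact: sheet_sign1|case: (l) hu1].
apply: (le_lt_trans hx).
move: hu2; rewrite ler_pdivrMr // => hu2.
by rewrite ltr_pdivrMr; have := T1; have := normr_ge0 u; nra.
Qed.

(** The equation of [H] times the velocity [dx / du], namely [speed] times [x^2 - eps]: the
    denominator of the diagonal part cancels, and the remainder term acquires the integrable
    weight. *)
Lemma column_of_H sh k : column_system T k c col_K (kinks g z T)
  (col_al (sheet_sign sh) k) (col_rho (sheet_sign sh))
  (fun i u => H sh z (xpath (sheet_sign sh) u) i k) (d SdR z 0 k).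
Proof.
have sg1 := sheet_sign1 sh.
have dH i u := H_ode zS (xpath_Omega sh u) (xpath_neq sh u) (F_model_path sh u) i k.
have sb u : u \notin kinks g z T -> `|slope g z T m (sheet_sign sh) u| <= tan (angle_of (gamma g)).
  by move=> us; apply: slope_bound.
split.
- move=> i u; apply: (gcont_comp (f := fun y => H sh z y i k)).
    exact: gderiv_cont (dH i u).
  exact: rcont_xpath.
- move=> i u us.
  have xe := xpath_neq sh u.
  have dx : rder (xpath (sheet_sign sh)) u ((xpath (sheet_sign sh) u ^+ 2 - eps z) * speed (sheet_sign sh) u).
    apply: (gderiv_comp (f := xt z)); first exact: cder_xpath.
    by apply: rder_tpath.
  apply: gderiv_eq (gderiv_comp (f := fun y => H sh z y i k) (dH i u) dx).
  rewrite /col_al /col_rho.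
  set X := xpath _ u in xe *; set S := speed _ u; set e := X ^+ 2 - eps z in xe *.
  have -> : \sum_(j < n) S * (e * Rem sys (eps z) X i j) * H sh z X j k =
     S * e * \sum_(j < n) Rem sys (eps z) X i j * H sh z X j k.
    by rewrite mulr_sumr; apply: eq_bigr => j _; ring.
  by field.
- move=> i u us ki; have := @gap sh u _ _ _ (sb u us) ki.
  rewrite /col_al -opprB mulrN reCN -/(speed _ _); lra.
- by move=> i u us ik; exact: (@gap sh u _ _ _ (sb u us) ik).
- by move=> u; rewrite /col_al subrr mulr0.
- move=> i j u us; rewrite /col_rho absCM /col_K -mulrA.
  have h1 : absC (speed (sheet_sign sh) u) <= 1 + tan (angle_of (gamma g)).
    by apply: absCD_le; rewrite ?absC1 // absCM absC_i mul1r absC_ofR; exact: sb.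
  apply: ler_pM; rewrite ?absC_ge0 //.
  rewrite absCM (_ : _ * L * _ = (4 / (bF g * m)) ^+ 2 * weight T u * L); last by ring.
  have h2 := @RemL sh u i j.
  have h3 : absC (xpath (sheet_sign sh) u ^+ 2 - eps z) <= (4 / (bF g * m)) ^+ 2 * weight T u.
    by apply: xt_path_deriv_bound.
  by apply: ler_pM => //; exact: absC_ge0.
- move=> e e0; have [V hV] := choice (fun i => H_end sh SdR i k e0).
  exists (\sum_(i < n) `|V i|) => u hu.
  have hu' i : u <= - V i.
    apply: (le_trans hu); rewrite lerN2 (le_trans (ler_norm _)) // (bigD1 i) //= lerDl.
    by rewrite sumr_ge0.
  split=> [|i ki]; first by have := hV k u (hu' k); rewrite mxE eqxx mulr1n.
  by have := hV i u (hu' i); rewrite mxE -val_eqE /= (gtn_eqF ki) mulr0n subr0.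
- move=> e e0; have [V hV] := choice (fun i => H_end sh SdL i k e0).
  exists (\sum_(i < n) `|V i|) => u hu i ik.
  have hu' : V i <= u.
    apply: (le_trans _ hu); rewrite (le_trans (ler_norm _)) // (bigD1 i) //= lerDl.
    by rewrite sumr_ge0.
  by have := hV i u hu'; rewrite mxE -val_eqE /= (ltn_eqF ik) mulr0n subr0.
Qed.

End OnPath.

End NormalizedSystem.

(** * The limit of the Stokes matrices *)

Section SmallEpsilon.
Variable R : realType.
Local Notation C := (CC R).
Variable g : geometry R.

#[global] Instance hat0_filter : Filter (hat0 g).
Proof.
apply: filter_from_filter; first by exists 1; exact: ltr01.
move=> a b a0 b0; exists (Num.min a b); first by rewrite /= lt_min a0.
by move=> z /= [zS]; rewrite lt_min => /andP[h1 h2].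
Qed.

Lemma hat0P (P : C -> Prop) : hat0 g P <-> exists2 d : R, 0 < d &
  forall z, sectorS g z -> absC (eps z) < d -> P z.
Proof.
split=> -[d d0 h]; exists d => //.
- by move=> z zS hz; apply: h.
- by move=> z [zS hz]; exact: h.
Qed.

Lemma hat0_proper : 0 < gamma g -> 0 < rho g -> ProperFilter (hat0 g).
Proof.
move=> g0 r0; apply: filter_from_proper => d /= d0.
pose a := Num.min (rho g) d / 2.
have a0 : 0 < a by rewrite divr_gt0 // lt_min r0.
have am : a < Num.min (rho g) d.
  by rewrite /a ltr_pdivrMr // ltr_pMr ?lt_min ?r0 // ltr1n.
move: am; rewrite lt_min => /andP[a1 a2].
(* The argument [2 * pi] is the middle of the sector. *)
pose w : C := Complex (ln a) (2 * pi); exists w.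
have hd : absC (eps w) < d by rewrite /eps absC_cexp /= lnK.
split; last exact: hd.
rewrite /sectorS /= lnK //; split => //.
by have := pi_gt0 R => p0; apply/andP; split; lra.
Qed.

Lemma expR_half_lt (z : C) (a : R) : 0 < a -> absC (eps z) < a ^+ 2 -> expR (reC z / 2) < a.
Proof.
move=> a0; rewrite absC_eps => h.
by rewrite -(ltr_pXn2r (n := 2)) ?nnegrE ?expR_ge0 // ltW.
Qed.

Definition mcvg (m n : nat) (A : C -> 'M[C]_(m, n)) (B : 'M[C]_(m, n)) : Prop :=
  forall i k, (fun z => A z i k : C) @ hat0 g --> (B i k : C).

Lemma cvg_near_eq (f h : C -> C) (l : C) : hat0 g (fun z => f z = h z) ->
  f @ hat0 g --> l -> h @ hat0 g --> l.
Proof.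
move=> E /cvg_absC hf; apply/cvg_absC => e e0.
by apply: filterS2 E (hf e e0) => z /= ->.
Qed.

Lemma cvg_gcont (f : C -> C) (h : C -> C) (l : C) : gcont id h l ->
  f @ hat0 g --> l -> (fun z => h (f z)) @ hat0 g --> h l.
Proof.
move=> hh /cvg_absC hf; apply/cvg_absC => e e0; have [d d0 hd] := hh e e0.
by apply: filterS (hf d d0) => z; exact: hd.
Qed.

Lemma cvgD_C (f h : C -> C) (a b : C) : f @ hat0 g --> a -> h @ hat0 g --> b ->
  (fun z => f z + h z) @ hat0 g --> a + b.
Proof. by move=> hf hh; exact: (@cvgD _ C _ _ _ f h a b hf hh). Qed.

Lemma cvgM_C (f h : C -> C) (a b : C) : f @ hat0 g --> a -> h @ hat0 g --> b ->
  (fun z => f z * h z) @ hat0 g --> a * b.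
Proof. by move=> hf hh; exact: (@cvgM C _ _ _ f h a b hf hh). Qed.

Lemma cvg_cst_C (a : C) : (fun=> a) @ hat0 g --> a.
Proof. exact: cvg_cst. Qed.

Lemma cvg_sum_C (I : Type) (r : seq I) (P : pred I) (f : I -> C -> C) (l : I -> C) :
  (forall i, f i @ hat0 g --> l i) ->
  (fun z => \sum_(i <- r | P i) f i z) @ hat0 g --> \sum_(i <- r | P i) l i.
Proof.
move=> h; elim: r => [|i r IH].
  rewrite big_nil; apply: (@cvg_near_eq (fun=> 0)); last exact: cvg_cst_C.
  by apply: filterE => z; rewrite big_nil.
rewrite big_cons; apply: (@cvg_near_eq (fun z => if P i
   then f i z + \sum_(j <- r | P j) f j z else \sum_(j <- r | P j) f j z)).
  by apply: filterE => z; rewrite big_cons.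
by case: (P i); [exact: (cvgD_C (h i) IH) | exact: IH].
Qed.

Lemma cvg_prod_C (I : Type) (r : seq I) (P : pred I) (f : I -> C -> C) (l : I -> C) :
  (forall i, f i @ hat0 g --> l i) ->
  (fun z => \prod_(i <- r | P i) f i z) @ hat0 g --> \prod_(i <- r | P i) l i.
Proof.
move=> h; elim: r => [|i r IH].
  rewrite big_nil; apply: (@cvg_near_eq (fun=> 1)); last exact: cvg_cst_C.
  by apply: filterE => z; rewrite big_nil.
rewrite big_cons; apply: (@cvg_near_eq (fun z => if P i
   then f i z * \prod_(j <- r | P j) f j z else \prod_(j <- r | P j) f j z)).
  by apply: filterE => z; rewrite big_cons.
by case: (P i); [exact: (cvgM_C (h i) IH) | exact: IH].
Qed.

Lemma mcvg_mul (m n p : nat) (A : C -> 'M[C]_(m, n)) (B : C -> 'M[C]_(n, p)) A0 B0 :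
  mcvg A A0 -> mcvg B B0 -> mcvg (fun z => A z *m B z) (A0 *m B0).
Proof.
move=> hA hB i k; rewrite mxE.
apply: (@cvg_near_eq (fun z => \sum_j A z i j * B z j k)).
  by apply: filterE => z; rewrite mxE.
by apply: cvg_sum_C => j; exact: (cvgM_C (hA i j) (hB j k)).
Qed.

Lemma mcvg_det (n : nat) (A : C -> 'M[C]_n) A0 : mcvg A A0 ->
  (fun z => \det (A z)) @ hat0 g --> \det A0.
Proof.
move=> hA; apply: cvg_sum_C => s; apply: cvgM_C; first exact: cvg_cst_C.
by apply: cvg_prod_C => i; exact: hA.
Qed.

(** By Cramer's formula, the determinant being eventually nonzero. *)
Lemma mcvg_inv (n : nat) (A : C -> 'M[C]_n) A0 : mcvg A A0 -> A0 \in unitmx ->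
  mcvg (fun z => invmx (A z)) (invmx A0).
Proof.
move=> hA A0u i k.
have d0 : \det A0 != 0 by rewrite -unitfE -unitmxE.
have hdet := mcvg_det hA.
rewrite /invmx A0u mxE.
apply: (@cvg_near_eq (fun z => (\det (A z))^-1 * \adj (A z) i k)).
  have /cvg_absC /(_ (absC (\det A0))) := hdet; rewrite absC_gt0 => /(_ d0).
  apply: filterS => z hz.
  have zd : \det (A z) != 0.
    by apply: contraTneq hz => ->; rewrite sub0r absCN ltxx.
  by rewrite /invmx unitmxE unitfE zd [RHS]mxE.
apply: cvgM_C; first by apply: (cvg_gcont (h := fun w : C => w^-1)) hdet; exact: gcont_inv.
rewrite mxE; apply: (@cvg_near_eq (fun z => cofactor (A z) k i)).
  by apply: filterE => z; rewrite mxE.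
apply: cvgM_C; first exact: cvg_cst_C.
apply: mcvg_det => i' k'; rewrite !mxE.
apply: (@cvg_near_eq (fun z => A z (lift k i') (lift i k'))); last exact: hA.
by apply: filterE => z; rewrite !mxE.
Qed.

End SmallEpsilon.

(** * Uniform continuity as the parameter tends to zero *)

Section UniformContinuity.
Variable R : realType.
Local Notation C := (CC R).

(** The parameters [e] and [e'] are both required to be near 0, not merely near each other: exactly
    what a Cauchy criterion along [hat0] needs. *)
Definition ucont (r : R) (q : C -> C -> C) : Prop := forall eta : R, 0 < eta ->
  exists2 d : R, 0 < d & forall e e' x x', absC e < d -> absC e' < d ->
    absC x <= r -> absC x' <= r -> absC (x - x') < d -> absC (q e x - q e' x') <= eta.

Definition ubounded (r : R) (q : C -> C -> C) (B : R) : Prop :=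
  exists2 d : R, 0 < d & forall e x, absC e < d -> absC x <= r -> absC (q e x) <= B.

Lemma ucontM r q q' B B' : 0 <= B -> 0 <= B' -> ucont r q -> ucont r q' ->
  ubounded r q B -> ubounded r q' B' -> ucont r (fun e x => q e x * q' e x).
Proof.
move=> B0 B'0 hq hq' [d1 d10 h1] [d2 d20 h2] eta eta0.
pose eta' := eta / (B + B' + 1).
have eta'0 : 0 < eta' by rewrite divr_gt0 //; lra.
have [d3 d30 h3] := hq _ eta'0; have [d4 d40 h4] := hq' _ eta'0.
exists (Num.min d1 (Num.min d2 (Num.min d3 d4))); first by rewrite !lt_min d10 d20 d30.
move=> e e' x x'; rewrite !lt_min => /and4P[a1 a2 a3 a4] /and4P[b1 b2 b3 b4] hx hx' /and4P[c1 c2 c3 c4].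
have -> : q e x * q' e x - q e' x' * q' e' x' =
   (q e x - q e' x') * q' e x + q e' x' * (q' e x - q' e' x') by ring.
apply: (@le_trans _ _ (eta' * B' + B * eta')).
  apply: absCD_le; rewrite absCM ler_pM ?absC_ge0 //.
  - exact: h3.
  - exact: h2.
  - exact: h1.
  - exact: h4.
have -> : eta = eta' * (B + B' + 1) by rewrite /eta' divfK // gt_eqF //; lra.
lra.
Qed.

Lemma analytic_near0 (f : C -> C) : analytic_at f 0 -> forall eta : R, 0 < eta ->
  exists2 d : R, 0 < d & forall e e', absC e < d -> absC e' < d ->
    absC (f e - f e') <= eta /\ absC (f e) <= absC (f 0) + eta.
Proof.
move=> /analytic_cont hf eta eta0; have [d d0 h] := hf (eta / 2) (divr_gt0 eta0 (ltr0n R 2)).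
exists d => // e e' he he'.
have h1 := h e; have h2 := h e'; rewrite /= !subr0 in h1 h2.
have {}h1 := h1 he; have {}h2 := h2 he'; split.
  rewrite (le_trans (absC_tri _ (f 0) _)) // [leRHS]splitr lerD // ?(ltW h1) //.
  by rewrite absCB ltW.
by rewrite -[f e](subrK (f 0)) addrC (le_trans (absCD _ _)) // lerD2l; lra.
Qed.

Lemma ucont_affine (r : R) (f h : C -> C) : 0 <= r -> analytic_at f 0 -> analytic_at h 0 ->
  ucont r (fun e x => f e + h e * x).
Proof.
move=> r0 hf hh eta eta0.
pose B := absC (h 0) + 1; have B0 : 0 < B by rewrite ltr_wpDl ?absC_ge0.
pose eta' := eta / (2 + r + B).
have eta'0 : 0 < eta' by rewrite divr_gt0 //; lra.
have [d1 d10 h1] := analytic_near0 hf eta'0.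
have [d2 d20 h2] := analytic_near0 hh eta'0.
have [d3 d30 h3] := analytic_near0 hh ltr01.
exists (Num.min (Num.min d1 d2) (Num.min d3 eta')); first by rewrite !lt_min d10 d20 d30.
move=> e e' x x'; rewrite !lt_min => /andP[/andP[a1 a2] /andP[a3 a4]] /andP[/andP[b1 b2] /andP[b3 b4]].
move=> hx hx' /andP[/andP[c1 c2] /andP[c3 c4]].
have -> : f e + h e * x - (f e' + h e' * x') = (f e - f e') + (h e * (x - x') + (h e - h e') * x') by ring.
apply: (@le_trans _ _ (eta' + (B * eta' + eta' * r))); last first.
  have -> : eta = eta' * (2 + r + B) by rewrite /eta' divfK // gt_eqF //; lra.
  lra.
apply: absCD_le; first by have [] := h1 e e' a1 b1.
have [h31 h32] := h3 e e' a3 b3; have [h21 h22] := h2 e e' a2 b2.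
by apply: absCD_le; rewrite absCM ler_pM ?absC_ge0 // ltW.
Qed.

Lemma ucont_lipschitz (r L : R) (q : C -> C -> C) : 0 < r -> 0 < L ->
  (forall e x e' x', absC e <= r -> absC x <= r -> absC e' <= r -> absC x' <= r ->
     absC (q e x - q e' x') <= L * (absC (e - e') + absC (x - x'))) -> ucont r q.
Proof.
move=> r0 L0 h eta eta0.
exists (Num.min r (eta / (3 * L))); first by rewrite lt_min r0 divr_gt0 // mulr_gt0.
move=> e e' x x'; rewrite !lt_min => /andP[a1 a2] /andP[b1 b2] hx hx' /andP[c1 c2].
apply: (le_trans (h _ _ _ _ (ltW a1) hx (ltW b1) hx')).
have := absCBD e e'; move: a2 b2 c2; rewrite !ltr_pdivlMr ?mulr_gt0 //.
nra.
Qed.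

Lemma ucont_weaken (r r' : R) q : r' <= r -> ucont r q -> ucont r' q.
Proof.
move=> rr h eta /h [d d0 hd]; exists d => // e e' x x' he he' hx hx'.
by apply: hd => //; exact: le_trans rr.
Qed.

Lemma ucont_flow (r : R) : 0 <= r -> r <= 1 -> ucont r (fun e x => x ^+ 2 - e).
Proof.
move=> r0 r1 eta eta0; exists (eta / 4); first by rewrite divr_gt0.
move=> e e' x x' he he' hx hx' hxx.
have -> : x ^+ 2 - e - (x' ^+ 2 - e') = (x - x') * (x + x') + (e' - e) by ring.
apply: (@le_trans _ _ (eta / 4 * 2 + (eta / 4 + eta / 4))); last by lra.
apply: absCD_le.
  by rewrite absCM ler_pM ?absC_ge0 ?(ltW hxx) // (le_trans (absCD _ _)) //; lra.
by rewrite (le_trans (absCBD _ _)) // lerD // ltW.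
Qed.

Lemma ubounded_flow (r : R) : 0 <= r -> r <= 1 -> ubounded r (fun e x => x ^+ 2 - e) 2.
Proof.
move=> r0 r1; exists 1 => // e x he hx; rewrite (le_trans (absCBD _ _)) // absCX.
by have := absC_ge0 x; nra.
Qed.

End UniformContinuity.

Section UnitDiagonal.
Variable R : realType.
Local Notation C := (CC R).

(** Diagonal dominance by columns: for a left null vector, the equation of the column indexed by its
    largest entry is contradictory. *)
Lemma near_scalar_unit (n : nat) (A : 'M[C]_n) (dd : 'I_n -> C) (kp : R) :
  (forall k, dd k != 0) -> kp * n%:R < 1 ->
  (forall i k, absC (A i k - (i == k)%:R * dd k) <= kp * absC (dd k)) -> A \in unitmx.
Proof.
move=> d0 hkp hA.
rewrite unitmxE unitfE; apply/negP => /det0P [v v0 vA].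
have [i0 hi0] : exists i, forall j, absC (v 0 j) <= absC (v 0 i).
  have /existsP [j0 _] : [exists j, v 0 j != 0].
    apply: contraNT v0 => /existsPn h; apply/eqP/rowP => j; rewrite mxE.
    by apply/eqP; rewrite -[_ == _]negbK; exact: h.
  pose i1 := [arg max_(i > j0) absC (v 0 i)]%O.
  exists i1 => j; rewrite /i1; case: arg_maxP => // i _ h; exact: h.
have vi0 : 0 < absC (v 0 i0).
  rewrite lt_neqAle absC_ge0 andbT eq_sym; apply: contra v0 => /eqP h.
  apply/eqP/rowP => j; rewrite mxE; apply: absC0_eq0; apply/eqP.
  by rewrite eq_le absC_ge0 andbT -h hi0.
have := congr1 (fun B : 'rV[C]_n => B 0 i0) vA; rewrite !mxE => E.
have E2 : v 0 i0 * dd i0 = - \sum_j v 0 j * (A j i0 - (j == i0)%:R * dd i0).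
  have -> : \sum_j v 0 j * (A j i0 - (j == i0)%:R * dd i0) = \sum_j v 0 j * A j i0 - v 0 i0 * dd i0.
    under eq_bigr do rewrite mulrBr.
    rewrite sumrB; congr (_ - _); rewrite (bigD1 i0) //= eqxx mul1r big1 ?addr0 //.
    by move=> j /negbTE ->; rewrite mul0r mulr0.
  by rewrite E sub0r opprK.
have : absC (v 0 i0) * absC (dd i0) <= absC (v 0 i0) * (kp * absC (dd i0)) * n%:R.
  rewrite -absCM E2 absCN (le_trans (absC_sum _ _ _)) //.
  apply: (@le_trans _ _ (\sum_(j < n) absC (v 0 i0) * (kp * absC (dd i0)))).
    by apply: ler_sum => j _; rewrite absCM ler_pM ?absC_ge0.
  by rewrite sumr_const card_ord -[leLHS]mulr_natr.
have di0 : 0 < absC (dd i0) by rewrite absC_gt0.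
have := mulr_gt0 vi0 di0; nra.
Qed.

End UnitDiagonal.

(** * Spectral gap and local bounds near the origin *)

Section LocalBounds.
Variable R : realType.
Local Notation C := (CC R).

Lemma fin_pos_lower (I : finType) (f : I -> R) : (forall i, 0 < f i) ->
  exists2 c : R, 0 < c & forall i, c <= f i.
Proof.
move=> f0; exists (\big[Num.min/1]_i f i); first by apply: lt_bigmin.
by move=> i; exact: bigmin_le_cond.
Qed.

Lemma lt_theta0 (n : nat) (sys : linear_family R n) (a : R) : 0 < a -> a < theta0 sys ->
  exists2 th, a < th & 0 < th < pi / 2 /\ forall q j : 'I_n, (q < j)%N ->
    0 <= reC (cexp (iC R * ofR th) * (lam sys 0 0 q - lam sys 0 0 j)) /\
    0 <= reC (cexp (- (iC R * ofR th)) * (lam sys 0 0 q - lam sys 0 0 j)).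
Proof.
move=> a0; rewrite /theta0; set S := [set th : R | _] => aS.
have [|th hS ath] := @sup_gt R S a _ aS; last by exists th.
apply/set0P/negP => /eqP S0; move: aS; rewrite S0 sup0.
by rewrite ltNge (ltW a0).
Qed.

Lemma reC_tilt (sl : R) (w : C) : reC ((1 + iC R * ofR sl) * w) = reC w - sl * imC w.
Proof. by rewrite mulrDl mul1r -mulrA reCD reC_iM imC_ofRM. Qed.

(** The definition of [theta0] gives non-strict inequalities at some [th > a]; the positive
    [sin (th - a)] makes them strict for slopes up to [tan a]. Differences with zero imaginary part
    are covered by the prenormal condition. *)
Lemma sector_gap (n : nat) (sys : linear_family R n) (a : R) : prenormal sys ->
  0 < a -> a < theta0 sys -> a < pi / 2 -> exists2 c : R, 0 < c &
  forall (sl : R) (q j : 'I_n), `|sl| <= tan a -> (q < j)%N ->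
    c <= reC ((1 + iC R * ofR sl) * (lam sys 0 0 q - lam sys 0 0 j)).
Proof.
move=> [_ _ _ hpos] a0 ath api.
have [th lt_a [/andP[th0 thpi] hth]] := lt_theta0 a0 ath.
have ca : 0 < cos a by apply: cos_gt0_pihalf; have := pi_gt0 R; lra.
have ct : 0 < cos th by apply: cos_gt0_pihalf; have := pi_gt0 R; lra.
have sd : 0 < sin (th - a) by apply: sin_gt0_pi; have := pi_gt0 R; lra.
have ta : 0 <= tan a.
  by rewrite /tan divr_ge0 ?(ltW ca) // ltW // sin_gt0_pi; have := pi_gt0 R; lra.
pose f (p : 'I_n * 'I_n) := if (p.1 < p.2)%N then
  reC (lam sys 0 0 p.1 - lam sys 0 0 p.2) - tan a * `|imC (lam sys 0 0 p.1 - lam sys 0 0 p.2)| else 1.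
have f0 p : 0 < f p.
  case: p => q j; rewrite /f /=; case: ifP => // qj.
  have := hpos q j qj; have := hth q j qj.
  move: (lam sys 0 0 q - lam sys 0 0 j) => w [].
  rewrite !reCM !reC_cexp !imC_cexp !reCN !imCN !reC_iM !imC_iM !imC_ofR !reC_ofR.
  rewrite !oppr0 !expR0 cosN sinN !mul1r => h1 h2 w0.
  have h3 : sin th * `|imC w| <= cos th * reC w.
    by have [iw|iw] := leP 0 (imC w); [rewrite ger0_norm //|rewrite ltr0_norm //]; lra.
  have [i0|i0] := eqVneq (imC w) 0; first by rewrite i0 normr0 mulr0 subr0.
  have iw : 0 < `|imC w| by rewrite normr_gt0.
  have E : tan a * cos a = sin a by rewrite /tan divfK // gt_eqF.
  have E2 : sin th = sin (th - a) * cos a + cos (th - a) * sin a by rewrite -sinD subrK.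
  have E3 : cos th = cos (th - a) * cos a - sin (th - a) * sin a by rewrite -cosD subrK.
  have E4 : sin th * cos a - cos th * sin a = sin (th - a).
    rewrite -sinB //.
  have : 0 < cos a * cos th * (reC w - tan a * `|imC w|).
    have -> : cos a * cos th * (reC w - tan a * `|imC w|) = cos a * (cos th * reC w)
      - cos th * (tan a * cos a) * `|imC w| by ring.
    rewrite E; have := ler_wpM2l (ltW ca) h3; have := mulr_gt0 sd iw; rewrite -E4; nra.
  by rewrite pmulr_rgt0 // mulr_gt0.
have [c c0 hc] := fin_pos_lower f0; exists c => // sl q j hsl qj.
apply: le_trans (hc (q, j)) _; rewrite /f /= qj reC_tilt.
move: (lam sys 0 0 q - lam sys 0 0 j) => w.
have : sl * imC w <= tan a * `|imC w|.
  by rewrite (le_trans (ler_norm _)) // normrM ler_wpM2r.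
lra.
Qed.

Lemma local_data (n : nat) (sys : linear_family R n) (a r : R) : prenormal sys -> 0 < r ->
  0 < a -> a < theta0 sys -> a < pi / 2 -> exists rx c L : R, [/\ [/\ 0 < rx, rx <= 1, rx < r, 0 < c & 0 < L],
  forall e x (sl : R) (q j : 'I_n), absC e <= rx -> absC x <= rx -> `|sl| <= tan a -> (q < j)%N ->
    c <= reC ((1 + iC R * ofR sl) * (lam sys e x q - lam sys e x j)),
  forall e x i j, absC e <= rx -> absC x <= rx -> absC (Rem sys e x i j) <= L,
  forall i, ucont rx (fun e x => lam sys e x i) &
  forall i j, ucont rx (fun e x => Rem sys e x i j)].
Proof.
move=> hsys r0 a0 ath api.
have [c c0 hc] := sector_gap hsys a0 ath api.
have ta : 0 < tan a.
  by rewrite /tan divr_gt0 // ?sin_gt0_pi ?cos_gt0_pihalf //; have := pi_gt0 R; lra.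
have [h0 h1 hR _] := hsys.
(* Two eigenvalues move by [eta] each and the factor has modulus at most [1 + tan a], so half of the
   gap survives. *)
pose eta := c / (4 * (1 + tan a)).
have eta0 : 0 < eta by rewrite divr_gt0 // mulr_gt0 //; lra.
have ul i (rr : R) : 0 <= rr -> ucont rr (fun e x => lam sys e x i).
  by move=> rr0; exact: (@ucont_affine R rr (fun e => Lam0 sys e 0 i) (fun e => Lam1 sys e 0 i)).
have dl i : exists d : R, 0 < d /\ forall e e' x x', absC e < d -> absC e' < d ->
    absC x <= 1 -> absC x' <= 1 -> absC (x - x') < d -> absC (lam sys e x i - lam sys e' x' i) <= eta.
  by have [d d0 hd] := ul i 1 ler01 _ eta0; exists d.
have [dlf hdl] := choice dl.
have [d1 d10 hd1] := fin_pos_lower (fun i => (hdl i).1).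
have dr (p : 'I_n * 'I_n) : exists rl : R * R, [/\ 0 < rl.1, 0 < rl.2,
    forall e x, absC e <= rl.1 -> absC x <= rl.1 -> absC (Rem sys e x p.1 p.2) <= rl.2 &
    ucont rl.1 (fun e x => Rem sys e x p.1 p.2)].
  have [rr [L [rr0 L0 hb hl]]] := analytic2_lipschitz (hR p.1 p.2).
  by exists (rr, L); split => //=; exact: ucont_lipschitz hl.
have [drf hdr] := choice dr.
have dr0 p : 0 < (drf p).1 by have [] := hdr p.
have [d2 d20 hd2] := fin_pos_lower dr0.
pose rx := Num.min (Num.min (d1 / 2) d2) (Num.min (r / 2) 1).
have [[k1 k2] [k3 k4]] : (rx <= d1 / 2 /\ rx <= d2) /\ (rx <= r / 2 /\ rx <= 1).
  by rewrite /rx !ge_min !lexx !orbT.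
have rx0 : 0 < rx by rewrite /rx !lt_min d20 ltr01 !divr_gt0.
exists rx, (c / 2), (1 + \sum_p (drf p).2); split.
- split => //; first by lra.
  + by rewrite divr_gt0.
  + by rewrite ltr_pwDl // sumr_ge0 // => p _; have [_ /ltW] := hdr p.
- move=> e x sl q j he hx hsl qj; have := hc sl q j hsl qj.
  have hh i : absC (lam sys e x i - lam sys 0 0 i) <= eta.
    have hdi := hd1 i; apply: (hdl i).2; rewrite ?subr0 ?absC0 //; move: hdi he hx k1 k4 d10; clear; lra.
  have -> : (1 + iC R * ofR sl) * (lam sys e x q - lam sys e x j) =
     (1 + iC R * ofR sl) * (lam sys 0 0 q - lam sys 0 0 j) +
     (1 + iC R * ofR sl) * ((lam sys e x q - lam sys 0 0 q) - (lam sys e x j - lam sys 0 0 j)) by ring.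
  rewrite reCD; set X := (_ * (_ - _ - _)).
  have : absC X <= (1 + tan a) * (eta + eta).
    rewrite /X absCM ler_pM ?absC_ge0 //.
      by apply: absCD_le; rewrite ?absC1 // absCM absC_i mul1r absC_ofR.
    by rewrite (le_trans (absCBD _ _)) // lerD.
  have -> : (1 + tan a) * (eta + eta) = c / 2.
    by rewrite /eta; field; rewrite gt_eqF //; move: ta; clear; lra.
  have := abs_reC X; rewrite ler_norml => /andP[h _]; move: h; clear; lra.
- move=> e x i j he hx; have [_ _ h _] := hdr (i, j).
  have h2 := hd2 (i, j).
  apply: (le_trans (h e x _ _)); rewrite /= ?(le_trans he) ?(le_trans hx) ?(le_trans k2) //.
  rewrite (bigD1 (i, j)) //= addrCA lerDl addr_ge0 // sumr_ge0 // => p _; by have [_ /ltW] := hdr p.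
- by move=> i; apply: ul; exact: ltW.
- move=> i j; have [_ _ _ h] := hdr (i, j); apply: ucont_weaken h.
  exact: le_trans (hd2 (i, j)).
Qed.

End LocalBounds.

(** * Convergence of the normalizing matrices at fixed times *)

Section StokesLimit.
Variable R : realType.
Local Notation C := (CC R).
Variables (n : nat) (sys : linear_family R n) (g : geometry R).
Variables (FD FU : C -> C -> 'M[C]_n) (H : sheet -> C -> C -> 'M[C]_n).
Hypotheses (hFD : is_FD sys g FD) (hFU : is_FU g FD FU).
Hypothesis hH : normalizing sys g FD FU H.
Hypotheses (gam0 : 0 < gamma g) (angle_lt : angle_of (gamma g) < pi / 2).
Hypotheses (c0p : 0 < c0 g) (c0small : c0 g * (1 + 2 / beta_of (gamma g)) <= 1 / 40).
Hypotheses (hgt0 : 0 < hgt g) (kap0 : 0 < kappa g) (kap1 : kappa g < 1 / 2) (rho0 : 0 < rho g).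
Hypothesis sh_small : forall z : C, sectorS g z -> expR (reC z / 2) * hgt g <= beta_of (gamma g).

Let tn := tan (angle_of (gamma g)).
Let proper0 : ProperFilter (hat0 g) := hat0_proper gam0 rho0.

Lemma hat0_small (a : R) : 0 < a -> hat0 g (fun z => sectorS g z /\ expR (reC z / 2) < a).
Proof.
move=> a0; apply/hat0P; exists (a ^+ 2); first by rewrite exprn_gt0.
by move=> z zS hz; split => //; exact: expR_half_lt.
Qed.

Lemma eps_cvg0 : @eps R @ hat0 g --> (0 : C).
Proof.
apply/cvg_absC => e e0; apply/hat0P; exists e => // z _ hz.
by move: hz; rewrite -[eps z]subr0.
Qed.

Lemma analytic_cvg0 (f : C -> C) : analytic_at f 0 -> (fun z => f (eps z)) @ hat0 g --> f 0.
Proof. by move=> hf; exact: (cvg_gcont (analytic_cont hf) eps_cvg0). Qed.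

Variables (rx c L T : R).
Hypotheses (rx0 : 0 < rx) (rx1 : rx <= 1) (rxr : rx < Defs.rad g) (cpos : 0 < c) (Lpos : 0 < L).
Hypothesis gap : forall e x (sl : R) (q j : 'I_n), absC e <= rx -> absC x <= rx -> `|sl| <= tn ->
  (q < j)%N -> c <= reC ((1 + iC R * ofR sl) * (lam sys e x q - lam sys e x j)).
Hypothesis RemL : forall e x i j, absC e <= rx -> absC x <= rx -> absC (Rem sys e x i j) <= L.
Hypothesis ulam : forall i, ucont rx (fun e x => lam sys e x i).
Hypothesis uRem : forall i j, ucont rx (fun e x => Rem sys e x i j).

Let m := Num.min 1 tn.
Let K := col_K g m L.
Hypothesis T1 : 1 <= T.
Hypothesis T_rx : 4 / (bF g * m) / T <= rx / 2.
Hypothesis T_col : n%:R * K * (c^-1 + 2) / T <= 1 / 2.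
Hypothesis T_unit : 2 * (n%:R * K * (c^-1 + 2) / T) * n%:R < 1.

Let tn0 : 0 < tn. Proof. by have [] := angle_facts gam0 angle_lt. Qed.
Let m0 : 0 < m. Proof. by rewrite lt_min ltr01 tn0. Qed.
Let m1 : m <= 1. Proof. by rewrite ge_min lexx. Qed.
Let mtan : m <= tan (angle_of (gamma g)). Proof. by rewrite ge_min lexx orbT. Qed.
Let K0 : 0 <= K.
Proof.
rewrite /K /col_K; apply: mulr_ge0; first by have := tn0; rewrite /tn; lra.
by apply: mulr_ge0; [exact: sqr_ge0|exact: ltW].
Qed.
Let eta1 := n%:R * K * (c^-1 + 2) / T.

(** The smallness of hat-epsilon demanded by the fixed [T]: the tent ends before [sigma] bends, and
    the path stays where the local bounds hold. *)
Definition good (z : C) : Prop := [/\ sectorS g z, expR (reC z / 2) * T <= c0 g,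
  expR (reC z / 2) + 4 / (bF g * m) / T <= rx & absC (eps z) <= rx].

Lemma good_near : hat0 g good.
Proof.
have T0 : 0 < T by apply: lt_le_trans T1.
have a0 : 0 < Num.min (c0 g / T) (rx / 2) by rewrite lt_min !divr_gt0.
apply: filterS (hat0_small a0) => z [zS]; rewrite lt_min => /andP[h1 h2].
have s0 := expR_ge0 (reC z / 2).
split=> //.
- by rewrite ltr_pdivlMr // in h1; exact: ltW.
- by have := T_rx; lra.
- rewrite absC_eps expr2; have := rx1; have := rx0; nra.
Qed.

Section GoodPoint.
Variables (d : side -> C -> 'rV[C]_n).
Hypothesis hends : forall l s z i k, sectorS g z ->
  H s z x i k @[x --> within (Omega g s z) (nbhs (xhat l z))] --> (diag_mx (d l z) i k : C).

Local Notation path z sh u := (xpath g z T m (sheet_sign R sh) u).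

Lemma path_bound z sh u : good z -> absC (path z sh u) <= rx.
Proof.
move=> [zS sT sr _]; apply: le_trans sr; apply: xt_path_bound => //.
exact: sheet_sign1.
Qed.

Lemma good_rad z : good z -> expR (reC z / 2) + 4 / (bF g * m) / T < Defs.rad g.
Proof. by move=> [_ _ h _]; exact: le_lt_trans rxr. Qed.

Lemma good_column z sh k : good z -> column_system T k c K (kinks g z T)
  (col_al sys g z T m (sheet_sign R sh) k) (col_rho sys g z T m (sheet_sign R sh))
  (fun i u => H sh z (path z sh u) i k) (d SdR z 0 k).
Proof.
move=> hz; have [zS sT sr er] := hz; have hr := good_rad hz.
have hg : forall (sh : sheet) (u sl : R) (q j : 'I_n), `|sl| <= tan (angle_of (gamma g)) ->
   (q < j)%N -> c <= reC ((1 + iC R * ofR sl) * (lam sys (eps z) (path z sh u) q -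
     lam sys (eps z) (path z sh u) j)).
  by move=> sh' u sl q j hsl qj; apply: gap => //; exact: path_bound.
have hR : forall sh u i j, absC (Rem sys (eps z) (path z sh u) i j) <= L.
  by move=> sh' u i j; apply: RemL => //; exact: path_bound.
apply: (column_of_H hH gam0 angle_lt zS T1 m0 m1 mtan c0p c0small sT hgt0 kap0 kap1
  (sh_small zS) hr hFD hFU hg hR _).
by move=> l s i k'; exact: hends.
Qed.

Lemma cs_weaken (k : 'I_n) c' K' s s' al rh y w : {subset s <= s'} ->
  column_system T k c' K' s al rh y w -> column_system T k c' K' s' al rh y w.
Proof.
move=> ss [h1 h2 h3 h4 h5 h6 h7 h8].
have hn u : u \notin s' -> u \notin s by apply: contra => /ss.
split=> //.
- by move=> i u /hn; exact: h2.
- by move=> i u /hn; exact: h3.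
- by move=> i u /hn; exact: h4.
- by move=> i j u /hn; exact: h6.
Qed.

Lemma tpath_same z z' sg u : `|u| <= c0 g / expR (reC z / 2) -> `|u| <= c0 g / expR (reC z' / 2) ->
  tpath g z T m sg u = tpath g z' T m sg u.
Proof. by move=> h h'; rewrite /tpath /height !sigma_in. Qed.

Lemma path_close z z' sh u : good z -> good z' ->
  `|u| <= c0 g / expR (reC z / 2) -> `|u| <= c0 g / expR (reC z' / 2) ->
  absC (path z sh u - path z' sh u) <= 40 * expR (reC z / 2) + 40 * expR (reC z' / 2).
Proof.
move=> [zS sT sr er] [zS' sT' sr' er'] h h'; rewrite /xpath.
have sg1 := sheet_sign1 R sh.
have h1 := xt_path_limit gam0 angle_lt T1 m0 m1 c0p c0small sT sg1 h.
have h2 := xt_path_limit gam0 angle_lt T1 m0 m1 c0p c0small sT' sg1 h'.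
rewrite -(tpath_same (sheet_sign R sh) h h') in h2 *.
set p := xt z _ in h1 *; set p' := xt z' _ in h2 *; set t := _^-1 in h1 h2.
have -> : p - p' = (p + t) - (p' + t) by ring.
by rewrite (le_trans (absCBD _ _)) // lerD.
Qed.

(** Two parameters are compared on a window [[-U, U]] chosen from [e] alone; only afterwards is
    hat-epsilon taken so small that both paths are flat outside the tent on that window and have the
    same times. *)
Lemma H_cauchy sh (u : R) i k (d0 : C) : (fun z => d SdR z 0 k) @ hat0 g --> d0 ->
  exists l : C, (fun z => H sh z (path z sh u) i k : C) @ hat0 g --> l.
Proof.
move=> hd; apply: (C_cauchy proper0) => e e0.
have ci : 0 < c^-1 by rewrite invr_gt0.
pose D := absC d0 + 1; have D0 : 0 < D by rewrite ltr_wpDl ?absC_ge0.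
pose tau := 2 * (n%:R * K) * (c^-1 + 1) * D.
have nK0 : 0 <= n%:R * K := mulr_ge0 (ler0n R n) K0.
have tau0 : 0 <= tau.
  by rewrite /tau; apply: mulr_ge0; [apply: mulr_ge0; [apply: mulr_ge0|]|]; lra.
pose U := `|u| + tau / (e / 8).
have e8 : 0 < e / 8 by rewrite divr_gt0.
have U0 : 0 <= tau / (e / 8) by rewrite divr_ge0 // ltW.
have Uu : `|u| <= U by rewrite /U lerDl.
have U00 : 0 <= U := le_trans (normr_ge0 _) Uu.
have htail (w : C) : absC w <= D -> tail n T c K w U <= e / 8.
  move=> hw; rewrite /tail ler_pdivrMr; last by have := T1; lra.
  apply: (@le_trans _ _ tau); first by rewrite /tau ler_wpM2l //; apply: mulr_ge0; [apply: mulr_ge0|]; lra.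
  have -> : tau = e / 8 * (tau / (e / 8)) by rewrite mulrC divfK // gt_eqF.
  rewrite ler_wpM2l ?(ltW e8) // /U; have := T1; have := normr_ge0 u; lra.
pose Q := (1 + n%:R) * (2 * D) * (c^-1 + 2 * U).
have Q0 : 0 < Q.
  by rewrite /Q !mulr_gt0 //; have := ler0n R n; lra.
(* [column_diff] doubles a sum of four terms: two tails, the difference of the diagonal limits and
   the forcing. Each gets [e / 8]. *)
pose eta := e / 8 / Q; have eta0 : 0 < eta by rewrite divr_gt0.
pose eta' := eta / (2 * (1 + tn)).
have tn1 : 0 < 1 + tn by have := tn0; lra.
have eta'0 : 0 < eta' by rewrite divr_gt0 // mulr_gt0.
have uflow : forall i j, ucont rx (fun e x => (x ^+ 2 - e) * Rem sys e x i j).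
  move=> i' j; apply: (@ucontM R rx (fun e x => x ^+ 2 - e) (fun e x => Rem sys e x i' j) 2 L).
  - by [].
  - exact: ltW.
  - by apply: ucont_flow => //; exact: ltW.
  - exact: uRem.
  - by apply: ubounded_flow => //; exact: ltW.
  - by exists rx => // e' x /ltW he hx; exact: RemL.
have hl j : exists dd : R, 0 < dd /\ forall e e' x x', absC e < dd -> absC e' < dd ->
    absC x <= rx -> absC x' <= rx -> absC (x - x') < dd -> absC (lam sys e x j - lam sys e' x' j) <= eta'.
  by have [dd dd0 h] := ulam j eta'0; exists dd.
have hr (p : 'I_n * 'I_n) : exists dd : R, 0 < dd /\ forall e e' x x', absC e < dd -> absC e' < dd ->
    absC x <= rx -> absC x' <= rx -> absC (x - x') < dd ->
    absC ((x ^+ 2 - e) * Rem sys e x p.1 p.2 - (x' ^+ 2 - e') * Rem sys e' x' p.1 p.2) <= eta'.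
  by have [dd dd0 h] := uflow p.1 p.2 _ eta'0; exists dd.
have [lf hlf] := choice hl; have [rf hrf] := choice hr.
have [d1 d10 hd1] := fin_pos_lower (fun j => (hlf j).1).
have [d2 d20 hd2] := fin_pos_lower (fun j => (hrf j).1).
pose dd := Num.min d1 d2.
have dd0 : 0 < dd by rewrite lt_min d10.
have [dd1 dd2] : dd <= d1 /\ dd <= d2 by rewrite /dd !ge_min !lexx orbT.
(* [dd / 80] matches the two errors [40 * s] of [path_close]; the second entry pushes the bends of
   [sigma] outside the window. *)
pose a := Num.min (dd / 80) (c0 g / (U + 1)).
have a0 : 0 < a by rewrite lt_min !divr_gt0 // ltr_wpDl.
have hdd : hat0 g (fun z => absC (d SdR z 0 k - d0) < Num.min 1 (e / 16)).
  by have /cvg_absC := hd; apply; rewrite lt_min ltr01 divr_gt0.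
have hee : hat0 g (fun z => absC (eps z) < dd) by apply/hat0P; exists dd.
exists (fun z => [/\ good z, expR (reC z / 2) < a, absC (d SdR z 0 k - d0) < Num.min 1 (e / 16) & absC (eps z) < dd]).
  apply: filterS2 (filterI good_near (hat0_small a0)) (filterI hdd hee).
  by move=> z [h1 [_ h2]] [h3 h4].
move=> z z' [gz sz dz ez] [gz' sz' dz' ez'].
have hD (w : C) : absC (w - d0) < Num.min 1 (e / 16) -> absC w <= D.
  rewrite lt_min => /andP[h _]; rewrite -[w](subrK d0) addrC (le_trans (absCD _ _)) //.
  by rewrite lerD2l ltW.
have dzz : absC (d SdR z 0 k - d SdR z' 0 k) <= e / 8.
  move: dz dz'; rewrite !lt_min => /andP[_ h1] /andP[_ h2].
  rewrite (le_trans (absC_tri _ d0 _)) // [absC (d0 - _)]absCB (_ : e / 8 = e / 16 + e / 16); last by field.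
  exact: lerD (ltW h1) (ltW h2).
(* The two paths bend at different abscissas; both systems are weakened to the union of the
   exceptional sets. *)
have sub1 : {subset kinks g z T <= kinks g z T ++ kinks g z' T} by move=> v hv; rewrite mem_cat hv.
have sub2 : {subset kinks g z' T <= kinks g z T ++ kinks g z' T} by move=> v hv; rewrite mem_cat hv orbT.
have cz := cs_weaken sub1 (good_column sh k gz).
have cz' := cs_weaken sub2 (good_column sh k gz').
have hin (y : C) v : expR (reC y / 2) < a -> - U <= v <= U -> `|v| < c0 g / expR (reC y / 2).
  rewrite lt_min => /andP[_ h]; rewrite -ler_norml => hv.
  rewrite ltr_pdivlMr ?expR_gt0 //; move: h; rewrite ltr_pdivlMr ?ltr_wpDl // => h.
  by apply: le_lt_trans h; rewrite mulrC ler_wpM2l ?expR_ge0 // (le_trans hv) // lerDl.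
have sp v : - U <= v <= U -> v \notin kinks g z T ++ kinks g z' T ->
    speed g z T m (sheet_sign R sh) v = speed g z' T m (sheet_sign R sh) v /\
    absC (speed g z T m (sheet_sign R sh) v) <= 1 + tn.
  move=> hv; rewrite mem_cat negb_or => /andP[k1 k2]; split.
    by rewrite /speed !slope_in //; apply: hin.
  have [zS sT _ _] := gz.
  apply: absCD_le; rewrite ?absC1 // absCM absC_i mul1r absC_ofR.
  by apply: slope_bound => //; exact: sheet_sign1.
have pc v : - U <= v <= U -> absC (path z sh v - path z' sh v) < dd.
  move=> hv; apply: (le_lt_trans (path_close sh gz gz' (ltW (hin _ _ sz hv)) (ltW (hin _ _ sz' hv)))).
  by move: sz sz'; rewrite !lt_min => /andP[h1 _] /andP[h2 _]; lra.
have hlam j v : - U <= v <= U -> absC (lam sys (eps z) (path z sh v) j - lam sys (eps z') (path z' sh v) j) <= eta'.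
  move=> hv; have hj := hd1 j; have hp := pc v hv.
  by apply: (hlf j).2; rewrite ?path_bound //; apply: lt_le_trans (le_trans dd1 hj).
have E1 : (1 + tn) * (eta' + eta') = eta by rewrite /eta'; field; rewrite gt_eqF.
apply: (le_trans (@column_diff R n T k c K T1 cpos K0 T_col _ _ _ _ _ _ _ _ _ U eta cz cz' U00 (ltW eta0) _ _ i u _)).
- move=> j v hv vs; have [s1 s2] := sp v hv vs; rewrite /col_al -s1 -mulrBr absCM -E1.
  rewrite ler_pM ?absC_ge0 //.
  set A1 := lam _ _ _ _; set A2 := lam _ _ _ _; set A3 := lam _ _ _ _; set A4 := lam _ _ _ _.
  have -> : A1 - A2 - (A3 - A4) = (A1 - A3) - (A2 - A4) by ring.
  by rewrite (le_trans (absCBD _ _)) // lerD // hlam.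
- move=> j j' v hv vs; have [s1 s2] := sp v hv vs; rewrite /col_rho -s1 -mulrBr absCM -E1.
  rewrite ler_pM ?absC_ge0 //; apply: (@le_trans _ _ eta'); last by rewrite lerDl ltW.
  have hj := hd2 (j, j'); have hp := pc v hv.
  by apply: (hrf (j, j')).2; rewrite ?path_bound //; apply: lt_le_trans (le_trans dd2 hj).
- by rewrite -ler_norml.
have t1 := htail _ (hD _ dz); have t2 := htail _ (hD _ dz').
have t3 : eta * ((1 + n%:R) * (2 * absC (d SdR z' 0 k))) * (c^-1 + 2 * U) <= e / 8.
  have -> : e / 8 = eta * Q by rewrite /eta divfK // gt_eqF.
  rewrite -mulrA ler_wpM2l ?(ltW eta0) // /Q ler_wpM2r //; first by rewrite addr_ge0 ?(ltW ci) // mulr_ge0.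
  by rewrite ler_wpM2l ?addr_ge0 // ler_wpM2l // hD.
lra.
Qed.

(** The estimate of [column_near] passes to the limit, so column [k] stays close to [d0 k] times a
    basis vector, relatively to [d0 k]; the choice of [T] makes this diagonally dominant. *)
Lemma H_limit sh (u : R) (d0 : 'I_n -> C) : (forall k, d0 k != 0) ->
  (forall k, (fun z => d SdR z 0 k) @ hat0 g --> d0 k) ->
  exists2 HL : 'M[C]_n, HL \in unitmx & mcvg g (fun z => H sh z (path z sh u)) HL.
Proof.
move=> d00 hd.
have hex (p : 'I_n * 'I_n) : exists l : C, (fun z => H sh z (path z sh u) p.1 p.2 : C) @ hat0 g --> l.
  exact: H_cauchy (hd p.2).
have [lf hlf] := choice hex.
pose HL : 'M[C]_n := \matrix_(i, k) lf (i, k).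
have hHL : mcvg g (fun z => H sh z (path z sh u)) HL.
  by move=> i k; rewrite mxE; exact: hlf (i, k).
exists HL => //.
apply: (near_scalar_unit d00 T_unit) => i k; rewrite -/eta1.
have e10 : 0 <= eta1.
  have ci : 0 < c^-1 by rewrite invr_gt0.
  by rewrite /eta1 divr_ge0 //; [apply: mulr_ge0; [exact: mulr_ge0 (ler0n R n) K0|lra] | have := T1; lra].
apply/ler_addgt0Pr => e e0; pose e' := e / (2 + 2 * eta1).
have e'0 : 0 < e' by rewrite divr_gt0 //; lra.
have /cvg_absC /(_ e' e'0) h1 := hHL i k.
have /cvg_absC /(_ e' e'0) h2 := hd k.
have [z [gz [h3 h4]]] := @filter_ex _ _ proper0 _ (filterI good_near (filterI h1 h2)).
have := column_near T1 cpos K0 T_col (good_column sh k gz) i u.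
rewrite -/eta1 /= in h3 h4 *; set X := H _ _ _ _ _ in h3 *; set w := d _ _ _ _ in h4 * => h5.
have E : e = e' * (2 + 2 * eta1) by rewrite /e' divfK // gt_eqF //; lra.
have -> : HL i k - (i == k)%:R * d0 k = - (X - HL i k) + (X - (i == k)%:R * w) + (i == k)%:R * (w - d0 k) by ring.
have w1 : absC w <= absC (d0 k) + e'.
  by rewrite -[w](subrK (d0 k)) addrC (le_trans (absCD _ _)) // lerD2l ltW.
have b1 : absC ((i == k)%:R * (w - d0 k)) <= e'.
  by rewrite absCM absC_nat (le_trans _ (ltW h4)) //; case: (i == k); rewrite ?mul1r ?mul0r ?absC_ge0.
have b2 : absC (- (X - HL i k)) <= e' by rewrite absCN ltW.
apply: (le_trans (absCD_le (absCD_le b2 h5) b1)).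
have := ler_wpM2l e10 w1; lra.
Qed.

End GoodPoint.

End StokesLimit.

(** * Convergence of the inverse Stokes matrices *)

Section StokesLimitTheorem.
Variable R : realType.
Local Notation C := (CC R).
Variables (n : nat) (sys : linear_family R n) (g : geometry R).
Variables (FD FU : C -> C -> 'M[C]_n) (H : sheet -> C -> C -> 'M[C]_n).
Variable St : side -> C -> 'M[C]_n.

Lemma mulmx1_invmx (A B : 'M[C]_n) : A *m B = 1%:M -> invmx A = B.
Proof. by move=> AB; have [Au _] := mulmx1_unit AB; rewrite -[LHS]mulmx1 -AB mulKmx. Qed.

Hypothesis hsys : prenormal sys.
Hypotheses (hFD : is_FD sys g FD) (hFU : is_FU g FD FU).
Hypotheses (hH : normalizing sys g FD FU H) (hSt : unfolded_stokes g FD H St).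
Hypotheses (gam0 : 0 < gamma g) (angle_lt : angle_of (gamma g) < pi / 2).
Hypothesis angle_theta : angle_of (gamma g) < theta0 sys.
Hypotheses (c0p : 0 < c0 g) (c0small : c0 g * (1 + 2 / beta_of (gamma g)) <= 1 / 40).
Hypotheses (hgt0 : 0 < hgt g) (kap0 : 0 < kappa g) (kap1 : kappa g < 1 / 2) (rho0 : 0 < rho g).
Hypotheses (del0 : 0 < delta g) (rad0 : 0 < Defs.rad g).
Hypothesis sh_small : forall z : C, sectorS g z -> expR (reC z / 2) * hgt g <= beta_of (gamma g).

(** [w] is the logarithm of the limiting point [-1 / t], and its imaginary part selects the branch
    that [is_FD] prescribes in the limit. *)
Lemma FD_limit (w t : C) : t = - cexp (- w) -> absC (cexp w) < Defs.rad g ->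
  - (pi + delta g) < imC w < delta g -> imC t < hgt g ->
  hat0 g (fun z => sectorS g z /\ Defs.Gam g ShD z t) ->
  exists2 F0 : 'M[C]_n, F0 \in unitmx & mcvg g (fun z => FD z (xt z t)) F0.
Proof.
move=> tw hw iw it hG.
have [Lg [_ _ hL hE]] := hFD; have [h0 h1 _ _] := hsys.
have {}hL := hL w hw iw; rewrite -tw in hL.
have {}hL := hL it.
pose v i := cexp (t * Lam0 sys 0 0 i + Lam1 sys 0 0 i / 2 * (2 * w)).
exists (diag_mx (\row_i v i)).
  rewrite unitmxE det_diag unitfE; apply/prodf_neq0 => i _.
  by rewrite mxE cexp_neq0.
move=> i k; rewrite !mxE.
apply: (@cvg_near_eq _ _ (fun z => cexp (t * Lam0 sys (eps z) 0 i + Lam1 sys (eps z) 0 i / 2 * Lg z t) * (i == k)%:R)).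
  by apply: filterS hG => z [zS zG]; rewrite hE // !mxE mulr_natr.
have -> : v i *+ (i == k) = v i * (i == k)%:R by rewrite mulr_natr.
apply: (@cvgM_C _ _ (fun z => cexp (t * Lam0 sys (eps z) 0 i +
  Lam1 sys (eps z) 0 i / 2 * Lg z t)) (fun=> (i == k)%:R)); last exact: cvg_cst_C.
apply: (@cvg_gcont _ _ _ (@cexp R)); first exact: gderiv_cont (gderiv_cexp _).
apply: (@cvgD_C _ _ (fun z => t * Lam0 sys (eps z) 0 i) (fun z => Lam1 sys (eps z) 0 i / 2 * Lg z t)).
  have q0 := @analytic_cvg0 R g (fun e => Lam0 sys e 0 i) (h0 i).
  exact: (cvgM_C (@cvg_cst_C R g t) q0).
exact: (cvgM_C (cvgM_C (@analytic_cvg0 R g (fun e => Lam1 sys e 0 i) (h1 i)) (@cvg_cst_C R g 2^-1)) hL).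
Qed.

Lemma stokes_limit_holds : stokes_limit g St.
Proof.
have [_ a0 b0 b1 tn0] := angle_facts gam0 angle_lt.
have [rx [c [L [[rx0 rx1 rxr cpos Lpos] gap RemL ulam uRem]]]] := local_data hsys rad0 a0 angle_theta angle_lt.
pose m := Num.min 1 (tan (angle_of (gamma g))).
have m0 : 0 < m by rewrite lt_min ltr01.
have m1 : m <= 1 by rewrite ge_min lexx.
pose K := col_K g m L.
have K0 : 0 <= K.
  rewrite /K /col_K; apply: mulr_ge0; first by rewrite addr_ge0 ?(ltW tn0).
  by apply: mulr_ge0; [exact: sqr_ge0|exact: ltW].
have bF0 : 0 < bF g by rewrite divr_gt0.
have bF1 : bF g <= 1 by rewrite /bF ler_pdivrMr //; lra.
pose B1 := 4 / (bF g * m); pose B2 := n%:R * K * (c^-1 + 2).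
have B10 : 1 <= B1.
  rewrite /B1 ler_pdivlMr ?mulr_gt0 // mul1r (@le_trans _ _ 1) ?ler1n //.
  by rewrite -[leRHS]mulr1 ler_pM // ltW.
have B20 : 0 <= B2.
  have ci : 0 < c^-1 by rewrite invr_gt0.
  by rewrite /B2; apply: mulr_ge0; [exact: mulr_ge0 (ler0n R n) K0|lra].
(* One summand for each requirement on [T] below. *)
pose T := 1 + 2 * B1 / rx + 2 * B2 + 2 * B2 * n%:R.
have q1 : 0 <= 2 * B1 / rx by apply: divr_ge0; lra.
have q2 : 0 <= 2 * B2 * n%:R by rewrite mulr_ge0 // mulr_ge0.
have T1 : 1 <= T by rewrite /T; lra.
have T0 : 0 < T by lra.
have T_rx : B1 / T <= rx / 2.
  rewrite ler_pdivrMr //; have E : B1 = rx / 2 * (2 * B1 / rx) by field; rewrite gt_eqF.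
  rewrite {1}E ler_wpM2l ?divr_ge0 ?(ltW rx0) // /T; lra.
have T_col : B2 / T <= 1 / 2 by rewrite ler_pdivrMr // /T; lra.
have T_unit : 2 * (B2 / T) * n%:R < 1.
  by rewrite mulrA mulrAC ltr_pdivrMr // /T; lra.
have TG := good_near c0p rx0 rx1 T1 T_rx.
have [d [d1 _ _ d3]] := H_ends hH.
(* The limits at x_R serve for both sides, since the diagonal entry of a column is always determined
   from the left end of the path. *)
have d0ex i : exists d0 : C, d0 != 0 /\ (fun z => d SdR z 0 i) @ hat0 g --> d0.
  by have [d0 h1 h2] := d3 SdR i; exists d0.
have [d0 hd0] := choice d0ex.
move=> l.
pose u := match l with SdL => T | SdR => - T end.
have uT : `|u| = T by rewrite /u; case: (l); rewrite ?normrN ger0_norm // ltW.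
have HU_lim sh := @H_limit R n sys g FD FU H hFD hFU hH gam0 angle_lt c0p c0small hgt0 kap0 kap1 rho0 sh_small
  rx c L T rx0 rx1 rxr cpos Lpos gap RemL ulam uRem T1 T_rx T_col T_unit d d1 sh u d0
  (fun i => (hd0 i).1) (fun i => (hd0 i).2).
have pathE z sh : good g rx T z -> xpath g z T m (sheet_sign R sh) u = xt z (ofR u).
  by move=> [_ sT _ _]; rewrite /xpath tpath_T.
have Hlim sh : exists2 HL : 'M[C]_n, HL \in unitmx & mcvg g (fun z => H sh z (xt z (ofR u))) HL.
  have [HL HLu hHL] := HU_lim sh; exists HL => // i k.
  apply: cvg_near_eq (hHL i k); apply: filterS TG => z gz.
  by rewrite pathE.
have side z : good g rx T z -> Omega_side g l z (xt z (ofR u)).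
  move=> gz; rewrite -(pathE z ShD) //; have [zS sT sr _] := gz.
  apply: xpath_side => //; first exact: le_lt_trans rxr.
  by rewrite /u; case: (l).
have GamT z : good g rx T z -> Defs.Gam g ShD z (ofR u).
  move=> gz; have [zS sT sr _] := gz; rewrite -(tpath_T m T1 sT (-1) uT).
  by apply: (xpath_Gam gam0 angle_lt zS T1 m0 m1 c0p c0small sT hgt0 kap0 _ ShD); exact: le_lt_trans rxr.
(* At [t = T] the limiting point is [-1 / T], of argument [- pi] on the sheet D; at [t = - T] it is
   [1 / T], of argument 0. *)
pose w : C := match l with SdL => ofR (- ln T) - iC R * ofR pi | SdR => ofR (- ln T) end.
have piR := pi_gt0 R.
have wu : ofR u = - cexp (- w).
  rewrite /u /w; case: (l).
    rewrite opprB addrC ofRN cexpD.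
    have -> : cexp (- - ofR (ln T)) = ofR T.
      by apply: ceqP; rewrite opprK ?reC_cexp ?imC_cexp /= ?cos0 ?sin0 ?lnK // ?mulr1 ?mulr0.
    have -> : cexp (iC R * ofR pi) = -1.
      apply: ceqP; rewrite ?reC_cexp ?imC_cexp !reC_iM !imC_iM !imC_ofR !reC_ofR oppr0 expR0 ?cospi ?sinpi ?reCN ?imCN ?reC1 ?imC1; lra.
    by rewrite mulrN1 opprK.
  rewrite !ofRN opprK; congr (- _).
  by apply: ceqP; rewrite ?reC_cexp ?imC_cexp /= ?cos0 ?sin0 ?lnK // ?mulr1 ?mulr0.
have [F0 F0u hF0] : exists2 F0 : 'M[C]_n, F0 \in unitmx & mcvg g (fun z => FD z (xt z (ofR u))) F0.
  apply: (FD_limit wu) => //.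
  - have -> : absC (cexp w) = T^-1.
      rewrite absC_cexp -[in RHS](lnK T0) -expRN; congr expR.
      by rewrite /w; case: (l); rewrite ?reCB ?reC_iM ?imC_ofR ?reC_ofR ?oppr0 ?addr0.
    apply: le_lt_trans rxr; apply: le_trans (_ : rx / 2 <= rx); last by rewrite ler_pdivrMr // ler_peMr ?ler1n // ltW.
    apply: le_trans T_rx; rewrite ler_peMl // invr_ge0 ltW //.
  - have iw : imC w = match l with SdL => - pi | SdR => 0 end.
      by rewrite /w; case: (l); rewrite ?imCB ?imC_iM ?imC_ofR ?reC_ofR ?sub0r.
    rewrite iw; case: (l); first by rewrite ltrN2 ltrDl del0 /=; apply: lt_trans del0; rewrite oppr_lt0.
    by rewrite oppr_lt0 del0 andbT addr_gt0.
  - by apply: filterS TG => z gz; split; [have [] := gz|exact: GamT].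
have [HD0 HD0u hHD] := Hlim ShD; have [HU0 HU0u hHU] := Hlim ShU.
(* The limit of [F_D^-1 H_U^-1 H_D F_D], the inverse of [C_l] read off at the common point [u]. *)
exists (invmx F0 *m (invmx HU0 *m (HD0 *m F0))).
  by rewrite !unitmx_mul !unitmx_inv F0u HU0u HD0u.
have hlim : mcvg g (fun z => invmx (FD z (xt z (ofR u))) *m (invmx (H ShU z (xt z (ofR u))) *m
    (H ShD z (xt z (ofR u)) *m FD z (xt z (ofR u))))) (invmx F0 *m (invmx HU0 *m (HD0 *m F0))).
  apply: mcvg_mul; first exact: mcvg_inv.
  by apply: mcvg_mul; [exact: mcvg_inv|exact: mcvg_mul].
move=> i k; apply: cvg_near_eq (hlim i k); apply: filterS TG => z gz.
have [zS _ _ _] := gz; have hs := side z gz; have [oD oU] := Omega_side_sub hs.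
have [WD _ _] := H_fundamental hH zS oD; have [WU _ _] := H_fundamental hH zS oU.
move: WD WU; rewrite !unitmx_mul => /andP[HDu FDu] /andP[HUu _].
have := St_side hSt zS hs; rewrite /= in FDu.
move: (H ShD z _) (H ShU z _) (FD z _) HDu HUu FDu => A B F Au Bu Fu E.
congr (fun M : 'M[C]_n => M i k); symmetry; apply: mulmx1_invmx.
have -> : St l z = invmx F *m (invmx A *m B) *m F.
  by rewrite E !mulmxA mulVmx // mul1mx -mulmxA mulVmx // mulmx1.
by rewrite !mulmxA mulmxK // mulmxK // mulmxKV // mulVmx.
Qed.

End StokesLimitTheorem.

(** * Formal invariants and first integrals *)

Section WildMultiplier.
Variable R : realType.
Local Notation C := (CC R).
Variables (n : nat) (sys : linear_family R n) (g : geometry R).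

Definition turn_sign (l : side) : C := match l with SdL => 1 | SdR => - 1 end.

Lemma turn_sign_sqr l : turn_sign l * turn_sign l = 1.
Proof. by case: l; rewrite /= ?mulrNN mulr1. Qed.

Lemma muE l z i : mu sys l z i = lam sys (eps z) (xhat l z) i / (2 * xhat l z).
Proof. by rewrite /mu /Umx !mxE eqxx mulr1n mulrC. Qed.

Definition multiplier l z i : C := cexp (turn_sign l * 2 * ofR pi * iC R * mu sys l z i).

Lemma DhatE l z : Dhat sys l z = diag_mx (\row_i multiplier l z i).
Proof. by []. Qed.

Lemma invmx_Dhat l z : invmx (Dhat sys l z) = diag_mx (\row_i (multiplier l z i)^-1).
Proof.
apply: mulmx1_invmx; rewrite DhatE mulmx_diag -diag_const_mx; congr diag_mx.
by apply/rowP => i; rewrite !mxE mulfV // cexp_neq0.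
Qed.

Lemma DeltaE l z j q : Delta sys l z j q = multiplier l z j / multiplier l z q.
Proof. by rewrite /Delta invmx_Dhat DhatE !mxE !eqxx !mulr1n. Qed.

Lemma xhat_neq0 l (z : C) : xhat l z != 0.
Proof. by case: l; rewrite /= ?oppr_eq0 sqrt_eps_neq0. Qed.

Lemma absC_xhat l (z : C) : absC (xhat l z) = expR (reC z / 2).
Proof. by case: l; rewrite /xhat ?absCN absC_sqrt_eps. Qed.

Lemma wild_multiplier_holds : spectral_gap sys g -> wild_multiplier sys g.
Proof.
move=> [c [c_gt0 hc]].
(* So [1 / alpha] is plus or minus the difference of the two formal invariants, and [alpha] is of
   order [xhat] divided by a difference of eigenvalues, which the spectral gap bounds below. *)
exists (fun l a b => turn_sign l / (a - b)) => l j q qj alpha.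
pose D z := lam sys (eps z) (xhat l z) j - lam sys (eps z) (xhat l z) q.
have Dc z : sectorS g z -> c < absC (D z).
  move=> zS; have key (a b : 'I_n) : (a < b)%N ->
      c < absC (lam sys (eps z) (xhat l z) a - lam sys (eps z) (xhat l z) b).
    move=> ab; have [h _] := hc z l a b zS ab.
    apply: lt_le_trans h _; rewrite (le_trans (reC_le _)) // absCM absC_cexp.
    by rewrite reC_iM imC_ofR oppr0 expR0 mul1r.
  have := qj; rewrite -val_eqE neq_ltn => /orP[/key|/key //].
  by rewrite absCB.
have D0 z : sectorS g z -> D z != 0.
  by move=> /Dc h; rewrite -absC_gt0; exact: lt_trans h.
have muD z : mu sys l z j - mu sys l z q = D z / (2 * xhat l z).
  by rewrite !muE -mulrBl.
have x20 (z : C) : 2 * xhat l z != 0 by apply: mulf_neq0; [rewrite pnatr_eq0|exact: xhat_neq0].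
have t0 : turn_sign l != 0 by case: (l); rewrite /= ?oppr_eq0 oner_neq0.
have aE z : sectorS g z -> alpha z = turn_sign l * (2 * xhat l z) / D z.
  by move=> zS; rewrite /alpha muD invf_div [LHS]mulrA.
split=> [z zS|].
  have az : alpha z != 0 by rewrite aE //; apply: mulf_neq0; [exact: mulf_neq0|rewrite invr_eq0 D0].
  split=> //; rewrite DeltaE -cexpB; congr cexp.
  rewrite -mulrBr /alpha invf_div.
  have := turn_sign_sqr l; move: (turn_sign l) t0 (mu sys l z j - mu sys l z q) (ofR pi) => t t0 m p tt.
  have -> : t^-1 = t by apply: (mulfI t0); rewrite mulfV.
  ring.
apply/cvg_absC => e e0; have ce : 0 < e * c / 2 by rewrite divr_gt0 // mulr_gt0.
apply: filterS (hat0_small g ce) => z [zS hs] /=.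
rewrite subr0 aE // absCf !absCM absC_xhat absC_nat.
have -> : absC (turn_sign l) = 1 by case: (l); rewrite /turn_sign ?absCN absC1.
rewrite mul1r ltr_pdivrMr; last by rewrite absC_gt0 D0.
have := Dc z zS; move: (absC (D z)) => Da; nra.
Qed.

End WildMultiplier.

(** * First integrals as quotients of signed minors *)

Section SignedMinors.
Variable R : realType.
Local Notation C := (CC R).

Lemma quotP1_scale (c a b : C) : c != 0 -> quotP1 (c * a) (c * b) = quotP1 a b.
Proof.
by move=> c0; rewrite /quotP1 mulf_eq0 (negbTE c0) /=; case: eqP => // _; rewrite -mulf_div divff // mul1r.
Qed.

Variable n : nat.

Definition signed_minors (B : 'M[C]_(n, n.+1)) : 'cV[C]_n.+1 :=
  \col_q ((-1) ^+ q * \det (col' q B)).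

(* Expanding the determinant of B bordered by a first row r shows that the
   vector of signed minors represents the linear form r |-> det [r; B]. *)
Lemma signed_minors_mul (B : 'M[C]_(n, n.+1)) (G : 'M[C]_n.+1) :
  G *m signed_minors (B *m G) = \det G *: signed_minors B.
Proof.
have expand (A : 'M[C]_(n, n.+1)) (r : 'rV[C]_n.+1) :
    @determinant C (1 + n) (col_mx r A) = (r *m signed_minors A) 0 0.
  rewrite (expand_det_row _ 0) mxE; apply: eq_bigr => q _; rewrite mxE; congr (_ * _).
    by case: splitP => [i1 _|//]; rewrite [i1]ord1.
  rewrite /cofactor add0n [RHS]mxE; congr (_ * \det _); apply/matrixP => i k; rewrite !mxE.
  by case: splitP => [[[|?] ?]|k'] //=; rewrite /bump leq0n !add1n => -[/ord_inj ->].
apply/colP => i.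
have := expand (B *m G) (row i G).
have -> : col_mx (row i G) (B *m G) = (col_mx (delta_mx 0 i) B : 'M[C]_(1 + n)) *m G.
  by rewrite mul_col_mx -rowE.
rewrite det_mulmx expand -[row i G *m _]row_mul -rowE !mxE => <-.
by rewrite mulrC.
Qed.

(** The matrix whose product with [W] has the vectors [b_i] as columns; it carries all the
    dependence on [Y]. *)
Definition riccati_rows (j : 'I_n.+1) (Y : 'cV[C]_n) : 'M[C]_(n, n.+1) :=
  \matrix_(k, i) ((i == j)%:R * Y k 0 + (i == lift j k)%:R).

Lemma omitE (W : 'M[C]_n.+1) (j : 'I_n.+1) (Y : 'cV[C]_n) (q : 'I_n.+1) :
  omit W j Y q = \det (col' q (riccati_rows j Y *m W)).
Proof.
rewrite /omit; congr (\det _); apply/matrixP => k i; rewrite !mxE.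
under eq_bigr do rewrite mxE mulrDl.
rewrite big_split /=; congr (_ + _).
  rewrite (bigD1 j) //= eqxx mul1r big1 ?addr0 1?mulrC // => p /negbTE ->.
  by rewrite !mul0r.
rewrite (bigD1 (lift j k)) //= eqxx mul1r big1 ?addr0 // => p /negbTE ->.
by rewrite mul0r.
Qed.

(** Both terms of the quotient are scaled by [(-1) ^+ j], which turns the relative sign of the
    definition into the sign of a cofactor. *)
Lemma first_integralE (W : 'M[C]_n.+1) (j : 'I_n.+1) (Y : 'cV[C]_n) (q : 'I_n.+1) :
  first_integral W j Y q = quotP1 (signed_minors (riccati_rows j Y *m W) q 0)
                                  (signed_minors (riccati_rows j Y *m W) j 0).
Proof.
have s0 (k : nat) : (-1) ^+ k != 0 :> C by rewrite expf_neq0 // oppr_eq0 oner_neq0.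
rewrite /first_integral !omitE !mxE -(quotP1_scale _ _ (s0 j)); congr quotP1.
by rewrite exprD [_ ^+ q * _]mulrC !mulrA -expr2 sqrr_sign mul1r.
Qed.

(** Finiteness of the first integrals says that the vector of minors is a nonzero multiple of [h];
    the factor [\det G] and that multiple cancel in each quotient. *)
Lemma first_integral_mul (W G : 'M[C]_n.+1) (j : 'I_n.+1) (Y : 'cV[C]_n) (h : 'cV[C]_n.+1) :
  G \in unitmx -> (forall q, first_integral W j Y q = Some (h q 0)) ->
  h j 0 = 1 /\ forall q, first_integral (W *m G) j Y q =
    quotP1 ((invmx G *m h) q 0) ((invmx G *m h) j 0).
Proof.
move=> Gu hh; set v := signed_minors (riccati_rows j Y *m W).
have hv q : v j 0 != 0 /\ v q 0 / v j 0 = h q 0.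
  by have := hh q; rewrite first_integralE /quotP1 -/v; case: eqP => // /eqP vj [<-].
have vj := (hv j).1; split; first by rewrite -(hv j).2 divff.
have vh : v = v j 0 *: h.
  by apply/colP => q; rewrite [RHS]mxE -(hv q).2 mulrC divfK.
move=> q; rewrite first_integralE mulmxA.
have -> : signed_minors (riccati_rows j Y *m W *m G) = (\det G * v j 0) *: (invmx G *m h).
  rewrite -[LHS](mulKmx Gu) signed_minors_mul -/v -scalemxAr {1}vh -scalemxAr scalerA.
  by [].
rewrite [X in quotP1 X _]mxE [X in quotP1 _ X]mxE quotP1_scale // mulf_neq0 //.
Qed.

End SignedMinors.

Section Unipotent.
Variable F : fieldType.

(** Rows are treated from the last one upwards: in row [i] of [A *m invmx A = 1%:M] all terms beyond
    the diagonal vanish by induction. *)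
Lemma inv_upper_unipotent (n : nat) (A : 'M[F]_n) : A \in unitmx -> (forall i, A i i = 1) ->
  (forall i k : 'I_n, (k < i)%N -> A i k = 0) ->
  (forall i, invmx A i i = 1) /\ (forall i k : 'I_n, (k < i)%N -> invmx A i k = 0).
Proof.
move=> Au A1 A0.
have key (d : nat) (i k : 'I_n) : (n - i <= d)%N -> (k <= i)%N -> invmx A i k = (i == k)%:R.
  elim: d i k => [|d IH] i k hd ki; first by move: hd; rewrite leqNgt subn_gt0 ltn_ord.
  have := congr1 (fun M : 'M[F]_n => M i k) (mulmxV Au).
  rewrite !mxE (bigD1 i) //= A1 mul1r big1 ?addr0 // => m mi.
  have [im|mi'] := ltnP i m; last by rewrite A0 ?mul0r // ltn_neqAle mi' andbT.
  rewrite IH ?(leq_trans ki (ltnW im)) //; last by rewrite -ltnS (leq_trans (ltn_sub2l (ltn_ord i) im)).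
  by rewrite -val_eqE /= gtn_eqF ?mulr0 // (leq_ltn_trans ki).
split=> [i|i k ki]; first by rewrite (key n) ?leq_subr // eqxx.
by rewrite (key n) ?leq_subr ?(ltnW ki) // -val_eqE /= gtn_eqF.
Qed.

Lemma inv_lower_unipotent (n : nat) (A : 'M[F]_n) : A \in unitmx -> (forall i, A i i = 1) ->
  (forall i k : 'I_n, (i < k)%N -> A i k = 0) ->
  (forall i, invmx A i i = 1) /\ (forall i k : 'I_n, (i < k)%N -> invmx A i k = 0).
Proof.
move=> Au A1 A0.
have [||| h1 h0] := @inv_upper_unipotent n A^T; rewrite ?unitmx_tr //.
- by move=> i; rewrite mxE.
- by move=> i k ki; rewrite mxE A0.
rewrite -trmx_inv in h1 h0.
by split=> [i|i k ik]; [have := h1 i|have := h0 k i ik]; rewrite mxE.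
Qed.

End Unipotent.

(** * The two forms of the monodromy formulas *)

Section MonodromyFormulas.
Variable R : realType.
Local Notation C := (CC R).
Variables (n : nat) (sys : linear_family R n.+1) (g : geometry R).
Variables (FD : C -> C -> 'M[C]_n.+1) (H : sheet -> C -> C -> 'M[C]_n.+1).
Variable St : side -> C -> 'M[C]_n.+1.

Lemma monodromy_formulas_holds l z (W : 'M[C]_n.+1) : unfolded_stokes g FD H St -> sectorS g z ->
  St l z \in unitmx ->
  monodromy_formulas sys l z (invmx (St l z)) W (W *m (St l z *m Dhat sys l z)).
Proof.
move=> hSt zS Su j Y h hh.
have Du : Dhat sys l z \in unitmx.
  rewrite unitmxE det_diag unitfE; apply/prodf_neq0 => i _.
  by rewrite mxE cexp_neq0.
have Gu : St l z *m Dhat sys l z \in unitmx by rewrite unitmx_mul Su.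
have [hj hq] := first_integral_mul Gu hh.
set K := invmx (St l z).
have GE : invmx (St l z *m Dhat sys l z) = invmx (Dhat sys l z) *m K.
  by apply: mulmx1_invmx; rewrite -mulmxA mulKVmx // mulmxV.
have vec q : first_integral (W *m (St l z *m Dhat sys l z)) j Y q =
    quotP1 (Delta sys l z j q * (K *m h) q 0) ((K *m h) j 0).
  have m0 i : multiplier sys l z i != 0 by exact: cexp_neq0.
  rewrite hq GE -mulmxA invmx_Dhat mul_diag_mx [X in quotP1 X _]mxE [X in quotP1 _ X]mxE !mxE.
  (* The inverse of [Dhat] gives the multipliers to the power -1; scaling by the one of index [j]
     clears the denominator and produces [Delta]. *)
  rewrite -(quotP1_scale _ _ (m0 j)) !mulrA mulfV // mul1r DeltaE -[_ * _^-1 * _]mulrA.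
  by rewrite !mulrA.
split=> [q _|q]; last by rewrite vec /monodromy_vector mul_diag_mx -row_mul !mxE.
rewrite vec /monodromy_entry !mxE.
have Kd : forall i, K i i = 1 /\ forall p : 'I_n.+1,
    match l with SdL => (i < p)%N | SdR => (p < i)%N end -> K i p = 0.
  case: l @K Su {Du Gu hq GE vec} => K Su.
    have [h1 h0] := inv_lower_unipotent Su (fun i => St_unipotent hSt SdL i zS)
      (fun i k => St_lower hSt zS (i := i) (k := k)).
    by move=> i; split=> // p; exact: h0.
  have [h1 h0] := inv_upper_unipotent Su (fun i => St_unipotent hSt SdR i zS)
    (fun i k => St_upper hSt zS (i := i) (k := k)).
  by move=> i; split=> // p; exact: h0.
have row_expand (i : 'I_n.+1) : \sum_p K i p * h p 0 = h i 0 +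
    \sum_(p < n.+1 | match l with SdL => (p < i)%N | SdR => (i < p)%N end) K i p * h p 0.
  have [Kii K0] := Kd i; rewrite (bigD1 i) //= Kii mul1r; congr (_ + _).
  rewrite [LHS](bigID (fun p : 'I_n.+1 => match l with SdL => (p < i)%N | SdR => (i < p)%N end)) /=.
  rewrite [X in _ + X]big1 ?addr0; last first.
    move=> p /andP[pi hp]; rewrite K0 ?mul0r //.
    by case: (l) hp pi; rewrite -val_eqE /=; case: ltngtP.
  by apply: eq_bigl => p; case: (l); rewrite -val_eqE /=; case: ltngtP.
by rewrite !row_expand hj; case: (l).
Qed.

End MonodromyFormulas.

(** * Monodromy *)

Section Continuation.
Variable R : realType.
Local Notation C := (CC R).
Local Notation cnear := (gnear (@id C)).

Lemma near_other_point (P : C -> Prop) (y a : C) (d : R) : cnear y P -> 0 < d ->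
  exists x, [/\ x != a, absC (x - y) < d & P x].
Proof.
move=> [e e0 he] d0; pose r := Num.min e d / 2.
have r0 : 0 < r by rewrite divr_gt0 // lt_min e0.
have [re rd] : r < e /\ r < d.
  have : Num.min e d <= e /\ Num.min e d <= d by rewrite !ge_min !lexx orbT.
  by move: r0; rewrite /r => r0 [h1 h2]; split; lra.
have key (s : R) : 0 < s -> s <= r -> y + ofR s != a -> exists x, [/\ x != a, absC (x - y) < d & P x].
  move=> s0 sr ya; exists (y + ofR s); split=> //.
    by rewrite addrAC subrr add0r absC_ofR gtr0_norm //; lra.
  by apply: he; rewrite addrAC subrr add0r absC_ofR gtr0_norm //; lra.
have [ya|] := eqVneq (y + ofR r) a; last exact: key.
apply: (key (r / 2)); [lra|lra|].
rewrite -ya -subr_eq0 opprD addrACA subrr add0r -ofRB -absC_eq0 absC_ofR normr_eq0.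
by apply/eqP; lra.
Qed.

(** Needed because the formulas are asserted for every continuation along the loop. Agreement of the
    two families of germs is open and closed in the parameter. *)
Lemma continuation_unique (n : nat) (gm : R -> C) (f g1 g2 : C -> 'M[C]_n) :
  {within `[0, 1], continuous gm} -> continuation gm f g1 -> continuation gm f g2 ->
  cnear (gm 1) (fun x => g1 x = g2 x).
Proof.
move=> gc [phi1 [/cnear_nbhs a1 /cnear_nbhs b1 c1 d1]] [phi2 [/cnear_nbhs a2 /cnear_nbhs b2 c2 d2]].
pose P u := cnear (gm u) (fun x => phi1 u x = phi2 u x).
suff P1 : P 1.
  by apply: gnear_imp (gnear_and P1 (gnear_and b1 b2)) => x [h [<- <-]].
have near_u u : 0 <= u <= 1 -> exists2 d : R, 0 < d & forall v, 0 <= v <= 1 -> `|v - u| < d ->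
    cnear (gm v) (fun x => phi1 v x = phi1 u x /\ phi2 v x = phi2 u x).
  move=> hu; have [e1 e10 h1] := within01_near hu (d1 u hu).
  have [e2 e20 h2] := within01_near hu (d2 u hu).
  exists (Num.min e1 e2); first by rewrite lt_min e10.
  move=> v hv; rewrite lt_min => /andP[k1 k2].
  by apply: gnear_and; apply/cnear_nbhs; [exact: h1|exact: h2].
apply: (@itv_connected R 0 1 P) => //.
- by apply: gnear_imp (gnear_and a1 a2) => x [-> ->].
- move=> u hu Pu; have [e1 e10 h1] := near_u u hu.
  have [e e0 he] := gnear_near Pu; have [e2 e20 h2] := within01 gc hu e0.
  exists (Num.min e1 e2); first by rewrite lt_min e10.
  move=> v hv; rewrite lt_min => /andP[k1 k2].
  have q := he (gm v) (h2 v hv k2).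
  by apply: gnear_imp (gnear_and q (h1 v hv k1)) => x [? [-> ->]].
- move=> u hu Pcl; have [e1 e10 h1] := near_u u hu.
  suff Pik i k : cnear (gm u) (fun x => phi1 u x i k = phi2 u x i k).
    apply: (gnear_imp (P := fun x => forall i k, phi1 u x i k = phi2 u x i k)).
      by move=> x h; apply/matrixP.
    by apply: gnear_all => i; apply: gnear_all => k; exact: Pik.
  have iso : cnear (gm u) (fun x => phi1 u x i k - phi2 u x i k = 0).
    apply: (analytic_isolated (analyticB (c1 u i k hu) (c2 u i k hu))) => d d0.
    have d20 : 0 < d / 2 by rewrite divr_gt0.
    have [e2 e20 h2] := within01 gc hu d20.
    have [|v [hv]] := Pcl (Num.min e1 e2); first by rewrite lt_min e10.
    rewrite lt_min => /andP[k1 k2] Pv.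
    (* A zero of the difference must avoid the centre [gm u] itself, since the path may be
       stationary there. *)
    have [x [xu xv [E [E1 E2]]]] := near_other_point (gm u) (gnear_and Pv (h1 v hv k1)) d20.
    exists x; split=> //; last by rewrite -E1 -E2 E subrr.
    by have := absC_tri x (gm v) (gm u); have := h2 v hv k2; lra.
  by apply: gnear_imp iso => x /eqP; rewrite subr_eq0 => /eqP.
- by rewrite ler01 lexx.
Qed.

Lemma cexp_close_inj (a b : C) : cexp a = cexp b -> absC (a - b) < 1 / 10 -> a = b.
Proof.
move=> E h; apply/eqP; rewrite -subr_eq0; apply/eqP; apply: cexp_small_eq1 => //.
by rewrite cexpB E divff // cexp_neq0.
Qed.

End Continuation.

(** * The model solution along a loop *)

Section Monodromy.
Variable R : realType.
Local Notation C := (CC R).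
Local Notation cder := (gderiv (@id C)).
Local Notation cnear := (gnear (@id C)).
Variables (n : nat) (sys : linear_family R n) (z : C) (gm : R -> C) (Lb : side -> R -> C).
Hypothesis gmc : {within `[0, 1], continuous gm}.
Hypothesis Lbc : forall l, {within `[0, 1], continuous (Lb l)}.
Hypothesis LbE : forall l (u : R), 0 <= u <= 1 -> cexp (Lb l u) = gm u - xhat l z.

(** Near [gm u], the branch of the logarithm of [(x - xhat l z) / (gm 0 - xhat l z)] obtained by
    following the loop: [Lb] records the path, the principal logarithm the local variation. *)
Definition log_along (l : side) (u : R) (x : C) : C :=
  Lb l u - Lb l 0 + cLog ((x - xhat l z) / (gm u - xhat l z)).

Definition model_along (v : 'I_n -> C) (u : R) (x : C) (i : 'I_n) : C :=
  v i * cexp (mu sys SdL z i * log_along SdL u x + mu sys SdR z i * log_along SdR u x).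

Lemma gm_neq l (u : R) : 0 <= u <= 1 -> gm u != xhat l z.
Proof. by move=> /(LbE l) E; rewrite -subr_eq0 -E cexp_neq0. Qed.

Lemma xhat_sqr l : xhat l z ^+ 2 = eps z.
Proof. by case: l; rewrite /xhat ?sqrrN sqrt_eps_sqr. Qed.

Lemma sqr_eps_neq (x : C) : x != xhat SdL z -> x != xhat SdR z -> x ^+ 2 - eps z != 0.
Proof.
move=> h1 h2; rewrite -(xhat_sqr SdL) subr_sqr; apply: mulf_neq0; rewrite ?subr_eq0 //.
by rewrite addr_eq0.
Qed.

(** The eigenvalue is affine in [x], and the formal invariants are its residues at the two singular
    points. *)
Lemma partial_fractions (x : C) i : x != xhat SdL z -> x != xhat SdR z ->
  mu sys SdL z i * (x - xhat SdL z)^-1 + mu sys SdR z i * (x - xhat SdR z)^-1 =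
  lam sys (eps z) x i / (x ^+ 2 - eps z).
Proof.
move=> h1 h2; have x2 := sqr_eps_neq h1 h2.
rewrite !muE -(xhat_sqr SdL) /lam in x2 *.
have s0 := sqrt_eps_neq0 z; rewrite /xhat in h1 h2 x2 *.
rewrite -subr_eq0 in h1; rewrite -subr_eq0 opprK in h2.
move: (Lam0 sys (eps z) 0 i) (Lam1 sys (eps z) 0 i) (sqrt_eps z) s0 h1 h2 x2 => a b s s0 h1 h2 x2.
by field; rewrite opprK x2 h2 s0 h1.
Qed.

Lemma near_branch (u : R) : 0 <= u <= 1 -> cnear (gm u) (fun x => forall l, absC (x - gm u) < absC (gm u - xhat l z)).
Proof.
move=> hu; exists (Num.min (absC (gm u - xhat SdL z)) (absC (gm u - xhat SdR z))).
  by rewrite lt_min !absC_gt0 !subr_eq0 !gm_neq.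
by move=> x; rewrite lt_min => /andP[h1 h2] [].
Qed.

Lemma branch_neq (u : R) x l : absC (x - gm u) < absC (gm u - xhat l z) -> x != xhat l z.
Proof. by move=> h; apply: contraTneq h => ->; rewrite absCB ltxx. Qed.

Lemma model_along_solves v (u : R) i : 0 <= u <= 1 -> cnear (gm u) (fun x =>
  cder (fun y => model_along v u y i) x
    (lam sys (eps z) x i / (x ^+ 2 - eps z) * model_along v u x i)).
Proof.
move=> hu; apply: gnear_imp (near_branch hu) => x hx.
have dl l : cder (log_along l u) x (x - xhat l z)^-1.
  apply: (gderiv_eq _ (gderivD (gderiv_cst _ _ _) (gderiv_cLog_ratio (gm_neq l hu) (hx l)))).
  exact: add0r.
have dE := gderivD (gderivZ (mu sys SdL z i) (dl SdL)) (gderivZ (mu sys SdR z i) (dl SdR)).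
rewrite partial_fractions in dE; try exact: (branch_neq (hx _)).
have := gderivZ (v i) (gderiv_comp (f := @cexp R) (gderiv_cexp _) dE).
by apply: gderiv_eq; rewrite /model_along mulrA mulrC.
Qed.

Lemma model_along_neq0 v (u : R) x i : v i != 0 -> model_along v u x i != 0.
Proof. by move=> vi; apply: mulf_neq0 => //; exact: cexp_neq0. Qed.

Lemma model_along_analytic v (u : R) i : v i != 0 -> 0 <= u <= 1 ->
  analytic_at (fun x => model_along v u x i) (gm u).
Proof.
move=> vi hu; apply: (@model_analytic R (Lam0 sys (eps z) 0 i) (Lam1 sys (eps z) 0 i) (eps z)).
- by apply: sqr_eps_neq; exact: gm_neq.
- exact: model_along_solves.
- exact: model_along_neq0.
Qed.

Lemma log_along_compat l (u : R) : 0 <= u <= 1 -> exists2 d : R, 0 < d &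
  forall v, 0 <= v <= 1 -> `|v - u| < d ->
    cnear (gm v) (fun x => log_along l v x = log_along l u x).
Proof.
(* Three terms below [1 / 30] keep the two branches within the range [1 / 10] of
   [cexp_close_inj]. *)
move=> hu; have e0 : 0 < 1 / 30 :> R by rewrite divr_gt0.
have gn w : 0 <= w <= 1 -> gm w - xhat l z != 0 by move=> hw; rewrite subr_eq0 gm_neq.
have ccont w : 0 <= w <= 1 -> gcont id (fun x => cLog ((x - xhat l z) / (gm w - xhat l z))) (gm w).
  move=> hw; apply: (gderiv_cont (v := (gm w - xhat l z)^-1)).
  by apply: gderiv_cLog_ratio; rewrite ?gm_neq // subrr absC0 absC_gt0 gn.
have c1 w : 0 <= w <= 1 -> cLog ((gm w - xhat l z) / (gm w - xhat l z)) = 0.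
  by move=> hw; rewrite divff ?cLog1 ?gn.
have [d1 d10 h1] := within01 (@Lbc l) hu e0.
have [d2 d20 h2] := gnear_near (gnear_and (ccont u hu _ e0) (near_branch hu)).
have [d3 d30 h3] := within01 gmc hu d20.
exists (Num.min d1 d3); first by rewrite lt_min d10.
move=> v hv; rewrite lt_min => /andP[k1 k3].
have q := h2 (gm v) (h3 v hv k3).
apply: gnear_imp (gnear_and q (gnear_and (ccont v hv _ e0) (near_branch hv))).
move=> x [[a1 a2] [b1 b2]].
have {}a1 : absC (cLog ((x - xhat l z) / (gm u - xhat l z))) < 1 / 30.
  by rewrite -[cLog _]subr0 -(c1 u hu); exact: a1.
have {}b1 : absC (cLog ((x - xhat l z) / (gm v - xhat l z))) < 1 / 30.
  by rewrite -[cLog _]subr0 -(c1 v hv); exact: b1.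
apply: cexp_close_inj.
  have h0 : 0 <= (0 : R) <= 1 by rewrite lexx ler01.
  rewrite /log_along [LHS]cexpD [RHS]cexpD !cexpB (@LbE l 0 h0) (@LbE l u hu) (@LbE l v hv).
  rewrite !cexp_cLog; [|exact: (reC_pos_ratio (gm_neq l hu) (a2 l))|exact: (reC_pos_ratio (gm_neq l hv) (b2 l))].
  have := branch_neq (a2 l); rewrite -subr_eq0 => xn.
  have := gn u hu; have := gn v hv.
  have := gn 0 h0; move: (gm u - _) (gm v - _) (gm 0 - _) (x - _) => A B D X D0 B0 A0.
  by field; rewrite D0 B0 A0.
have -> : log_along l v x - log_along l u x = (Lb l v - Lb l u) +
    (cLog ((x - xhat l z) / (gm v - xhat l z)) - cLog ((x - xhat l z) / (gm u - xhat l z))).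
  by rewrite /log_along; ring.
have t1 := h1 v hv k1.
apply: (@le_lt_trans _ _ (absC (Lb l v - Lb l u) + (absC (cLog ((x - xhat l z) / (gm v - xhat l z))) +
  absC (cLog ((x - xhat l z) / (gm u - xhat l z)))))); last by lra.
by apply: absCD_le => //; exact: absCBD.
Qed.

Lemma model_along_compat v0 (u : R) : 0 <= u <= 1 -> exists2 d : R, 0 < d &
  forall v, 0 <= v <= 1 -> `|v - u| < d ->
    cnear (gm v) (fun x => model_along v0 v x = model_along v0 u x).
Proof.
move=> hu; have [d1 d10 h1] := log_along_compat SdL hu; have [d2 d20 h2] := log_along_compat SdR hu.
exists (Num.min d1 d2); first by rewrite lt_min d10.
move=> v hv; rewrite lt_min => /andP[k1 k2].
apply: gnear_imp (gnear_and (h1 v hv k1) (h2 v hv k2)) => x [E1 E2].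
by apply/funext => i; rewrite /model_along E1 E2.
Qed.

End Monodromy.

(** * The monodromy matrix of W_V *)

Section MonodromyMatrix.
Variable R : realType.
Local Notation C := (CC R).
Local Notation cder := (gderiv (@id C)).
Local Notation cnear := (gnear (@id C)).
Variables (n : nat) (sys : linear_family R n) (g : geometry R).
Variables (FD FU : C -> C -> 'M[C]_n) (H : sheet -> C -> C -> 'M[C]_n).
Variables (St : side -> C -> 'M[C]_n) (WV : sheet -> C -> C -> 'M[C]_n).
Variables (z : C).
Hypotheses (hFD : is_FD sys g FD) (hH : normalizing sys g FD FU H).
Hypotheses (hSt : unfolded_stokes g FD H St).
Hypothesis hWV : is_WV g (fun z x => H ShD z x *m FD z x) WV.
Hypotheses (gam0 : 0 < gamma g) (angle_lt : angle_of (gamma g) < pi / 2) (zS : sectorS g z).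
Hypotheses (c0p : 0 < c0 g) (kap1 : kappa g < 1 / 2) (hgt0 : 0 < hgt g).
Hypotheses (sh_small : expR (reC z / 2) * hgt g <= beta_of (gamma g)).
Hypothesis c0_small : c0 g <= beta_of (gamma g) / 2.

Lemma Fsheet_unit s x : Omega g s z x -> H s z x \in unitmx /\ Fsheet FD FU s z x \in unitmx.
Proof.
move=> hx; have [W _ _] := H_fundamental hH zS hx.
by move: W; rewrite unitmx_mul => /andP[].
Qed.

Lemma H_center s s' x : Omega_C g z x -> H s z x = H s' z x.
Proof.
move=> hx; have [HDu _] := Fsheet_unit (Omega_C_sub hx).
have E : H ShU z x = H ShD z x.
  by rewrite -[LHS](mulKVmx HDu) (St_center hSt zS hx) mulmx1.
by case: s s' => [] []; rewrite ?E.
Qed.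

Lemma St_unit l x : Omega_side g l z x -> St l z \in unitmx.
Proof.
move=> hx; have [oD oU] := Omega_side_sub hx.
have [HDu FDu] := Fsheet_unit oD; have [HUu _] := Fsheet_unit oU; rewrite /Fsheet in FDu.
have := St_side hSt zS hx => E.
have -> : St l z = invmx (FD z x) *m (invmx (H ShD z x) *m H ShU z x) *m FD z x.
  by rewrite E !mulmxA mulVmx // mul1mx -mulmxA mulVmx // mulmx1.
by rewrite !unitmx_mul !unitmx_inv FDu HDu HUu.
Qed.

Lemma H_side l x : Omega_side g l z x -> H ShU z x *m FD z x = H ShD z x *m FD z x *m St l z.
Proof.
move=> hx; have [oD _] := Omega_side_sub hx.
have [HDu FDu] := Fsheet_unit oD; rewrite /Fsheet in FDu.
rewrite -[H ShU z x](mulKVmx HDu) (St_side hSt zS hx) !mulmxA -[X in X = _]mulmxA.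
by rewrite mulVmx // mulmx1.
Qed.

Section Loop.
Variables (l : side) (gm : R -> C) (sh : R -> sheet) (Lb : side -> R -> C).
Let p := gm 0.
Hypotheses (hp : Omega_side g l z p) (gm1 : gm 1 = p).
Hypotheses (hpath : path_in_V g z gm sh) (sh0 : sh 0 = ShD) (sh1 : sh 1 = ShU).
Hypothesis Lbc : forall l, {within `[0, 1], continuous (Lb l)}.
Hypothesis LbE : forall l (u : R), 0 <= u <= 1 -> cexp (Lb l u) = gm u - xhat l z.
Hypothesis Lbl : Lb l 1 - Lb l 0 = 2 * ofR pi * iC R * turn_sign R l.
Hypothesis Lbo : Lb (opposite l) 1 - Lb (opposite l) 0 = 0.

Let v (i : 'I_n) := FD z p i i.
Let f := model_along sys z gm Lb v.
(** The candidate germs: the matrix [H] of the current sheet times the explicit branch of the model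
    solution, started with the diagonal of [FD] at the base point. *)
Let phi (u : R) (x : C) : 'M[C]_n := H (sh u) z x *m diag_mx (\row_i f u x i).

Let h01 : 0 <= (0 : R) <= 1. Proof. by rewrite lexx ler01. Qed.
Let h11 : 0 <= (1 : R) <= 1. Proof. by rewrite lexx ler01. Qed.
Let pD : Omega g ShD z p := (Omega_side_sub hp).1.

Lemma FD_entry x : Omega g ShD z x -> forall i k, i != k -> FD z x i k = 0.
Proof.
move=> hx i k ik; have [w [_ ->]] := FD_diag gam0 angle_lt zS c0p kap1 hgt0 sh_small c0_small hFD hx.
by rewrite !mxE (negbTE ik).
Qed.

Lemma v_neq0 i : v i != 0.
Proof.
have [w [w0 E]] := FD_diag gam0 angle_lt zS c0p kap1 hgt0 sh_small c0_small hFD pD.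
by rewrite /v E !mxE eqxx mulr1n.
Qed.

Lemma f_at_p i : f 0 p i = v i.
Proof.
have E l' : log_along z gm Lb l' 0 p = 0.
  by rewrite /log_along subrr add0r divff ?cLog1 // subr_eq0 (gm_neq LbE).
by rewrite /f /model_along !E !mulr0 addr0 cexp0 mulr1.
Qed.

Lemma f_is_FD : cnear p (fun x => FD z x = diag_mx (\row_i f 0 x i)).
Proof.
have oD := OmegaD_open gam0 angle_lt zS c0p kap1 hgt0 sh_small c0_small pD.
have di i : cnear p (fun x => FD z x i i = f 0 x i).
  have s2 : cnear p (fun x => cder (fun y => FD z y i i) x
      (lam sys (eps z) x i / (x ^+ 2 - eps z) * FD z x i i)).
    by apply: gnear_imp oD => x hx; exact: (FD_model gam0 angle_lt zS c0p kap1 hgt0 sh_small c0_small hFD hx).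
  have := @ode_unique R (fun y => lam sys (eps z) y i / (y ^+ 2 - eps z)) (fun y => FD z y i i)
    (fun y => f 0 y i) p s2 (model_along_solves sys LbE v i h01).
  rewrite f_at_p => /(_ (v_neq0 i)); apply: gnear_imp => x.
  by rewrite -/(v i) divff ?mul1r // v_neq0.
apply: gnear_imp (gnear_and oD (gnear_all di)) => x [hx E].
apply/matrixP => i k; rewrite !mxE; have [<-|ik] := eqVneq i k; first by rewrite mulr1n E.
by rewrite mulr0n FD_entry.
Qed.

(** Around the loop only the logarithm at [xhat l z] changes, by one signed turn; the other returns
    to its value. *)
Lemma f_turn x i : f 1 x i = f 0 x i * multiplier sys l z i.
Proof.
have E l' : log_along z gm Lb l' 1 x = Lb l' 1 - Lb l' 0 + log_along z gm Lb l' 0 x.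
  by rewrite /log_along gm1 subrr add0r.
rewrite /f /model_along /multiplier -mulrA -cexpD; congr (_ * cexp _); rewrite !E.
move: Lbl Lbo; case: (l) => /= -> ->.
  by ring.
by ring.
Qed.

Lemma phi_continuation : continuation gm (WV ShD z) (fun x => WV ShD z x *m (St l z *m Dhat sys l z)).
Proof.
have [gmc hOm hsh] := hpath; have [WVD _ _] := hWV zS.
have oD := OmegaD_open gam0 angle_lt zS c0p kap1 hgt0 sh_small c0_small pD.
have oS := Omega_side_open gam0 angle_lt zS c0p kap1 hgt0 sh_small c0_small hp.
exists phi; split.
- apply/cnear_nbhs; rewrite -/p; apply: gnear_imp (gnear_and oD f_is_FD) => x [hx E].
  by rewrite /phi sh0 -E WVD.
- apply/cnear_nbhs; rewrite gm1; apply: gnear_imp (gnear_and oS (gnear_and oD f_is_FD)) => x [hs [hx E]].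
  have -> : phi 1 x = H ShU z x *m (FD z x *m Dhat sys l z).
    rewrite /phi sh1 E DhatE mulmx_diag; congr (_ *m diag_mx _).
    by apply/rowP => i; rewrite !mxE f_turn.
  by rewrite WVD // mulmxA (H_side hs) -mulmxA.
- move=> u i k hu.
  apply: (@analytic_ext _ (fun x => H (sh u) z x i k * f u x k)).
    by exists 1 => // x _; rewrite /phi mul_mx_diag !mxE.
  apply: analyticM; first exact: (H_slice hH zS (hOm u hu)).
  by apply: model_along_analytic; rewrite ?v_neq0.
- move=> u hu; have [d1 d10 h1] := model_along_compat sys gmc Lbc LbE v hu.
  have [d2 d20 h2] := within01_near hu (hsh u hu).
  apply: (near_within01 (d := Num.min d1 d2)); first by rewrite lt_min d10.
  move=> w hw; rewrite lt_min => /andP[k1 k2]; apply/cnear_nbhs.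
  (* The sheet function need not be continuous, but it can only change over Omega_C, where the two
     matrices [H] agree on an open set. *)
  have HH : cnear (gm w) (fun x => H (sh w) z x = H (sh u) z x).
    case: (h2 w hw k2) => [->|oC]; first by exists 1.
    apply: gnear_imp (OmegaC_open gam0 angle_lt zS c0p kap1 hgt0 sh_small c0_small oC).
    by move=> x hx; exact: H_center.
  by apply: gnear_imp (gnear_and HH (h1 w hw k1)) => x [E1 E2]; rewrite /phi E1 /f E2.
Qed.

End Loop.

Lemma monodromy_matrix l p (gm : R -> C) : monodromy_loop g l z p gm ->
  [/\ St l z \in unitmx, gm 1 = p, {within `[0, 1], continuous gm} &
   continuation gm (WV ShD z) (fun x => WV ShD z x *m (St l z *m Dhat sys l z))].
Proof.
move=> [hp gm0 gm1 [sh [hpath sh0 sh1]] [[L1 [L1c L1E L1t]] [L2 [L2c L2E L2t]]]].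
have gmc : {within `[0, 1], continuous gm} by have [] := hpath.
split=> //; first exact: St_unit hp.
(* The two winding conditions are stated for [l] and its opposite; the logarithms are reindexed by
   the side itself. *)
pose Lb l' := match l, l' with SdL, SdL => L1 | SdR, SdR => L1 | _, _ => L2 end.
rewrite -gm0 in hp gm1.
apply: (@phi_continuation l gm sh Lb hp gm1 hpath sh0 sh1).
- by move=> l'; rewrite /Lb; case: (l); case: l'; [exact: L1c|exact: L2c|exact: L2c|exact: L1c].
- by rewrite /Lb; case: (l) L1E L2E => /= h1 h2 [] u hu; [exact: h1|exact: h2|exact: h2|exact: h1].
- by rewrite /Lb /turn_sign; case: (l) L1t => ->; rewrite ?mulrNz.
- by rewrite /Lb; case: (l) L2t => /= ->; rewrite mulr0.
Qed.

End MonodromyMatrix.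

Lemma small_c0 (R : realType) (gam : R) : 0 < gam -> angle_of gam < pi / 2 ->
  exists2 c1 : R, 0 < c1 & forall c, 0 < c < c1 -> c * (1 + 2 / beta_of gam) <= 1 / 40 /\ c <= beta_of gam / 2.
Proof.
move=> g0 ga; have [_ _ b0 b1 _] := angle_facts g0 ga.
have q : 0 < 1 + 2 / beta_of gam by rewrite addr_gt0 // divr_gt0.
exists (Num.min (1 / 40 / (1 + 2 / beta_of gam)) (beta_of gam / 2)).
  by rewrite lt_min !divr_gt0.
move=> c /andP[c0]; rewrite lt_min => /andP[h1 h2].
by split; [rewrite -ler_pdivlMr // ltW|exact: ltW].
Qed.

Lemma theta0_le (R : realType) (n : nat) (sys : linear_family R n) (a : R) :
  0 < a -> a < theta0 sys -> a < pi / 2.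
Proof.
move=> a0 at0; have [th lt_th [/andP[_ th2] _]] := lt_theta0 a0 at0.
exact: lt_trans th2.
Qed.

Theorem theorem4p39 (R : realType) (n : nat) (sys : linear_family R n)
    (hn : (2 <= n)%N) (hsys : prenormal sys)
    (gam : R) (hgam : 0 < gam) (hgam0 : gam * (1 + 2 * gam / pi) < theta0 sys) :
  exists r0 : R, 0 < r0 /\ forall r : R, 0 < r < r0 ->
  forall dl kap : R, 0 < dl -> admissible_delta sys r dl -> 0 < kap < 1 / 2 ->
  exists c1 : R, 0 < c1 /\ forall c : R, 0 < c < c1 ->
  forall h : R, 0 < h < r^-1 ->
  exists rho0 : R, 0 < rho0 /\ forall rh : R, 0 < rh < rho0 ->
  forall g : geometry R, g = Geometry gam r dl kap c h rh ->
  spectral_gap sys g ->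
  forall (FD FU : CC R -> CC R -> 'M[CC R]_n)
    (H : sheet -> CC R -> CC R -> 'M[CC R]_n)
    (St : side -> CC R -> 'M[CC R]_n)
    (WV : sheet -> CC R -> CC R -> 'M[CC R]_n),
  is_FD sys g FD -> is_FU g FD FU -> normalizing sys g FD FU H ->
  unfolded_stokes g FD H St -> is_WV g (fun z x => H ShD z x *m FD z x) WV ->
  [/\ wild_multiplier sys g,
      stokes_limit g St &
      forall (l : side) (z p : CC R) (loop : R -> CC R),
        sectorS g z -> monodromy_loop g l z p loop ->
        (exists MW, continuation loop (WV ShD z) MW) /\
        forall MW, continuation loop (WV ShD z) MW ->
          \forall x \near p,
            monodromy_formulas sys l z (invmx (St l z)) (WV ShD z x) (MW x)].
Proof.
have a0 : 0 < angle_of gam.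
  have := pi_gt0 R => p0; rewrite mulr_gt0 // addr_gt0 // divr_gt0 // mulr_gt0 //.
have angle_lt : angle_of gam < pi / 2 := theta0_le a0 hgam0.
have [_ _ b0 _ _] := angle_facts hgam angle_lt.
have [c1 c10 hc1] := small_c0 hgam angle_lt.
exists 1; split=> // r /andP[r_gt0 _] dl kap dl0 _ /andP[kap0 kap1].
exists c1; split=> // c hc h /andP[h0 _].
have [c_gt0 _] := andP hc; have [c2 c3] := hc1 c hc.
(* Then [expR (reC z / 2) * h] is below [beta_of gam], so that the strip of height [h] stays clear
   of the next pole of the flow. *)
exists ((beta_of gam / h) ^+ 2); split; first by rewrite exprn_gt0 // divr_gt0.
move=> rh /andP[rh0 rh1] g gE gap FD FU H St WV hFD hFU hH hSt hWV.
have sh_small (z : CC R) : sectorS g z -> expR (reC z / 2) * hgt g <= beta_of (gamma g).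
  rewrite gE => -[/= hz _]; rewrite -ler_pdivlMr // ltW //; apply: expR_half_lt; first by rewrite divr_gt0.
  by rewrite /eps absC_cexp (lt_trans hz).
(* The minors are those of a matrix with [n - 1] rows, so the size is written as a successor. *)
have hn1 : exists m, n = m.+1 by case: (n) hn => // m _; exists m.
have [m nE] := hn1; subst n.
have [E1 E2 E3 E4 E5] : [/\ gamma g = gam, Defs.rad g = r, delta g = dl, kappa g = kap & c0 g = c].
  by rewrite gE.
have [E6 E7] : hgt g = h /\ rho g = rh by rewrite gE.
clear gE; rewrite -?E1 -?E2 -?E3 -?E4 -?E5 -?E6 -?E7 in a0 angle_lt b0 hgam hgam0 c2 c3 c_gt0 r_gt0 dl0 kap0 kap1 h0 rh0.
split.
- exact: wild_multiplier_holds.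
- exact: (stokes_limit_holds hsys hFD hFU hH hSt).
move=> l z p loop zS hloop.
have [Su gm1 gmc hcont] := monodromy_matrix hFD hH hSt hWV hgam angle_lt zS c_gt0 kap1 h0 (sh_small z zS) c3 hloop.
split; first by exists (fun x => WV ShD z x *m (St l z *m Dhat sys l z)).
move=> MW hMW; apply/cnear_nbhs; have := continuation_unique gmc hcont hMW; rewrite gm1.
apply: gnear_imp => x <-; exact: (monodromy_formulas_holds _ hSt zS Su).
Qed.
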